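(* Let $\mathbb{K}$ be a non-Archimedean local field, let $n \geq 1$ be an integer and let $\alpha > 0$. Let $Y$ be a UMD Banach function space and let $1 < p < \infty$. Then the Taibleson operator $D^\alpha \otimes \mathrm{Id}_Y$ on the Bochner space $\mathrm{L}^p(\mathbb{K}^n,Y)$ admits a bounded $\mathrm{H}^\infty(\Sigma_\theta)$ functional calculus for every angle $\theta > 0$ (that is, for every $\theta\in(0,\pi)$), and it admits a bounded Hörmander $\mathrm{H\ddot{o}r}^s_2(\mathbb{R}_+^* )$ functional calculus for every $s > \frac32$.
   Context: **Local fields.** A non-Archimedean local field $\mathbb{K}$ is a non-discrete locally compact (commutative) field whose module function $|\cdot|$ satisfies $|x+y|\le\max\{|x|,|y|\}$. Put $\mathcal{O}=\{x\in\mathbb{K}:|x|\le 1\}$ and $\mathfrak{p}=\{x\in\mathbb{K}:|x|<1\}=\beta\mathcal{O}$ for a prime element $\beta$; $q$ is the cardinality of the finite residue field $\mathcal{O}/\mathfrak{p}$, and $|\cdot|$ is normalized by $|\beta|=q^{-1}$. For $x=(x_1,\dots,x_n)\in\mathbb{K}^n$ put $\|x\|_{\mathbb{K}^n}=\max_{1\le i\le n}|x_i|$. The Haar measure on $(\mathbb{K}^n,+)$ is normalized so that $\mathcal{O}^n$ has measure $1$. Let $x\cdot y=x_1y_1+\cdots+x_ny_n$, and fix a (continuous, unitary) character $\chi:\mathbb{K}\to\mathbb{C}$ of $(\mathbb{K},+)$ that is trivial on $\mathcal{O}$ and non-trivial on $\beta^{-1}\mathcal{O}$. **Taibleson operator.**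 For suitable $f$ (e.g. locally constant with compact support), $$(D^\alpha f)(x)=\frac{1-q^\alpha}{1-q^{-\alpha-n}}\int_{\mathbb{K}^n}\frac{f(y)-f(x)}{\|y-x\|_{\mathbb{K}^n}^{\alpha+n}}\,dy,$$ the integral being improper (a sum over the spheres $\|y-x\|_{\mathbb{K}^n}=q^k$, $k\in\mathbb{Z}$); equivalently $D^\alpha$ is the Fourier multiplier with symbol $\|\cdot\|_{\mathbb{K}^n}^\alpha$. For $t>0$ let $K_t(x)=\int_{\mathbb{K}^n}e^{-t\|\xi\|_{\mathbb{K}^n}^\alpha}\overline{\chi(x\cdot\xi)}\,d\xi$ and $T_tf=K_t*f$, $T_0=\mathrm{Id}$. Then $(T_t\otimes\mathrm{Id}_Y)_{t\ge0}$ is a strongly continuous semigroup on $\mathrm{L}^p(\mathbb{K}^n,Y)$, and $D^\alpha\otimes\mathrm{Id}_Y$ denotes the negative of its infinitesimal generator (a closed densely defined operator). **UMD Banach function space.** Given a complete $\sigma$-finite measure space $(\Omega',\mathcal{A},\mu)$, a Banach function space $Y$ over it is a complex Banach space of (classes of) locally integrable functions on $\Omega'$ such that: (1) if $f\in Y$, $g$ is measurable and $|g|\le|f|$ a.e., then $g\in Y$ and $\|g\|_Y\le\|f\|_Y$; (2) if $(f_k)$ is an increasing sequence of positive functions in $Y$ with $\sup_k\|f_k\|_Y<\infty$ and $f_k\to f$ a.e., then $f\in Y$ and $\|f\|_Y=\sup_k\|f_k\|_Y$; (3) $1_A\in Y$ for all $A\in\mathcal{A}$ with $\mu(A)<\infty$.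 It is a UMD Banach function space if it is moreover a UMD Banach space. **$\mathrm{H}^\infty$ calculus.** For $\theta\in(0,\pi)$ let $\Sigma_\theta=\{z\in\mathbb{C}\setminus\{0\}:|\arg z|<\theta\}$. A closed densely defined operator $A$ on a Banach space $X$ is sectorial of type $\omega\in(0,\pi)$ if $\sigma(A)\subset\overline{\Sigma_\omega}$ and for every $\nu\in(\omega,\pi)$ the set $\{z(z\,\mathrm{Id}-A)^{-1}:z\in\mathbb{C}\setminus\overline{\Sigma_\nu}\}$ is bounded; $\omega(A)$ is the infimum of such $\omega$. $\mathrm{H}^\infty_0(\Sigma_\theta)$ is the algebra of bounded holomorphic $f:\Sigma_\theta\to\mathbb{C}$ with $|f(z)|\le C\min\{|z|^s,|z|^{-s}\}$ for some $C,s>0$; $\|f\|_{\mathrm{H}^\infty(\Sigma_\theta)}=\sup_{\Sigma_\theta}|f|$. For $\theta\in(\omega(A),\pi)$ and $f\in\mathrm{H}^\infty_0(\Sigma_\theta)$ put $f(A)=\frac1{2\pi i}\int_{\partial\Sigma_\nu}f(z)(z\,\mathrm{Id}-A)^{-1}dz$ for any $\nu\in(\omega(A),\theta)$ ($\partial\Sigma_\nu$ oriented counterclockwise around the sector). $A$ admits a bounded $\mathrm{H}^\infty(\Sigma_\theta)$ functional calculus if $A$ is sectorial with $\omega(A)<\theta$ and there is $C\ge 0$ with $\|f(A)\|_{X\to X}\le C\|f\|_{\mathrm{H}^\infty(\Sigma_\theta)}$ for all $f\in\mathrm{H}^\infty_0(\Sigma_\theta)$. **Hörmander calculus.** Fix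 any non-zero $C^\infty$ function $\eta:\,]0,\infty[\,\to\mathbb{R}$ with compact support. For $s>0$ put $\|g\|_{\mathrm{W}^{s,2}(\mathbb{R})}=\|(1+\xi^2)^{s/2}\hat g(\xi)\|_{\mathrm{L}^2(\mathbb{R})}$ and $$\|f\|_{\mathrm{H\ddot{o}r}^s_2(\mathbb{R}_+^* )}=\sup_{t>0}\|x\mapsto\eta(x)f(tx)\|_{\mathrm{W}^{s,2}(\mathbb{R})},$$ and let $\mathrm{H\ddot{o}r}^s_2(\mathbb{R}_+^* )$ be the space of $f:\,]0,\infty[\,\to\mathbb{C}$ for which this is finite. $D^\alpha$ is positive selfadjoint on $\mathrm{L}^2(\mathbb{K}^n)$, so $f(D^\alpha)$ is defined on $\mathrm{L}^2(\mathbb{K}^n)$ by spectral calculus (it is the Fourier multiplier with symbol $\xi\mapsto f(\|\xi\|_{\mathbb{K}^n}^\alpha)$). That $D^\alpha\otimes\mathrm{Id}_Y$ admits a bounded Hörmander $\mathrm{H\ddot{o}r}^s_2(\mathbb{R}_+^* )$ calculus on $X=\mathrm{L}^p(\mathbb{K}^n,Y)$ means: there is a constant $C$ such that for every $f\in\mathrm{H\ddot{o}r}^s_2(\mathbb{R}_+^* )$ the operator $f(D^\alpha)\otimes\mathrm{Id}_Y$, defined on $(\mathrm{L}^2(\mathbb{K}^n)\cap\mathrm{L}^p(\mathbb{K}^n))\otimes Y$, extends to a bounded operator $f(D^\alpha\otimes\mathrm{Id}_Y)$ on $X$ with $\|f(D^\alpha\otimes\mathrm{Id}_Y)\|_{X\to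 X}\le C\|f\|_{\mathrm{H\ddot{o}r}^s_2(\mathbb{R}_+^* )}$.
   Formalization: In the Hörmander calculus, functions f of finite Hörmander norm are taken continuous on ]0,∞[ (the continuous representative), since for f changed at a single spectral point such as f = 1_{{1}} the norm is 0 while f(D^α) is non-zero. *)

(* Defs.v *)
From HB Require Import structures.
From mathcomp Require Import all_boot all_order all_algebra.
From mathcomp Require Import complex.
From mathcomp Require Import all_classical all_reals all_analysis.
From mathcomp Require Import measurable_realfun.

Set Implicit Arguments.
Unset Strict Implicit.
Unset Printing Implicit Defensive.

Import Order.TTheory GRing.Theory Num.Theory.
Import numFieldNormedType.Exports.

Local Open Scope classical_set_scope.
Local Open Scope ring_scope.
Local Open Scope complex_scope.
Local Open Scope quotient_scope.

(* In a normed space over R[i] the library norm is R[i]-valued; [nrm] is the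
   same number seen in R. *)
Definition nrm (R : realType) (Y : normedModType R[i]) (y : Y) : R :=
  complex.Re `|y|.

Section nrm_lemmas.
Context (R : realType).

Lemma nrmE (Y : normedModType R[i]) (x : Y) : `|x| = (nrm x)%:C.
Proof.
by rewrite /nrm; have := normr_ge0 x; case: `|x| => a b /andP[/= /eqP -> _].
Qed.

Lemma nrm_ge0 (Y : normedModType R[i]) (x : Y) : 0 <= nrm x.
Proof. by have := normr_ge0 x; rewrite nrmE lecR. Qed.

Lemma ler_nrmD (Y : normedModType R[i]) (x y : Y) :
  nrm (x + y) <= nrm x + nrm y.
Proof. by have := ler_normD x y; rewrite !nrmE -rmorphD lecR. Qed.

Lemma nrmZ (Y : normedModType R[i]) (a : R[i]) (x : Y) :
  nrm (a *: x) = nrm (a : R[i]^o) * nrm x.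
Proof.
by apply: complexI; rewrite rmorphM /= -!nrmE normrZ.
Qed.

Lemma ler_dist_nrm (Y : normedModType R[i]) (x y : Y) :
  `|nrm x - nrm y| <= nrm (x - y).
Proof.
have h (u v : Y) : nrm u - nrm v <= nrm (u - v).
  by rewrite lerBlDr -{1}(subrK v u) ler_nrmD.
rewrite ler_norml h andbT lerNl opprB.
by rewrite [leRHS](_ : _ = nrm (y - x)) ?h// /nrm distrC.
Qed.

Lemma cvg_nrm (Y : normedModType R[i]) (u : nat -> Y) (l : Y) :
  u @ \oo --> l -> (fun n => nrm (u n)) @ \oo --> nrm l.
Proof.
move=> ul; apply/cvgrPdist_lt => e e0.
have /cvgrPdist_lt/(_ e%:C) := ul.
rewrite ltcR => /(_ e0); apply: filterS => n.
rewrite nrmE ltcR; exact/le_lt_trans/ler_dist_nrm.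
Qed.

End nrm_lemmas.

Section simple_functions.
Context (R : realType) (Y : normedModType R[i]) (T : Type).

(* The list [:: (A_1, y_1); ...; (A_m, y_m)] encodes the simple function
   1_{A_1} y_1 + ... + 1_{A_m} y_m. *)
Definition sfun := seq (set T * Y).

Definition sfun_eval (s : sfun) (x : T) : Y :=
  \sum_(a <- s) \1_(a.1) x *: a.2.

Definition sfun_integral (mu : set T -> \bar R) (s : sfun) : Y :=
  \sum_(a <- s) (fine (mu a.1))%:C *: a.2.

Definition sfun_over (S : set (set T)) (mu : set T -> \bar R) (s : sfun) :=
  forall a, a \in s -> S a.1 /\ (mu a.1 < +oo)%E.

Definition strongly_measurable (S : set (set T)) (mu : set T -> \bar R)
    (f : T -> Y) :=
  exists s : nat -> sfun, (forall n, sfun_over S mu (s n)) /\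
    forall x, sfun_eval (s n) x @[n --> \oo] --> f x.

End simple_functions.

Section bochner.
Context d (T : measurableType d) (R : realType) (Y : normedModType R[i]).
Variable mu : {measure set T -> \bar R}.

Definition has_bochner_integral (f : T -> Y) (y : Y) :=
  strongly_measurable measurable mu f /\
  exists s : nat -> sfun Y T, [/\ forall n, sfun_over measurable mu (s n),
    (\int[mu]_x (nrm (f x - sfun_eval (s n) x))%:E)%E @[n --> \oo] --> 0%E &
    sfun_integral mu (s n) @[n --> \oo] --> y].

Definition bochner (D : set T) (f : T -> Y) : Y :=
  xget 0 [set y | has_bochner_integral (fun x => \1_D x *: f x) y].

End bochner.
Arguments bochner {d T R Y} mu D f.

Definition BNorm d (T : measurableType d) (R : realType)
    (Y : normedModType R[i]) (mu : {measure set T -> \bar R}) (p : R)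
    (f : T -> Y) : \bar R :=
  ('N[mu]_p%:E[EFin \o (fun x => nrm (f x))])%E.
Arguments BNorm {d T R Y} mu p f.

Definition BLfun d (T : measurableType d) (R : realType)
    (Y : normedModType R[i]) (mu : {measure set T -> \bar R}) (p : R) :
    {pred T -> Y} :=
  fun f => `[< strongly_measurable measurable mu f /\ (BNorm mu p f < +oo)%E >].

Section BLfun_theory.
Context d (T : measurableType d) (R : realType) (Y : normedModType R[i]).
Variables (mu : {measure set T -> \bar R}) (p : R) (p1 : 1 <= p).
Implicit Types f g : T -> Y.

Lemma measurable_nrm_sfun (s : sfun Y T) (y : Y) :
  sfun_over measurable mu s ->
  measurable_fun setT (fun x => nrm (y + sfun_eval s x)).
Proof.
elim: s y => [|[A z] s IH] y sS.
  rewrite (_ : (fun x => _) = cst (nrm y)) //.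
  by apply/funext => x; rewrite /sfun_eval big_nil addr0.
have [mA _] : measurable A /\ (mu A < +oo)%E.
  by apply: (sS (A, z)); rewrite inE eqxx.
have {}IH w : measurable_fun setT (fun x => nrm (w + sfun_eval s x)).
  by apply: IH => a sa; apply: sS; rewrite inE sa orbT.
rewrite (_ : (fun x => _) = fun x => if x \in A
    then nrm ((y + z) + sfun_eval s x) else nrm (y + sfun_eval s x)).
  apply: measurable_fun_if => //=.
  - apply: (measurable_fun_bool true).
    rewrite setTI (_ : _ @^-1` _ = A)//; apply/seteqP; split=> x /=.
      by move/set_mem.
    by move=> Ax; exact/mem_set.
  - exact: measurable_funS (IH _).
  - exact: measurable_funS (IH _).
apply/funext => x; rewrite /sfun_eval big_cons /= indicE.
by case: ifPn => _; rewrite ?scale1r ?scale0r ?add0r// addrA.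
Qed.

Lemma strongly_measurable_nrm f :
  strongly_measurable measurable mu f ->
  measurable_fun setT (fun x => nrm (f x)).
Proof.
move=> [s [sS sf]].
apply: (@measurable_fun_cvg _ _ _ setT (fun n x => nrm (sfun_eval (s n) x))).
- move=> n; have := measurable_nrm_sfun 0 (sS n).
  by under eq_fun do rewrite add0r.
- by move=> x _; exact: cvg_nrm (sf x).
Qed.

Lemma strongly_measurable0 :
  strongly_measurable measurable mu (fun=> 0 : Y).
Proof.
exists (fun=> [::]); split=> // x; rewrite (_ : (fun n => _) = cst 0).
  exact: cvg_cst.
by apply/funext => n; rewrite /sfun_eval big_nil.
Qed.

Lemma strongly_measurableDZ (a : R[i]) f g :
  strongly_measurable measurable mu f -> strongly_measurable measurable mu g ->
  strongly_measurable measurable mu (a *: f + g).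
Proof.
move=> [s [sS sf]] [t [tS tg]].
exists (fun n => [seq (b.1, a *: b.2) | b <- s n] ++ t n); split.
  move=> n b; rewrite mem_cat => /orP[/mapP[c cs ->]|]; last exact: tS.
  exact: (sS n c cs).
move=> x; rewrite (_ : (fun n => _) =
    fun n => a *: sfun_eval (s n) x + sfun_eval (t n) x).
  by apply: cvgD; [exact: cvgZr (sf x)|exact: tg].
apply/funext => n; rewrite /sfun_eval big_cat /= big_map scaler_sumr.
by congr (_ + _); apply: eq_bigr => b _; rewrite !scalerA mulrC.
Qed.

Lemma BNorm_ge0 f : (0 <= BNorm mu p f)%E.
Proof. exact: Lnorm_ge0. Qed.

Lemma BNormD f g :
  strongly_measurable measurable mu f -> strongly_measurable measurable mu g ->
  (BNorm mu p (f + g)%R <= BNorm mu p f + BNorm mu p g)%E.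
Proof.
move=> mf mg.
have mnf := strongly_measurable_nrm mf.
have mng := strongly_measurable_nrm mg.
have p1' : (1 <= p%:E)%E by rewrite lee_fin.
apply: le_trans (@eminkowski _ _ _ mu _ _ _ mnf mng p1').
rewrite /BNorm unlock /Lnorm /=.
apply: gt0_ler_poweR.
- by rewrite invr_ge0 (le_trans ler01).
- rewrite in_itv /= leey andbT; apply: integral_ge0 => x _.
  by rewrite lee_fin powR_ge0.
- rewrite in_itv /= leey andbT; apply: integral_ge0 => x _.
  by rewrite lee_fin powR_ge0.
apply: ge0_le_integral => //.
- apply/measurable_EFinP; apply: (@measurableT_comp _ _ _ _ _ _ (@powR R ^~ p)) => //.
  apply: measurableT_comp => //; apply: strongly_measurable_nrm.
  by have := strongly_measurableDZ 1 mf mg; rewrite scale1r.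
- apply/measurable_EFinP; apply: (@measurableT_comp _ _ _ _ _ _ (@powR R ^~ p)) => //.
  by apply: measurableT_comp => //; exact: measurable_funD.
move=> x _; rewrite lee_fin; apply: ge0_ler_powR; rewrite ?nnegrE//.
  by rewrite (le_trans ler01).
rewrite /= !ger0_norm ?addr_ge0 ?nrm_ge0//; exact: ler_nrmD.
Qed.

Lemma BNormZ (a : R[i]) f : f \in BLfun mu p ->
  BNorm mu p (a *: f) = ((nrm (a : R[i]^o))%:E * BNorm mu p f)%E.
Proof.
move=> /asboolP[mf lf].
have Lf : (fun x => nrm (f x)) \in Lfun mu p%:E.
  rewrite inE; apply/andP; split; rewrite inE /=.
    exact: strongly_measurable_nrm.
  exact: lf.
have p1' : (1 <= p%:E)%E by rewrite lee_fin.
have := LnormZ (Lfun_Sub p1' Lf) (nrm (a : R[i]^o)).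
rewrite ger0_norm ?nrm_ge0// => <-; rewrite /BNorm; congr (Lnorm _ _ _).
by apply/funext => x /=; rewrite nrmZ.
Qed.

Lemma BLfun_submod_closed : submod_closed (@BLfun d T R Y mu p).
Proof.
split.
  apply/asboolP; split; first exact: strongly_measurable0.
  rewrite /BNorm (_ : _ \o _ = cst 0%E) ?Lnorm0 ?ltry//.
    by rewrite gt_eqF// lte_fin (lt_le_trans ltr01).
  by apply/funext => x /=; rewrite /nrm normr0.
move=> a f g lf lg; have := BNormZ a lf.
move: lf lg => /asboolP[mf lf] /asboolP[mg lg] af.
apply/asboolP; split; first exact: strongly_measurableDZ.
have maf : strongly_measurable measurable mu (a *: f).
  by have := strongly_measurableDZ a mf strongly_measurable0; rewrite addr0.
apply: le_lt_trans (BNormD maf mg) _.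
by rewrite af lte_add_pinfty// lte_mul_pinfty// lee_fin nrm_ge0.
Qed.

End BLfun_theory.

Record seminorm (R : realType) (V : lmodType R[i]) := Seminorm {
  seminorm_fun :> V -> R;
  seminormD : forall x y, seminorm_fun (x + y) <= seminorm_fun x + seminorm_fun y;
  seminormZ : forall (a : R[i]) x,
    seminorm_fun (a *: x) = nrm (a : R[i]^o) * seminorm_fun x }.

Section sepquot.
Context (R : realType) (V : lmodType R[i]) (q : seminorm V).
Implicit Types x y z : V.

Lemma seminorm0 : q 0 = 0.
Proof. by rewrite -(scale0r (0 : V)) seminormZ {1}/nrm normr0 mul0r. Qed.

Lemma seminormN x : q (- x) = q x.
Proof. by rewrite -scaleN1r seminormZ {1}/nrm normrN1 mul1r. Qed.

Lemma seminorm_ge0 x : 0 <= q x.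
Proof.
have := seminormD q x (- x); rewrite subrr seminorm0 seminormN -mulr2n.
by rewrite pmulrn_lge0.
Qed.

Definition sep_eq x y := q (x - y) == 0.

Lemma sep_eq_refl : reflexive sep_eq.
Proof. by move=> x; rewrite /sep_eq subrr seminorm0. Qed.

Lemma sep_eq_sym : symmetric sep_eq.
Proof. by move=> x y; rewrite /sep_eq -opprB seminormN. Qed.

Lemma sep_eq_trans : transitive sep_eq.
Proof.
move=> y x z /eqP xy /eqP yz; rewrite /sep_eq eq_le seminorm_ge0 andbT.
by have := seminormD q (x - y) (y - z); rewrite addrA subrK xy yz addr0.
Qed.

Canonical sep_eq_equiv := EquivRel sep_eq sep_eq_refl sep_eq_sym sep_eq_trans.

(* V / {q = 0}, normed by q *)
Definition sepquot : Type := {eq_quot sep_eq}.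
HB.instance Definition _ := Choice.on sepquot.
HB.instance Definition _ := EqQuotient.on sepquot.

Definition sep_class x : sepquot := \pi_sepquot x.

Lemma sep_classP x y : sep_class x = sep_class y <-> q (x - y) = 0.
Proof.
rewrite /sep_class; split=> [/eqP|qxy].
  by rewrite eqmodE => /eqP.
by apply/eqP; rewrite eqmodE; exact/eqP.
Qed.

Lemma sep_reprK (u : sepquot) : sep_class (repr u) = u.
Proof. exact: reprK. Qed.

Lemma sep_repr_class x : q (repr (sep_class x) - x) = 0.
Proof. by apply/sep_classP; rewrite sep_reprK. Qed.

Lemma sepW (P : sepquot -> Prop) : (forall x, P (sep_class x)) -> forall u, P u.
Proof. by move=> Px u; rewrite -(sep_reprK u). Qed.

Lemma seminorm_eq0D x y : q x = 0 -> q y = 0 -> q (x + y) = 0.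
Proof.
move=> x0 y0; apply/eqP; rewrite eq_le seminorm_ge0 andbT.
by rewrite (le_trans (seminormD q _ _))// x0 y0 addr0.
Qed.

Definition sep_zero : sepquot := sep_class 0.
Definition sep_opp (u : sepquot) : sepquot := sep_class (- repr u).
Definition sep_add (u v : sepquot) : sepquot := sep_class (repr u + repr v).
Definition sep_scale (a : R[i]) (u : sepquot) : sepquot :=
  sep_class (a *: repr u).
Definition sep_norm (u : sepquot) : R[i] := (q (repr u))%:C.

Lemma sep_oppE x : sep_opp (sep_class x) = sep_class (- x).
Proof.
by apply/sep_classP; rewrite -opprD seminormN sep_repr_class.
Qed.

Lemma sep_addE x y : sep_add (sep_class x) (sep_class y) = sep_class (x + y).
Proof.
by apply/sep_classP; rewrite opprD addrACA seminorm_eq0D ?sep_repr_class.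
Qed.

Lemma sep_scaleE a x : sep_scale a (sep_class x) = sep_class (a *: x).
Proof.
by apply/sep_classP; rewrite -scalerBr seminormZ sep_repr_class mulr0.
Qed.

Lemma sep_normE x : sep_norm (sep_class x) = (q x)%:C.
Proof.
congr (_ %:C); apply/eqP; rewrite eq_le.
have h y z : q (y - z) = 0 -> q y <= q z.
  by move=> yz; rewrite -{1}(subrK z y) (le_trans (seminormD q _ _))// yz add0r.
by rewrite !h// ?sep_repr_class// -opprB seminormN sep_repr_class.
Qed.

Lemma sep_addA : associative sep_add.
Proof.
by elim/sepW=> x; elim/sepW=> y; elim/sepW=> z; rewrite !sep_addE addrA.
Qed.

Lemma sep_addC : commutative sep_add.
Proof. by elim/sepW=> x; elim/sepW=> y; rewrite !sep_addE addrC. Qed.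

Lemma sep_add0 : left_id sep_zero sep_add.
Proof. by elim/sepW=> x; rewrite sep_addE add0r. Qed.

Lemma sep_addN : left_inverse sep_zero sep_opp sep_add.
Proof. by elim/sepW=> x; rewrite sep_oppE sep_addE addNr. Qed.

HB.instance Definition _ :=
  GRing.isZmodule.Build sepquot sep_addA sep_addC sep_add0 sep_addN.

Lemma sep_scaleA a b u : sep_scale a (sep_scale b u) = sep_scale (a * b) u.
Proof. by elim/sepW: u => x; rewrite !sep_scaleE scalerA. Qed.

Lemma sep_scale1 : left_id 1 sep_scale.
Proof. by elim/sepW=> x; rewrite sep_scaleE scale1r. Qed.

Lemma sep_scaleDr : right_distributive sep_scale +%R.
Proof.
move=> a; elim/sepW=> x; elim/sepW=> y.
by rewrite -[_ + _]/(sep_add _ _) -[RHS]/(sep_add _ _) !(sep_addE, sep_scaleE)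
  scalerDr.
Qed.

Lemma sep_scaleDl u : {morph sep_scale^~ u : a b / a + b}.
Proof.
elim/sepW: u => x a b.
by rewrite -[RHS]/(sep_add _ _) !(sep_addE, sep_scaleE) scalerDl.
Qed.

HB.instance Definition _ := GRing.Zmodule_isLmodule.Build R[i] sepquot
  sep_scaleA sep_scale1 sep_scaleDr sep_scaleDl.

Lemma sep_normD u v : sep_norm (u + v) <= sep_norm u + sep_norm v.
Proof.
elim/sepW: u => x; elim/sepW: v => y.
by rewrite -[_ + sep_class _]/(sep_add _ _) sep_addE !sep_normE -rmorphD lecR
  seminormD.
Qed.

Lemma sep_normZ (a : R[i]) u : sep_norm (a *: u) = `|a| * sep_norm u.
Proof.
elim/sepW: u => x; rewrite -[_ *: _]/(sep_scale _ _) sep_scaleE !sep_normE.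
by rewrite seminormZ rmorphM /= -nrmE.
Qed.

Lemma sep_norm_eq0 u : sep_norm u = 0 -> u = 0.
Proof.
elim/sepW: u => x; rewrite sep_normE => /complexI qx.
by apply/sep_classP; rewrite subr0.
Qed.

HB.instance Definition _ := Lmodule_isNormed.Build R[i] sepquot
  sep_normD sep_normZ sep_norm_eq0.

End sepquot.

Section BLp.
Context d (T : measurableType d) (R : realType) (Y : normedModType R[i]).
Variables (mu : {measure set T -> \bar R}) (p : R) (p1 : 1 <= p).

Definition BLpred of 1 <= p : {pred T -> Y} := BLfun mu p.

HB.instance Definition _ := GRing.isSubmodClosed.Build R[i] (T -> Y)
  (BLpred p1) (@BLfun_submod_closed d T R Y mu p p1).

(* p-integrable strongly measurable functions, before identification almost
   everywhere *)
Record BLtype := BLType { BLval :> T -> Y; _ : BLval \in BLpred p1 }.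

HB.instance Definition _ := [isSub for BLval].
HB.instance Definition _ := [Choice of BLtype by <:].
HB.instance Definition _ := [SubChoice_isSubLmodule of BLtype by <:].

Definition BLp_seminorm (f : BLtype) : R := fine (BNorm mu p f).

Lemma BLp_seminormE (f : BLtype) : (BLp_seminorm f)%:E = BNorm mu p f.
Proof.
rewrite /BLp_seminorm fineK// ge0_fin_numE ?BNorm_ge0//.
by case: f => f /= /asboolP[].
Qed.

Lemma BLp_seminormD f g :
  BLp_seminorm (f + g) <= BLp_seminorm f + BLp_seminorm g.
Proof.
rewrite -lee_fin EFinD !BLp_seminormE.
case: f g => [f /asboolP[mf _]] [g /asboolP[mg _]] /=; exact: BNormD.
Qed.

Lemma BLp_seminormZ (a : R[i]) f :
  BLp_seminorm (a *: f) = nrm (a : R[i]^o) * BLp_seminorm f.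
Proof.
by apply: EFin_inj; rewrite EFinM !BLp_seminormE; case: f => f Lf; exact: BNormZ.
Qed.

Definition BLp : Type := sepquot (Seminorm BLp_seminormD BLp_seminormZ).
HB.instance Definition _ := NormedModule.on BLp.

Definition BLclass (f : BLtype) : BLp := sep_class _ f.

Lemma BLclassP (f g : BLtype) :
  BLclass f = BLclass g <-> {ae mu, forall x, f x = g x}.
Proof.
have nrm0 (y z : Y) : nrm (y - z) = 0 <-> y = z.
  split=> [yz|->]; last by rewrite /nrm subrr normr0.
  by apply/eqP; rewrite -subr_eq0 -normr_eq0 nrmE yz.
have mfg : measurable_fun setT (EFin \o fun x => nrm (f x - g x)).
  apply/measurable_EFinP.
  case: f g => [f /asboolP[mf _]] [g /asboolP[mg _]] /=.
  apply: (@strongly_measurable_nrm _ _ _ _ mu (f - g)).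
  by have := strongly_measurableDZ (-1) mg mf; rewrite scaleN1r addrC.
have -> : BLclass f = BLclass g <-> BNorm mu p (f \- g) = 0%E.
  rewrite /BLclass; split=> [/sep_classP /= fg|fg].
    by rewrite -[LHS](BLp_seminormE (f - g)) fg.
  by apply/sep_classP; rewrite /= /BLp_seminorm [X in fine X]fg.
have p0 : 0 < p := lt_le_trans ltr01 p1.
have p0' : (0 < p%:E)%E by rewrite lte_fin.
rewrite /BNorm; split=> fg.
  by apply: filterS (Lnorm_eq0_eq0 mfg p0' fg) => x /(_ I) [] /nrm0.
rewrite unlock /Lnorm /=.
rewrite (_ : (\int[mu]_x _)%E = 0%E) ?poweR0r//.
  by rewrite gt_eqF// invr_gt0.
rewrite (@ge0_ae_eq_integral _ _ _ mu setT _ (cst 0%E)) ?integral0//.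
  apply/measurable_EFinP.
  apply: (@measurableT_comp _ _ _ _ _ _ (@powR R ^~ p)) => //.
  by apply: measurableT_comp => //; exact/measurable_EFinP.
apply: filterS fg => x fg _ /=.
by rewrite fg (nrm0 _ _).2// normr0 powR0// gt_eqF.
Qed.

Definition in_class (F : BLp) (f : T -> Y) :=
  exists2 g : BLtype, F = BLclass g & {ae mu, forall x, g x = f x}.

End BLp.
Arguments BLclass {d T R Y mu p p1} f.
Arguments in_class {d T R Y mu p p1} F f.

Section umd.
Context (R : realType) (Y : normedModType R[i]).

Definition is_filtration d (T : measurableType d) (Fil : nat -> set (set T)) :=
  (forall k, sigma_algebra setT (Fil k) /\ Fil k `<=` measurable) /\
  (forall k, Fil k `<=` Fil k.+1).

Definition Lp_martingale d (T : measurableType d) (P : probability T R) (p : R)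
    (Fil : nat -> set (set T)) (f : nat -> T -> Y) :=
  (forall k, strongly_measurable (Fil k) P (f k) /\
     (BNorm P p (f k) < +oo)%E) /\
  (forall k (A : set T), Fil k A -> bochner P A (f k.+1) = bochner P A (f k)).

Definition UMD := forall p : R, 1 < p -> exists beta : R,
  forall d (T : measurableType d) (P : probability T R)
    (Fil : nat -> set (set T)) (f : nat -> T -> Y) (N : nat) (eps : nat -> bool),
  is_filtration Fil -> Lp_martingale P p Fil f ->
  (BNorm P p (fun w => (\sum_(k < N) (-1) ^+ eps k *: (f k.+1 w - f k w))%R) <=
   beta%:E * BNorm P p (fun w => (\sum_(k < N) (f k.+1 w - f k w))%R))%E.

End umd.

Section banach_function_space.
Context d (Omega : measurableType d) (R : realType).
Variable m : {measure set Omega -> \bar R}.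

Definition measurable_complex (g : Omega -> R[i]) :=
  measurable_fun setT (fun w => complex.Re (g w)) /\
  measurable_fun setT (fun w => complex.Im (g w)).

Definition locally_integrable_fun (g : Omega -> R[i]) :=
  measurable_complex g /\
  forall A, measurable A -> (m A < +oo)%E ->
    (\int[m]_(w in A) (nrm (g w : R[i]^o))%:E < +oo)%E.

(* The Banach space Y is a space of classes of functions on Omega through
   [ev], which picks a representative of every element of Y; positivity and
   [<=] are those of R[i], hence concern real values only. *)
Record Banach_function_space (Y : completeNormedModType R[i])
    (ev : Y -> Omega -> R[i]) : Prop := {
  bfs_locally_integrable : forall y, locally_integrable_fun (ev y);
  bfs_linear : forall (a : R[i]) y z,
    {ae m, forall w, ev (a *: y + z) w = a * ev y w + ev z w};
  bfs_inj : forall y z, {ae m, forall w, ev y w = ev z w} -> y = z;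
  bfs_ideal : forall y (g : Omega -> R[i]), measurable_complex g ->
    {ae m, forall w, `|g w| <= `|ev y w|} ->
    exists z, {ae m, forall w, ev z w = g w} /\ nrm z <= nrm y;
  bfs_fatou : forall (u : nat -> Y) (g : Omega -> R[i]),
    (forall k, {ae m, forall w, 0 <= ev (u k) w}) ->
    (forall k, {ae m, forall w, ev (u k) w <= ev (u k.+1) w}) ->
    has_ubound (range (fun k => nrm (u k))) ->
    {ae m, forall w, (ev (u k) w : R[i]^o) @[k --> \oo] --> (g w : R[i]^o)} ->
    exists y, {ae m, forall w, ev y w = g w} /\
      nrm y = sup (range (fun k => nrm (u k)));
  bfs_indic : forall A, measurable A -> (m A < +oo)%E ->
    exists y, {ae m, forall w, ev y w = \1_A w} }.

End banach_function_space.

Section sectorial.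
Context (R : realType) (X : normedModType R[i]).

(* (Unbounded) operators are given by their graph. *)
Implicit Types A : X -> X -> Prop.

Definition closed_densely_defined A :=
  [/\ A 0 0,
      forall (a : R[i]) x y x' y',
        A x y -> A x' y' -> A (a *: x + x') (a *: y + y'),
      forall x y y', A x y -> A x y' -> y = y',
      closed [set xy : X * X | A xy.1 xy.2] &
      dense [set x | exists y, A x y]].

Definition resolvent A (z : R[i]) (y : X) : X :=
  xget 0 [set x | A x (z *: x - y)].

Definition resolvent_set A : set R[i]^o :=
  [set z | (forall y, exists! x, A x (z *: x - y)) /\
    exists M : R, forall y, nrm (resolvent A z y) <= M * nrm y].

Definition polar (r phi : R) : R[i] := (r * cos phi) +i* (r * sin phi).

Definition sector (theta : R) : set R[i]^o :=
  [set z | exists r phi, [/\ 0 < r, `|phi| < theta & z = polar r phi]].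

Definition sectorial_of_type A (omega : R) :=
  [/\ 0 < omega < pi, closed_densely_defined A,
      ~` resolvent_set A `<=` closure (sector omega) &
      forall nu, omega < nu < pi -> exists M : R,
        forall z x, ~ closure (sector nu) z ->
          nrm (z *: resolvent A z x) <= M * nrm x].

Definition sectorial A := exists omega, sectorial_of_type A omega.

Definition sectoriality_angle A : R := inf [set omega | sectorial_of_type A omega].

(* integral along the boundary of the sector of angle [nu]: upper half-line
   towards 0, then lower half-line from 0 *)
Definition sector_integral (nu : R) (g : R[i] -> X) : X :=
  bochner lebesgue_measure `]0, +oo[ (fun r : R =>
    polar 1 (- nu) *: g (polar r (- nu))) -
  bochner lebesgue_measure `]0, +oo[ (fun r : R =>
    polar 1 nu *: g (polar r nu)).

Definition holomorphic_on (D : set R[i]^o) (f : R[i]^o -> R[i]^o) :=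
  forall z, D z -> derivable f z 1.

Definition Hinfty0 (theta : R) (f : R[i]^o -> R[i]^o) :=
  [/\ holomorphic_on (sector theta) f,
      exists M, forall z, sector theta z -> nrm (f z) <= M &
      exists C s : R, [/\ 0 < C, 0 < s & forall z, sector theta z ->
        nrm (f z) <= C * Num.min (nrm z `^ s) (nrm z `^ (- s))]].

Definition Hinfty_norm (theta : R) (f : R[i]^o -> R[i]^o) : R :=
  sup [set nrm (f z) | z in sector theta].

(* x |-> f(A) x, computed along the boundary of the sector of angle [nu] *)
Definition Hinfty_op A (nu : R) (f : R[i]^o -> R[i]^o) (x : X) : X :=
  (0 +i* (2 * pi))^-1 *: sector_integral nu (fun z => f z *: resolvent A z x).

Definition bounded_Hinfty_calculus A (theta : R) :=
  [/\ sectorial A, sectoriality_angle A < theta &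
    exists2 C : R, 0 <= C & forall f nu x, Hinfty0 theta f ->
      sectoriality_angle A < nu < theta ->
      nrm (Hinfty_op A nu f x) <= C * Hinfty_norm theta f * nrm x].

Definition generator (U : R -> X -> X) : X -> X -> Prop := fun x y =>
  (t%:C)^-1 *: (U t x - x) @[t --> 0^'+] --> y.

End sectorial.

HB.mixin Record isTopologicalField K & GRing.Field K & TopologicalZmodule K := {
  mulf_continuous : continuous (fun xy : K * K => xy.1 * xy.2);
  invf_continuous : forall x : K, x != 0 -> {for x, continuous (@GRing.inv K)} }.

#[short(type="topFieldType")]
HB.structure Definition TopologicalField :=
  {K of GRing.Field K & TopologicalZmodule K & isTopologicalField K}.

HB.instance Definition _ (K : topFieldType) m n :=
  Topological.on 'M[K]_(m, n).

(* V with 0 as default point, as required of measurable types *)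
Definition pointed_at0 (V : Type) : Type := V.
HB.instance Definition _ (V : zmodType) := Choice.on (pointed_at0 V).
HB.instance Definition _ (V : zmodType) := isPointed.Build (pointed_at0 V) 0.

Notation borel V := (g_sigma_algebraType (@open V : set (set (pointed_at0 V)))).

Section haar.
Context (R : realType) (V : PreTopologicalZmodule.type).

Definition Haar_measure (mu : {measure set (borel V) -> \bar R}) :=
  [/\ forall (a : V) (A : set V), measurable (A : set (borel V)) ->
        mu [set a + x | x in A] = mu A,
      forall A : set V, compact A -> (mu A < +oo)%E,
      forall U : set V, open U -> U !=set0 -> (0 < mu U)%E,
      forall A : set V, measurable (A : set (borel V)) ->
        mu A = ereal_inf [set mu U | U in [set U : set V | open U /\ A `<=` U]] &
      forall U : set V, open U ->
        mu U = ereal_sup [set mu A | A in [set A : set V | compact A /\ A `<=` U]]].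

End haar.

Section local_field.
Context (R : realType) (K : topFieldType).

(* the module function |x|: multiplication by x scales Haar measure by |x| *)
Definition modulus (x : K) : R :=
  if x == 0 then 0 else
  xget 0 [set r : R | exists2 mu : {measure set (borel K) -> \bar R},
    Haar_measure mu & forall A : set K, measurable (A : set (borel K)) ->
      mu [set x * y | y in A] = (r%:E * mu A)%E].

Definition nonarchimedean_local_field :=
  [/\ hausdorff_space K, locally_compact [set: K], ~ open [set (0 : K)] &
      forall x y, modulus (x + y) <= Num.max (modulus x) (modulus y)].

Definition integers : set K := [set x | modulus x <= 1].
Definition maximal_ideal : set K := [set x | modulus x < 1].

Definition prime_element (beta : K) :=
  maximal_ideal = [set beta * x | x in integers].

Definition unitary_character (chi : K -> R[i]) :=
  [/\ continuous (chi : K -> R[i]^o),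
      forall x y, chi (x + y) = chi x * chi y &
      forall x, `|chi x| = 1].

Definition vnorm n (x : 'rV[K]_n) : R := \big[Num.max/0]_(i < n) modulus (x ord0 i).

Definition vdot n (x y : 'rV[K]_n) : K := \sum_(i < n) x ord0 i * y ord0 i.

Definition integers_n n : set 'rV[K]_n := [set x | forall i, integers (x ord0 i)].

End local_field.
Arguments integers_n R K n : clear implicits.

Section taibleson.
Context (R : realType) (K : topFieldType) (n : nat).
Variables (mu : {measure set (borel 'rV[K]_n) -> \bar R}) (chi : K -> R[i]).
Variable alpha : R.

Local Notation Kn := 'rV[K]_n.
Implicit Types phi psi : Kn -> R[i]^o.

Definition heat_kernel (t : R) (x : Kn) : R[i]^o :=
  bochner mu setT (fun xi : Kn =>
    (expR (- t * vnorm R xi `^ alpha))%:C * (chi (vdot x xi))^* : R[i]^o).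

Definition convolution (k : Kn -> R[i]) phi (x : Kn) : R[i]^o :=
  bochner mu setT (fun y : Kn => k (x - y) * phi y : R[i]^o).

Definition fourier phi (xi : Kn) : R[i]^o :=
  bochner mu setT (fun x : Kn => chi (vdot x xi) * phi x : R[i]^o).

(* g is the Fourier transform of phi in L^2: extension of [fourier] by density
   of L^1 \cap L^2 *)
Definition fourier_L2 phi (g : Kn -> R[i]^o) :=
  [/\ phi \in BLfun mu 2, g \in BLfun mu 2 &
    exists u : nat -> Kn -> R[i]^o,
    [/\ forall k, u k \in BLfun mu 1 /\ u k \in BLfun mu 2,
        BNorm mu 2 (u k - phi) @[k --> \oo] --> 0%E &
        BNorm mu 2 (fourier (u k) - g) @[k --> \oo] --> 0%E]].

(* graph of f(D^alpha) on L^2 *)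
Definition spectral_multiplier (f : R -> R[i]) phi psi :=
  exists g h, [/\ fourier_L2 phi g, fourier_L2 psi h &
    {ae mu, forall xi, h xi = f (vnorm R xi `^ alpha) * g xi}].

Context (Y : normedModType R[i]) (p : R) (p1 : 1 <= p).
Local Notation X := (BLp Y mu p1).

Definition tensor_extension (S : (Kn -> R[i]^o) -> (Kn -> R[i]^o) -> Prop)
    (U : X -> X) :=
  forall phi psi (y : Y) (F : X), S phi psi ->
    in_class F (fun x => phi x *: y) -> in_class (U F) (fun x => psi x *: y).

Definition heat_semigroup (U : R -> {linear X -> X}) :=
  (forall F, U 0 F = F) /\
  forall t, 0 < t -> continuous (U t) /\
    tensor_extension (fun phi psi => phi \in BLfun mu p /\
      psi = convolution (heat_kernel t) phi) (U t).

(* graph of D^alpha (x) Id_Y *)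
Definition taibleson (F G : X) :=
  exists2 U, heat_semigroup U & generator U F (- G).

End taibleson.
Arguments taibleson {R K n} mu chi alpha Y {p} p1 F G.

Section hormander.
Context (R : realType).

(* C^oo with compact support in ]0, +oo[, extended by 0 *)
Definition bump_function (eta : R -> R) :=
  [/\ forall k x, derivable (derive1n k eta) x 1,
      exists a b, 0 < a /\ forall x, eta x != 0 -> a <= x <= b &
      exists x, eta x != 0].

Definition fourier_R (g : R -> R[i]) (xi : R) : R[i]^o :=
  bochner lebesgue_measure setT (fun x : R =>
    (cos (x * xi) -i* sin (x * xi)) * g x : R[i]^o).

(* W^{s,2} norm of an integrable function *)
Definition sobolev_norm (s : R) (g : R -> R[i]) : \bar R :=
  BNorm lebesgue_measure 2 (fun xi : R =>
    ((1 + xi ^+ 2) `^ (s / 2))%:C * fourier_R g xi : R[i]^o).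

Definition hormander_norm (eta : R -> R) (s : R) (f : R -> R[i]) : \bar R :=
  ereal_sup [set sobolev_norm s (fun x => (eta x)%:C * f (t * x)) |
    t in [set t : R | 0 < t]].

(* Only the values of f on ]0, +oo[ matter. For s > 1/2 a class of functions of
   finite norm has a unique continuous representative, and it is the one which
   f(D^alpha) refers to: the spectrum of D^alpha is Lebesgue negligible. *)
Definition hormander_space (eta : R -> R) (s : R) (f : R -> R[i]) :=
  (forall x, 0 < x -> {for x, continuous (f : R -> R[i]^o)}) /\
  (hormander_norm eta s f < +oo)%E.

End hormander.

Definition taibleson_hormander_calculus (R : realType) (K : topFieldType) (n : nat)
    (mu : {measure set (borel 'rV[K]_n) -> \bar R}) (chi : K -> R[i]) (alpha : R)
    (Y : normedModType R[i]) (p : R) (p1 : 1 <= p) (eta : R -> R) (s : R) :=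
  exists2 C : R, 0 <= C & forall f, hormander_space eta s f ->
    exists2 U : {linear BLp Y mu p1 -> BLp Y mu p1},
      tensor_extension (fun phi psi => phi \in BLfun mu p /\
        spectral_multiplier mu chi alpha f phi psi) U &
      forall F, nrm (U F) <= C * fine (hormander_norm eta s f) * nrm F.

(* Main.v *)
(** Two balls of K^n are nested or disjoint, so the averages E_k over the balls
    of radius q^-k are conditional expectations, and D^alpha = sum_k A^k Delta_k
    with A = q^alpha and Delta_k = E_k - E_(k-1).  A real multiplier bounded by 1
    is a convex combination of signs, so UMD bounds sum_k m_k Delta_k on
    L^p(K^n, Y) by a constant times sup_k |m_k|.  Both calculi thus reduce to
    scalars: Cauchy's formula on the boundary of the sector at each eigenvalue
    A^k, and the bound of |f| by its Hoermander norm, which follows from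
    Fejer summation of its Fourier integral.  The generator is matched with
    sum_k A^k Delta_k by summing the heat kernel over spheres. *)
Require Import Defs.
From HB Require Import structures.
From mathcomp Require Import all_boot all_order all_algebra.
From mathcomp Require Import complex.
From mathcomp Require Import all_classical all_reals all_analysis.
From mathcomp Require Import measurable_realfun zify ring lra.
Set Implicit Arguments.
Unset Strict Implicit.
Unset Printing Implicit Defensive.
Import Order.TTheory GRing.Theory Num.Theory.
Import numFieldNormedType.Exports.
Local Open Scope classical_set_scope.
Local Open Scope ring_scope.
Local Open Scope complex_scope.

Local Notation smeas := (strongly_measurable measurable).
Local Notation has_bochner := has_bochner_integral.
Local Notation seval := sfun_eval.

(** The modulus of [K] is defined through Haar measure, so its multiplicativity, the discreteness of
    its values and the compactness of its balls must first be drawn from the uniqueness of Haar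
    measure. A Haar measure on [K] itself comes from the nontriviality of the character, which
    forces some modulus to be nonzero. UMD speaks of probability spaces, while K^n has infinite
    measure: finite combinations of indicators of balls live in one large ball, the martingale
    estimate is made there, and density does the rest. From then on only the record
    [spectral_resolution] is used, and operator identities are checked on each Delta_k. The obstacle
    in Cauchy's formula is that the eigenvalues lie inside the sector: the pole at l is removed by
    subtracting f(l) psi, where psi(l) = 1 and psi decays at 0 and infinity; the remaining integral
    has an explicit primitive. The link with Fourier analysis is that the transform of the indicator
    of a ball is a multiple of the indicator of the dual ball. So E_k also cuts the Fourier
    transform off to a ball, and the symbol is constant on the shell between two such balls. *)

Lemma eqW d (T : porderType d) (x y : T) : x = y -> (x <= y)%O.
Proof. by move=> ->. Qed.

Lemma measurable_enrm d (T : measurableType d) (R : realType) (Y : normedModType R[i])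
    (mu : {measure set T -> \bar R}) (f : T -> Y) :
  smeas mu f -> measurable_fun setT (fun x => (nrm (f x))%:E).
Proof. by move=> mf; apply/measurable_EFinP; exact: strongly_measurable_nrm mf. Qed.

(** * Haar measure on a topological field *)

Lemma finite_translates (G : topologicalZmodType) (A U : set G) :
  compact A -> nbhs 0 U ->
  exists s : seq G, forall x, A x -> exists2 c, c \in s & U (x - c).
Proof.
move=> /compact_near_coveringP cA U0.
(* The filter of finite subsets of [G] directed by inclusion: near-covering compactness along it
   yields one finite set that serves all points of [A]. *)
pose F : set_system (seq G) :=
  [set P | exists s0 : seq G, forall s : seq G, {subset s0 <= s} -> P s].
have FF : Filter F.
  split; first by exists [::].
  - move=> P Q [s sP] [t tQ]; exists (s ++ t) => r sr; split.
      by apply: sP => x xs; apply: sr; rewrite mem_cat xs.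
    by apply: tQ => x xs; apply: sr; rewrite mem_cat xs orbT.
  - by move=> P Q PQ [s sP]; exists s => r /sP /PQ.
have := cA _ F (fun s x => exists2 c, c \in s & U (x - c)) FF.
case=> [x Ax|s sP]; last by exists s; apply: sP.
exists ([set y | U (y - x)], [set s : seq G | x \in s]).
  split=> /=; last by exists [:: x] => s; apply; rewrite inE.
  have : (fun y => y - x) y @[y --> x] --> (0 : G).
    rewrite -(subrr x); apply: (@continuous_comp _ _ _ (fun y => (y, x))
      (fun z : G * G => z.1 - z.2)); last exact: sub_continuous.
    by apply: cvg_pair => /=; [exact: cvg_id|exact: cvg_cst].
  exact.
by case=> y s /= [Uy xs]; exists x.
Qed.

Section topological_group.
Context (G : topologicalZmodType).

Lemma addl_continuous (x : G) : continuous (fun y => x + y).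
Proof.
move=> y; apply: (@continuous_comp _ _ _ (fun y => (x, y))
  (fun z : G * G => z.1 + z.2)); last exact: add_continuous.
by apply: cvg_pair => /=; [exact: cvg_cst|exact: cvg_id].
Qed.

Lemma nbhs_shift (x : G) (U : set G) :
  nbhs x U -> nbhs 0 [set y | U (x + y)].
Proof.
by have := @addl_continuous x 0; rewrite /continuous_at addr0; exact.
Qed.

Lemma nbhs_add_split (U : set G) : nbhs 0 U ->
  exists2 P, nbhs 0 P & forall x y, P x -> P y -> U (x + y).
Proof.
move=> U0; have := @add_continuous G (0, 0); rewrite /continuous_at /= addr0.
move=> /(_ U U0)[[P Q] /= [P0 Q0] PQ].
exists (P `&` Q); first exact: filterI.
by move=> x y [Px _] [_ Qy]; exact: (PQ (x, y)).
Qed.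

Lemma nbhs_opp (U : set G) : nbhs 0 U -> nbhs 0 [set x | U (- x)].
Proof.
by move=> U0; have := @opp_continuous G 0; rewrite /continuous_at oppr0; exact.
Qed.

End topological_group.

Section topological_field.
Context (K : topFieldType).

Lemma mull_continuous (x : K) : continuous (fun y => x * y).
Proof.
move=> y; apply: (@continuous_comp _ _ _ (fun y => (x, y))
  (fun z : K * K => z.1 * z.2)); last exact: mulf_continuous.
by apply: cvg_pair => /=; [exact: cvg_cst|exact: cvg_id].
Qed.

Lemma mulr_continuousl (x : K) : continuous (fun y => y * x).
Proof.
move=> y; rewrite (_ : (fun y => _) = (fun y => x * y)); last first.
  by apply/funext => z; rewrite mulrC.
exact: mull_continuous.
Qed.

Lemma compact_mull (x : K) (V : set K) :
  compact V -> compact [set x * y | y in V].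
Proof.
move=> cV; apply: continuous_compact => //.
apply: continuous_subspaceT; exact: mull_continuous.
Qed.

Lemma compact_small_mul (V U : set K) :
  compact V -> nbhs 0 U -> \forall a \near (0 : K), forall v, V v -> U (a * v).
Proof.
move=> /compact_near_coveringP cV U0.
have := cV _ (nbhs (0 : K)) (fun a v => U (a * v)) _; apply => v Vv.
have := @mulf_continuous K (v, 0); rewrite /continuous_at /= mulr0.
move=> /(_ U U0)[[P Q] /= [P0 Q0] PQ].
exists (P, Q) => // -[v' a] [/= Pv Qa].
by rewrite mulrC; exact: (PQ (v', a)).
Qed.

Lemma nbhs0_mull (a : K) (U : set K) : a != 0 ->
  nbhs 0 U -> nbhs 0 [set a * y | y in U].
Proof.
move=> a0 U0; have h : (fun y => a^-1 * y) @ (0 : K) --> a^-1 * 0.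
  exact: mull_continuous.
rewrite mulr0 in h; have {}h : nbhs 0 [set y | U (a^-1 * y)] by exact: h.
apply: filterS h => y Uy.
by exists (a^-1 * y) => //; rewrite mulVKf.
Qed.

Hypothesis hausK : hausdorff_space K.
Hypothesis lcK : locally_compact [set: K].
Hypothesis ndK : ~ open [set (0 : K)].

Lemma compact_nbhs0 : exists2 V : set K, nbhs 0 V & compact V.
Proof.
have [V V0 [cV _]] := lcK (I : [set: K] 0); exists V => //.
by move: V0; rewrite /within /=; apply: filterS => x; exact.
Qed.

Lemma nbhs0_nontrivial (U : set K) : nbhs 0 U -> exists2 u, U u & u != 0.
Proof.
move=> U0; apply: contrapT => h; apply: ndK.
have U00 : U `<=` [set 0].
  by move=> u Uu; apply: contrapT => /eqP u0; apply: h; exists u.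
rewrite openE => x ->; exact: filterS U0.
Qed.

(** Take [a] so small that a V lies in V without the point 1. The powers of [a] then stay in the
    compact [V] and cluster at some s. If s = 0, one power close to 0 maps [V] into [U], and so do
    all later ones because a V is contained in V. *)
Lemma topologically_nilpotent : exists a (V : set K), [/\ a != 0, nbhs 0 V,
  compact V, V 1 /\ (forall m v, V v -> V (a ^+ m * v)) & forall U, nbhs 0 U ->
    exists k, forall m v, (k <= m)%N -> V v -> U (a ^+ m * v)].
Proof.
have [V0 V00 cV0] := compact_nbhs0.
have [v0 V0v0 v00] := nbhs0_nontrivial V00.
pose V := [set v0^-1 * y | y in V0].
have cV : compact V by exact: compact_mull.
have nV : nbhs 0 V by apply: nbhs0_mull => //; rewrite invr_eq0.
have V1 : V 1 by exists v0 => //; rewrite mulVf.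
have W0 : nbhs 0 (V `&` ~` [set 1]).
  apply: filterI => //; apply: open_nbhs_nbhs; split.
    apply: closed_openC; apply: accessible_closed_set1.
    exact: hausdorff_accessible.
  by move=> /= /eqP; rewrite eq_sym oner_eq0.
have [a aV a0] := nbhs0_nontrivial (compact_small_mul cV W0).
have aVV m v : V v -> V (a ^+ m * v).
  elim: m v => [|m IH] v Vv; first by rewrite mul1r.
  by rewrite exprSr -mulrA; apply: IH; exact: (aV _ Vv).1.
exists a, V; split=> // U U0.
have [s [Vs cls]] : V `&` cluster ((fun m => a ^+ m) @ \oo) !=set0.
  apply: cV; exists 0%N => // m _ /=.
  by have := aVV m 1 V1; rewrite mulr1.
have tail P m : nbhs s P -> exists2 k, (m <= k)%N & P (a ^+ k).
  move=> sP; have [||x [[k mk <-] Px]] := cls [set a ^+ k | k in [set k | (m <= k)%N]] P.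
  - by exists m => // k /= mk; exists k.
  - exact: sP.
  by exists k.
have [s0|s0] := eqVneq s 0.
  have := compact_small_mul cV U0; rewrite -s0 => sP.
  have [k _ Pk] := tail _ 0%N sP; exists k => m v km Vv.
  by rewrite -(subnKC km) exprD -mulrA; apply: Pk; exact: aVV.
(* A nonzero cluster point is impossible: two powers near s have a quotient a^(l - k), l > k, near
   1, while this quotient lies in the closed set a V, which misses 1. *)
exfalso.
pose C := [set a * y | y in V].
have : closed C by apply: compact_closed => //; exact: compact_mull.
rewrite closure_id => CE.
suff : C 1 by case=> v Vv av1; apply: (aV _ Vv).2.
rewrite CE => P P1.
have : (fun z : K * K => z.1 * z.2^-1) z @[z --> (s, s)] --> s * s^-1.
  apply: (@cvg_comp _ _ _ (fun z : K * K => (z.1, z.2^-1))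
    (fun z : K * K => z.1 * z.2) _ (nbhs (s, s^-1))); last first.
    exact: (@mulf_continuous K (s, s^-1)).
  apply: cvg_pair => /=; first exact: cvg_fst.
  apply: (@cvg_comp _ _ _ snd (@GRing.inv K) _ (nbhs s)); first exact: cvg_snd.
  exact: invf_continuous.
rewrite divff// => /(_ _ P1)[[Q1 Q2] /= [Qs1 Qs2] QP].
have Qs : nbhs s (Q1 `&` Q2) by exact: filterI.
have [k _ [_ Qk]] := tail _ 0%N Qs.
have [l kl [Ql _]] := tail _ k.+1 Qs.
have ak0 j : a ^+ j != 0 by rewrite expf_neq0.
exists (a ^+ (l - k)); split; last first.
  have := QP (a ^+ l, a ^+ k) (conj Ql Qk) => /=.
  by rewrite -{1}(subnKC (ltnW kl)) exprD mulrAC divff// mul1r.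
exists (a ^+ (l - k.+1)).
  by have := aVV (l - k.+1)%N 1 V1; rewrite mulr1.
by rewrite -exprS -subSn// subSS.
Qed.

End topological_field.

(** * Uniqueness of Haar measure *)

Section haar_uniqueness.
Context (R : realType) (G : topologicalZmodType).

Lemma continuous_borel_measurable (H : topologicalZmodType) (f : G -> H) :
  continuous f -> measurable_fun setT (f : borel G -> borel H).
Proof.
move=> cf; apply: (@measurability _ _ (borel G) (borel H) setT f (@open H)) => //.
move=> _ [U oU <-]; apply: sub_sigma_algebra; rewrite setTI.
exact: open_comp.
Qed.

Lemma continuous_preimage_borel (H : topologicalZmodType) (f : G -> H)
    (A : set H) : continuous f -> measurable (A : set (borel H)) ->
  measurable ([set x | A (f x)] : set (borel G)).
Proof.
move=> cf mA; have := continuous_borel_measurable cf measurableT mA.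
by rewrite setTI.
Qed.

Hypothesis base0 : exists2 V : nat -> set G, forall k, nbhs 0 (V k) &
  forall U, nbhs 0 U -> exists k, V k `<=` U.
Hypothesis sigma_compact : exists2 C : nat -> set G, forall j, compact (C j) &
  forall x, exists j, C j x.

(** The preimage of an open set has to be a countable union of measurable rectangles. Finite nets of
    the compacts [C j] at the scales [V k] form a countable dense set, and the translates of the
    [V k] by its points are the sides of these rectangles. *)
Lemma measurable_fun_borel_add :
  measurable_fun setT (fun z : borel G * borel G => (z.1 + z.2 : G) : borel G).
Proof.
have [V V0 Vb] := base0; have [C cC CT] := sigma_compact.
have /choice[s sP] : forall jk : nat * nat, exists s : seq G,
    forall x, C jk.1 x -> exists2 c, c \in s & (V jk.2)° (x - c).
  by move=> [j k]; apply: finite_translates => //; exact: nbhs_interior.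
pose T := (nat * nat * nat)%type.
pose d (t : T) := nth 0 (s t.1) t.2.
have dense_d k x : exists t, (V k)° (x - d t).
  have [j Cj] := CT x; have [c cs Vc] := sP (j, k) x Cj.
  by exists ((j, k), index c (s (j, k))); rewrite /d /= nth_index.
pose P k t := [set x | (V k)° (x - d t)] : set (borel G).
have mP k t : measurable (P k t).
  apply: sub_sigma_algebra; apply: (@open_comp _ _ (fun x : G => x - d t)).
    move=> x _; have := @addl_continuous G (- d t) x.
    by rewrite (_ : +%R (- d t) = fun x => x - d t)//; apply/funext => z; rewrite addrC.
  exact: open_interior.
apply: (@measurability _ _ _ (borel G) setT _ (@open G)) => //.
move=> _ [U oU <-]; rewrite setTI.
pose F (i : T * T * nat) := if `[< P i.2 i.1.1 `*` P i.2 i.1.2 `<=`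
  [set z | U (z.1 + z.2)] >] then P i.2 i.1.1 `*` P i.2 i.1.2 else set0.
rewrite (_ : _ @^-1` _ = \bigcup_i F i).
  apply: countable_bigcupT_measurable; first exact: countableP.
  move=> i; rewrite /F; case: ifP => _ //.
  by apply: measurableX.
apply/seteqP; split=> [[x y] /= Uxy|z [i _]]; last first.
  by rewrite /F; case: ifP => // /asboolP; exact.
have := @nbhs_shift G (x + y) U (open_nbhs_nbhs (conj oU Uxy)).
move=> /nbhs_add_split[P1 P10 P1P].
have [Q Q0 QP] := nbhs_add_split P10.
have [k Vk] := Vb _ (filterI Q0 (nbhs_opp Q0)).
have [t Vt] := dense_d k x; have [u Vu] := dense_d k y.
exists ((t, u), k) => //; rewrite /F; case: asboolP => // -[].
move=> [x' y'] [/= x't y'u].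
have h (a a' : G) v : (V k)° (a - d v) -> (V k)° (a' - d v) -> P1 (a' - a).
  move=> /interior_subset/Vk[_ /= h1] /interior_subset/Vk[h2 _].
  by have := QP _ _ h2 h1; rewrite opprB addrA subrK.
have := P1P _ _ (h _ _ _ Vt x't) (h _ _ _ Vu y'u).
rewrite /= (_ : x + y + _ = x' + y')//.
by rewrite addrACA !(addrC _ (_ - _)) !subrK.
Qed.

Definition translation_invariant (nu : set (borel G) -> \bar R) :=
  forall (a : G) (A : set G), measurable (A : set (borel G)) ->
    nu [set a + x | x in A] = nu A.

Lemma translation_preimage (nu : set (borel G) -> \bar R) (a : G) (A : set G) :
  translation_invariant nu -> measurable (A : set (borel G)) ->
  nu [set x | A (a + x)] = nu A.
Proof.
move=> inv mA; rewrite -(inv (- a) A mA); congr nu.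
apply/seteqP; split=> [x Ax|_ [x Ax <-]] /=; last by rewrite addNKr.
by exists (a + x) => //; rewrite addKr.
Qed.

Variables nu nu' : {sigma_finite_measure set (borel G) -> \bar R}.
Hypothesis inv : translation_invariant nu.
Hypothesis inv' : translation_invariant nu'.

(** Fubini for the set of (x, y) with x + y in A and y in B gives the left side. Translating y by x
    turns it into the set with y in A and y - x in B, and Fubini for that one gives the right
    side. *)
Lemma haar_unique (A B : set G) : measurable (A : set (borel G)) ->
  measurable (B : set (borel G)) ->
  (nu A * nu' B = nu' A * nu [set (- x)%R | x in B])%E.
Proof.
move=> mA mB.
have mopp : measurable_fun setT ((fun x => - x : G) : borel G -> borel G).
  by apply: continuous_borel_measurable; exact: opp_continuous.
pose S1 := [set z : borel G * borel G | A (z.1 + z.2 : G) /\ B z.2].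
have mS1 : measurable S1.
  apply: measurableI.
    by have := measurable_fun_borel_add measurableT mA; rewrite setTI.
  have := @measurable_snd _ _ (borel G) (borel G) measurableT _ mB.
    by rewrite setTI.
pose S2 := [set z : borel G * borel G | A z.2 /\ B (z.2 - z.1 : G)].
have mS2 : measurable S2.
  apply: measurableI.
    have := @measurable_snd _ _ (borel G) (borel G) measurableT _ mA.
    by rewrite setTI.
  have mf : measurable_fun setT (fun z : borel G * borel G =>
      (z.2 : borel G, (- z.1 : G) : borel G)).
    apply/measurable_fun_pairP; split => /=; first exact: measurable_snd.
    exact: (measurableT_comp mopp measurable_fst).
  have := measurableT_comp measurable_fun_borel_add mf.
  by move=> /(_ measurableT _ mB); rewrite setTI.
have fub (S : set (borel G * borel G)) : measurable S ->
    (\int[nu]_x nu' [set y | S (x, y)] = \int[nu']_y nu [set x | S (x, y)])%E.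
  move=> mS.
  have mSx x : measurable [set y | S (x, y)].
    by have := measurable_xsection x mS; rewrite xsectionE.
  have mSy y : measurable [set x | S (x, y)].
    by have := measurable_ysection y mS; rewrite ysectionE.
  have := @fubini_tonelli _ _ _ _ R nu nu' (EFin \o \1_S).
  rewrite /= => fT; transitivity (\int[nu]_x \int[nu']_y (\1_S (x, y))%:E)%E.
    apply: eq_integral => x _; rewrite -[X in nu' X]setIT.
    rewrite -(integral_indic nu' measurableT (mSx x)).
    by apply: eq_integral => y _; rewrite !indicE.
  rewrite fT; first last.
  - by move=> z; rewrite lee_fin.
  - by apply/measurable_EFinP; exact: measurable_indic.
  apply: eq_integral => y _; rewrite -[X in nu X]setIT.
  rewrite -(integral_indic nu measurableT (mSy y)).
  by apply: eq_integral => x _; rewrite !indicE.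
have oppB : [set - x | x in B] = [set x | B (- x)].
  apply/seteqP; split=> [_ [x Bx <-]|x Bx] /=; first by rewrite opprK.
  by exists (- x) => //; rewrite opprK.
have mB' : measurable ([set x | B (- x)] : set (borel G)).
  by have := mopp measurableT _ mB; rewrite setTI.
have cst_section (c : \bar R) (C : set (borel G)) : measurable C -> (0 <= c)%E ->
    (c * nu' C = \int[nu']_y (c * (\1_C y)%:E))%E.
  move=> mC c0; rewrite ge0_integralZl//.
    by rewrite integral_indic// setIT.
  by apply/measurable_EFinP; exact: measurable_indic.
rewrite oppB (muleC (nu' A)) !cst_section//.
transitivity (\int[nu']_y nu [set x | S1 (x, y)])%E.
  apply: eq_integral => y _; rewrite indicE /S1 /=.
  have [yB|yB] := boolP (y \in B).
    rewrite mule1 -(translation_preimage y inv mA); congr (nu _).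
    apply/seteqP; split=> x /=; rewrite addrC; last by case.
    by move=> Axy; split=> //; exact: set_mem.
  rewrite mule0 (_ : [set x | _] = set0) ?measure0//.
  by apply/seteqP; split=> x //= -[_ /mem_set]; rewrite (negbTE yB).
rewrite -fub//; transitivity (\int[nu]_x nu' [set y | S2 (x, y)])%E.
  apply: eq_integral => x _.
  have mS2x : measurable ([set y | S2 (x, y)] : set (borel G)).
    by have := measurable_xsection x mS2; rewrite xsectionE.
  rewrite -(translation_preimage x inv' mS2x); congr (nu' _).
  by apply/seteqP; split=> y /=; rewrite /S1 /S2 /= addrAC subrr add0r.
rewrite fub//; apply: eq_integral => y _; rewrite indicE /S2 /=.
have [yA|yA] := boolP (y \in A).
  rewrite mule1 -(translation_preimage (- y) inv mB'); congr (nu _).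
  apply/seteqP; split=> x /=; rewrite opprD opprK; first by case.
  by move=> By; split=> //; exact: set_mem.
rewrite mule0 (_ : [set x | _] = set0) ?measure0//.
by apply/seteqP; split=> x //= -[/mem_set]; rewrite (negbTE yA).
Qed.

End haar_uniqueness.

(** * The modulus of a local field *)

(** The proof of sigma-finiteness is an argument of the name, so that the sigma-finite structure can
    be attached to the measure. *)
Definition sigma_finite_copy d (T : measurableType d) (R : realType)
  (nu : {measure set T -> \bar R}) of sigma_finite setT nu : set T -> \bar R := nu.

Section sigma_finite_copy.
Context d (T : measurableType d) (R : realType) (nu : {measure set T -> \bar R}).
Hypothesis sf : sigma_finite setT nu.
HB.instance Definition _ := Measure.on (sigma_finite_copy sf).
HB.instance Definition _ :=
  @Measure_isSigmaFinite.Build _ _ _ (sigma_finite_copy sf) sf.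
End sigma_finite_copy.

Section modulus.
Context (R : realType) (K : topFieldType).
Hypothesis hK : nonarchimedean_local_field R K.
Local Notation mod := (@modulus R K).

Let hausK : hausdorff_space K. Proof. by case: hK. Qed.
Let lcK : locally_compact [set: K]. Proof. by case: hK. Qed.
Let ndK : ~ open [set (0 : K)]. Proof. by case: hK. Qed.

Lemma ultrametric (x y : K) : mod (x + y) <= Num.max (mod x) (mod y).
Proof. by case: hK. Qed.

Lemma modulus0 : mod 0 = 0.
Proof. by rewrite /modulus eqxx. Qed.

(** [modulus] picks its value with [xget] and default 0 among numbers that come with a Haar measure,
    so a nonzero value reveals one. *)
Lemma haar_exists (x : K) : mod x != 0 ->
  exists nu : {measure set (borel K) -> \bar R}, Haar_measure nu.
Proof.
rewrite /modulus; case: ifP => // _; first by rewrite eqxx.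
case: xgetP => [r -> [nu hnu _] _|_]; first by exists nu.
by rewrite eqxx.
Qed.

Lemma exhausted_by_compacts : exists a (V : set K),
  [/\ a != 0, nbhs 0 V, compact V & forall x, exists j, V (a ^+ j * x)].
Proof.
have [a [V [a0 V0 cV [V1 aVV] aV]]] := topologically_nilpotent hausK lcK ndK.
exists a, V; split=> // x.
have h : (y * x @[y --> (0 : K)] --> 0 * x) by exact: mulr_continuousl.
rewrite mul0r in h; have {}h : nbhs 0 [set y | V (y * x)] by exact: h.
have [j ajx] := aV _ h; exists j.
by have := ajx j 1 (leqnn _) V1; rewrite /= mulr1.
Qed.

Lemma field_countable_base : exists2 V : nat -> set K, forall k, nbhs 0 (V k) &
  forall U, nbhs 0 U -> exists k, V k `<=` U.
Proof.
have [a [V [a0 V0 cV [V1 aVV] aV]]] := topologically_nilpotent hausK lcK ndK.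
exists (fun k => [set a ^+ k * y | y in V]) => [k|U U0].
  by apply: nbhs0_mull => //; rewrite expf_neq0.
have [k ak] := aV _ U0; exists k => _ [v Vv <-]; exact: ak.
Qed.

Lemma field_sigma_compact : exists2 C : nat -> set K, forall j, compact (C j) &
  forall x, exists j, C j x.
Proof.
have [a [V [a0 V0 cV aV]]] := exhausted_by_compacts.
exists (fun j => [set a ^- j * y | y in V]) => [j|x].
  exact: compact_mull.
have [j Vj] := aV x; exists j, (a ^+ j * x) => //.
by rewrite mulKf// expf_neq0.
Qed.

Lemma compact_borel (C : set K) : compact C -> measurable (C : set (borel K)).
Proof.
move=> cC; rewrite -[C]setCK; apply: measurableC; apply: sub_sigma_algebra.
by apply: closed_openC; exact: compact_closed.
Qed.

Lemma compact_finite_sigma_finite (nu : {measure set (borel K) -> \bar R}) :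
  (forall C : set K, compact C -> (nu C < +oo)%E) -> sigma_finite setT nu.
Proof.
move=> nuC; have [C cC CT] := field_sigma_compact.
exists (C : nat -> set (borel K)).
  by apply/seteqP; split=> // x _; have [j Cj] := CT x; exists j.
by move=> j; split; [exact: compact_borel|exact: nuC].
Qed.

Lemma mull_preimage_borel (x : K) (A : set K) : measurable (A : set (borel K)) ->
  measurable ([set y | A (x * y)] : set (borel K)).
Proof.
move=> mA; apply: (@continuous_preimage_borel K K (fun y => x * y)) => //.
exact: mull_continuous.
Qed.

Lemma image_mull (x : K) (A : set K) : x != 0 ->
  [set x * y | y in A] = [set y | A (x^-1 * y)].
Proof.
move=> x0; apply/seteqP; split=> [_ [y Ay <-]|y Ay] /=; first by rewrite mulKf.
by exists (x^-1 * y) => //; rewrite mulVKf.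
Qed.

Section haar.
Variable nu : {measure set (borel K) -> \bar R}.
Hypothesis hnu : Haar_measure nu.

Let nu_inv : translation_invariant nu. Proof. by case: hnu. Qed.
Let nu_fin (C : set K) : compact C -> (nu C < +oo)%E.
Proof. by case: hnu => _ + _ _ _; exact. Qed.
Let nu_pos (U : set K) : open U -> U !=set0 -> (0 < nu U)%E.
Proof. by case: hnu => _ _ + _ _; exact. Qed.

Let test_set : exists B : set K, [/\ compact B, measurable (B : set (borel K)),
  [set - x | x in B] = B & (0 < nu B < +oo)%E].
Proof.
have [a [V [a0 V0 cV _]]] := exhausted_by_compacts.
have cV' : compact [set - x | x in V].
  by apply: continuous_compact => //; apply: continuous_subspaceT; exact: opp_continuous.
have cB : compact (V `|` [set - x | x in V]) by exact: compactU.
exists (V `|` [set - x | x in V]); split=> //; first exact: compact_borel.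
  rewrite image_setU setUC; congr setU; apply/seteqP; split=> [_ [_ [y Vy <-] <-]|y Vy].
    by rewrite opprK.
  by exists (- y); [exists y|rewrite opprK].
rewrite nu_fin// andbT (@lt_le_trans _ _ (nu V°))//.
  by apply: nu_pos; [exact: open_interior|exists 0].
apply: le_measure; rewrite ?inE.
- by apply: sub_sigma_algebra; exact: open_interior.
- exact: compact_borel.
by move=> y /interior_subset Vy; left.
Qed.

(** The constant is nu'(B) / nu(B) for a compact [B] of positive finite measure. [B] is chosen
    symmetric, so that the reflection in [haar_unique] disappears. *)
Lemma haar_proportional (nu' : {measure set (borel K) -> \bar R}) :
  translation_invariant nu' ->
  (forall C : set K, compact C -> (nu' C < +oo)%E) ->
  exists2 c : R, 0 <= c & forall A : set K, measurable (A : set (borel K)) ->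
    nu' A = (c%:E * nu A)%E.
Proof.
move=> inv' fin'; have [B [cB mB NB /andP[B0 Boo]]] := test_set.
have sf := compact_finite_sigma_finite nu_fin.
have sf' := compact_finite_sigma_finite fin'.
have fB : nu B \is a fin_num by rewrite ge0_fin_numE ?Boo// ltW.
have fB' : nu' B \is a fin_num by rewrite ge0_fin_numE ?fin'.
exists (fine (nu' B) / fine (nu B)).
  by rewrite divr_ge0 ?fine_ge0.
move=> A mA; have := @haar_unique R K field_countable_base field_sigma_compact
  (sigma_finite_copy sf) (sigma_finite_copy sf') nu_inv inv' A B mA mB.
rewrite NB /sigma_finite_copy => AB.
have B0' : 0 < fine (nu B) by rewrite -lte_fin fineK.
have nuBV : (nu B * ((fine (nu B))^-1)%:E = 1)%E.
  by rewrite -[X in (X * _)%E](fineK fB) -EFinM divff ?gt_eqF.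
by rewrite EFinM fineK// muleAC (muleC (nu' B)) AB -muleA nuBV mule1.
Qed.

(** The push-forward of [nu] by x^-1 is translation invariant, hence c times [nu]. The Haar measure
    chosen inside [modulus] may be another one, but it is a nonzero multiple of [nu], so it has the
    same factor c. *)
Lemma modulusP (x : K) : x != 0 -> 0 < mod x /\
  forall A : set K, measurable (A : set (borel K)) ->
    nu [set x * y | y in A] = ((mod x)%:E * nu A)%E.
Proof.
move=> x0.
have mf : measurable_fun setT ((fun y => x^-1 * y : K) : borel K -> borel K).
  by apply: continuous_borel_measurable; exact: mull_continuous.
pose nuf : {measure set (borel K) -> \bar R} :=
  pushforward nu ((fun y => x^-1 * y : K) : borel K -> borel K).
pose nux := nuf mf.
have nuxE (A : set K) : nux A = nu [set x * y | y in A].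
  by rewrite image_mull.
have [c c0 cP] : exists2 c : R, 0 <= c &
    forall A : set K, measurable (A : set (borel K)) -> nux A = (c%:E * nu A)%E.
  apply: haar_proportional => [a A mA|C cC].
    rewrite !nuxE -[RHS](nu_inv (x * a)); last first.
      by rewrite image_mull//; exact: mull_preimage_borel.
    congr (nu _); apply/seteqP; split=> [_ [_ [y Ay <-] <-]|_ [_ [y Ay <-] <-]].
      by exists (x * y); [exists y|rewrite mulrDr].
    by exists (a + y); [exists y|rewrite mulrDr].
  by rewrite nuxE; apply: nu_fin; exact: compact_mull.
have [B [cB mB NB /andP[B0 Boo]]] := test_set.
have : exists r, exists2 mu : {measure set (borel K) -> \bar R},
    Haar_measure mu & forall A : set K, measurable (A : set (borel K)) ->
      mu [set x * y | y in A] = (r%:E * mu A)%E.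
  by exists c, nu => // A mA; rewrite -nuxE cP.
move=> /(xgetPex 0); rewrite /modulus (negbTE x0).
set r := xget _ _ => -[mu' hmu' rP].
have [inv' fin' pos' _ _] := hmu'.
have [e e0 eP] := haar_proportional inv' fin'.
have xB : measurable ([set x * y | y in B] : set (borel K)).
  by rewrite image_mull//; exact: mull_preimage_borel.
have fB : nu B \is a fin_num by rewrite ge0_fin_numE ?Boo// ltW.
have e1 : e != 0.
  apply/eqP => e0'; have := pos' setT openT (ex_intro _ 0 I).
  by rewrite eP// e0' mul0e ltxx.
have rc : r = c.
  have nuB0 : fine (nu B) != 0 by rewrite gt_eqF// -lte_fin fineK.
  have := rP B mB; rewrite eP// eP// -nuxE cP// -(fineK fB) -!EFinM => -[] h.
  by apply: (mulfI (mulf_neq0 e1 nuB0)); lra.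
rewrite rc; split; last by move=> A mA; rewrite -nuxE cP.
rewrite lt_neqAle c0 andbT eq_sym; apply/eqP => c0'.
have : (0 < nux setT)%E.
  rewrite nuxE (_ : [set x * y | y in _] = setT); first by apply: nu_pos; [exact: openT|exists 0].
  by apply/seteqP; split=> // y _; exists (x^-1 * y) => //; rewrite mulVKf.
by rewrite cP// c0' mul0e ltxx.
Qed.

Lemma modulus_gt0 x : x != 0 -> 0 < mod x.
Proof. by move=> /modulusP[]. Qed.

Lemma modulus_ge0 x : 0 <= mod x.
Proof. by have [->|/modulus_gt0/ltW//] := eqVneq x 0; rewrite modulus0. Qed.

Lemma modulusM x y : mod (x * y) = mod x * mod y.
Proof.
have [->|x0] := eqVneq x 0; first by rewrite mul0r modulus0 mul0r.
have [->|y0] := eqVneq y 0; first by rewrite mulr0 modulus0 mulr0.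
have [B [cB mB NB /andP[B0 Boo]]] := test_set.
have fB : nu B \is a fin_num by rewrite ge0_fin_numE ?Boo// ltW.
have [_ /(_ _ mB) hxy] := modulusP (mulf_neq0 x0 y0).
have [_ hx] := modulusP x0; have [_ /(_ _ mB) hy] := modulusP y0.
have myB : measurable ([set y * z | z in B] : set (borel K)).
  by rewrite image_mull//; exact: mull_preimage_borel.
have := hx _ myB; rewrite hy.
rewrite (_ : [set x * z | z in _] = [set x * y * z | z in B]).
  rewrite hxy -(fineK fB) -!EFinM => -[] /eqP; rewrite mulrA (inj_eq (mulIf _)).
    by move/eqP.
  by rewrite gt_eqF// -lte_fin fineK.
apply/seteqP; split=> [_ [_ [z Bz <-] <-]|_ [z Bz <-]].
  by exists z; rewrite ?mulrA.
by exists (y * z); [exists z|rewrite mulrA].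
Qed.

Let modM := modulusM.
Let mod_gt0 := modulus_gt0.
Let mod_ge0 := modulus_ge0.

Lemma modulus_neq0 x : (mod x != 0) = (x != 0).
Proof.
have [->|/mod_gt0/gt_eqF->//] := eqVneq x 0; by rewrite modulus0 eqxx.
Qed.

Lemma modulus1 : mod 1 = 1.
Proof.
have h : mod 1 != 0 by rewrite modulus_neq0 oner_neq0.
by apply: (mulfI h); rewrite -modM !mulr1.
Qed.

Lemma modulusV x : mod x^-1 = (mod x)^-1.
Proof.
have [->|x0] := eqVneq x 0; first by rewrite invr0 modulus0 invr0.
have h : mod x != 0 by rewrite modulus_neq0.
by apply: (mulfI h); rewrite -modM !divff// modulus1.
Qed.

Lemma modulusX x k : mod (x ^+ k) = mod x ^+ k.
Proof. by elim: k => [|k IH]; rewrite ?modulus1// !exprS modM IH. Qed.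

Lemma modulusXz x (k : int) : mod (x ^ k) = mod x ^ k.
Proof. by case: k => k; rewrite ?NegzE -?invr_expz ?modulusV -!exprnP modulusX. Qed.

Lemma modulusN x : mod (- x) = mod x.
Proof.
have h : mod (-1) ^+ 2 = 1 by rewrite -modulusX sqrrN expr1n modulus1.
rewrite -mulN1r modM; have /eqP := h; rewrite sqrf_eq1 => /orP[/eqP->|/eqP e].
  by rewrite mul1r.
by have := mod_ge0 (-1); rewrite e; lra.
Qed.

Lemma ultrametricB x y : mod (x - y) <= Num.max (mod x) (mod y).
Proof. by rewrite -(modulusN y) ultrametric. Qed.

Lemma modulus_le_near x y : mod (x - y) < mod y -> mod y <= mod x.
Proof.
move=> h; have := ultrametricB x (x - y); rewrite opprB addrCA subrr addr0.
by rewrite le_max => /orP[//|]; rewrite leNgt h.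
Qed.


(** For x in the compact neighbourhood V, the set x V lies in the compact V V, so |x| nu(V) <= nu(V
    V). *)
Lemma modulus_bounded_near0 : exists2 M : R, 0 < M & nbhs 0 [set x | mod x <= M].
Proof.
have [V V0 cV] := compact_nbhs0 lcK.
have cVV : compact [set z.1 * z.2 | z in V `*` V].
  apply: continuous_compact; last exact: compact_setX.
  by apply: continuous_subspaceT; exact: mulf_continuous.
have [_ fin pos _ _] := hnu.
have nuV0 : (0 < nu V)%E.
  apply: (@lt_le_trans _ _ (nu V°)).
    by apply: pos; [exact: open_interior|exists 0].
  apply: le_measure; rewrite ?inE; [|exact: (compact_borel)|exact: interior_subset].
  by apply: sub_sigma_algebra; exact: open_interior.
have fV : nu V \is a fin_num by rewrite ge0_fin_numE ?fin.
have fVV := fin _ cVV.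
have {}fVV : nu [set z.1 * z.2 | z in V `*` V] \is a fin_num by rewrite ge0_fin_numE.
have v0 : 0 < fine (nu V) by rewrite -lte_fin fineK.
pose M := fine (nu [set z.1 * z.2 | z in V `*` V]) / fine (nu V).
exists (M + 1); first by rewrite ltr_wpDl// divr_ge0// ?fine_ge0// ltW.
apply: filterS V0 => x Vx /=.
have M0 : 0 <= M by rewrite divr_ge0// ?fine_ge0// ltW.
have [->|x0] := eqVneq x 0; first by rewrite modulus0; lra.
have [_ h] := modulusP x0.
have mV := compact_borel cV.
have : (nu [set (x * y)%R | y in V] <= nu [set (z.1 * z.2)%R | z in V `*` V])%E.
  apply: le_measure; rewrite ?inE.
  - by apply: (compact_borel); exact: compact_mull.
  - exact: (compact_borel).
  by move=> _ [y Vy <-]; exists (x, y).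
rewrite h// -(fineK fV) -(fineK fVV) -EFinM lee_fin -ler_pdivlMr// => /le_trans; apply.
by rewrite -/M; lra.
Qed.

Variable beta : K.
Hypothesis hbeta : prime_element R beta.
Hypothesis b0 : beta != 0.

Lemma modulus_prime_lt1 : mod beta < 1.
Proof.
have : maximal_ideal R beta.
  by rewrite hbeta; exists 1; rewrite ?mulr1//= /integers /= modulus1.
by [].
Qed.

Let rho := mod beta.
Let rho0 : 0 < rho. Proof. exact: mod_gt0. Qed.
Let rho1 : rho < 1. Proof. exact: modulus_prime_lt1. Qed.

Lemma modulus_lt1 x : mod x < 1 -> mod x <= rho.
Proof.
move=> x1; have : maximal_ideal R x by [].
rewrite hbeta => -[y /= y1 <-]; rewrite modM -[leRHS]mulr1.
by rewrite ler_pM2l.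
Qed.

Lemma small_power (r : R) : 0 < r -> exists k, rho ^+ k < r.
Proof.
move=> r0; have : (fun k => rho ^+ k) @ \oo --> (0 : R).
  by apply: cvg_expr; rewrite ger0_norm// ltW.
move=> /cvgrPdist_lt /(_ r r0)[k _ /(_ k (leqnn k)) /=].
by rewrite sub0r normrN ger0_norm ?exprn_ge0 ?ltW//; exists k.
Qed.

(** For |y| <= 1 take the least m with rho^m < |y|. Then |y / beta^(m - 1)| <= 1, and strict
    inequality would bring the quotient down to [rho] by [modulus_lt1], against the choice of m. *)
Lemma value_group x : x != 0 -> exists k : int, mod x = rho ^ k.
Proof.
have small y : y != 0 -> mod y <= 1 -> exists k : nat, mod y = rho ^+ k.
  move=> y0 y1; have /small_power ex := mod_gt0 y0.
  case: (ex_minnP ex) => m ym mmin.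
  have m0 : (0 < m)%N.
    by rewrite lt0n; apply: contraTneq ym => ->; rewrite expr0 -leNgt.
  exists m.-1; have my : mod y <= rho ^+ m.-1.
    by rewrite leNgt; apply/negP => /mmin; rewrite leqNgt prednK// leqnn.
  have := @modulus_lt1 (y / beta ^+ m.-1); rewrite modM modulusV modulusX -/rho.
  rewrite ler_pdivrMr ?exprn_gt0// -exprS prednK// leNgt ym.
  rewrite ltr_pdivrMr ?exprn_gt0// mul1r => h.
  by apply/eqP; rewrite eq_le my leNgt; apply/negP => /h.
move=> x0; have [x1|x1] := leP (mod x) 1.
  by have [k ->] := small _ x0 x1; exists k.
have [||k xk] := small x^-1; first by rewrite invr_eq0.
  by rewrite modulusV invf_le1 ?mod_gt0// ltW.
exists (- k%:Z); rewrite -[x]invrK modulusV xk.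
by rewrite -invr_expz.
Qed.

Lemma nbhs0_modulus_le (r : R) : 0 < r -> nbhs 0 [set x | mod x <= r].
Proof.
move=> r0; have [M M0 MV] := modulus_bounded_near0.
have [k rk] := small_power (divr_gt0 r0 M0).
have bk : beta ^+ k != 0 by rewrite expf_neq0.
apply: filterS (nbhs0_mull bk MV) => _ [y /= yM <-].
rewrite modM modulusX -/rho (le_trans (ler_wpM2l _ yM)) ?exprn_ge0 ?ltW//.
by rewrite -ltr_pdivlMr.
Qed.

Lemma modulus_le_closed (r : R) : closed [set x | mod x <= r].
Proof.
rewrite -openC openE => x /= /negP; rewrite -ltNge => rx.
have [r0|r0] := ltP 0 (mod x / 2); last first.
  have [x0|x0] := eqVneq x 0; last by have := mod_gt0 x0; lra.
  apply: filterE => y /= /(le_trans (mod_ge0 y)) r0'.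
  by move: rx; rewrite x0 modulus0; lra.
have h : nbhs x [set y | mod (y - x) <= mod x / 2].
  have : (fun y => y - x) y @[y --> x] --> (0 : K).
    rewrite -(subrr x); apply: (@continuous_comp _ _ _ (fun y => (y, x))
      (fun z : K * K => z.1 - z.2)); last exact: sub_continuous.
    by apply: cvg_pair => /=; [exact: cvg_id|exact: cvg_cst].
  by move=> /(_ _ (nbhs0_modulus_le r0)).
apply: filterS h => y /= yx; apply/negP; rewrite -ltNge.
by apply: (lt_le_trans rx); apply: modulus_le_near; lra.
Qed.

(** With [a] and [V] from [topologically_nilpotent], the modulus is at least some c > 0 on the
    compact shell V minus the interior of a V. If j > 0 is least with a^j x in V, then a^j x lies in
    this shell, so c <= |a|^j |x|; this bounds j, and the ball sits inside the compact set a^-k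
    V. *)
Lemma modulus_le_compact (r : R) : compact [set x | mod x <= r].
Proof.
have [a [V [a0 V0 cV [V1 aVV] aV]]] := topologically_nilpotent hausK lcK ndK.
have exh x : exists j, V (a ^+ j * x).
  have h : (y * x @[y --> (0 : K)] --> 0 * x) by exact: mulr_continuousl.
  rewrite mul0r in h; have {}h : nbhs 0 [set y | V (y * x)] by exact: h.
  have [j ajx] := aV _ h; exists j.
  by have := ajx j 1 (leqnn _) V1; rewrite /= mulr1.
have moda1 : mod a < 1.
  have h2 : 0 < 2^-1 :> R by rewrite invr_gt0.
  have [k' ak'] := aV _ (nbhs0_modulus_le h2).
  have := ak' k' 1 (leqnn _) V1; rewrite /= mulr1 modulusX => h.
  by rewrite ltNge; apply/negP => /(@exprn_ege1 _ k'); lra.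
pose aVi := [set a * y | y in V]°.
have cC : compact (V `&` ~` aVi).
  by apply: compact_closedI => //; apply: open_closedC; exact: open_interior.
have aVi0 : aVi 0 by apply: nbhs0_mull.
(* The lower bound is sought as 1 / (n + 1) by near-covering compactness; around a point y the
   ultrametric inequality keeps the modulus at least |y|. *)
have [c c0 cP] : exists2 c : R, 0 < c & forall y, (V `&` ~` aVi) y -> c <= mod y.
  have /compact_near_coveringP/(_ nat \oo (fun n y => n.+1%:R^-1 <= mod y)) := cC.
  case=> [y [_ Cy]|n _ nP]; last first.
    by exists n.+1%:R^-1 => [|y Cy]; [rewrite invr_gt0 ltr0n|exact: (nP n (leqnn n) y)].
  have y0 : y != 0 by apply: contra_notN Cy => /eqP ->.
  have my0 := mod_gt0 y0.
  exists ([set x | mod (x - y) <= mod y / 2], [set n : nat | n.+1%:R^-1 <= mod y]).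
    split=> /=; last first.
      have /cvgrPdist_lt/(_ _ my0) := @cvg_harmonic R; apply: filterS => m /=.
      by rewrite sub0r normrN ger0_norm ?invr_ge0// => /ltW.
    have : (fun x => x - y) x @[x --> y] --> (0 : K).
      rewrite -(subrr y); apply: (@continuous_comp _ _ _ (fun x => (x, y))
        (fun z : K * K => z.1 - z.2)); last exact: sub_continuous.
      by apply: cvg_pair => /=; [exact: cvg_id|exact: cvg_cst].
    have y2 : 0 < mod y / 2 by lra.
    by move=> /(_ _ (nbhs0_modulus_le y2)).
  move=> [x m] /= [xy my]; apply: (le_trans my); apply: modulus_le_near; lra.
have [r0|r0] := ltP r 0.
  rewrite (_ : [set x | _] = set0); first exact: compact0.
  by apply/seteqP; split=> // x /= /(le_trans (mod_ge0 x)); lra.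
have ma0 := mod_ge0 a.
have [k rk] : exists k, r * mod a ^+ k < c.
  have : (fun k => mod a ^+ k) @ \oo --> (0 : R) by apply: cvg_expr; rewrite ger0_norm.
  have cr : 0 < c / (r + 1) by rewrite divr_gt0//; lra.
  move=> /cvgrPdist_lt /(_ _ cr)[k _ /(_ k (leqnn k)) /=].
  rewrite sub0r normrN ger0_norm ?exprn_ge0// ltr_pdivlMr; last by lra.
  exists k; have := exprn_ge0 k ma0; lra.
have cakV : compact [set a ^- k * y | y in V] by exact: compact_mull.
apply: (subclosed_compact _ cakV); first exact: modulus_le_closed.
move=> x /= xr; exists (a ^+ k * x); last by rewrite mulKf// expf_neq0.
case: (ex_minnP (P := fun j => `[< V (a ^+ j * x) >])) => [|j /asboolP Vj jmin].
  by have [j Vj] := exh x; exists j; apply/asboolP.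
have [jk|kj] := leqP j k; first by rewrite -(subnK jk) exprD -mulrA; exact: aVV.
exfalso; have j0 : (0 < j)%N by exact: leq_trans kj.
have : (V `&` ~` aVi) (a ^+ j * x).
  split=> // /interior_subset [y Vy ayx].
  suff /asboolP/jmin : V (a ^+ j.-1 * x) by rewrite leqNgt prednK// leqnn.
  move: ayx; rewrite -(prednK j0) exprS -mulrA => /(mulfI a0) <-.
  exact: Vy.
move=> /cP; rewrite modM modulusX => h.
have : mod a ^+ j <= mod a ^+ k.
  by apply: ler_wiXn2l => //; [exact: ltW|exact: ltnW].
have := mod_ge0 x; have := exprn_ge0 k ma0; have := exprn_ge0 j ma0.
nra.
Qed.

End haar.
End modulus.

(** * Bochner integrals *)

Lemma cvg0_le (R : realType) (I : Type) (F : set_system I) {FF : Filter F} (u v : I -> R) :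
  (\forall i \near F, 0 <= u i <= v i) -> v @ F --> (0 : R) -> u @ F --> (0 : R).
Proof.
move=> uv /cvgrPdist_lt v0; apply/cvgrPdist_lt => e /v0; apply: filterS2 uv => i.
move=> /andP[u0 uv]; rewrite !sub0r !normrN !ger0_norm//; last exact: le_trans uv.
exact: le_lt_trans.
Qed.

Section nrm_theory.
Context (R : realType) (Y : normedModType R[i]).
Implicit Types x y z : Y.

Lemma nrm0 : nrm (0 : Y) = 0.
Proof. by rewrite /nrm normr0. Qed.

Lemma nrmN x : nrm (- x) = nrm x.
Proof. by rewrite /nrm normrN. Qed.

Lemma nrmBC x y : nrm (x - y) = nrm (y - x).
Proof. by rewrite /nrm distrC. Qed.

Lemma nrm_eq0 x : nrm x = 0 -> x = 0.
Proof. by move=> x0; apply/eqP; rewrite -normr_eq0 nrmE x0. Qed.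

Lemma nrm_real (r : R) : nrm (r%:C : R[i]^o) = `|r|.
Proof. by rewrite /nrm normc_def /= expr0n/= addr0 sqrtr_sqr. Qed.

Lemma nrmZr (r : R) x : nrm (r%:C *: x) = `|r| * nrm x.
Proof. by rewrite nrmZ nrm_real. Qed.

Lemma ler_nrmB x y : nrm (x - y) <= nrm x + nrm y.
Proof. by rewrite -[nrm y]nrmN ler_nrmD. Qed.

Lemma ler_nrm_dist y x z : nrm (x - z) <= nrm (x - y) + nrm (y - z).
Proof. by rewrite -{1}(subrK y x) -addrA ler_nrmD. Qed.

Lemma ler_nrm_sum (I : Type) (s : seq I) (F : I -> Y) (P : pred I) :
  nrm (\sum_(i <- s | P i) F i) <= \sum_(i <- s | P i) nrm (F i).
Proof.
elim/big_ind2 : _ => //; first by rewrite nrm0.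
by move=> x r y t xr yt; rewrite (le_trans (ler_nrmD _ _))// lerD.
Qed.

Lemma cvg_nrmP (I : Type) (F : set_system I) {FF : Filter F} (u : I -> Y) (l : Y) :
  u @ F --> l <-> (fun i => nrm (u i - l)) @ F --> (0 : R).
Proof.
split=> [/cvgrPdist_lt ul|/cvgrPdist_lt ul].
  apply/cvgrPdist_lt => e e0; have := ul e%:C.
  rewrite ltcR => /(_ e0); apply: filterS => i.
  by rewrite nrmE ltcR sub0r normrN ger0_norm ?nrm_ge0// nrmBC.
apply/cvgrPdist_lt => -[e e']; rewrite ltcE /= => /andP[/eqP -> e0].
apply: filterS (ul e e0) => i; rewrite sub0r normrN ger0_norm ?nrm_ge0// nrmBC.
by rewrite -ltcR -nrmE.
Qed.

(** Completeness for sequences and the real-valued norm: this form holds for [R[i]^o] and passes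
    from [Y] to [BLp]. *)
Definition seq_complete := forall u : nat -> Y,
  (forall e, 0 < e -> exists N, forall m n, (N <= m)%N -> (N <= n)%N ->
     nrm (u m - u n) <= e) -> exists l : Y, u @ \oo --> l.

Lemma cvg_nrm_unique (u : nat -> Y) (l l' : Y) :
  u @ \oo --> l -> u @ \oo --> l' -> l = l'.
Proof. by move=> ul ul'; apply: (cvg_unique _ ul ul') => //; exact: norm_hausdorff. Qed.

End nrm_theory.

Lemma complete_seq_complete (R : realType) (Y : completeNormedModType R[i]) :
  seq_complete Y.
Proof.
move=> u cu; apply/cvg_ex => /=; apply: cauchy_cvg; apply: cauchy_exP.
move=> -[e e']; rewrite ltcE /= => /andP[/eqP -> e0].
have e2 : 0 < e / 2 by rewrite divr_gt0.
have [N uN] := cu _ e2; exists (u N); exists N => // n /= Nn.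
rewrite -ball_normE /= /ball_ nrmE ltcR; have := uN _ _ (leqnn N) Nn; lra.
Qed.

Section complex_nrm.
Context (R : realType).

Lemma Re_le_nrm (z : R[i]^o) : `|complex.Re z| <= nrm z.
Proof.
case: z => a b; rewrite /nrm normc_def /= -sqrtr_sqr ler_wsqrtr// lerDl sqr_ge0//.
Qed.

Lemma Im_le_nrm (z : R[i]^o) : `|complex.Im z| <= nrm z.
Proof.
case: z => a b; rewrite /nrm normc_def /= -sqrtr_sqr ler_wsqrtr// lerDr sqr_ge0//.
Qed.

Lemma nrm_le_ReIm (z : R[i]^o) : nrm z <= `|complex.Re z| + `|complex.Im z|.
Proof.
case: z => a b; rewrite /nrm normc_def /=.
rewrite -[leRHS]ger0_norm ?addr_ge0// -sqrtr_sqr ler_wsqrtr//.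
by rewrite sqrrD !real_normK ?num_real//; have := mulr_ge0 (normr_ge0 a) (normr_ge0 b); lra.
Qed.

Lemma seq_complete_complex : seq_complete R[i]^o.
Proof.
move=> u cu.
have comp (f : R[i] -> R) : (forall z w, `|f z - f w| <= nrm (z - w : R[i]^o)) ->
    exists l : R, f \o u @ \oo --> l.
  move=> fB; apply/cvg_ex; apply: cauchy_cvg; apply: cauchy_exP => e e0.
  have e2 : 0 < e / 2 by rewrite divr_gt0.
  have [N uN] := cu _ e2; exists (f (u N)); exists N => // n /= Nn.
  rewrite -ball_normE /= /ball_; have := fB (u N) (u n).
  have := uN _ _ (leqnn N) Nn; lra.
have [|a ua] := comp (@complex.Re R).
  by move=> z w; rewrite -raddfB; exact: Re_le_nrm.
have [|b ub] := comp (@complex.Im R).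
  by move=> z w; rewrite -raddfB; exact: Im_le_nrm.
exists (a +i* b); apply/cvg_nrmP.
have h : (fun n => `|complex.Re (u n) - a| + `|complex.Im (u n) - b|) @ \oo --> (0 : R).
  by rewrite -[X in _ --> X]addr0; apply: cvgD; apply/norm_cvg0P; exact/subr_cvg0.
apply: cvg0_le h; apply: nearW => n; rewrite nrm_ge0/=.
by apply: (le_trans (nrm_le_ReIm _)); case: (u n).

Qed.

End complex_nrm.

Section dominated.
Context d (T : measurableType d) (R : realType) (mu : {measure set T -> \bar R}).

Lemma dominated_cvg0 (g : nat -> T -> R) (h : T -> R) :
  (forall n, measurable_fun setT (g n)) -> measurable_fun setT h ->
  (forall n x, 0 <= g n x <= h x) -> (\int[mu]_x (h x)%:E < +oo)%E ->
  (forall x, g ^~ x @ \oo --> (0 : R)) ->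
  (\int[mu]_x (g n x)%:E)%E @[n --> \oo] --> 0%E.
Proof.
move=> mg mh gh ih g0.
have h0 x : 0 <= h x by case/andP: (gh 0%N x) => /le_trans; apply.
have [] := @dominated_convergence _ _ _ mu setT measurableT
  (fun n x => (g n x)%:E) (cst 0%E) (EFin \o h).
- by move=> n; exact/measurable_EFinP.
- exact: measurable_cst.
- by apply: aeW => x _; apply/fine_cvgP; split; [exact: nearW|exact: g0].
- apply/integrableP; split; first exact/measurable_EFinP.
  by under eq_integral do rewrite /= ger0_norm//.
- apply: aeW => x n _ /=; rewrite lee_fin.
  by have /andP[g0' gh'] := gh n x; rewrite ger0_norm.
by move=> _ _; rewrite integral0.
Qed.

End dominated.

Section bochner_theory.
Context d (T : measurableType d) (R : realType) (Y : normedModType R[i]).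
Variable mu : {measure set T -> \bar R}.
Implicit Types (f g : T -> Y) (s : Defs.sfun Y T).

Lemma seval_nil x : seval ([::] : Defs.sfun Y T) x = 0.
Proof. by rewrite /sfun_eval big_nil. Qed.

Lemma seval_cons (a : set T * Y) s x :
  seval (a :: s) x = \1_(a.1) x *: a.2 + seval s x.
Proof. by rewrite /sfun_eval big_cons. Qed.

Lemma seval_cat s s' x :
  seval (s ++ s') x = seval s x + seval s' x.
Proof. by rewrite /sfun_eval big_cat. Qed.

Lemma sfun_integral_cat s s' :
  sfun_integral mu (s ++ s') = sfun_integral mu s + sfun_integral mu s'.
Proof. by rewrite /sfun_integral big_cat. Qed.

Lemma sfun_over_cons a s : sfun_over measurable mu (a :: s) ->
  [/\ measurable a.1, (mu a.1 < +oo)%E & sfun_over measurable mu s].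
Proof.
move=> sS; have [ma fa] := sS a (mem_head _ _); split=> // b bs.
by apply: sS; rewrite inE bs orbT.
Qed.

Lemma sfun_over_cat (S : set (set T)) s s' : sfun_over S mu s -> sfun_over S mu s' ->
  sfun_over S mu (s ++ s').
Proof. by move=> h h' a; rewrite mem_cat => /orP[/h|/h']. Qed.

Definition sfun_scale (c : R[i]) s : Defs.sfun Y T := [seq (b.1, c *: b.2) | b <- s].

Lemma seval_scale c s x : seval (sfun_scale c s) x = c *: seval s x.
Proof.
rewrite /sfun_eval big_map scaler_sumr; apply: eq_bigr => b _ /=.
by rewrite !scalerA mulrC.
Qed.

Lemma sfun_integral_scale c s :
  sfun_integral mu (sfun_scale c s) = c *: sfun_integral mu s.
Proof.
rewrite /sfun_integral big_map scaler_sumr; apply: eq_bigr => b _ /=.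
by rewrite !scalerA mulrC.
Qed.

Lemma sfun_over_scale (S : set (set T)) c s :
  sfun_over S mu s -> sfun_over S mu (sfun_scale c s).
Proof. by move=> h a /mapP[b bs ->] /=; exact: (h b bs). Qed.

Definition sfun_restrict (A : set T) s : Defs.sfun Y T := [seq (b.1 `&` A, b.2) | b <- s].

Lemma seval_restrict A s x :
  seval (sfun_restrict A s) x = \1_A x *: seval s x.
Proof.
rewrite /sfun_eval big_map scaler_sumr; apply: eq_bigr => b _ /=.
by rewrite scalerA indicI mulrC.
Qed.

Lemma sfun_over_restrict A s : measurable A -> sfun_over measurable mu s ->
  sfun_over measurable mu (sfun_restrict A s).
Proof.
move=> mA h a /mapP[b bs ->] /=; have [mb fb] := h b bs; split.
  exact: measurableI.
apply: le_lt_trans fb; apply: le_measure; rewrite ?inE//; first exact: measurableI.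
Qed.

Lemma smeas_sfun s : sfun_over measurable mu s ->
  smeas mu (seval s).
Proof. by move=> sS; exists (fun=> s); split=> // x; exact: cvg_cst. Qed.

Lemma smeasD f g :
  smeas mu f -> smeas mu g ->
  smeas mu (fun x => f x + g x).
Proof. by move=> mf mg; have := strongly_measurableDZ 1 mf mg; rewrite scale1r. Qed.

Lemma smeasZ c f : smeas mu f ->
  smeas mu (fun x => c *: f x).
Proof.
move=> mf; have := strongly_measurableDZ c mf (strongly_measurable0 Y mu).
by rewrite addr0.
Qed.

Lemma smeasB f g :
  smeas mu f -> smeas mu g ->
  smeas mu (fun x => f x - g x).
Proof.
move=> mf mg; have := smeasD mf (smeasZ (-1) mg).
by under eq_fun do rewrite scaleN1r.
Qed.

Lemma smeas_sum (I : Type) (r : seq I) (F : I -> T -> Y) :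
  (forall i, smeas mu (F i)) ->
  smeas mu (fun x => \sum_(i <- r) F i x).
Proof.
move=> mF; elim: r => [|i r IH].
  by under eq_fun do rewrite big_nil; exact: strongly_measurable0.
by under eq_fun do rewrite big_cons; exact: smeasD.
Qed.

Lemma smeas_restrict A f : measurable A ->
  smeas mu f ->
  smeas mu (fun x => \1_A x *: f x).
Proof.
move=> mA [s [sS sf]]; exists (fun n => sfun_restrict A (s n)); split.
  by move=> n; exact: sfun_over_restrict.
move=> x; under eq_fun do rewrite seval_restrict.
by apply: cvgZ; [exact: cvg_cst|exact: sf].
Qed.

Lemma measurable_nrm_sub f s : smeas mu f ->
  sfun_over measurable mu s ->
  measurable_fun setT (fun x => nrm (f x - seval s x)).
Proof.
move=> mf sS; apply: (@strongly_measurable_nrm _ _ _ _ mu).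
by apply: smeasB => //; exact: smeas_sfun.
Qed.

(** The sets of a simple function may overlap. The induction therefore cuts [B] along the first set,
    and the constant [y] accumulates the value already reached on the current piece. *)
Lemma nrm_sfun_integral_over s B (y : Y) : measurable B -> (mu B < +oo)%E ->
  sfun_over measurable mu s ->
  ((nrm ((fine (mu B))%:C *: y + \sum_(a <- s) (fine (mu (a.1 `&` B)))%:C *: a.2))%:E
   <= \int[mu]_(x in B) (nrm (y + seval s x))%:E)%E.
Proof.
elim: s B y => [|[A z] s IH] B y mB fB sS.
  rewrite big_nil addr0 nrmZr ger0_norm ?fine_ge0//.
  under eq_integral do rewrite seval_nil addr0.
  by rewrite (integral_cst mu mB (nrm y)%:E) muleC EFinM fineK// ge0_fin_numE.
have [/= mA fA {}sS] := sfun_over_cons sS.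
have mBA : measurable (B `&` A) by exact: measurableI.
have mBNA : measurable (B `\` A) by exact: measurableD.
have sub C D : measurable C -> measurable D -> C `<=` D -> (mu D < +oo)%E -> (mu C < +oo)%E.
  by move=> mC mD CD; apply: le_lt_trans; apply: le_measure; rewrite ?inE.
have fBA : (mu (B `&` A) < +oo)%E by apply: sub fB.
have fBNA : (mu (B `\` A) < +oo)%E by apply: sub fB => //; exact: subDsetl.
have msplit C : measurable C -> fine (mu (C `&` B)) =
    fine (mu (C `&` (B `&` A))) + fine (mu (C `&` (B `\` A))).
  move=> mC; rewrite -fineD.
  - rewrite -measureU//; first by rewrite -setIUr setUIDK//.
    + exact: measurableI.
    + exact: measurableI.
    + by apply/seteqP; split=> // x [[_ [_ Ax]] [_ [_]]]; exact.
  - by rewrite ge0_fin_numE//; apply: sub fBA => //; exact: measurableI.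
  - by rewrite ge0_fin_numE//; apply: sub fBNA => //; exact: measurableI.
have h1 := IH _ (y + z) mBA fBA sS; have h2 := IH _ y mBNA fBNA sS.
have mcons (C : set T) : measurable C ->
    measurable_fun C (fun x => (nrm (y + seval ((A, z) :: s) x))%:E).
  move=> mC; apply/measurable_EFinP; apply: (@measurable_funS _ _ _ _ setT) => //.
  apply: (@measurable_nrm_sfun _ _ _ _ mu) => a; rewrite inE => /predU1P[->|/sS]//.
have -> : (\int[mu]_(x in B) (nrm (y + seval ((A, z) :: s) x))%:E =
    \int[mu]_(x in B `&` A) (nrm ((y + z) + seval s x))%:E +
    \int[mu]_(x in B `\` A) (nrm (y + seval s x))%:E)%E.
  rewrite -[in LHS](setUIDK B A) ge0_integral_setU//; last 3 first.
  - by rewrite setUIDK; exact: mcons.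
  - by move=> x _; rewrite lee_fin nrm_ge0.
  - rewrite disj_set2E; apply/eqP/seteqP; split=> // x [[_ Ax] [_]]; exact.
  congr (_ + _)%E; apply: eq_integral => x /set_mem[Bx Ax]; congr (nrm _)%:E.
    by rewrite seval_cons /= indicE mem_set// scale1r addrA.
  by rewrite seval_cons /= indicE memNset// scale0r add0r.
apply: le_trans (leeD h1 h2); rewrite -EFinD lee_fin.
apply: le_trans (ler_nrmD _ _); apply: eqW.
congr (nrm _); rewrite big_cons /= addrACA -big_split /=.
have -> : fine (mu B) = fine (mu (B `&` A)) + fine (mu (B `\` A)).
  by have := msplit setT measurableT; rewrite !setTI.
rewrite scalerDr rmorphD scalerDl (setIC A) -!addrA; congr (_ + _).
rewrite addrCA; congr (_ + _); congr (_ + _); apply: eq_big_seq => a as_.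
by rewrite -scalerDl -rmorphD -msplit//; have [] := sS _ as_.
Qed.

Lemma sfun_support s : sfun_over measurable mu s ->
  exists B, [/\ measurable B, (mu B < +oo)%E & forall a, a \in s -> a.1 `<=` B].
Proof.
elim: s => [_|a s IH sS]; first by exists set0; rewrite measure0.
have [ma fa {}sS] := sfun_over_cons sS; have [B [mB fB sB]] := IH sS.
exists (a.1 `|` B); split; first exact: measurableU.
  by apply: le_lt_trans (measureU2 mu ma mB) _; exact: lte_add_pinfty.
by move=> b; rewrite inE => /predU1P[->|/sB bB] x ?; [left|right; exact: bB].
Qed.

Lemma nrm_sfun_integral s : sfun_over measurable mu s ->
  ((nrm (sfun_integral mu s))%:E <= \int[mu]_x (nrm (seval s x))%:E)%E.
Proof.
move=> sS; have [B [mB fB sB]] := sfun_support sS.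
have ms : measurable_fun setT (fun x => (nrm (seval s x))%:E).
  by apply/measurable_EFinP/(@strongly_measurable_nrm _ _ _ _ mu)/smeas_sfun.
apply: (@le_trans _ _ (\int[mu]_(x in B) (nrm (0 + seval s x))%:E)%E).
  apply: le_trans (nrm_sfun_integral_over 0 mB fB sS).
  rewrite scaler0 add0r lee_fin; apply: eqW.
  congr (nrm _); apply: eq_big_seq => a as_; do 3 f_equal.
  by rewrite (setIidl (sB _ as_)).
under eq_integral do rewrite add0r.
by apply: ge0_subset_integral => // x _; rewrite lee_fin nrm_ge0.
Qed.

Lemma nrm_integral_triangle f g h : smeas mu f ->
  smeas mu g -> smeas mu h ->
  (\int[mu]_x (nrm (f x - h x))%:E <=
   \int[mu]_x (nrm (f x - g x))%:E + \int[mu]_x (nrm (g x - h x))%:E)%E.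
Proof.
move=> mf mg mh.
have m (u v : T -> Y) : smeas mu u ->
    smeas mu v ->
    measurable_fun setT (fun x => (nrm (u x - v x))%:E).
  by move=> mu_ mv; apply/measurable_EFinP/(@strongly_measurable_nrm _ _ _ _ mu)/smeasB.
have p u : forall x : T, setT x -> (0 <= (nrm (u x : Y))%:E)%E.
  by move=> x _; rewrite lee_fin nrm_ge0.
rewrite -ge0_integralD//; try exact: m; try exact: p.
apply: ge0_le_integral => //; [exact: p|exact: m| |].
  by apply: emeasurable_funD; exact: m.
by move=> x _; rewrite -EFinD lee_fin ler_nrm_dist.
Qed.

Lemma bochner_sfun s : sfun_over measurable mu s ->
  has_bochner mu (seval s) (sfun_integral mu s).
Proof.
move=> sS; split; first exact: smeas_sfun.
exists (fun=> s); split=> //; last exact: cvg_cst.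
rewrite (_ : (fun=> _) = cst 0%E); first exact: cvg_cst.
apply/funext => n; apply: integral0_eq => x _; by rewrite subrr nrm0.
Qed.

Lemma bochnerDZ (c : R[i]) f g y z :
  has_bochner mu f y -> has_bochner mu g z ->
  has_bochner mu (fun x => c *: f x + g x) (c *: y + z).
Proof.
move=> [mf [s [sS sf sy]]] [mg [t [tS tg tz]]].
split; first exact: (strongly_measurableDZ c mf mg).
exists (fun n => sfun_scale c (s n) ++ t n); split.
- by move=> n; apply: sfun_over_cat => //; exact: sfun_over_scale.
- have m u n : smeas mu u -> forall r : nat -> Defs.sfun Y T,
      (forall n, sfun_over measurable mu (r n)) ->
      measurable_fun setT (fun x => (nrm (u x - seval (r n) x))%:E).
    by move=> mu_ r rS; apply/measurable_EFinP/measurable_nrm_sub.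
  apply: (@squeeze_cvge _ _ _ _ (cst 0%E) _
    (fun n => (nrm (c : R[i]^o))%:E * (\int[mu]_x (nrm (f x - seval (s n) x))%:E)
      + \int[mu]_x (nrm (g x - seval (t n) x))%:E)%E).
  + apply: nearW => n; apply/andP; split.
      by apply: integral_ge0 => x _; rewrite lee_fin nrm_ge0.
    rewrite -ge0_integralZl//; last 3 first.
    * exact: m.
    * by move=> x _; rewrite lee_fin nrm_ge0.
    * by rewrite lee_fin nrm_ge0.
    rewrite -ge0_integralD//; last 4 first.
    * by move=> x _; rewrite -EFinM lee_fin mulr_ge0 ?nrm_ge0.
    * by apply: measurable_funeM; exact: m.
    * by move=> x _; rewrite lee_fin nrm_ge0.
    * exact: m.
    apply: ge0_le_integral => //.
    * by move=> x _; rewrite lee_fin nrm_ge0.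
    * apply/measurable_EFinP/measurable_nrm_sub; first exact: (strongly_measurableDZ c mf mg).
      by apply: sfun_over_cat => //; exact: sfun_over_scale.
    * by apply: emeasurable_funD; [apply: measurable_funeM|]; exact: m.
    * move=> x _; rewrite -EFinM -EFinD lee_fin seval_cat seval_scale.
      rewrite opprD addrACA -scalerBr (le_trans (ler_nrmD _ _))// lerD2r.
      by rewrite nrmZ.
  + exact: cvg_cst.
  + rewrite -[X in _ --> X]adde0 -[X in (X + _)%E](mule0 (nrm (c : R[i]^o))%:E).
    by apply: cvgeD => //; exact: cvgeZl.
- under eq_fun do rewrite sfun_integral_cat sfun_integral_scale.
  by apply: cvgD => //; apply: cvgZ => //; exact: cvg_cst.
Qed.

Lemma nrm_bochner f y : has_bochner mu f y ->
  ((nrm y)%:E <= \int[mu]_x (nrm (f x))%:E)%E.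
Proof.
move=> [mf [s [sS sf sy]]].
have mfE : (\int[mu]_x (nrm (f x))%:E = \int[mu]_x (nrm (f x - 0))%:E)%E.
  by under [in RHS]eq_integral do rewrite subr0.
have h n : ((nrm (sfun_integral mu (s n)))%:E <=
    \int[mu]_x (nrm (f x))%:E + \int[mu]_x (nrm (f x - seval (s n) x))%:E)%E.
  apply: le_trans (nrm_sfun_integral (sS n)) _.
  have := @nrm_integral_triangle _ _ _ (smeas_sfun (sS n)) mf
    (strongly_measurable0 Y mu).
  rewrite -mfE addeC; under eq_integral do rewrite subr0; move=> /le_trans; apply.
  by under [X in (_ + X <= _)%E]eq_integral do rewrite nrmBC.
have cl : (nrm (sfun_integral mu (s n)))%:E @[n --> \oo] --> (nrm y)%:E.
  apply/fine_cvgP; split; [exact: nearW|exact: (cvg_nrm sy)].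
have I0 : (0 <= \int[mu]_x (nrm (f x))%:E)%E.
  by apply: integral_ge0 => x _; rewrite lee_fin nrm_ge0.
have [->|fi] := eqVneq (\int[mu]_x (nrm (f x))%:E)%E +oo%E; first exact: leey.
have cr : (\int[mu]_x (nrm (f x))%:E + \int[mu]_x (nrm (f x - seval (s n) x))%:E)%E
    @[n --> \oo] --> (\int[mu]_x (nrm (f x))%:E + 0)%E.
  apply: cvgeD => //; last exact: cvg_cst.
  by rewrite fin_num_adde_defl.
rewrite -[leRHS]adde0 -(cvg_lim _ cl)// -(cvg_lim _ cr)//.
by apply: lee_lim; [exact: cvgP cl|exact: cvgP cr|exact: nearW].
Qed.

Lemma bochner_unique f y z :
  has_bochner mu f y -> has_bochner mu f z -> y = z.
Proof.
move=> fy fz; have := nrm_bochner (bochnerDZ (-1) fy fz).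
rewrite (_ : (\int[mu]_x _)%E = 0%E); last first.
  by apply: integral0_eq => x _; rewrite scaleN1r addNr nrm0.
rewrite lee_fin => h; apply/eqP; rewrite eq_sym -subr_eq0; apply/eqP/nrm_eq0.
by apply/eqP; rewrite eq_le nrm_ge0 andbT -[z - y]addrC -scaleN1r.
Qed.

Lemma bochnerE D f y : has_bochner mu (fun x => \1_D x *: f x) y ->
  bochner mu D f = y.
Proof.
move=> fy; rewrite /bochner; apply: xget_unique => // z fz.
exact: bochner_unique fz fy.
Qed.

Lemma bochnerTE f y : has_bochner mu f y -> bochner mu setT f = y.
Proof.
move=> fy; apply: bochnerE.
by under eq_fun do rewrite indicE in_setT scale1r.
Qed.

(** Each approximant is set to 0 where its norm exceeds 2 |f|. Where f does not vanish this changes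
    nothing from some index on; where f vanishes the cut approximants vanish too. *)
Lemma simple_approximation f : smeas mu f ->
  exists s : nat -> Defs.sfun Y T, [/\ forall n, sfun_over measurable mu (s n),
    forall x, seval (s n) x @[n --> \oo] --> f x &
    forall n x, nrm (seval (s n) x) <= 2 * nrm (f x)].
Proof.
move=> mf; have [s [sS sf]] := mf.
have mnf := strongly_measurable_nrm mf.
pose A n := [set x | nrm (seval (s n) x) <= 2 * nrm (f x)].
have mA n : measurable (A n).
  rewrite -[A n]setTI; apply: measurable_fun_le => //.
    exact/(@strongly_measurable_nrm _ _ _ _ mu)/smeas_sfun.
  exact: measurable_funM.
exists (fun n => sfun_restrict (A n) (s n)); split.
- by move=> n; exact: sfun_over_restrict.
- move=> x; under eq_fun do rewrite seval_restrict.
  have [fx0|fx0] := eqVneq (f x) 0.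
    rewrite fx0; rewrite (_ : (fun n => _) = cst 0); first exact: cvg_cst.
    apply/funext => n; rewrite indicE; case: (boolP (x \in A n)) => [/set_mem|_]; last first.
      by rewrite scale0r.
    rewrite /A /= fx0 nrm0 mulr0 scale1r => h; apply: nrm_eq0; apply/eqP.
    by rewrite eq_le nrm_ge0 h.
  have nfx0 : 0 < nrm (f x).
    by rewrite lt_neqAle nrm_ge0 andbT eq_sym; apply: contra fx0 => /eqP/nrm_eq0 ->.
  apply: cvg_trans (sf x); apply: near_eq_cvg.
  have /cvgrPdist_lt/(_ _ nfx0) := cvg_nrm (sf x); apply: filterS => n /= h.
  rewrite indicE mem_set ?scale1r// /A /=.
  by move: h; rewrite ltr_norml; lra.
- move=> n x; rewrite seval_restrict indicE; case: (boolP (x \in A n)) => [/set_mem|_].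
    by rewrite scale1r.
  by rewrite scale0r nrm0 mulr_ge0 ?nrm_ge0.
Qed.

Lemma bochner_exists f : seq_complete Y ->
  smeas mu f -> (\int[mu]_x (nrm (f x))%:E < +oo)%E ->
  exists y, has_bochner mu f y.
Proof.
move=> cY mf fi; have [s [sS sf sb]] := simple_approximation mf.
have I0 : (\int[mu]_x (nrm (f x - seval (s n) x))%:E)%E @[n --> \oo] --> 0%E.
  (* The dominating factor 3 is 1 from f and 2 from its simple approximants. *)
  apply: (@dominated_cvg0 _ _ _ mu _ (fun x => 3 * nrm (f x))).
  - by move=> n; exact: measurable_nrm_sub.
  - by apply: measurable_funM => //; exact: strongly_measurable_nrm mf.
  - move=> n x; rewrite nrm_ge0 (le_trans (ler_nrmB _ _))//.
    by have := sb n x; lra.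
  - under eq_integral do rewrite EFinM.
    rewrite ge0_integralZl//; first by rewrite lte_mul_pinfty.
    + exact: measurable_enrm mf.
    + by move=> x _; rewrite lee_fin nrm_ge0.
  - move=> x; under eq_fun do rewrite nrmBC; apply/cvg_nrmP; exact: sf.
have [y sy] : exists y : Y, sfun_integral mu (s n) @[n --> \oo] --> y.
  apply: cY => e e0; have e2 : 0 < e / 2 by lra.
  have /fine_cvgP[[N1 _ hN1] /cvgrPdist_lt/(_ _ e2)[N2 _ hN2]] := I0.
  have hN n : (maxn N1 N2 <= n)%N ->
      (\int[mu]_x (nrm (f x - seval (s n) x))%:E <= (e / 2)%:E)%E.
    rewrite geq_max => /andP[n1 n2]; rewrite -(fineK (hN1 n n1)) lee_fin.
    by have := hN2 n n2; rewrite /= sub0r normrN ltr_norml => /andP[_ /ltW].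
  exists (maxn N1 N2) => m n Nm Nn; rewrite -lee_fin.
  have mnS : sfun_over measurable mu (s m ++ sfun_scale (-1) (s n)).
    by apply: sfun_over_cat => //; exact: sfun_over_scale.
  have := nrm_sfun_integral mnS.
  rewrite sfun_integral_cat sfun_integral_scale scaleN1r => /le_trans; apply.
  under eq_integral do rewrite seval_cat seval_scale scaleN1r.
  have := nrm_integral_triangle (smeas_sfun (sS m)) mf (smeas_sfun (sS n)).
  move=> /le_trans; apply; rewrite [e]splitr EFinD leeD ?hN//.
  by under eq_integral do rewrite nrmBC; exact: hN.
by exists y; split=> //; exists s.
Qed.

End bochner_theory.

Section bochner_linear.
Context d (T : measurableType d) (R : realType) (Y Z : normedModType R[i]).
Variable mu : {measure set T -> \bar R}.

Lemma bochner_linear_map (L : Y -> Z) (C : R) (f : T -> Y) (y : Y) :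
  (forall x x', L (x + x') = L x + L x') -> (forall a x, L (a *: x) = a *: L x) ->
  (forall x, nrm (L x) <= C * nrm x) ->
  has_bochner mu f y -> has_bochner mu (fun x => L (f x)) (L y).
Proof.
move=> LD LZ Lb [mf [s [sS sf sy]]].
have L0 : L 0 = 0 by rewrite -(scale0r (0 : Y)) LZ scale0r.
have LB x x' : L (x - x') = L x - L x' by rewrite LD -scaleN1r LZ scaleN1r.
have Lb' x : nrm (L x) <= `|C| * nrm x.
  by rewrite (le_trans (Lb x))// ler_wpM2r ?nrm_ge0// ler_norm.
pose M (s : Defs.sfun Y T) : Defs.sfun Z T := [seq (b.1, L b.2) | b <- s].
have MS t : sfun_over measurable mu t -> sfun_over measurable mu (M t).
  by move=> tS a /mapP[b bt ->] /=; exact: (tS b bt).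
have Me t x : seval (M t) x = L (seval t x).
  rewrite /sfun_eval big_map /=; elim: t => [|b t IH]; first by rewrite !big_nil L0.
  by rewrite !big_cons LD LZ IH.
have Mi t : sfun_integral mu (M t) = L (sfun_integral mu t).
  rewrite /sfun_integral big_map /=; elim: t => [|b t IH]; first by rewrite !big_nil L0.
  by rewrite !big_cons LD LZ IH.
have Lc (u : nat -> Y) l : u @ \oo --> l -> (fun n => L (u n)) @ \oo --> L l.
  move=> /cvg_nrmP ul; apply/cvg_nrmP.
  apply: (@cvg0_le _ _ _ _ _ (fun n => `|C| * nrm (u n - l))).
    by apply: nearW => n; rewrite nrm_ge0 -LB Lb'.
  by rewrite -(mulr0 `|C|); apply: cvgM => //; exact: cvg_cst.
have mLf : smeas mu (fun x => L (f x)).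
  have [t [tS tf]] := mf; exists (fun n => M (t n)); split; first by move=> n; exact: MS.
  by move=> x; under eq_fun do rewrite Me; exact: Lc.
split=> //; exists (fun n => M (s n)); split.
- by move=> n; exact: MS.
- apply: (@squeeze_cvge _ _ _ _ (cst 0%E) _
    (fun n => `|C|%:E * \int[mu]_x (nrm (f x - seval (s n) x))%:E)%E).
  + apply: nearW => n; apply/andP; split.
      by apply: integral_ge0 => x _; rewrite lee_fin nrm_ge0.
    rewrite -ge0_integralZl//; last 2 first.
    * by apply/measurable_EFinP; exact: (measurable_nrm_sub mf (sS n)).
    * by move=> x _; rewrite lee_fin nrm_ge0.
    apply: ge0_le_integral => //.
    * by move=> x _; rewrite lee_fin nrm_ge0.
    * by apply/measurable_EFinP; exact: (measurable_nrm_sub mLf (MS _ (sS n))).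
    * apply: measurable_funeM.
      by apply/measurable_EFinP; exact: (measurable_nrm_sub mf (sS n)).
    * by move=> x _; rewrite -EFinM lee_fin Me -LB.
  + exact: cvg_cst.
  + by rewrite -(mule0 `|C|%:E); exact: cvgeZl.
- by under eq_fun do rewrite Mi; exact: Lc.
Qed.

End bochner_linear.

Section bochner_more.
Context d (T : measurableType d) (R : realType) (Y : normedModType R[i]).
Variable mu : {measure set T -> \bar R}.

Lemma integral_nrm_sfun (s : Defs.sfun Y T) : sfun_over measurable mu s ->
  (\int[mu]_x (nrm (seval s x))%:E < +oo)%E.
Proof.
elim: s => [_|[A z] s IH sS].
  rewrite integral0_eq// => x _; by rewrite seval_nil nrm0.
have [/= mA fA {}sS] := sfun_over_cons sS.
have ms : measurable_fun setT (fun x => (nrm (seval s x))%:E).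
  by apply/measurable_EFinP/(@strongly_measurable_nrm _ _ _ _ mu)/smeas_sfun.
have mAz : measurable_fun setT (fun x : T => ((\1_A x)%:E * (nrm z)%:E)%E).
  by apply: emeasurable_funM => //; apply/measurable_EFinP; exact: measurable_indic.
apply: (@le_lt_trans _ _ (\int[mu]_x ((\1_A x)%:E * (nrm z)%:E) +
    \int[mu]_x (nrm (seval s x))%:E)%E).
  rewrite -ge0_integralD//; last 2 first.
  - by move=> x _; rewrite -EFinM lee_fin mulr_ge0 ?nrm_ge0.
  - by move=> x _; rewrite lee_fin nrm_ge0.
  apply: ge0_le_integral => //.
  - by move=> x _; rewrite lee_fin nrm_ge0.
  - apply/measurable_EFinP; apply: (@strongly_measurable_nrm _ _ _ _ mu).
    apply: smeas_sfun => a; rewrite inE => /predU1P[->|/sS]//.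
  - exact: emeasurable_funD.
  - move=> x _; rewrite seval_cons -EFinM -EFinD lee_fin.
    rewrite (le_trans (ler_nrmD _ _))// lerD2r /=.
    by rewrite !indicE; case: (x \in A); rewrite ?(scale1r, mul1r, scale0r, nrm0, mul0r).
apply: lte_add_pinfty; last exact: IH.
rewrite ge0_integralZr//.
- by rewrite integral_indic// setIT muleC lte_mul_pinfty// lee_fin nrm_ge0.
- by apply/measurable_EFinP; exact: measurable_indic.
- by rewrite lee_fin nrm_ge0.
Qed.

Lemma bochner_lty (f : T -> Y) y : has_bochner mu f y ->
  (\int[mu]_x (nrm (f x))%:E < +oo)%E.
Proof.
move=> [mf [s [sS sf sy]]].
have /fine_cvgP[[n _ hn] _] := sf.
have := nrm_integral_triangle mf (smeas_sfun (sS n)) (strongly_measurable0 Y mu).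
under eq_integral do rewrite subr0; move=> /le_lt_trans; apply.
apply: lte_add_pinfty.
  by have := hn n (leqnn n); rewrite ge0_fin_numE//; apply: integral_ge0 => x _; rewrite lee_fin nrm_ge0.
by under eq_integral do rewrite subr0; exact: integral_nrm_sfun.
Qed.

Lemma bochner_smeas (f : T -> Y) y :
  has_bochner mu f y -> smeas mu f.
Proof. by case. Qed.

Lemma bochner0 : has_bochner mu (fun=> 0 : Y) 0.
Proof.
have := @bochner_sfun _ T R Y mu [::].
rewrite /sfun_integral big_nil.
by rewrite (_ : seval [::] = fun=> 0)//; [apply|apply/funext => x; rewrite seval_nil].
Qed.

Lemma bochnerD (f g : T -> Y) y z :
  has_bochner mu f y -> has_bochner mu g z ->
  has_bochner mu (fun x => f x + g x) (y + z).
Proof.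
move=> fy gz; have := bochnerDZ 1 fy gz; rewrite scale1r.
by under eq_fun do rewrite scale1r.
Qed.

Lemma bochnerZ (c : R[i]) (f : T -> Y) y :
  has_bochner mu f y -> has_bochner mu (fun x => c *: f x) (c *: y).
Proof.
move=> fy; have := bochnerDZ c fy bochner0; rewrite addr0.
by under eq_fun do rewrite addr0.
Qed.

Lemma bochnerB (f g : T -> Y) y z :
  has_bochner mu f y -> has_bochner mu g z ->
  has_bochner mu (fun x => f x - g x) (y - z).
Proof.
move=> fy gz; have := bochnerD fy (bochnerZ (-1) gz).
by rewrite scaleN1r; under eq_fun do rewrite scaleN1r.
Qed.

Lemma bochner_sum (I : eqType) (r : seq I) (F : I -> T -> Y) (y : I -> Y) :
  (forall i, i \in r -> has_bochner mu (F i) (y i)) ->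
  has_bochner mu (fun x => \sum_(i <- r) F i x) (\sum_(i <- r) y i).
Proof.
elim: r => [_|i r IH Fy].
  by rewrite big_nil; under eq_fun do rewrite big_nil; exact: bochner0.
rewrite big_cons; under eq_fun do rewrite big_cons.
apply: bochnerD; first by apply: Fy; rewrite mem_head.
by apply: IH => j jr; apply: Fy; rewrite inE jr orbT.
Qed.

Lemma bochner_scale_vector (c : T -> R[i]^o) (J : R[i]^o) (v : Y) :
  has_bochner mu c J -> has_bochner mu (fun x => c x *: v) (J *: v).
Proof.
move=> cJ; apply: (@bochner_linear_map _ _ _ R[i]^o Y mu
  (fun a => a *: v) (nrm v) c J) => //.
- by move=> a b; rewrite scalerDl.
- by move=> a b; rewrite scalerA.
- by move=> a; rewrite nrmZ mulrC.
Qed.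

Lemma nrm_bochner_le (f : T -> Y) y (g : T -> R) :
  has_bochner mu f y -> measurable_fun setT g -> (forall x, nrm (f x) <= g x) ->
  ((nrm y)%:E <= \int[mu]_x (g x)%:E)%E.
Proof.
move=> fy mg fg; apply: le_trans (nrm_bochner fy) _.
apply: ge0_le_integral => //.
- by move=> x _; rewrite lee_fin nrm_ge0.
- exact: measurable_enrm fy.1.
- exact/measurable_EFinP.
- by move=> x _; rewrite lee_fin.
Qed.

End bochner_more.

Section bochner_complex.
Context d (T : measurableType d) (R : realType).
Variable mu : {measure set T -> \bar R}.

Let integrable_indic_lty (A : set T) : measurable A -> (mu A < +oo)%E ->
  mu.-integrable setT (fun x => (\1_A x : R)%:E).
Proof.
move=> mA fA; apply/integrableP; split; first exact/measurable_EFinP/measurable_indic.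
under eq_integral do rewrite /= ger0_norm//.
by rewrite integral_indic// setIT.
Qed.

Let Re_sfun (s : Defs.sfun R[i]^o T) : sfun_over measurable mu s ->
  mu.-integrable setT (fun x => (complex.Re (seval s x))%:E) /\
  (\int[mu]_x (complex.Re (seval s x))%:E = (complex.Re (sfun_integral mu s))%:E)%E.
Proof.
elim: s => [_|[A z] s IH sS].
  under [X in mu.-integrable _ X]eq_fun do rewrite seval_nil /=.
  split; first exact: integrable0.
  by rewrite /sfun_integral big_nil integral0_eq// => x _; rewrite seval_nil.
have [/= mA fA {}sS] := sfun_over_cons sS; have [IH1 IH2] := IH sS.
have e x : ((complex.Re (seval ((A, z) :: s) x))%:E =
    ((complex.Re z)%:E * (\1_A x)%:E) + (complex.Re (seval s x))%:E)%E.
  rewrite seval_cons raddfD EFinD /= -EFinM !indicE; congr (_%:E + _)%E.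
  by case: (x \in A); rewrite ?(scale1r, mulr1, scale0r, mulr0).
have iA : mu.-integrable setT (fun x => (complex.Re z)%:E * (\1_A x)%:E)%E.
  apply: integrableZl => //; exact: integrable_indic_lty.
split; first by under eq_fun do rewrite e; exact: integrableD.
under eq_integral do rewrite e; rewrite integralD// IH2 integralZl//; last exact: integrable_indic_lty.
rewrite integral_indic// setIT /sfun_integral big_cons raddfD EFinD; congr (_ + _)%E.
rewrite -(@fineK _ (mu A)) ?ge0_fin_numE// -EFinM /=; congr (_%:E).
by case: z {e iA} => a b /=; rewrite mul0r subr0 mulrC.
Qed.

(** Carries complex Bochner integrals over to Lebesgue integrals of real functions, where the
    fundamental theorem of calculus and Fubini's theorem apply. *)
Lemma bochner_Re (c : T -> R[i]^o) (J : R[i]^o) :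
  has_bochner mu c J ->
  mu.-integrable setT (fun x => (complex.Re (c x))%:E) /\
  (\int[mu]_x (complex.Re (c x))%:E = (complex.Re J)%:E)%E.
Proof.
move=> cJ; have clt := bochner_lty cJ.
have [mc [s [sS sc sJ]]] := cJ.
have mRe : measurable_fun setT (fun x => complex.Re (c x)).
  have [t [tS tc]] := mc.
  apply: (@measurable_fun_cvg _ _ _ setT (fun n x => complex.Re (seval (t n) x))).
    move=> n; apply/measurable_EFinP; have [+ _] := Re_sfun (tS n).
    exact: measurable_int.
  move=> x _; have /cvg_nrmP := tc x => h; apply/subr_cvg0/norm_cvg0P.
  apply: cvg0_le h; apply: nearW => n; rewrite normr_ge0 /= -raddfB; exact: Re_le_nrm.
have ic : mu.-integrable setT (fun x => (complex.Re (c x))%:E).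
  apply/integrableP; split; first exact/measurable_EFinP.
  apply: le_lt_trans clt; apply: ge0_le_integral => //.
  - by apply/measurable_EFinP; exact: measurableT_comp.
  - exact: measurable_enrm mc.
  - by move=> x _ /=; rewrite lee_fin Re_le_nrm.
split=> //.
have h n : (`|\int[mu]_x (complex.Re (c x))%:E - (complex.Re (sfun_integral mu (s n)))%:E| <=
    \int[mu]_x (nrm (c x - seval (s n) x))%:E)%E.
  have [i1 <-] := Re_sfun (sS n).
  rewrite -integralB//; apply: le_trans (le_abse_integral _ _ _) _ => //.
    by apply/measurable_EFinP; apply: measurable_funB => //; apply/measurable_EFinP; exact: measurable_int i1.
  apply: ge0_le_integral => //.
  - apply: measurableT_comp => //; apply/measurable_EFinP.
    apply: measurable_funB => //; apply/measurable_EFinP; exact: measurable_int i1.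
  - by apply/measurable_EFinP; exact: (measurable_nrm_sub mc (sS n)).
  - by move=> x _ /=; rewrite lee_fin -raddfB Re_le_nrm.
have fI : (\int[mu]_x (complex.Re (c x))%:E)%E \is a fin_num by exact: integral_fune_fin_num.
rewrite -(fineK fI) in h *; congr EFin.
have cl : (fun n => complex.Re (sfun_integral mu (s n))) @ \oo -->
    fine (\int[mu]_x (complex.Re (c x))%:E)%E.
  apply/subr_cvg0/norm_cvg0P.
  have /fine_cvgP[[N _ hN] scf] := sc.
  apply: cvg0_le scf; exists N => // n Nn /=; rewrite normr_ge0 /= distrC.
  by rewrite -lee_fin fineK; [have := h n; rewrite -EFinB|exact: hN].
apply/esym; apply: (cvg_unique _ _ cl) => //.
have /cvg_nrmP hJ := sJ; apply/subr_cvg0/norm_cvg0P.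
by apply: cvg0_le hJ; apply: nearW => n; rewrite normr_ge0 /= -raddfB; exact: Re_le_nrm.
Qed.

Lemma bochner_Im (c : T -> R[i]^o) (J : R[i]^o) :
  has_bochner mu c J ->
  mu.-integrable setT (fun x => (complex.Im (c x))%:E) /\
  (\int[mu]_x (complex.Im (c x))%:E = (complex.Im J)%:E)%E.
Proof.
move=> cJ; have := bochner_Re (bochnerZ (0 -i* 1) cJ).
have e z : complex.Re ((0 -i* 1) *: (z : R[i]^o)) = complex.Im z.
  by case: z => a b /=; rewrite mul0r sub0r mulN1r opprK.
by rewrite e; under eq_fun do rewrite e.
Qed.

End bochner_complex.

(** * Bochner spaces *)

(** The approximants sample [h] at the left ends of a mesh of width 1 / (n + 1) on an interval from
    -(n + 1) to n + 1. A left end may fall outside [U], where nothing is known of [h]; the value is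
    then 0, which happens only finitely often for a given point of the open set [U]. *)
Lemma smeas_continuous (R : realType) (Z : normedModType R[i])
    (h : R -> Z) (U : set R) : open U ->
  (forall x, U x -> h y @[y --> x] --> h x) ->
  strongly_measurable measurable (@lebesgue_measure R) (fun x => \1_U x *: h x).
Proof.
move=> oU ch.
pose l n (j : nat) : R := - n.+1%:R + j%:R / n.+1%:R.
pose v n j : Z := if l n j \in U then h (l n j) else 0.
pose I n j : set R := [set` `[l n j, l n j.+1[ ] `&` U.
pose s n : Defs.sfun Z R := [seq (I n j, v n j) | j <- iota 0 (2 * n.+1 ^ 2)].
have mU : measurable (U : set (measurableTypeR R)) by exact: open_measurable.
exists s; split.
  move=> n _ /mapP[j _ ->] /=; have mI : measurable (I n j) by exact: measurableI.
  split=> //; apply: (@le_lt_trans _ _ (lebesgue_measure [set` `[l n j, l n j.+1[ ])).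
    by apply: le_measure; rewrite ?inE//; exact: subIsetl.
  rewrite lebesgue_measure_itv /=; case: ifP => _; rewrite ?ltry// -EFinB ltry.
move=> x; rewrite indicE; have [/set_mem Ux|nUx] := boolP (x \in U); last first.
  rewrite scale0r (_ : (fun n => _) = cst 0); first exact: cvg_cst.
  apply/funext => n; rewrite /sfun_eval big_map big1// => j _ /=.
  rewrite indicE memNset ?scale0r// => -[_ /mem_set]; by apply/negP.
rewrite scale1r.
(* The index of the cell that contains x, as soon as |x| < n + 1. *)
pose j0 n := Num.truncn ((x + n.+1%:R) * n.+1%:R).
have j0P n : `|x| < n.+1%:R -> [/\ l n (j0 n) <= x, x < l n (j0 n).+1 & (j0 n < 2 * n.+1 ^ 2)%N].
  rewrite ltr_norml => /andP[xn nx].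
  have n0 : 0 < n.+1%:R :> R by rewrite ltr0n.
  have /truncn_itv/andP[] : 0 <= (x + n.+1%:R) * n.+1%:R by apply: mulr_ge0; lra.
  rewrite -/(j0 n) => h1 h2; split.
  - by rewrite /l addrC lerBlDr ler_pdivrMr.
  - by rewrite /l addrC ltrBrDr ltr_pdivlMr.
  - rewrite -(ltr_nat R); apply: le_lt_trans h1 _.
    by rewrite natrM natrX expr2 mulrA ltr_pM2r//; lra.
have bigx : \forall n \near \oo, `|x| < n.+1%:R.
  exists (Num.truncn `|x|) => // n /= xn.
  have /truncn_itv/andP[_ ] := normr_ge0 x => /lt_le_trans; apply.
  by rewrite ler_nat ltnS.
have lx : (fun n => l n (j0 n)) @ \oo --> x.
  apply/subr_cvg0/norm_cvg0P.
  apply: (@cvg0_le _ _ _ _ _ (@harmonic R)); last exact: cvg_harmonic.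
  apply: filterS bigx => n /j0P[h1 h2 _]; rewrite normr_ge0 /=.
  rewrite ler0_norm ?subr_le0// opprB.
  have : l n (j0 n).+1 = l n (j0 n) + n.+1%:R^-1.
    by rewrite /l -addrA -[(j0 n).+1%:R]natr1 mulrDl mul1r.
  by move=> le; rewrite lerBlDl -le ltW.
have lU : \forall n \near \oo, U (l n (j0 n)).
  by apply: lx; exact: open_nbhs_nbhs.
have := cvg_comp _ _ lx (ch x Ux); apply: cvg_trans; apply: near_eq_cvg.
apply: filterS2 bigx lU => n /j0P[h1 h2 h3] Ul /=.
have eqj j : j \in iota 0 (2 * n.+1 ^ 2) -> j != j0 n -> \1_(I n j) x *: v n j = 0.
  move=> _ jj0; rewrite indicE memNset ?scale0r// => -[] /=.
  rewrite in_itv /= => /andP[g1 g2] _.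
  have n0 : 0 < n.+1%:R :> R by rewrite ltr0n.
  have lm (a b : nat) : l n a < l n b -> (a < b)%N.
    by rewrite /l ltrD2l ltr_pM2r ?invr_gt0// ltr_nat.
  have := lm _ _ (le_lt_trans g1 h2); have := lm _ _ (le_lt_trans h1 g2).
  by rewrite !ltnS => k1 k2; move: jj0; rewrite eqn_leq k1 k2.
rewrite /sfun_eval /s big_map (bigD1_seq (j0 n)) ?iota_uniq ?mem_iota//=.
rewrite big_seq_cond big1 ?addr0; last by move=> j /andP[ji jj]; exact: eqj.
rewrite indicE mem_set ?scale1r ?/v ?mem_set//.
by split=> //=; rewrite in_itv /= h1.
Qed.

Lemma ecvg0P (R : realType) (u : nat -> \bar R) : (forall n, 0 <= u n)%E ->
  u @ \oo --> 0%E <-> forall e : R, 0 < e -> \forall n \near \oo, (u n <= e%:E)%E.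
Proof.
move=> u0; split.
  move=> /fine_cvgP[fu /cvgrPdist_le ufe] e /ufe; apply: filterS2 fu => n fn.
  by rewrite sub0r normrN /= ger0_norm ?fine_ge0// -lee_fin fineK.
move=> h; apply/fine_cvgP; split.
  have := h 1 ltr01; apply: filterS => n un; rewrite ge0_fin_numE//.
  exact: le_lt_trans un (ltry _).
apply/cvgrPdist_le => e /h; apply: filterS => n un.
rewrite sub0r normrN /= ger0_norm ?fine_ge0// -lee_fin fineK//.
by rewrite ge0_fin_numE//; exact: le_lt_trans un (ltry _).
Qed.

Section Lp.
Context d (T : measurableType d) (R : realType) (Y : normedModType R[i]).
Variables (mu : {measure set T -> \bar R}) (p : R).
Hypothesis p1 : 1 <= p.
Implicit Types f g : T -> Y.

Let p0 : 0 < p. Proof. exact: lt_le_trans p1. Qed.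

Definition pint f := (\int[mu]_x ((nrm (f x)) `^ p)%:E)%E.

Lemma pint_ge0 f : (0 <= pint f)%E.
Proof. by apply: integral_ge0 => x _; rewrite lee_fin powR_ge0. Qed.

Lemma BNormE f : BNorm mu p f = (pint f `^ p^-1)%E.
Proof.
rewrite /BNorm unlock /Lnorm /pint; apply: (congr1 (fun z => poweR z p^-1)).
by apply: eq_integral => x _; rewrite /= ger0_norm ?nrm_ge0.
Qed.

Lemma BNorm_powR f : (BNorm mu p f `^ p)%E = pint f.
Proof. by rewrite BNormE -poweRrM mulVf ?gt_eqF// poweRe1// pint_ge0. Qed.

Lemma BNorm_le f (c : R) : 0 <= c ->
  (BNorm mu p f <= c%:E)%E = (pint f <= (c `^ p)%:E)%E.
Proof.
move=> c0; apply/idP/idP => h.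
  rewrite -BNorm_powR -poweR_EFin; apply: gt0_ler_poweR => //; first exact: ltW.
  - by rewrite in_itv /= BNorm_ge0 leey.
  - by rewrite in_itv /= lee_fin c0 leey.
have -> : c%:E = ((c `^ p)%:E `^ p^-1)%E.
  by rewrite -poweR_EFin -poweRrM mulfV ?gt_eqF// poweRe1.
rewrite BNormE; apply: gt0_ler_poweR => //; first by rewrite invr_ge0 ltW.
- by rewrite in_itv /= pint_ge0 leey.
- by rewrite in_itv /= lee_fin powR_ge0 leey.
Qed.

Lemma BNorm_lty f : (BNorm mu p f < +oo)%E = (pint f < +oo)%E.
Proof.
apply/idP/idP => h; first by rewrite -BNorm_powR poweR_lty.
by rewrite BNormE poweR_lty.
Qed.

Lemma measurable_nrmX f : smeas mu f ->
  measurable_fun setT (fun x => ((nrm (f x)) `^ p)%:E).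
Proof.
move=> mf; apply/measurable_EFinP.
apply: (@measurableT_comp _ _ _ _ _ _ (@powR R ^~ p)) => //.
exact: strongly_measurable_nrm mf.
Qed.

Lemma BNorm_cvg0 (u : nat -> T -> Y) : pint (u n) @[n --> \oo] --> 0%E ->
  BNorm mu p (u n) @[n --> \oo] --> 0%E.
Proof.
move=> /ecvg0P h; apply/ecvg0P; first by move=> n; exact: BNorm_ge0.
move=> e e0; have := h (fun n => pint_ge0 _) (e `^ p) (powR_gt0 _ e0).
by apply: filterS => n; rewrite -BNorm_le// ltW.
Qed.

Lemma pint_mono f g : smeas mu f ->
  smeas mu g ->
  (forall x, nrm (f x) <= nrm (g x)) -> (pint f <= pint g)%E.
Proof.
move=> mf mg fg; apply: ge0_le_integral => //; try exact: measurable_nrmX.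
- by move=> x _; rewrite lee_fin powR_ge0.
- by move=> x _; rewrite lee_fin ge0_ler_powR ?nnegrE ?nrm_ge0// ltW.
Qed.

Lemma sfun_bounded (s : Defs.sfun Y T) : sfun_over measurable mu s ->
  exists C : R, 0 <= C /\ exists B, [/\ measurable B, (mu B < +oo)%E &
    forall x, nrm (seval s x) <= C * \1_B x].
Proof.
move=> sS; have [B [mB fB sB]] := sfun_support sS.
exists (\sum_(a <- s) nrm a.2); split; first by apply: sumr_ge0 => a _; exact: nrm_ge0.
exists B; split=> // x; rewrite /sfun_eval (le_trans (ler_nrm_sum _ _ _))//.
rewrite mulr_suml big_seq [leRHS]big_seq; apply: ler_sum => a as_.
rewrite !indicE; have [/set_mem ax|_] := boolP (x \in a.1).
  by rewrite scale1r (mem_set (sB a as_ x ax)) mulr1.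
by rewrite scale0r nrm0 mulr_ge0 ?nrm_ge0.
Qed.

Lemma sfun_BLfun (s : Defs.sfun Y T) : sfun_over measurable mu s ->
  seval s \in BLfun mu p.
Proof.
move=> sS; apply/asboolP; split; first exact: smeas_sfun.
rewrite BNorm_lty; have [C [C0 [B [mB fB sB]]]] := sfun_bounded sS.
apply: (@le_lt_trans _ _ (\int[mu]_x ((C `^ p)%:E * (\1_B x)%:E))%E).
  apply: ge0_le_integral => //.
  - by move=> x _; rewrite lee_fin powR_ge0.
  - by apply: measurable_nrmX; exact: smeas_sfun.
  - by apply: measurable_funeM; apply/measurable_EFinP; exact: measurable_indic.
  - move=> x _; rewrite -EFinM lee_fin; have := sB x; rewrite indicE.
    case: (x \in B); rewrite ?mulr1 ?mulr0 => h.
      by rewrite ge0_ler_powR ?nnegrE ?nrm_ge0// ltW.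
    by rewrite (_ : nrm _ = 0) ?powR0 ?gt_eqF//; apply/eqP; rewrite eq_le nrm_ge0 h.
rewrite ge0_integralZl//; last 2 first.
- by apply/measurable_EFinP; exact: measurable_indic.
- by rewrite lee_fin powR_ge0.
by rewrite integral_indic// setIT lte_mul_pinfty// lee_fin powR_ge0.
Qed.

Lemma Lp_simple_dense f : f \in BLfun mu p -> exists s : nat -> Defs.sfun Y T,
  (forall n, sfun_over measurable mu (s n)) /\
  BNorm mu p (fun x => f x - seval (s n) x) @[n --> \oo] --> 0%E.
Proof.
move=> /asboolP[mf fp]; have [s [sS sf sb]] := simple_approximation mf.
exists s; split=> //; apply: BNorm_cvg0.
have mfs n : smeas mu (fun x => f x - seval (s n) x).
  by apply: smeasB => //; exact: smeas_sfun.
apply: (@dominated_cvg0 _ _ _ mu _ (fun x => 3 `^ p * (nrm (f x)) `^ p)).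
- by move=> n; apply/measurable_EFinP; exact: measurable_nrmX (mfs n).
- by apply: measurable_funM => //; apply/measurable_EFinP; exact: measurable_nrmX mf.
- move=> n x; rewrite powR_ge0 /= -powRM ?nrm_ge0// ge0_ler_powR ?nnegrE ?nrm_ge0//; last 2 first.
    by rewrite mulr_ge0 ?nrm_ge0.
    by rewrite (le_trans (ler_nrmB _ _))//; have := sb n x; lra.
  exact: ltW.
- under eq_integral do rewrite EFinM.
  rewrite ge0_integralZl//; last 2 first.
  + exact: measurable_nrmX mf.
  + by move=> x _; rewrite lee_fin powR_ge0.
  by rewrite lte_mul_pinfty ?lee_fin ?powR_ge0// -/(pint f) -BNorm_lty.
- move=> x; have /cvg_nrmP h : (fun n => seval (s n) x) @ \oo --> f x by exact: sf.
  have h0 : (fun n => (nrm (seval (s n) x - f x)) `^ p) @ \oo --> (0 : R).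
    apply/cvgrPdist_lt => e e0.
    have /cvgrPdist_lt/(_ _ (powR_gt0 p^-1 e0)) := h; apply: filterS => n.
    rewrite !sub0r !normrN !ger0_norm ?nrm_ge0 ?powR_ge0// => hh.
    have -> : e = (e `^ p^-1) `^ p by rewrite -powRrM mulVf ?gt_eqF// powRr1// ltW.
    by apply: gt0_ltr_powR; rewrite ?nnegrE ?nrm_ge0 ?powR_ge0.
  by under eq_fun do rewrite nrmBC.
Qed.

Lemma BNorm_ae f g : smeas mu f ->
  smeas mu g -> {ae mu, forall x, f x = g x} ->
  BNorm mu p f = BNorm mu p g.
Proof.
move=> mf mg fg; rewrite !BNormE; apply: (congr1 (fun z => poweR z p^-1)).
apply: ge0_ae_eq_integral => //; try exact: measurable_nrmX.
- by move=> x _; rewrite lee_fin powR_ge0.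
- by move=> x _; rewrite lee_fin powR_ge0.
- by apply: filterS fg => x -> _.
Qed.

Let cvg_powR (a : nat -> R) (b : R) : (forall n, 0 <= a n) -> a @ \oo --> b ->
  (fun n => a n `^ p) @ \oo --> b `^ p.
Proof.
move=> a0 ab; have b0 : 0 <= b.
  by rewrite -(cvg_lim _ ab)//; apply: limr_ge; [exact: cvgP ab|exact: nearW].
move: b0; rewrite le_eqVlt => /predU1P[b0|b0].
  rewrite -b0 powR0 ?gt_eqF//; apply/cvgrPdist_lt => e e0.
  have /cvgrPdist_lt/(_ _ (powR_gt0 p^-1 e0)) := ab; apply: filterS => n.
  rewrite -b0 !sub0r !normrN !ger0_norm ?powR_ge0// => hh.
  have -> : e = (e `^ p^-1) `^ p by rewrite -powRrM mulVf ?gt_eqF// powRr1// ltW.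
  by apply: gt0_ltr_powR; rewrite ?nnegrE ?powR_ge0.
have h : (fun n => expR (p * ln (a n))) @ \oo --> expR (p * ln b).
  apply: continuous_cvg; first exact: continuous_expR.
  by apply: cvgM; [exact: cvg_cst|apply: continuous_cvg ab; exact: continuous_ln].
rewrite {2}/powR gt_eqF//; apply: cvg_trans h; apply: near_eq_cvg.
have /cvgrPdist_lt/(_ _ b0) := ab; apply: filterS => n.
by rewrite /powR => abn; rewrite gt_eqF//; move: abn; rewrite ltr_norml => /andP[_]; lra.
Qed.

Let BNorm_fatou_everywhere (u : nat -> T -> Y) v (c : R) : 0 <= c ->
  (forall n, smeas mu (u n)) ->
  (forall x, u n x @[n --> \oo] --> v x) ->
  (forall n, BNorm mu p (u n) <= c%:E)%E -> (BNorm mu p v <= c%:E)%E.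
Proof.
move=> c0 mu_ uv uc; rewrite BNorm_le//.
have := @fatou _ _ _ mu setT measurableT (fun n x => ((nrm (u n x)) `^ p)%:E).
move=> /(_ (fun n => measurable_nrmX (mu_ n))) h.
apply: (@le_trans _ _ (\int[mu]_x limn_einf (fun n => ((nrm (u n x)) `^ p)%:E))%E).
  apply: eqW; apply: eq_integral => x _.
  have hc : ((nrm (u n x)) `^ p)%:E @[n --> \oo] --> ((nrm (v x)) `^ p)%:E.
    apply/fine_cvgP; split; first exact: nearW.
    by apply: cvg_powR; [move=> n; exact: nrm_ge0|exact: (cvg_nrm (uv x))].
  by rewrite is_cvg_limn_einfE; [rewrite (cvg_lim _ hc)|exact: cvgP hc].
apply: le_trans (h _) _; first by move=> n x _; rewrite lee_fin powR_ge0.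
rewrite limn_einf_lim; apply: lime_le; first exact: is_cvg_einfs.
apply: nearW => n; apply: (@le_trans _ _ (pint (u n))).
  by apply: ereal_inf_lbound; exists n => /=.
by rewrite -BNorm_le.
Qed.

Lemma BNorm_fatou (u : nat -> T -> Y) v (c : R) : 0 <= c ->
  (forall n, smeas mu (u n)) ->
  smeas mu v ->
  {ae mu, forall x, u n x @[n --> \oo] --> v x} ->
  (forall n, BNorm mu p (u n) <= c%:E)%E -> (BNorm mu p v <= c%:E)%E.
Proof.
move=> c0 mu_ mv uv uc.
have [N [mN N0 sN]] := uv.
have aeN g : smeas mu g ->
    BNorm mu p (fun x => \1_(~` N) x *: g x) = BNorm mu p g.
  move=> mg; apply: BNorm_ae => //.
    by apply: smeas_restrict => //; exact: measurableC.
  exists N; split=> // x; apply: contra_notP => Nx.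
  by rewrite /= indicE mem_set ?scale1r.
rewrite -aeN//; apply: (@BNorm_fatou_everywhere (fun n x => \1_(~` N) x *: u n x)) => //.
- by move=> n; apply: smeas_restrict => //; exact: measurableC.
- move=> x; rewrite indicE; have [/set_mem Nx|Nx] := boolP (x \in ~` N).
    rewrite scale1r; under eq_fun do rewrite scale1r.
    by apply: contrapT => h; apply: Nx; exact: sN.
  rewrite scale0r; under eq_fun do rewrite scale0r; exact: cvg_cst.
- by move=> n; rewrite aeN.
Qed.

(** Chebyshev bounds the measure of the k-th exceptional set by (4^-k / 2^-k)^p, which is at most
    2^-k because p >= 1; Borel-Cantelli concludes. *)
Lemma chebyshev_ae (w : nat -> T -> Y) :
  (forall k, smeas mu (w k)) ->
  (forall k, BNorm mu p (w k) <= (4^-1 ^+ k)%:E)%E ->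
  {ae mu, forall x, exists n, forall k, (n <= k)%N -> nrm (w k x) < 2^-1 ^+ k}.
Proof.
move=> mw wk; pose A k := [set x | 2^-1 ^+ k <= nrm (w k x)].
have mA k : measurable (A k).
  rewrite -[A k]setTI; apply: measurable_fun_le => //; exact: strongly_measurable_nrm (mw k).
have muA k : (mu (A k) <= (2^-1 ^+ k)%:E)%E.
  have h4 : 0 <= 4^-1 ^+ k :> R by rewrite exprn_ge0.
  have h2 : 0 < 2^-1 ^+ k :> R by rewrite exprn_gt0.
  have := wk k; rewrite BNorm_le// => hp.
  have : ((((2^-1 ^+ k) `^ p)%:E * mu (A k)) <= ((4^-1 ^+ k) `^ p)%:E)%E.
    apply: le_trans hp; rewrite -(integral_cst mu (mA k)).
    apply: (@le_trans _ _ (\int[mu]_(x in A k) ((nrm (w k x)) `^ p)%:E)%E).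
      apply: ge0_le_integral => //.
      - by move=> x _; rewrite lee_fin powR_ge0.
      - by apply: measurable_funTS; exact: measurable_nrmX (mw k).
      - by move=> x Ax; rewrite lee_fin ge0_ler_powR ?nnegrE ?nrm_ge0// ltW.
    apply: ge0_subset_integral => //; first exact: measurable_nrmX (mw k).
    by move=> x _; rewrite lee_fin powR_ge0.
  have -> : 4^-1 ^+ k = 2^-1 ^+ k * 2^-1 ^+ k :> R by rewrite -exprMn; congr (_ ^+ _); lra.
  have hp0 : (0 < ((2^-1 ^+ k) `^ p)%:E)%E by rewrite lte_fin powR_gt0.
  rewrite (powRM _ (ltW h2) (ltW h2)) EFinM lee_pmul2l//.
  move=> /le_trans; apply; rewrite lee_fin -[leRHS](powRr1 (ltW h2)).
  apply: ger_powR => //; rewrite h2 /=.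
  by apply: exprn_ile1; lra.
have : mu (lim_sup_set A) = 0%E.
  apply: lim_sup_set_cvg0 => //.
  apply: (@le_lt_trans _ _ (\sum_(k <oo) (2 / (2 ^ (k + 1))%:R)%:E)%E).
    apply: lee_nneseries => // k _; apply: le_trans (muA k) _; rewrite lee_fin.
    by rewrite addn1 natrX exprS invfM mulrA divff ?pnatr_eq0// mul1r exprVn.
  by have := @cvg_geometric_eseries_half R 2 0 => /cvg_lim -> //; rewrite ltry.
move=> A0; exists (lim_sup_set A); split=> //.
  by apply: bigcap_measurable => // n _; apply: bigcup_measurable => k _; exact: mA.
move=> x h n _; apply: contrapT => nn; apply: h; exists n => k nk.
by rewrite ltNge; apply/negP => Akx; apply: nn; exists k.
Qed.

Lemma BNorm_cvg0_subseq (u : nat -> T -> Y) :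
  (forall n, smeas mu (u n)) ->
  BNorm mu p (u n) @[n --> \oo] --> 0%E ->
  exists phi : nat -> nat, (forall k, (k <= phi k)%N) /\
    {ae mu, forall x, u (phi k) x @[k --> \oo] --> (0 : Y)}.
Proof.
move=> mu_ /ecvg0P uv.
have /choice[phi phiP] : forall k, exists n, (k <= n)%N /\
    (BNorm mu p (u n) <= (4^-1 ^+ k)%:E)%E.
  move=> k; have h4 : 0 < 4^-1 ^+ k :> R by rewrite exprn_gt0.
  have [N _ hN] := uv (fun n => BNorm_ge0 _ _ _) _ h4.
  by exists (maxn k N); rewrite leq_maxl; split=> //; apply: hN; exact: leq_maxr.
exists phi; split; first by move=> k; case: (phiP k).
have := @chebyshev_ae (fun k => u (phi k)) (fun k => mu_ _) (fun k => (phiP k).2).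
apply: filterS => x [n hn]; apply/cvg_nrmP.
apply: (@cvg0_le _ _ _ _ _ (fun k => 2^-1 ^+ k)); last first.
  by apply: cvg_expr; rewrite ger0_norm; lra.
by exists n => // k nk /=; rewrite nrm_ge0 subr0 ltW ?hn.
Qed.

Lemma Lp_limit_ae (u : nat -> T -> Y) v w :
  (forall n, smeas mu (u n)) ->
  smeas mu v ->
  BNorm mu p (fun x => u n x - v x) @[n --> \oo] --> 0%E ->
  {ae mu, forall x, u n x @[n --> \oo] --> w x} ->
  {ae mu, forall x, v x = w x}.
Proof.
move=> mu_ mv uv uw.
have [phi [phik phiv]] := BNorm_cvg0_subseq (fun n => smeasB (mu_ n) mv) uv.
apply: filterS2 phiv uw => x hv hw.
have h1 : u (phi k) x @[k --> \oo] --> v x.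
  by apply/cvg_nrmP; move/cvg_nrmP: hv; under eq_fun do rewrite subr0.
have h2 : u (phi k) x @[k --> \oo] --> w x.
  apply: (cvg_comp phi (fun n => u n x)) hw.
  by move=> A [N _ hN]; exists N => // k /= Nk; apply: hN; exact: leq_trans (phik k).
exact: cvg_nrm_unique h1 h2.
Qed.

End Lp.

(** The Hoermander condition identifies f(D^alpha) through L^2 limits, the multiplier operators are
    L^p limits; a common subsequence converging almost everywhere reconciles the two. *)
Lemma Lp_Lq_limit_ae d (T : measurableType d) (R : realType) (Y : normedModType R[i])
    (mu : {measure set T -> \bar R}) (p q : R) (u : nat -> T -> Y) v w :
  1 <= p -> 1 <= q ->
  (forall n, smeas mu (u n)) ->
  smeas mu v -> smeas mu w ->
  BNorm mu p (fun x => u n x - v x) @[n --> \oo] --> 0%E ->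
  BNorm mu q (fun x => u n x - w x) @[n --> \oo] --> 0%E ->
  {ae mu, forall x, v x = w x}.
Proof.
move=> p1 q1 mu_ mv mw uv uw.
have [phi [phik phiv]] := BNorm_cvg0_subseq p1 (fun n => smeasB (mu_ n) mv) uv.
have : {ae mu, forall x, w x = v x}.
  apply: (@Lp_limit_ae _ _ _ _ _ q q1 (fun k => u (phi k))) => //.
    apply/ecvg0P; first by move=> n; exact: BNorm_ge0.
    move=> e e0; have /ecvg0P := uw => /(_ (fun n => BNorm_ge0 _ _ _) e e0)[N _ hN].
    by exists N => // k /= Nk; apply: hN => /=; exact: leq_trans (phik k).
  apply: filterS phiv => x /cvg_nrmP h; apply/cvg_nrmP.
  by under eq_fun do rewrite -[_ - _]subr0.
by apply: filterS.
Qed.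

Section Lp_space.
Context d (T : measurableType d) (R : realType) (Y : normedModType R[i]).
Variables (mu : {measure set T -> \bar R}) (p : R) (p1 : 1 <= p).
Local Notation X := (BLp Y mu p1).
Implicit Types (f g : T -> Y) (F G : X).

Definition toBL f (h : f \in BLfun mu p) : BLtype Y mu p1 := @BLType _ _ _ _ mu p p1 f h.

Lemma nrm_BLclass (f : BLtype Y mu p1) : (nrm (BLclass f : X))%:E = BNorm mu p f.
Proof. by rewrite -[RHS](BLp_seminormE f) /nrm -[`|_|]/(sep_norm _) sep_normE. Qed.

Lemma BLclassDZ (a : R[i]) (f g : BLtype Y mu p1) :
  BLclass (a *: f + g) = a *: BLclass f + BLclass g :> X.
Proof.
by rewrite -[RHS]/(sep_add (sep_scale a _) _) sep_scaleE sep_addE.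
Qed.

Lemma BLp_rep F : exists f : BLtype Y mu p1, F = BLclass f.
Proof. by exists (repr F); rewrite /BLclass sep_reprK. Qed.

Lemma BLval_BLfun (f : BLtype Y mu p1) : (f : T -> Y) \in BLfun mu p.
Proof. by case: f. Qed.

Lemma BLfun_sm f : f \in BLfun mu p -> smeas mu f.
Proof. by move=> /asboolP[]. Qed.

Lemma in_class_BLclass (f : BLtype Y mu p1) : in_class (BLclass f) f.
Proof. by exists f => //; exact: aeW. Qed.

Lemma in_class_toBL f (h : f \in BLfun mu p) : in_class (BLclass (toBL h)) f.
Proof. exact: in_class_BLclass. Qed.

Lemma in_class_ae F f g : in_class F f -> {ae mu, forall x, f x = g x} -> in_class F g.
Proof.
by move=> [h -> hf] fg; exists h => //; apply: filterS2 hf fg => x -> ->.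
Qed.

Lemma in_class_inj F G f : in_class F f -> in_class G f -> F = G.
Proof.
move=> [h -> hf] [k -> kf]; apply/BLclassP.
by apply: filterS2 hf kf => x -> ->.
Qed.

Lemma in_class_ae_eq F f g : in_class F f -> in_class F g -> {ae mu, forall x, f x = g x}.
Proof.
move=> [h -> hf] [k /BLclassP hk kf].
by apply: filterS3 hf hk kf => x <- -> <-.
Qed.

Lemma in_classDZ (a : R[i]) F G f g : in_class F f -> in_class G g ->
  in_class (a *: F + G) (fun x => a *: f x + g x).
Proof.
move=> [h -> hf] [k -> kg]; exists (a *: h + k); first by rewrite BLclassDZ.
by apply: filterS2 hf kg => x <- <-.
Qed.

Lemma in_classZ (a : R[i]) F f : in_class F f -> in_class (a *: F) (fun x => a *: f x).
Proof.
have h0 : in_class (0 : X) (fun=> 0).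
  by exists 0; [rewrite -[LHS]/(BLclass 0)|exact: aeW].
by move=> Ff; have := in_classDZ a Ff h0; rewrite addr0; under eq_fun do rewrite addr0.
Qed.

Lemma in_classB F G f g : in_class F f -> in_class G g ->
  in_class (F - G) (fun x => f x - g x).
Proof.
move=> Ff Gg; have := in_classDZ (-1) Gg Ff; rewrite scaleN1r addrC.
by under eq_fun do rewrite scaleN1r addrC.
Qed.

Lemma nrm_in_class F f : in_class F f -> smeas mu f ->
  (nrm F)%:E = BNorm mu p f.
Proof.
move=> [g -> gf] mf; rewrite nrm_BLclass; apply: BNorm_ae => //.
exact: BLfun_sm (BLval_BLfun g).
Qed.

Lemma in_class_exists F : exists f, f \in BLfun mu p /\ in_class F f.
Proof.
have [f ->] := BLp_rep F; exists f; split; first exact: BLval_BLfun.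
exact: in_class_BLclass.
Qed.

Lemma simple_approx_class F (e : R) : 0 < e -> exists s : Defs.sfun Y T,
  sfun_over measurable mu s /\ forall G, in_class G (seval s) -> nrm (F - G) <= e.
Proof.
move=> e0; have [f [Lf Ff]] := in_class_exists F.
have [s [sS /ecvg0P sf]] := Lp_simple_dense p1 Lf.
have [N _ hN] := sf (fun n => BNorm_ge0 _ _ _) e e0.
exists (s N); split=> // G Gs; rewrite -lee_fin (nrm_in_class (in_classB Ff Gs)).
  by apply: hN => /=.
by apply: smeasB; [exact: BLfun_sm|exact: smeas_sfun].
Qed.

(** Riesz-Fischer along simple functions: approximants of a fast subsequence converge almost
    everywhere, and the same approximants, cut off on the exceptional null set, make the limit
    strongly measurable. *)
Lemma Lp_complete : seq_complete Y -> seq_complete X.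
Proof.
(* The approximant of index k is within 2 a(k) of all later u(m), so two approximants differ by at
   most 4 a(k) = 4^-k, as [chebyshev_ae] requires. *)
move=> cY u cu; pose a (k : nat) : R := 4^-1 ^+ k / 4.
have a4 k : a k = 4^-1 ^+ k / 4 by [].
have h4 k : 0 < 4^-1 ^+ k :> R by rewrite exprn_gt0.
have a0 k : 0 < a k by rewrite divr_gt0.
have /choice[N NP] := fun k => cu _ (a0 k).
have /choice[s sP] := fun k => simple_approx_class (u (N k)) (a0 k).
pose S k : X := BLclass (toBL (sfun_BLfun p1 (sP k).1)).
have Ss k : in_class (S k) (seval (s k)) by exact: in_class_toBL.
have Su k m : (N k <= m)%N -> nrm (S k - u m) <= 2 * a k.
  move=> km; have := ler_nrm_dist (u (N k)) (S k) (u m).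
  have h := (sP k).2 _ (Ss k); rewrite nrmBC in h.
  have := NP k _ _ (leqnn _) km; lra.
have aS j k : (k <= j)%N -> a j <= a k.
  move=> kj; rewrite ler_pM2r//; apply: ler_wiXn2l => //; lra.
have SS k j : (k <= j)%N -> nrm (S j - S k) <= 4^-1 ^+ k.
  move=> kj; pose m := maxn (N k) (N j).
  have := ler_nrm_dist (u m) (S j) (S k).
  have := Su k m (leq_maxl _ _); have := Su j m (leq_maxr _ _).
  rewrite (nrmBC (S k)); have := aS _ _ kj; rewrite !a4; lra.
have mS k : smeas mu (seval (s k)).
  exact: smeas_sfun (sP k).1.
have SSB k j : (k <= j)%N ->
    (BNorm mu p (fun x => (seval (s j) x - seval (s k) x)%R) <= (4^-1 ^+ k)%:E)%E.
  move=> kj; rewrite -(nrm_in_class (in_classB (Ss j) (Ss k))); last exact: smeasB.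
  by rewrite lee_fin SS.
have cheb := @chebyshev_ae _ _ _ _ mu p p1
  (fun k x => seval (s k.+1) x - seval (s k) x)
  (fun k => smeasB (mS k.+1) (mS k)) (fun k => SSB k k.+1 (leqnSn k)).
have [L [mL L0 sL]] := cheb.
(* The limit is arbitrary on the null set [L]; the function [f] below is 0 there. *)
have /choice[l lP] : forall x, exists l : Y, ~ L x -> seval (s k) x @[k --> \oo] --> l.
  move=> x; have [Lx|nLx] := pselect (L x); first by exists 0.
  have [n hn] : exists n, forall k, (n <= k)%N ->
      nrm (seval (s k.+1) x - seval (s k) x) < 2^-1 ^+ k.
    by apply: contrapT => h; apply: nLx; exact: sL.
  have tail k j : (n <= k)%N ->
      nrm (seval (s (k + j)%N) x - seval (s k) x) <= 2 * 2^-1 ^+ k - 2 * 2^-1 ^+ (k + j).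
    move=> nk; elim: j => [|j IH]; first by rewrite addn0 !subrr nrm0.
    have := ler_nrm_dist (seval (s (k + j)%N) x) (seval (s (k + j.+1)%N) x) (seval (s k) x).
    have := hn (k + j)%N (leq_trans nk (leq_addr _ _)).
    by rewrite addnS exprS; lra.
  have [|y sy] := cY (fun k => seval (s k) x); last by exists y.
  move=> e e0; have : (fun k => 2^-1 ^+ k) @ \oo --> (0 : R).
    by apply: cvg_expr; rewrite ger0_norm; lra.
  have e4 : 0 < e / 4 by lra.
  move=> /cvgrPdist_lt/(_ _ e4)[M _ hM]; exists (maxn n M) => i j.
  have hk k : (maxn n M <= k)%N -> nrm (seval (s k) x - seval (s (maxn n M)) x) <= e / 2.
    move=> /subnKC <-; have := tail (maxn n M) (k - maxn n M)%N (leq_maxl _ _).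
    have := hM (maxn n M) (leq_maxr _ _); rewrite /= sub0r normrN ger0_norm ?exprn_ge0// => h.
    have : 0 <= 2^-1 ^+ (maxn n M + (k - maxn n M)) :> R by rewrite exprn_ge0.
    lra.
  move=> /hk hi /hk hj.
  have := ler_nrm_dist (seval (s (maxn n M)) x) (seval (s i) x) (seval (s j) x).
  by rewrite (nrmBC (seval (s (maxn n M)) x)); lra.
pose f x := \1_(~` L) x *: l x.
have mf : smeas mu f.
  exists (fun k => sfun_restrict (~` L) (s k)); split.
    by move=> k; apply: sfun_over_restrict; [exact: measurableC|exact: (sP k).1].
  move=> x; under eq_fun do rewrite seval_restrict.
  rewrite /f indicE; have [/set_mem/lP h|_] := boolP (x \in ~` L).
    by rewrite scale1r; under eq_fun do rewrite scale1r.
  by rewrite scale0r; under eq_fun do rewrite scale0r; exact: cvg_cst.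
have fS k : (BNorm mu p (fun x => (f x - seval (s k) x)%R) <= (4^-1 ^+ k)%:E)%E.
  apply: (@BNorm_fatou _ _ _ _ _ _ p1 (fun j x => seval (s (j + k)%N) x - seval (s k) x)).
  - exact: ltW.
  - by move=> n; exact: smeasB.
  - exact: smeasB.
  - exists L; split=> // x; apply: contra_notP => nLx; apply: cvgB; last exact: cvg_cst.
    have : seval (s j) x @[j --> \oo] --> f x.
      by rewrite /f indicE mem_set ?scale1r//; exact: lP.
    by rewrite -(cvg_shiftn k).
  - by move=> n; apply: SSB; exact: leq_addl.
have Lf : f \in BLfun mu p.
  apply/asboolP; split=> //.
  have /asboolP[_ s0] := sfun_BLfun p1 (sP 0%N).1.
  have := BNormD p1 (smeasB mf (mS 0%N)) (mS 0%N).
  rewrite (_ : _ + _ = f); last first.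
    by apply/funext => x; rewrite -[LHS]/(f x - seval (s 0%N) x + seval (s 0%N) x) subrK.
  move=> /le_lt_trans; apply; apply: lte_add_pinfty => //.
  exact: le_lt_trans (fS 0%N) (ltry _).
exists (BLclass (toBL Lf)); apply/cvg_nrmP/cvgrPdist_le => e e0.
have [k hk] : exists k, 4^-1 ^+ k <= e / 2.
  have : (fun k => 4^-1 ^+ k) @ \oo --> (0 : R) by apply: cvg_expr; rewrite ger0_norm; lra.
  have e2 : 0 < e / 2 by lra.
  move=> /cvgrPdist_le/(_ _ e2)[k _ /(_ k (leqnn k))] /=.
  by rewrite sub0r normrN ger0_norm ?exprn_ge0//; exists k.
exists (N k) => // m /= km; rewrite sub0r normrN ger0_norm ?nrm_ge0//.
have := ler_nrm_dist (S k) (u m) (BLclass (toBL Lf)).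
have := Su k m km; rewrite (nrmBC (S k) (u m)) (nrmBC (S k)).
have : nrm (BLclass (toBL Lf) - S k) <= 4^-1 ^+ k.
  rewrite -lee_fin (nrm_in_class (in_classB (in_class_toBL Lf) (Ss k)))//.
  exact: smeasB.
rewrite a4; lra.
Qed.

End Lp_space.

(** * Martingale multipliers *)

(** The vector [w] collects the terms whose sign is already fixed, so that the induction frees one
    coefficient at a time. *)
Lemma sign_multiplier_le (R : realType) (X : normedModType R[i]) (n : nat)
    (v : nat -> X) (C : R) (m : nat -> R) (w : X) :
  (forall eps : nat -> bool, nrm (w + \sum_(k < n) (-1) ^+ eps k *: v k) <= C) ->
  (forall k, `|m k| <= 1) -> nrm (w + \sum_(k < n) (m k)%:C *: v k) <= C.
Proof.
move=> hC m1; elim: n w hC => [|n IH] w hC.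
  by have := hC (fun=> false); rewrite !big_ord0.
have IH' (b : bool) : nrm ((w + (-1) ^+ b *: v n) + \sum_(k < n) (m k)%:C *: v k) <= C.
  apply: IH => eps; have := hC (fun k => if k == n then b else eps k).
  rewrite big_ord_recr /= eqxx addrCA addrC -addrA.
  under eq_bigr => i _ do rewrite (ltn_eqF (ltn_ord i)).
  by rewrite addrA addrAC addrC addrA.
set s := \sum_(k < n) _ in IH' *.
have h0 := IH' false; have h1 := IH' true.
rewrite expr0 scale1r in h0; rewrite expr1 scaleN1r in h1.
have /andP[m1' m1''] : -1 <= m n <= 1 by rewrite -ler_norml.
have -> : w + \sum_(k < n.+1) (m k)%:C *: v k =
    ((1 + m n) / 2)%:C *: (w + v n + s) + ((1 - m n) / 2)%:C *: (w - v n + s).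
  rewrite big_ord_recr /= -/s (addrAC w) (addrAC w (- v n)).
  rewrite !(scalerDr _ (w + s)) scalerN -scaleNr addrACA -!scalerDl -rmorphN -!rmorphD.
  have -> : (1 + m n) / 2 + (1 - m n) / 2 = 1 by lra.
  have -> : (1 + m n) / 2 - (1 - m n) / 2 = m n by lra.
  by rewrite scale1r addrA.
apply: (le_trans (ler_nrmD _ _)); rewrite !nrmZr !ger0_norm; [|lra|lra].
have -> : C = (1 + m n) / 2 * C + (1 - m n) / 2 * C by lra.
by apply: lerD; apply: ler_wpM2l => //; lra.
Qed.

Lemma cvg_sum0 (R : realType) (I : Type) (F : set_system I) {FF : Filter F} (n : nat)
    (u : nat -> I -> R) : (forall j, u j @ F --> (0 : R)) ->
  (fun i => \sum_(j < n) u j i) @ F --> (0 : R).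
Proof.
move=> u0; elim: n => [|n IH].
  by under eq_fun do rewrite big_ord0; exact: cvg_cst.
have h := @cvgD _ _ _ F FF _ _ _ _ IH (u0 n); rewrite addr0 in h.
by under eq_fun do rewrite big_ord_recr /=.
Qed.

Definition Delta (R : realType) (X : normedModType R[i]) (E : int -> X -> X) (k : int) (x : X) :=
  E k x - E (k - 1) x.

(** All that the functional calculus uses of the averages E_k. The UMD property of [Y] enters
    through [sr_umd] alone. *)
Record spectral_resolution (R : realType) (X : normedModType R[i])
    (E : int -> X -> X) (C0 : R) : Prop := {
  sr_linear : forall k (a : R[i]) x y, E k (a *: x + y) = a *: E k x + E k y;
  sr_contraction : forall k x, nrm (E k x) <= nrm x;
  sr_comp : forall j k x, (j <= k)%R -> E j (E k x) = E j x /\ E k (E j x) = E j x;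
  sr_up : forall x, E n%:Z x @[n --> \oo] --> x;
  sr_down : forall x, E (- n%:Z) x @[n --> \oo] --> (0 : X);
  sr_C0 : 0 <= C0;
  sr_umd : forall (a : int) (n : nat) (eps : nat -> bool) x,
    nrm (\sum_(k < n) (-1) ^+ eps k *: Delta E (a + k%:Z) x) <= C0 * nrm x }.

Section multipliers.
Context (R : realType) (X : normedModType R[i]).
Hypothesis cX : seq_complete X.
Variables (E : int -> X -> X) (C0 : R).
Hypothesis H : spectral_resolution E C0.
Local Notation Delta := (Delta E).
Let E_linear := sr_linear H.
Let E_contraction := sr_contraction H.
Let E_comp := sr_comp H.
Let E_up := sr_up H.
Let E_down := sr_down H.
Let C0_ge0 := sr_C0 H.
Let E_umd := sr_umd H.

Implicit Types (m : int -> R[i]) (x y : X).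

Lemma E0 k : E k 0 = 0.
Proof. by have := E_linear k (-1) 0 0; rewrite !scaleN1r oppr0 addr0 addNr. Qed.

Lemma ED k x y : E k (x + y) = E k x + E k y.
Proof. by have := E_linear k 1 x y; rewrite !scale1r. Qed.

Lemma EZ k a x : E k (a *: x) = a *: E k x.
Proof. by have := E_linear k a x 0; rewrite !addr0 E0 addr0. Qed.

Lemma EB k x y : E k (x - y) = E k x - E k y.
Proof. by rewrite ED -scaleN1r EZ scaleN1r. Qed.

Lemma Delta0 k : Delta k 0 = 0.
Proof. by rewrite /Delta !E0 subrr. Qed.

Lemma DeltaDZ k a x y : Delta k (a *: x + y) = a *: Delta k x + Delta k y.
Proof. by rewrite /Delta !E_linear scalerBr opprD addrACA. Qed.

Lemma DeltaZ k a x : Delta k (a *: x) = a *: Delta k x.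
Proof. by have := DeltaDZ k a x 0; rewrite !addr0 Delta0 addr0. Qed.

Lemma DeltaD k x y : Delta k (x + y) = Delta k x + Delta k y.
Proof. by have := DeltaDZ k 1 x y; rewrite !scale1r. Qed.

Lemma DeltaB k x y : Delta k (x - y) = Delta k x - Delta k y.
Proof. by rewrite DeltaD -scaleN1r DeltaZ scaleN1r. Qed.

Lemma Delta_sum k (I : Type) (r : seq I) (F : I -> X) :
  Delta k (\sum_(i <- r) F i) = \sum_(i <- r) Delta k (F i).
Proof.
elim: r => [|i r IH]; first by rewrite !big_nil Delta0.
by rewrite !big_cons DeltaD IH.
Qed.

Lemma nrm_Delta k x : nrm (Delta k x) <= 2 * nrm x.
Proof.
rewrite (le_trans (ler_nrmB _ _))//.
by have := E_contraction k x; have := E_contraction (k - 1) x; lra.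
Qed.

Lemma Delta_Delta j k x : Delta j (Delta k x) = if j == k then Delta k x else 0.
Proof.
have Emin a b : E a (E b x) = E (Order.min a b) x.
  case: (leP a b) => ab; first by have [] := E_comp x ab.
  by have [] := E_comp x (ltW ab).
rewrite {1}/Delta /Delta !EB !Emin; case: ltgtP => [jk|kj|->].
- have jk1 : (j <= k - 1)%R by lia.
  have j1k : (j - 1 <= k)%R by lia.
  have j1k1 : (j - 1 <= k - 1)%R by lia.
  by rewrite (min_l jk1) (min_l j1k) (min_l j1k1) !subrr.
- have k1j : (k <= j - 1)%R by lia.
  have h2 : (k - 1 <= j)%R by lia.
  have h3 : (k - 1 <= j - 1)%R by lia.
  by rewrite (min_r k1j) (min_r h2) (min_r h3) subrr.
- have h : (k - 1 <= k)%R by lia.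
  by rewrite !minxx (min_r h) (min_l h) subrr subr0.
Qed.

(** The indices run from 1 - n to n, so that for m = 1 the sum telescopes to E_n - E_(-n), the
    operator [truncation n] below. *)
Definition partial_sum m (n : nat) x :=
  \sum_(i < 2 * n) m (1 - n%:Z + i%:Z) *: Delta (1 - n%:Z + i%:Z) x.

Lemma telescope_Delta (a : int) n x :
  \sum_(i < n) Delta (a + i%:Z) x = E (a + n%:Z - 1) x - E (a - 1) x.
Proof.
elim: n => [|n IH]; first by rewrite big_ord0 addr0 subrr.
rewrite big_ord_recr /= IH /Delta addrC subrKA; congr (E _ x - _).
by rewrite -natz -[n.+1]addn1 PoszD; lia.
Qed.

Definition truncation (n : nat) x := E n%:Z x - E (- n%:Z) x.

Lemma truncationE n x : truncation n x = \sum_(i < 2 * n) Delta (1 - n%:Z + i%:Z) x.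
Proof. by rewrite telescope_Delta /truncation; congr (E _ x - E _ x); lia. Qed.

Lemma truncation_cvg x : truncation n x @[n --> \oo] --> x.
Proof. by rewrite -[X in _ --> X]subr0; apply: cvgB; [exact: E_up|exact: E_down]. Qed.

Lemma truncation_close x e : 0 < e -> exists b, nrm (truncation b x - x) <= e.
Proof.
move=> e0; have /cvg_nrmP/cvgrPdist_le/(_ _ e0)[b _ /(_ b (leqnn b)) /=] := @truncation_cvg x.
by rewrite sub0r normrN ger0_norm ?nrm_ge0//; exists b.
Qed.

Lemma Delta_eq0 x : (forall k, Delta k x = 0) -> x = 0.
Proof.
move=> h; apply: (@cvg_nrm_unique _ _ _ _ _ (@truncation_cvg x)).
rewrite (_ : (fun n => _) = cst 0); first exact: cvg_cst.
by apply/funext => n; rewrite truncationE big1.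
Qed.

(** An identity between operators thus becomes a scalar identity on each Delta_k; every later
    computation with multipliers is made this way. *)
Lemma Delta_inj x y : (forall k, Delta k x = Delta k y) -> x = y.
Proof.
by move=> h; apply/eqP; rewrite -subr_eq0; apply/eqP/Delta_eq0 => k; rewrite DeltaB h subrr.
Qed.

Lemma Delta_truncation k n x : Delta k (truncation n x) =
  if (- n%:Z < k <= n%:Z)%R then Delta k x else 0.
Proof.
rewrite truncationE Delta_sum; case: ifPn => kn; last first.
  rewrite big1// => i _; rewrite Delta_Delta; case: eqP => // ki.
  by have := ltn_ord i; lia.
have ki : (absz (k + n%:Z - 1)%R < 2 * n)%N by lia.
rewrite (bigD1 (Ordinal ki)) //= big1 ?addr0.
  by rewrite Delta_Delta ifT; [congr (Delta _ x)|]; lia.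
move=> i; rewrite -val_eqE /= => ik; rewrite Delta_Delta ifF//.
by apply/negbTE; apply: contra ik => /eqP; lia.
Qed.

(** Dividing by [B] reduces to coefficients in [-1, 1]; the factor 2 comes from treating real and
    imaginary parts separately. *)
Lemma nrm_sum_multiplier m (B : R) (a : int) n x : 0 <= B ->
  (forall k, nrm (m k : R[i]^o) <= B) ->
  nrm (\sum_(i < n) m (a + i%:Z) *: Delta (a + i%:Z) x) <= 2 * C0 * B * nrm x.
Proof.
move=> B0 mB.
have realcase (r : nat -> R) : (forall k, `|r k| <= B) ->
    nrm (\sum_(i < n) (r i)%:C *: Delta (a + i%:Z) x) <= C0 * B * nrm x.
  move=> rB; move: B0; rewrite le_eqVlt => /predU1P[B0|B0].
    rewrite big1 ?nrm0 -?B0 ?mulr0 ?mul0r// => i _.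
    have : `|r i| <= 0 by rewrite B0.
    by rewrite normr_le0 => /eqP ->; rewrite scale0r.
  have h := @sign_multiplier_le R X n (fun i => Delta (a + i%:Z) x) (C0 * nrm x) (fun k => r k / B) 0.
  have {}h : nrm (0 + \sum_(i < n) (r i / B)%:C *: Delta (a + i%:Z) x) <= C0 * nrm x.
    apply: h => [eps|k]; first by rewrite add0r; exact: E_umd.
    by rewrite normrM normfV (ger0_norm (ltW B0)) ler_pdivrMr// mul1r.
  rewrite add0r in h.
  have -> : \sum_(i < n) (r i)%:C *: Delta (a + i%:Z) x =
      B%:C *: \sum_(i < n) (r i / B)%:C *: Delta (a + i%:Z) x.
    rewrite scaler_sumr; apply: eq_bigr => i _.
    by rewrite scalerA -rmorphM mulrCA divff ?gt_eqF// mulr1.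
  by rewrite nrmZr (ger0_norm (ltW B0)) (mulrC C0) -mulrA ler_pM2l.
have e : \sum_(i < n) m (a + i%:Z) *: Delta (a + i%:Z) x =
    \sum_(i < n) (complex.Re (m (a + i%:Z)))%:C *: Delta (a + i%:Z) x +
    ('i%C : R[i]) *: \sum_(i < n) (complex.Im (m (a + i%:Z)))%:C *: Delta (a + i%:Z) x.
  rewrite scaler_sumr -big_split /=; apply: eq_bigr => i _.
  by rewrite scalerA -scalerDl -complexE.
rewrite e (le_trans (ler_nrmD _ _))// nrmZ.
have -> : nrm ('i%C : R[i]^o) = 1.
  by rewrite /nrm normc_def /= expr0n expr1n add0r sqrtr1.
have h1 := realcase (fun i => complex.Re (m (a + i%:Z))) (fun k => le_trans (Re_le_nrm _) (mB _)).
have h2 := realcase (fun i => complex.Im (m (a + i%:Z))) (fun k => le_trans (Im_le_nrm _) (mB _)).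
by rewrite mul1r; lra.
Qed.

Section one_multiplier.
Variables (m : int -> R[i]) (B : R).
Hypothesis B0 : 0 <= B.
Hypothesis mB : forall k, nrm (m k : R[i]^o) <= B.

Let nrm_partial_sum n x : nrm (partial_sum m n x) <= 2 * C0 * B * nrm x.
Proof. exact: nrm_sum_multiplier. Qed.

Let partial_sumDZ n (a : R[i]) x y :
  partial_sum m n (a *: x + y) = a *: partial_sum m n x + partial_sum m n y.
Proof.
rewrite /partial_sum scaler_sumr -big_split /=; apply: eq_bigr => i _.
by rewrite DeltaDZ scalerDr !scalerA mulrC.
Qed.

Let Delta_partial_sum k n x : Delta k (partial_sum m n x) =
  if (- n%:Z < k <= n%:Z)%R then m k *: Delta k x else 0.
Proof.
rewrite Delta_sum; case: ifPn => kn; last first.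
  rewrite big1// => i _; rewrite DeltaZ Delta_Delta; case: eqP => [ki|]; last by rewrite scaler0.
  by have := ltn_ord i; lia.
have ki : (absz (k + n%:Z - 1)%R < 2 * n)%N by lia.
rewrite (bigD1 (Ordinal ki)) //= big1 ?addr0.
  have -> : 1 - n%:Z + (absz (k + n%:Z - 1)%R)%:Z = k by lia.
  by rewrite DeltaZ Delta_Delta eqxx.
move=> i; rewrite -val_eqE /= => ik; rewrite DeltaZ Delta_Delta ifF ?scaler0//.
by apply/negbTE; apply: contra ik => /eqP; lia.
Qed.

Let partial_sum_truncation n b x : (b <= n)%N ->
  partial_sum m n (truncation b x) = partial_sum m b x.
Proof.
move=> bn; apply: Delta_inj => k; rewrite !Delta_partial_sum Delta_truncation.
case: ifPn => h1; case: ifPn => h2 => //; rewrite ?scaler0//.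
by exfalso; move: h1 h2; lia.
Qed.

(** The partial sums are uniformly bounded operators and become stationary on every truncation, and
    truncations are dense, so they form a Cauchy sequence. *)
Lemma partial_sum_cvg x : exists y, partial_sum m n x @[n --> \oo] --> y.
Proof.
apply: cX => e e0; pose K := 2 * C0 * B + 1.
have K0 : 0 < K by rewrite ltr_wpDl// !mulr_ge0.
have eK : 0 < e / (2 * K) by rewrite divr_gt0// mulr_gt0.
have [b hb] := truncation_close x eK.
have h n : (b <= n)%N -> nrm (partial_sum m n x - partial_sum m b x) <= e / 2.
  move=> bn; rewrite -(partial_sum_truncation x bn).
  have := partial_sumDZ n (-1) (truncation b x) x; rewrite !scaleN1r ![- _ + _]addrC => <-.
  apply: le_trans (nrm_partial_sum _ _) _; rewrite nrmBC.
  apply: (@le_trans _ _ (K * (e / (2 * K)))).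
    apply: ler_pM => //; [|exact: nrm_ge0|by rewrite /K; lra].
    by rewrite !mulr_ge0.
  by rewrite (_ : K * _ = e / 2)//; field; rewrite gt_eqF.
exists b => i j /h hi /h hj.
have := ler_nrm_dist (partial_sum m b x) (partial_sum m i x) (partial_sum m j x).
by rewrite (nrmBC (partial_sum m b x)); lra.
Qed.

Definition multiplier x := xget 0 [set y | partial_sum m n x @[n --> \oo] --> y].

Lemma multiplierP x : partial_sum m n x @[n --> \oo] --> multiplier x.
Proof.
by have [y hy] := partial_sum_cvg x; rewrite /multiplier; case: xgetP => [z _ //|/(_ y)].
Qed.

Lemma multiplierDZ (a : R[i]) x y :
  multiplier (a *: x + y) = a *: multiplier x + multiplier y.
Proof.
apply: (@cvg_nrm_unique _ _ _ _ _ (@multiplierP _)).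
under eq_fun do rewrite partial_sumDZ.
by apply: cvgD; [apply: cvgZ; [exact: cvg_cst|]|]; exact: multiplierP.
Qed.

Lemma nrm_multiplier x : nrm (multiplier x) <= 2 * C0 * B * nrm x.
Proof.
have h := cvg_nrm (@multiplierP x); rewrite -(cvg_lim _ h)//.
by apply: limr_le; [exact: cvgP h|exact: nearW].
Qed.

Lemma cvg_Delta k (u : nat -> X) x : u @ \oo --> x ->
  (fun n => Delta k (u n)) @ \oo --> Delta k x.
Proof.
move=> /cvg_nrmP ux; apply/cvg_nrmP.
apply: (@cvg0_le _ _ _ _ _ (fun n => 2 * nrm (u n - x))).
  by apply: nearW => n; rewrite nrm_ge0 -DeltaB nrm_Delta.
by rewrite -(mulr0 2); apply: cvgM => //; exact: cvg_cst.
Qed.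

Lemma Delta_multiplier k x : Delta k (multiplier x) = m k *: Delta k x.
Proof.
have h := @cvg_Delta k _ _ (@multiplierP x); apply: (@cvg_nrm_unique _ _ _ _ _ h).
apply: cvg_trans (@cvg_cst _ (m k *: Delta k x) _ \oo _); apply: near_eq_cvg.
exists `|k|.+1 => // n /= kn; rewrite Delta_partial_sum ifT//; lia.
Qed.

End one_multiplier.

Lemma nrm_complexM (a b : R[i]) : nrm (a * b : R[i]^o) = nrm (a : R[i]^o) * nrm (b : R[i]^o).
Proof. exact: (@nrmZ R R[i]^o). Qed.

Lemma nrm_complexV (a : R[i]) : nrm (a^-1 : R[i]^o) = (nrm (a : R[i]^o))^-1.
Proof.
have [->|a0] := eqVneq a 0; first by rewrite invr0 nrm0 invr0.
have na : nrm (a : R[i]^o) != 0 by apply: contra a0 => /eqP/nrm_eq0 ->.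
apply: (mulfI na); rewrite -nrm_complexM !divff//.
by rewrite /nrm normr1.
Qed.

Lemma multiplier_unique m (B : R) x y : 0 <= B -> (forall k, nrm (m k : R[i]^o) <= B) ->
  (forall k, Delta k y = m k *: Delta k x) -> multiplier m x = y.
Proof.
by move=> B0 mB h; apply: Delta_inj => k; rewrite (Delta_multiplier B0 mB) h.
Qed.

Lemma multiplier_truncation m (B : R) b x : 0 <= B ->
  (forall k, nrm (m k : R[i]^o) <= B) ->
  multiplier m (truncation b x) = \sum_(i < 2 * b) m (1 - b%:Z + i%:Z) *: Delta (1 - b%:Z + i%:Z) x.
Proof.
move=> B0 mB; rewrite truncationE.
have Msum : forall n (F : nat -> X), multiplier m (\sum_(i < n) F i) = \sum_(i < n) multiplier m (F i).
  elim=> [F|n IH F].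
    by rewrite !big_ord0; apply: (multiplier_unique B0 mB) => k; rewrite Delta0 scaler0.
  rewrite !big_ord_recr /= -IH.
  by have := multiplierDZ B0 mB 1 (\sum_(i < n) F i) (F n); rewrite !scale1r.
rewrite (Msum _ (fun i => Delta (1 - b%:Z + i%:Z) x)); apply: eq_bigr => i _.
apply: (multiplier_unique B0 mB) => k.
by rewrite DeltaZ Delta_Delta; case: eqP => [->//|_]; rewrite !scaler0.
Qed.

(** Dominated convergence for multipliers: up to a small multiple of the norm x may be replaced by a
    truncation, on which only finitely many coefficients matter. It gives the continuity of the
    resolvent along a ray and the derivative of the semigroup at 0. *)
Lemma multiplier_cvg (I : Type) (F : set_system I) {FF : Filter F}
    (mt : I -> int -> R[i]) m (B : R) x : 0 <= B ->
  (forall i k, nrm (mt i k : R[i]^o) <= B) -> (forall k, nrm (m k : R[i]^o) <= B) ->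
  (forall k, (fun i => nrm (mt i k - m k : R[i]^o)) @ F --> (0 : R)) ->
  (fun i => multiplier (mt i) x) @ F --> multiplier m x.
Proof.
move=> B0 mtB mB mtm; apply/cvg_nrmP/cvgrPdist_le => e e0.
pose K := 2 * C0 * (2 * B) + 1.
have K0 : 0 < K by rewrite ltr_wpDl// !mulr_ge0.
have eK : 0 < e / (2 * K) by rewrite divr_gt0// mulr_gt0.
have [b hb] := truncation_close x eK.
pose dm i k := mt i k - m k.
have B2 : 0 <= 2 * B by rewrite mulr_ge0.
have dmB i k : nrm (dm i k : R[i]^o) <= 2 * B.
  by rewrite (le_trans (ler_nrmB _ _))//; have := mtB i k; have := mB k; lra.
have dE i : multiplier (mt i) x - multiplier m x =
    multiplier (dm i) (x - truncation b x) + multiplier (dm i) (truncation b x).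
  have := multiplierDZ B2 (dmB i) 1 (x - truncation b x) (truncation b x).
  rewrite !scale1r subrK => <-; apply: Delta_inj => k.
  by rewrite DeltaB (Delta_multiplier B0 (mtB i)) (Delta_multiplier B0 mB) (Delta_multiplier B2 (dmB i)) -scalerBl.
have h0 : (fun i => \sum_(j < 2 * b) nrm (dm i (1 - b%:Z + j%:Z) : R[i]^o) *
    nrm (Delta (1 - b%:Z + j%:Z) x)) @ F --> (0 : R).
  apply: (@cvg_sum0 _ _ _ _ _ (fun j i => nrm (dm i (1 - b%:Z + j%:Z) : R[i]^o) *
      nrm (Delta (1 - b%:Z + j%:Z) x))) => j.
  have := @cvgM _ _ F FF _ _ _ _ (mtm (1 - b%:Z + j%:Z)) (@cvg_cst _ (nrm (Delta (1 - b%:Z + j%:Z) x)) _ F FF).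
  by rewrite mul0r.
have e2 : 0 < e / 2 by rewrite divr_gt0.
have /cvgrPdist_le/(_ _ e2) := h0; apply: filterS => i.
rewrite sub0r normrN ger0_norm; last by apply: sumr_ge0 => j _; rewrite mulr_ge0// nrm_ge0.
move=> hs; rewrite sub0r normrN ger0_norm ?nrm_ge0// dE (le_trans (ler_nrmD _ _))//.
rewrite (splitr e) lerD//.
  apply: le_trans (nrm_multiplier B2 (dmB i) _) _; rewrite nrmBC.
  have -> : e / 2 = K * (e / (2 * K)) by field; rewrite gt_eqF.
  apply: ler_pM => //; [|exact: nrm_ge0|by rewrite /K; lra].
  by rewrite !mulr_ge0.
rewrite (multiplier_truncation b x B2 (dmB i)); apply: le_trans hs.
apply: (le_trans (ler_nrm_sum _ _ _)); apply: ler_sum => j _.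
by rewrite nrmZ.
Qed.

Variable lam : int -> R.
Hypothesis lam_gt0 : forall k, 0 < lam k.

Definition spectral_graph x y := forall k, Delta k y = (lam k)%:C *: Delta k x.

Lemma spectral_graph_resolvent (z : R[i]) (e : R) x y : 0 < e ->
  (forall k, e <= nrm (z - (lam k)%:C : R[i]^o)) ->
  spectral_graph x (z *: x - y) <-> x = multiplier (fun k => (z - (lam k)%:C)^-1) y.
Proof.
move=> e0 ze.
have zn k : z - (lam k)%:C != 0.
  by apply/eqP => h; have := ze k; rewrite h nrm0 leNgt e0.
have zV k : nrm ((z - (lam k)%:C)^-1 : R[i]^o) <= e^-1.
  by rewrite nrm_complexV lef_pV2 ?posrE// (lt_le_trans e0).
have e0' : 0 <= e^-1 by rewrite invr_ge0 ltW.
split=> [h|-> k].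
  apply/esym/(multiplier_unique e0' zV) => k.
  have := h k; rewrite DeltaB DeltaZ => /eqP.
  rewrite subr_eq addrC -subr_eq -scalerBl => /eqP <-.
  by rewrite scalerA mulVf// scale1r.
rewrite DeltaB DeltaZ (Delta_multiplier e0' zV) !scalerA -[X in _ - X]scale1r -scalerBl.
congr (_ *: _); apply/eqP; rewrite subr_eq; apply/eqP.
by rewrite -[X in _ = _ + X](divff (zn k)) -mulrDl addrC; congr (_ / _); ring.
Qed.

Lemma spectral_resolventE (z : R[i]) (e : R) y : 0 < e ->
  (forall k, e <= nrm (z - (lam k)%:C : R[i]^o)) ->
  resolvent spectral_graph z y = multiplier (fun k => (z - (lam k)%:C)^-1) y.
Proof.
move=> e0 ze; rewrite /resolvent; apply: xget_unique => [|x] /=.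
  exact/(spectral_graph_resolvent _ _ e0 ze).
by move/(spectral_graph_resolvent _ _ e0 ze).
Qed.

Lemma spectral_graph_closed_densely_defined : closed_densely_defined spectral_graph.
Proof.
split.
- by move=> k; rewrite Delta0 scaler0.
- move=> a x y x' y' h h' k; rewrite !DeltaDZ (h k) (h' k).
  rewrite [RHS]scalerDr !scalerA.
  by rewrite (mulrC a).
- by move=> x y y' h h'; apply: Delta_inj => k; rewrite (h k) (h' k).
- move=> [x y] cl k /=; apply/eqP; rewrite -subr_eq0; apply/eqP/nrm_eq0/eqP.
  rewrite eq_le nrm_ge0 andbT; apply/ler_addgt0Pr => e e0; rewrite add0r.
  have l0 := lam_gt0 k; pose d := e / (2 * (1 + lam k)).
  have d0 : 0 < d by rewrite divr_gt0// mulr_gt0// addr_gt0.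
  have nb u : nbhs (u : X) [set v | nrm (v - u) < d].
    apply/nbhs_ballP; exists d%:C => /=; first by rewrite ltcR.
    by move=> v; rewrite -ball_normE /ball_ /= nrmE ltcR nrmBC.
  have [|[x' y'] [/= h [/= hx hy]]] := cl [set w | nrm (w.1 - x) < d /\ nrm (w.2 - y) < d].
    by exists ([set v | nrm (v - x) < d], [set v | nrm (v - y) < d]); [split; exact: nb|case].
  have -> : Delta k y - (lam k)%:C *: Delta k x =
      Delta k (y - y') + (lam k)%:C *: Delta k (x' - x).
    rewrite !DeltaB (h k) (scalerBr _ (Delta k x')); set u := _ *: Delta k x'.
    by rewrite addrA subrK.
  rewrite (le_trans (ler_nrmD _ _))// nrmZr (ger0_norm (ltW l0)).
  have h1 := nrm_Delta k (y - y'); have h2 := nrm_Delta k (x' - x).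
  rewrite (nrmBC y) in h1.
  apply: (@le_trans _ _ (2 * d + lam k * (2 * d))).
    by apply: lerD; [lra|rewrite ler_pM2l//; lra].
  by apply: eqW; rewrite /d; field; rewrite gt_eqF// addr_gt0.
(* The domain is dense because it contains all truncations, where the operator is a finite sum. *)
- move=> U [x Ux] oU; have : nbhs x U by exact: open_nbhs_nbhs.
  move=> /(@truncation_cvg x)[n _ /(_ n (leqnn n))] /= Un; exists (truncation n x); split=> //=.
  exists (\sum_(i < 2 * n) (lam (1 - n%:Z + i%:Z))%:C *: Delta (1 - n%:Z + i%:Z) x) => k.
  rewrite truncationE !Delta_sum scaler_sumr; apply: eq_bigr => i _.
  by rewrite DeltaZ Delta_Delta; case: eqP => [->//|_]; rewrite !scaler0.
Qed.

End multipliers.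

(** * Cauchy's formula on a sector *)

Lemma mean_value_bound (R : realType) (F f : R -> R) (a b M : R) : a <= b ->
  (forall x, a <= x <= b -> is_derive x 1 F (f x)) ->
  (forall x, a <= x <= b -> `|f x| <= M) -> `|F b - F a| <= M * (b - a).
Proof.
rewrite le_eqVlt => /predU1P[->|ab] dF fM; first by rewrite !subrr mulr0 normr0.
have [c] : exists2 c, c \in `]a, b[%R & F b - F a = f c * (b - a).
  apply: MVT => // [x|]; first by rewrite in_itv /= => /andP[ax xb]; apply: dF; rewrite !ltW.
  apply: derivable_within_continuous => x; rewrite in_itv /= => xab.
  by have [] := dF x xab.
rewrite in_itv /= => /andP[ac cb] ->; rewrite normrM (gtr0_norm (_ : 0 < b - a)) ?subr_gt0//.
by rewrite ler_wpM2r ?subr_ge0 ?(ltW ab)// fM// (ltW ac) (ltW cb).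
Qed.

Lemma midpoint_itv (R : realType) (a b : R) : a < b ->
  [/\ a < (a + b) / 2, (a + b) / 2 < b, (a + b) / 2 - a = (b - a) / 2 &
    b - (a + b) / 2 = (b - a) / 2].
Proof. by move=> ab; split; lra. Qed.

Lemma dist_in_itv (R : realType) (a b x y : R) :
  a <= x <= b -> a <= y <= b -> `|x - y| <= b - a.
Proof. by move=> /andP[? ?] /andP[? ?]; rewrite ler_norml; lra. Qed.

(** * Green's theorem on a rectangle *)

Section green.
Context (R : realType).
Variables (P Q SP SQ : R -> R -> R) (A B C D : R).
Hypothesis dSP : forall r s, A < r < B -> C < s < D ->
  is_derive r 1 (fun x => SP x s) (P r s).
Hypothesis dSQ : forall r s, A < r < B -> C < s < D ->
  is_derive s 1 (fun y => SQ r y) (Q r s).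
Hypothesis curl_free : forall r s, A < r < B -> C < s < D ->
  exists p q k : R, forall e, 0 < e -> exists2 de, 0 < de & forall x y,
    `|x - r| < de -> `|y - s| < de ->
    `|P x y - P r s - (p * (x - r) + k * (y - s))| <= e * (`|x - r| + `|y - s|) /\
    `|Q x y - Q r s - (k * (x - r) + q * (y - s))| <= e * (`|x - r| + `|y - s|).

(** The circulation of P dr + Q ds around the rectangle, written with an antiderivative [SP] of P in
    r and an antiderivative [SQ] of Q in s. *)
Definition flux a b c d := (SP b c - SP a c) - (SP b d - SP a d) +
  ((SQ b d - SQ b c) - (SQ a d - SQ a c)).

Let cell := ((R * R) * (R * R))%type.
Let width (x : cell) := x.1.2 - x.1.1.
Let height (x : cell) := x.2.2 - x.2.1.
Let fl (x : cell) := flux x.1.1 x.1.2 x.2.1 x.2.2.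

(** Goursat's bisection, which asks for pointwise differentiability only. Circulation is additive,
    so one quarter always keeps the ratio of circulation to area; at the common point of the nested
    quarters the equal mixed coefficients k make the circulation of smaller order than the area. *)
Lemma green_rectangle a b c d : A < a -> a < b -> b < B -> C < c -> c < d -> d < D ->
  flux a b c d = 0.
Proof.
move=> Aa ab bB Cc cd dD; apply/eqP/negPn/negP => fn0.
pose e0 := `|flux a b c d| / ((b - a) * (d - c)).
have W0 : 0 < b - a by rewrite subr_gt0.
have H0 : 0 < d - c by rewrite subr_gt0.
have e00 : 0 < e0 by rewrite divr_gt0 ?mulr_gt0// normr_gt0.
pose bad (x : cell) := [/\ a <= x.1.1 /\ x.1.2 <= b, c <= x.2.1 /\ x.2.2 <= d,
  x.1.1 < x.1.2 /\ x.2.1 < x.2.2 & e0 * (width x * height x) <= `|fl x|].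
pose half (x y : cell) := [/\ x.1.1 <= y.1.1 /\ y.1.2 <= x.1.2,
  x.2.1 <= y.2.1 /\ y.2.2 <= x.2.2, width y = width x / 2 & height y = height x / 2].
(* If all four quarters had a ratio below [e0], so would their union. *)
have step (x : cell) : exists y, bad x -> bad y /\ half x y.
  have [bx|nbx] := pselect (bad x); last by exists x.
  case: x bx => [[a1 b1] [c1 d1]] [/= [aa1 b1b] [cc1 d1d] [ab1 cd1] hbad].
  pose m := (a1 + b1) / 2; pose l := (c1 + d1) / 2.
  have [am mb wl wr] : [/\ a1 < m, m < b1, m - a1 = (b1 - a1) / 2 & b1 - m = (b1 - a1) / 2] by exact: midpoint_itv.
  have [cl ld hl hr] : [/\ c1 < l, l < d1, l - c1 = (d1 - c1) / 2 & d1 - l = (d1 - c1) / 2] by exact: midpoint_itv.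
  have am1 := ltW am; have mb1 := ltW mb; have cl1 := ltW cl; have ld1 := ltW ld.
  have mb' := le_trans (ltW mb) b1b; have am' := le_trans aa1 (ltW am).
  have ld' := le_trans (ltW ld) d1d; have cl' := le_trans cc1 (ltW cl).
  have good (u v s t : R) : (u, v) = (a1, m) \/ (u, v) = (m, b1) ->
      (s, t) = (c1, l) \/ (s, t) = (l, d1) ->
      `|flux u v s t| < e0 * ((v - u) * (t - s)) \/
      exists y, bad ((a1, b1), (c1, d1)) -> bad y /\ half ((a1, b1), (c1, d1)) y.
    move=> huv hst; case: (ltP (`|flux u v s t|) (e0 * ((v - u) * (t - s)))) => h; first by left.
    right; exists ((u, v), (s, t)) => _; rewrite /bad /half /fl /width /height /=.
    case: huv hst h => -[-> ->] [] [-> ->] h.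
    + by do 2 split.
    + by do 2 split.
    + by do 2 split.
    + by do 2 split.
  have [h1|//] := good a1 m c1 l (or_introl erefl) (or_introl erefl).
  have [h2|//] := good a1 m l d1 (or_introl erefl) (or_intror erefl).
  have [h3|//] := good m b1 c1 l (or_intror erefl) (or_introl erefl).
  have [h4|//] := good m b1 l d1 (or_intror erefl) (or_intror erefl).
  exfalso; move: hbad; rewrite /fl /width /height /= leNgt => /negP; apply.
  have -> : flux a1 b1 c1 d1 = flux a1 m c1 l + flux a1 m l d1 + (flux m b1 c1 l + flux m b1 l d1).
    by rewrite /flux; ring.
  apply: (le_lt_trans (ler_normD _ _)).
  apply: (@lt_le_trans _ _ (e0 * ((m - a1) * (l - c1)) + e0 * ((m - a1) * (d1 - l)) +
     (e0 * ((b1 - m) * (l - c1)) + e0 * ((b1 - m) * (d1 - l))))).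
    by apply: ltrD; apply: le_lt_trans (ler_normD _ _) _; exact: ltrD.
  by apply: eqW; rewrite /m /l; field.
have {step}[next nextP] := choice step.
pose s n := iter n next ((a, b), (c, d)).
have sbad n : bad (s n).
  elim: n => [|n IH]; last by have [] := nextP _ IH.
  split=> //=; rewrite /fl /width /height /= /e0 divfK//.
  by rewrite gt_eqF// mulr_gt0.
have shalf n : half (s n) (s n.+1) by have [] := nextP _ (sbad n).
have smono n k : [/\ (s n).1.1 <= (s (n + k)%N).1.1 /\ (s (n + k)%N).1.2 <= (s n).1.2 &
    (s n).2.1 <= (s (n + k)%N).2.1 /\ (s (n + k)%N).2.2 <= (s n).2.2].
  elim: k => [|k [[h1 h2] [h3 h4]]]; first by rewrite addn0.
  rewrite addnS; have [[g1 g2] [g3 g4] _ _] := shalf (n + k)%N.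
  by split; split; [exact: le_trans h1 g1|exact: le_trans g2 h2|exact: le_trans h3 g3|exact: le_trans g4 h4].
have sw n : width (s n) = (b - a) / 2 ^+ n.
  elim: n => [|n IH]; first by rewrite expr0 divr1.
  by have [_ _ -> _] := shalf n; rewrite IH exprS invfM; ring.
have sh n : height (s n) = (d - c) / 2 ^+ n.
  elim: n => [|n IH]; first by rewrite expr0 divr1.
  by have [_ _ _ ->] := shalf n; rewrite IH exprS invfM; ring.
have inside (u v : nat -> R) : (forall n k, u n <= u (n + k)%N /\ v (n + k)%N <= v n) ->
    (forall n, u n <= v n) -> exists z, forall n, u n <= z <= v n.
  move=> mono uv; have uvm n m : u n <= v m.
    rewrite (le_trans (mono n m).1)// (le_trans (uv _))//.
    by rewrite addnC; exact: (mono m n).2.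
  exists (sup (range u)) => n; apply/andP; split.
    by apply: sup_upper_bound; [split; [exists (u 0%N), 0%N|exists (v 0%N) => _ [k _ <-]]|exists n].
  by apply: ge_sup; [exists (u 0%N), 0%N|move=> _ [k _ <-]].
have [r hr] : exists r, forall n, (s n).1.1 <= r <= (s n).1.2.
  apply: inside => [n k|n]; first by have [] := smono n k.
  by have [_ _ [/ltW]] := sbad n.
have [t ht] : exists t, forall n, (s n).2.1 <= t <= (s n).2.2.
  apply: inside => [n k|n]; first by have [] := smono n k.
  by have [_ _ [_ /ltW]] := sbad n.
have hr0 : A < r < B.
  by have /andP[h1 h2] := hr 0%N; rewrite (lt_le_trans Aa h1) (le_lt_trans h2 bB).
have ht0 : C < t < D.
  by have /andP[h1 h2] := ht 0%N; rewrite (lt_le_trans Cc h1) (le_lt_trans h2 dD).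
have [p [q [k hloc]]] := curl_free hr0 ht0.
pose W := b - a; pose H := d - c.
(* Chosen so that the final estimate 2 e (w + h)^2 is half of e0 w h for every rectangle similar to
   the first one. *)
pose e := e0 * (W * H) / (4 * (W + H) ^+ 2).
have WH : 0 < W + H by rewrite addr_gt0.
have e_gt0 : 0 < e.
  by apply: divr_gt0; apply: mulr_gt0 => //; [exact: mulr_gt0|exact: exprn_gt0].
have [de de0 {}hloc] := hloc _ e_gt0.
have [n hn] : exists n, (W + H) / 2 ^+ n < de.
  have [n hn] : exists n : nat, (W + H) / de < n%:R.
    exists (Num.truncn ((W + H) / de)).+1; exact: truncnS_gt.
  exists n; rewrite ltr_pdivrMr ?exprn_gt0// mulrC -ltr_pdivrMr// (lt_trans hn)//.
  by rewrite -natrX ltr_nat ltn_expl.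
have [[aa bb] [cc dd] [ab' cd'] hbad] := sbad n.
have {}hr := hr n; have {}ht := ht n; have wn := sw n; have hnn := sh n.
move: aa bb cc dd ab' cd' hbad hr ht wn hnn; rewrite /fl /width /height.
case: (s n) => [[a1 b1] [c1 d1]] /=.
move=> aa bb cc dd ab1 cd1 hbad /andP[ar rb] /andP[ct td] wn hnn.
pose w := W / 2 ^+ n; pose h := H / 2 ^+ n.
have wh : w + h = (W + H) / 2 ^+ n by rewrite [RHS]mulrDl.
have w0 : 0 < w by rewrite divr_gt0// exprn_gt0.
have h0 : 0 < h by rewrite divr_gt0// exprn_gt0.
have wE : b1 - a1 = w by [].
have hE : d1 - c1 = h by [].
have near x y : a1 <= x <= b1 -> c1 <= y <= d1 ->
   `|P x y - P r t - (p * (x - r) + k * (y - t))| <= e * (w + h) /\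
   `|Q x y - Q r t - (k * (x - r) + q * (y - t))| <= e * (w + h).
  move=> /andP[ax xb] /andP[cy yd].
  have xr : `|x - r| <= w by rewrite -wE; apply: dist_in_itv; apply/andP.
  have yt : `|y - t| <= h by rewrite -hE; apply: dist_in_itv; apply/andP.
  rewrite -wh in hn.
  have xr' : `|x - r| < de by rewrite (le_lt_trans xr)// (le_lt_trans _ hn)// lerDl ltW.
  have yt' : `|y - t| < de by rewrite (le_lt_trans yt)// (le_lt_trans _ hn)// lerDr ltW.
  have [h1 h2] := hloc x y xr' yt'.
  have le : e * (`|x - r| + `|y - t|) <= e * (w + h) by rewrite ler_pM2l// lerD.
  by split; [exact: le_trans h1 le|exact: le_trans h2 le].
have A1 x : a1 <= x <= b1 -> A < x < B by move=> /andP[h1 h2]; rewrite (lt_le_trans Aa (le_trans aa h1)) (le_lt_trans (le_trans h2 bb) bB).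
have C1 y : c1 <= y <= d1 -> C < y < D.
  by move=> /andP[h1 h2]; rewrite (lt_le_trans Cc (le_trans cc h1)) (le_lt_trans (le_trans h2 dd) dD).
have cin : c1 <= c1 <= d1 by rewrite lexx ltW.
have din : c1 <= d1 <= d1 by rewrite lexx ltW.
have ain : a1 <= a1 <= b1 by rewrite lexx ltW.
have bin : a1 <= b1 <= b1 by rewrite lexx ltW.
(* The terms in k remove the linear part of the integrand in each direction. Over the rectangle they
   contribute k h w and - k w h, which cancel in the circulation. *)
have est1 := @mean_value_bound R (fun x => SP x c1 - SP x d1 + k * h * x)
  (fun x => P x c1 - P x d1 + k * h) a1 b1 (2 * e * (w + h)) (ltW ab1).
have {}est1 : `|(SP b1 c1 - SP b1 d1 + k * h * b1) - (SP a1 c1 - SP a1 d1 + k * h * a1)| <= 2 * e * (w + h) * (b1 - a1).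
  apply: est1 => x hx.
    have d1' := dSP (A1 x hx) (C1 _ cin); have d2' := dSP (A1 x hx) (C1 _ din).
    by apply: is_derive_eq; rewrite /GRing.scale /= mulr1.
  have [n1 _] := near x c1 hx cin; have [n2 _] := near x d1 hx din.
  have -> : P x c1 - P x d1 + k * h = (P x c1 - P r t - (p * (x - r) + k * (c1 - t))) -
    (P x d1 - P r t - (p * (x - r) + k * (d1 - t))) by rewrite -hE; ring.
  by rewrite (le_trans (ler_normB _ _))// -mulrA mulr_natl mulr2n lerD.
have est2 := @mean_value_bound R (fun y => SQ b1 y - SQ a1 y - k * w * y)
  (fun y => Q b1 y - Q a1 y - k * w) c1 d1 (2 * e * (w + h)) (ltW cd1).
have {}est2 : `|(SQ b1 d1 - SQ a1 d1 - k * w * d1) - (SQ b1 c1 - SQ a1 c1 - k * w * c1)| <= 2 * e * (w + h) * (d1 - c1).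
  apply: est2 => y hy.
    have d1' := dSQ (A1 _ ain) (C1 _ hy); have d2' := dSQ (A1 _ bin) (C1 _ hy).
    by apply: is_derive_eq; rewrite /GRing.scale /= mulr1.
  have [_ n1] := near a1 y ain hy; have [_ n2] := near b1 y bin hy.
  have -> : Q b1 y - Q a1 y - k * w = (Q b1 y - Q r t - (k * (b1 - r) + q * (y - t))) -
    (Q a1 y - Q r t - (k * (a1 - r) + q * (y - t))) by rewrite -wE; ring.
  by rewrite (le_trans (ler_normB _ _))// -mulrA mulr_natl mulr2n lerD.
have : `|flux a1 b1 c1 d1| <= 2 * e * (w + h) * w + 2 * e * (w + h) * h.
  rewrite -{2}wE -{3}hE; apply: le_trans (lerD est1 est2); apply: le_trans (ler_normD _ _).
  apply: eqW; congr (`| _ |).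
  by rewrite /flux -wE -hE; ring.
apply/negP; rewrite -ltNge; apply: lt_le_trans hbad.
rewrite wE hE -mulrDr wh /e /w /h.
rewrite (_ : 2 * _ * _ * _ = e0 * (W / 2 ^+ n * (H / 2 ^+ n)) / 2); last first.
  by field; rewrite ?expf_neq0// gt_eqF.
by rewrite ltr_pdivrMr// ltr_pMr ?ltr1n// mulr_gt0// mulr_gt0.
Qed.

End green.

Local Notation nC z := (nrm (z : _[i]^o)).

Lemma derivable_expansion (K : numFieldType) (f : K^o -> K^o) (x : K^o) : derivable f x 1 ->
  forall e : K, 0 < e -> exists2 de : K, 0 < de & forall y, `|y - x| < de ->
    `|f y - f x - 'D_1 f x * (y - x)| <= e * `|y - x|.
Proof.
move=> df e e0.
have /cvgrPdist_le/(_ _ e0) := df; rewrite /= -/(derive f x 1).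
move=> [de /= de0 h]; exists de => // y yx.
have [->|yx0] := eqVneq y x; first by rewrite !subrr mulr0 subr0 normr0 mulr0.
have y0 : y - x != 0 by rewrite subr_eq0.
have := h (y - x); rewrite /ball_ /= sub0r normrN => /(_ yx y0).
rewrite /GRing.scale /= mulr1 subrK => h1.
have -> : f y - f x - 'D_1 f x * (y - x) =
    - (('D_1 f x - (y - x)^-1 * (f y - f x)) * (y - x)).
  by rewrite mulrBl mulrAC mulVf// mul1r opprB.
by rewrite normrN normrM ler_wpM2r.
Qed.

(** * First order expansions in two real variables *)

Section expansion.
Context (R : realType).
Implicit Types (F G : R -> R -> R[i]) (g : R[i]^o -> R[i]^o).

Lemma complex_expansion g (z : R[i]) : derivable g z 1 ->
  exists d : R[i], forall e, 0 < e -> exists2 de, 0 < de & forall w,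
    nC (w - z) < de -> nC (g w - g z - d * (w - z)) <= e * nC (w - z).
Proof.
move=> dg; exists ('D_1 g z) => e e0.
have eC : 0 < e%:C :> R[i] by rewrite ltcR.
have [de de0 h] := derivable_expansion dg eC.
have deE : de = (complex.Re de)%:C by move: de0; case: (de) => a b /andP[/= /eqP -> _].
exists (complex.Re de); first by rewrite -ltcR -deE.
move=> w wz; rewrite -lecR rmorphM /= -!nrmE; apply: h.
by rewrite nrmE deE ltcR.
Qed.

(** Real differentiability of F at (r, s), with partial derivatives p in the first and k in the
    second variable. *)
Definition expands F (r s : R) (p k : R[i]) := forall e : R, 0 < e ->
  exists2 de, 0 < de & forall x y, `|x - r| < de -> `|y - s| < de ->
    nC (F x y - F r s - (p * (x - r)%:C + k * (y - s)%:C)) <= e * (`|x - r| + `|y - s|).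

Lemma nrm_realC (x : R) : nC (x%:C) = `|x|.
Proof. by rewrite /nrm normc_def /= expr0n addr0 sqrtr_sqr. Qed.

Lemma expands_lip F r s p k : expands F r s p k -> exists2 L : R, 0 < L &
  exists2 de, 0 < de & forall x y, `|x - r| < de -> `|y - s| < de ->
    nC (F x y - F r s) <= L * (`|x - r| + `|y - s|).
Proof.
move=> /(_ 1 ltr01)[de de0 h]; exists (nC p + nC k + 1).
  by rewrite ltr_wpDl// addr_ge0// nrm_ge0.
exists de => // x y xr ys; have {}h := h x y xr ys.
rewrite -[F x y - F r s](subrK (p * (x - r)%:C + k * (y - s)%:C)).
apply: (le_trans (ler_nrmD _ _)); rewrite [leRHS]mulrDl addrC lerD//.
apply: (le_trans (ler_nrmD _ _)); rewrite !nrm_complexM !nrm_realC.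
have := nrm_ge0 (p : R[i]^o); have := nrm_ge0 (k : R[i]^o) => k0 p0.
by rewrite mulrDl !mulrDr lerD// ?lerDl ?lerDr mulr_ge0.
Qed.

Lemma expandsM F G r s p k p' k' : expands F r s p k -> expands G r s p' k' ->
  expands (fun x y => F x y * G x y) r s (p * G r s + F r s * p') (k * G r s + F r s * k').
Proof.
move=> hF hG e e0.
have [L L0 [d1 d10 hL]] := expands_lip hF.
have [L' L'0 [d2 d20 hL']] := expands_lip hG.
pose a := nC (G r s) + 1; pose b := nC (F r s) + 1.
have a0 : 0 < a by rewrite ltr_wpDl// nrm_ge0.
have b0 : 0 < b by rewrite ltr_wpDl// nrm_ge0.
have e3 : 0 < e / 3 by rewrite divr_gt0.
have [d3 d30 hF'] := hF (e / 3 / a) (divr_gt0 e3 a0).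
have [d4 d40 hG'] := hG (e / 3 / b) (divr_gt0 e3 b0).
have LL : 0 < L * L' by exact: mulr_gt0.
pose d5 := e / 6 / (L * L').
have d50 : 0 < d5 by rewrite !divr_gt0.
exists (Num.min (Num.min d1 d2) (Num.min (Num.min d3 d4) d5)).
  by rewrite !lt_min d10 d20 d30 d40 d50.
move=> x y; rewrite !lt_min => /andP[/andP[x1 x2] /andP[/andP[x3 x4] x5]].
move=> /andP[/andP[y1 y2] /andP[/andP[y3 y4] y5]].
set D := `|x - r| + `|y - s|.
have D0 : 0 <= D by rewrite addr_ge0.
set EF := F x y - F r s - (p * (x - r)%:C + k * (y - s)%:C).
set EG := G x y - G r s - (p' * (x - r)%:C + k' * (y - s)%:C).
have -> : F x y * G x y - F r s * G r s -
   ((p * G r s + F r s * p') * (x - r)%:C + (k * G r s + F r s * k') * (y - s)%:C) =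
   EF * G r s + F r s * EG + (F x y - F r s) * (G x y - G r s).
  by rewrite /EF /EG; ring.
apply: (le_trans (ler_nrmD _ _)).
have -> : e * D = e / 3 * D + e / 3 * D + e / 3 * D by field.
apply: lerD.
  apply: (le_trans (ler_nrmD _ _)); apply: lerD; rewrite nrm_complexM.
    apply: (@le_trans _ _ (e / 3 / a * D * a)).
      by apply: ler_pM; rewrite ?nrm_ge0//; [exact: hF'|rewrite lerDl].
    by rewrite -mulrA (mulrC D) mulrA divfK// gt_eqF.
  apply: (@le_trans _ _ (b * (e / 3 / b * D))).
    by apply: ler_pM; rewrite ?nrm_ge0//; [rewrite lerDl|exact: hG'].
  by rewrite mulrA (mulrC b) divfK// gt_eqF.
rewrite nrm_complexM; apply: (@le_trans _ _ ((L * D) * (L' * D))).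
  by apply: ler_pM; rewrite ?nrm_ge0//; [exact: hL|exact: hL'].
have -> : L * D * (L' * D) = (L * L' * D) * D by ring.
apply: ler_wpM2r => //; rewrite mulrC -ler_pdivlMr//.
have -> : e / 3 / (L * L') = d5 + d5 by rewrite /d5; field; rewrite !gt_eqF.
by rewrite /D lerD// ltW.
Qed.

Lemma expands_comp g F r s p k d : expands F r s p k ->
  (forall e, 0 < e -> exists2 de, 0 < de & forall w, nC (w - F r s) < de ->
    nC (g w - g (F r s) - d * (w - F r s)) <= e * nC (w - F r s)) ->
  expands (fun x y => g (F x y)) r s (d * p) (d * k).
Proof.
move=> hF hg e e0.
have [L L0 [d1 d10 hL]] := expands_lip hF.
pose b := nC d + 1; have b0 : 0 < b by rewrite ltr_wpDl// nrm_ge0.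
have e2 : 0 < e / 2 by rewrite divr_gt0.
have [d2 d20 hF'] := hF (e / 2 / b) (divr_gt0 e2 b0).
have [d3 d30 {}hg] := hg (e / 2 / L) (divr_gt0 e2 L0).
have d40 : 0 < d3 / L / 2 by rewrite !divr_gt0.
exists (Num.min (Num.min d1 d2) (d3 / L / 2)); first by rewrite !lt_min d10 d20 d40.
move=> x y; rewrite !lt_min => /andP[/andP[x1 x2] x4] /andP[/andP[y1 y2] y4].
have {}hF' := hF' x y x2 y2; have {}hL := hL x y x1 y1.
set D := `|x - r| + `|y - s| in hF' hL *.
have D0 : 0 <= D by rewrite addr_ge0.
have hd3 : nC (F x y - F r s) < d3.
  apply: le_lt_trans hL _; rewrite mulrC -ltr_pdivlMr// (splitr (d3 / L)) /D.
  by rewrite ltrD.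
have {hg}hd3 := hg _ hd3.
have -> : g (F x y) - g (F r s) - (d * p * (x - r)%:C + d * k * (y - s)%:C) =
   (g (F x y) - g (F r s) - d * (F x y - F r s)) +
   d * (F x y - F r s - (p * (x - r)%:C + k * (y - s)%:C)) by ring.
apply: (le_trans (ler_nrmD _ _)); rewrite nrm_complexM.
have -> : e * D = e / 2 * D + e / 2 * D by field.
apply: lerD.
  apply: le_trans hd3 _; apply: (@le_trans _ _ (e / 2 / L * (L * D))).
    by rewrite ler_pM2l// !divr_gt0.
  by rewrite mulrA divfK// gt_eqF.
apply: (@le_trans _ _ (b * (e / 2 / b * D))).
  by apply: ler_pM; rewrite ?nrm_ge0// lerDl.
by rewrite mulrA (mulrC b) divfK// gt_eqF.
Qed.

Lemma expands_fst (r s : R) : expands (fun x _ => x%:C) r s 1 0.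
Proof.
move=> e e0; exists 1 => // x y _ _.
rewrite mul1r mul0r addr0 -rmorphB subrr nrm0.
by apply: mulr_ge0; [exact: ltW|exact: addr_ge0].
Qed.

Lemma expands_cst (c : R[i]) (r s : R) : expands (fun _ _ => c) r s 0 0.
Proof.
move=> e e0; exists 1 => // x y _ _.
rewrite !mul0r addr0 subr0 subrr nrm0.
by apply: mulr_ge0; [exact: ltW|exact: addr_ge0].
Qed.

Lemma expands_polar1 (r s : R) : expands (fun _ y => polar 1 y) r s 0 ('i%C * polar 1 s).
Proof.
move=> e e0; have e2 : 0 < e / 2 by rewrite divr_gt0.
have dc : derivable (cos : R^o -> R^o) s 1 by exact: derivable_cos.
have ds : derivable (sin : R^o -> R^o) s 1 by exact: derivable_sin.
have [d1 d10 h1] := derivable_expansion dc e2.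
have [d2 d20 h2] := derivable_expansion ds e2.
exists (Num.min d1 d2); first by rewrite lt_min d10.
move=> x y _; rewrite lt_min => /andP[/h1 {}h1 /h2 {}h2].
have dcE : 'D_1 (cos : R^o -> R^o) s = - sin s by apply: derive_val.
have dsE : 'D_1 (sin : R^o -> R^o) s = cos s by apply: derive_val.
rewrite dcE in h1; rewrite dsE in h2; rewrite mul0r add0r.
apply: (@le_trans _ _ (e / 2 * `|y - s| + e / 2 * `|y - s|)).
  apply: le_trans (nrm_le_ReIm _) _; apply: lerD.
    apply: le_trans h1; apply: eqW; congr (`| _ |).
    by rewrite /polar /=; ring.
  apply: le_trans h2; apply: eqW; congr (`| _ |).
  by rewrite /polar /=; ring.
by rewrite -mulrDl -splitr ler_pM2l// lerDr.
Qed.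

Lemma polarM (r s : R) : polar r s = r%:C * polar 1 s.
Proof. by apply/eqP; rewrite eq_complex /= !mul1r !mul0r subr0 addr0 !eqxx. Qed.

Lemma nrm_polar (r s : R) : nC (polar r s) = `|r|.
Proof.
rewrite /nrm normc_def /= !exprMn -mulrDr cos2Dsin2 mulr1.
by rewrite sqrtr_sqr.
Qed.

End expansion.

Lemma antiderivative_exists (R : realType) (f : R -> R) (A B : R) : A < B ->
  (forall x, A <= x <= B -> {for x, continuous f}) ->
  exists F : R -> R, (forall x, A < x < B -> is_derive x 1 F (f x)) /\
    forall a b, A < a -> a < b -> b < B ->
      (\int[lebesgue_measure]_(x in `[a, b]) (f x)%:E = (F b - F a)%:E)%E.
Proof.
move=> AB cf.
pose F x := (\int[lebesgue_measure]_(t in [set` `[A, x]]) (f t))%R.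
have fi : lebesgue_measure.-integrable `[A, B] (EFin \o f).
  apply: continuous_compact_integrable; first exact: segment_compact.
  apply: continuous_in_subspaceT => x; rewrite inE /= in_itv /= => xAB.
  exact: cf.
have dF x : A < x < B -> is_derive x 1 F (f x).
  move=> /andP[Ax xB]; have cfx : {for x, continuous f} by apply: cf; rewrite !ltW.
  have [d1 d2] := @continuous_FTC1_closed R f A x B xB fi Ax cfx.
  by apply: (DeriveDef d1); have := d2; rewrite derive1E.
exists F; split=> // a b Aa ab bB.
have inAB x : a <= x <= b -> A < x < B.
  by move=> /andP[ax xb]; rewrite (lt_le_trans Aa ax) (le_lt_trans xb bB).
have dFx x : a <= x <= b -> derivable F x 1 by move=> /inAB/dF[].
have cF x : a <= x <= b -> {for x, continuous F}.
  by move=> /dFx /derivable1_diffP/differentiable_continuous.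
rewrite (@continuous_FTC2 _ f F)// ?EFinB//.
- apply: continuous_in_subspaceT => x; rewrite inE /= in_itv /= => xab.
  by apply: cf; have /andP[? ?] := inAB _ xab; rewrite !ltW.
- split.
  + by move=> x; rewrite in_itv /= => /andP[? ?]; apply: dFx; rewrite !ltW.
  + by apply: cvg_at_right_filter; apply: cF; rewrite lexx ltW.
  + by apply: cvg_at_left_filter; apply: cF; rewrite lexx ltW.
- move=> x; rewrite in_itv /= => /andP[? ?].
  have xab : a <= x <= b by rewrite !ltW.
  have [_ e] := dF _ (inAB _ xab).
  by rewrite derive1E.
Qed.

(** * Rotating a ray of integration *)

Section rays.
Context (R : realType).
Variables (th : R) (g : R[i]^o -> R[i]^o) (M : R -> R).
Hypothesis dg : forall r s, 0 < r -> s != 0 -> `|s| < th -> derivable g (polar r s) 1.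
Hypothesis gM : forall r s, 0 < r -> `|s| < th -> nC (g (polar r s)) <= M r.
Local Notation mu := (@lebesgue_measure R).

(** In polar coordinates g(z) dz is [ray_fun] dr + [arc_fun] ds. *)
Definition ray_fun (r s : R) : R[i]^o := polar 1 s * g (polar r s).
Definition arc_fun (r s : R) : R[i]^o := 'i%C * r%:C * ray_fun r s.

Lemma nrm_ray_fun r s : 0 < r -> `|s| < th -> nC (ray_fun r s) <= M r.
Proof.
by move=> r0 sth; rewrite nrm_complexM nrm_polar normr1 mul1r gM.
Qed.

Lemma nrm_i : nC ('i%C : R[i]) = 1.
Proof. by rewrite /nrm normc_def /= expr0n expr1n add0r sqrtr1. Qed.

Lemma nrm_arc_fun r s : 0 < r -> `|s| < th -> nC (arc_fun r s) <= r * M r.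
Proof.
move=> r0 sth; rewrite /arc_fun nrm_complexM nrm_complexM nrm_i mul1r nrm_realC (gtr0_norm r0).
by rewrite ler_pM2l// nrm_ray_fun.
Qed.

Lemma expands_eq F r s (p k p' : R[i]) : expands F r s p k -> p = p' -> expands F r s p' k.
Proof. by move=> h <-. Qed.

(** The shared coefficient k is the Cauchy-Riemann equation in polar coordinates: it expresses that
    g(z) dz is closed, which is the hypothesis [curl_free] of Green's theorem. *)
Lemma ray_expands r s : derivable g (polar r s) 1 ->
  exists p k q, expands ray_fun r s p k /\ expands arc_fun r s k q.
Proof.
move=> dgrs; have hz := expandsM (expands_fst r s) (expands_polar1 r s).
have [d hd] := complex_expansion dgrs.
rewrite polarM in hd.
have hg := expands_comp hz hd.
have hP := expandsM (expands_polar1 r s) hg.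
have hi := expandsM (expands_cst 'i%C r s) (expands_fst r s).
have PE : ray_fun = (fun x y => polar 1 y * g (x%:C * polar 1 y)).
  by apply/funext => x; apply/funext => y; rewrite /ray_fun (polarM x y).
rewrite -PE in hP; have hQ := expandsM hi hP; rewrite /= in hP hQ.
eexists; eexists; eexists; split; first exact: hP.
apply: (expands_eq hQ).
by rewrite /ray_fun (polarM r s); ring.
Qed.

Section component.
Variable c : R[i] -> R.
Hypothesis cB : forall u v, c (u - v) = c u - c v.
Hypothesis cZ : forall u (x : R), c (u * x%:C) = c u * x.
Hypothesis cle : forall u, `|c u| <= nC u.
Hypothesis cint : forall (G : R -> R[i]^o) (J : R[i]^o), has_bochner mu G J ->
  (\int[mu]_x (c (G x))%:E = (c J)%:E)%E.

Let c0 : c 0 = 0.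
Proof. by rewrite -(subrr 0) cB subrr. Qed.

Let cD u v : c (u + v) = c u + c v.
Proof.
have := cB u (- v); rewrite opprK => ->.
by have := cB 0 v; rewrite sub0r c0 sub0r => ->; rewrite opprK.
Qed.

Let expands_continuous F r s p k : expands F r s p k ->
  {for r, continuous (fun x => c (F x s))} /\ {for s, continuous (fun y => c (F r y))}.
Proof.
move=> /expands_lip[L L0 [de de0 hL]].
split; apply/cvgrPdist_le => e e0.
  have m0 : 0 < Num.min de (e / L) by rewrite lt_min de0 divr_gt0.
  exists (Num.min de (e / L)) => //= x; rewrite /ball_ /= lt_min => /andP[h1 h2].
  rewrite -cB (le_trans (cle _))// nrmBC (le_trans (hL _ _ _ _)) ?subrr ?normr0// 1?distrC//.
  by rewrite addr0 mulrC -ler_pdivlMr// ltW.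
have m0 : 0 < Num.min de (e / L) by rewrite lt_min de0 divr_gt0.
exists (Num.min de (e / L)) => //= x; rewrite /ball_ /= lt_min => /andP[h1 h2].
rewrite -cB (le_trans (cle _))// nrmBC (le_trans (hL _ _ _ _)) ?subrr ?normr0// 1?distrC//.
by rewrite add0r mulrC -ler_pdivlMr// ltW.
Qed.

(** [c] stands for the real or the imaginary part. By Green's theorem on [a, b] x [s1, s2] the two
    ray integrals differ by the two arc integrals, and an arc of radius r contributes at most r M(r)
    (s2 - s1). *)
Lemma ray_component a b s1 s2 : 0 < a -> a < b -> s1 < s2 ->
  (0 < s1 /\ s2 < th) \/ (- th < s1 /\ s2 < 0) -> forall J1 J2 : R[i]^o,
  has_bochner mu (fun r => \1_`[a, b] r *: ray_fun r s1) J1 ->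
  has_bochner mu (fun r => \1_`[a, b] r *: ray_fun r s2) J2 ->
  `|c J1 - c J2| <= (a * M a + b * M b) * (s2 - s1).
Proof.
move=> a0 ab s12 hs J1 J2 /cint h1 /cint h2.
(* A margin around [s1, s2] that still avoids the angle 0, where differentiability may fail, and the
   angles beyond [th]. *)
have [C [D [Cs1 s2D hCD]]] : exists C D, [/\ C < s1, s2 < D &
    forall s, C <= s <= D -> s != 0 /\ `|s| < th].
  case: hs => -[h h'].
    exists (s1 / 2), ((s2 + th) / 2); split; [lra|lra|] => s /andP[? ?].
    by split; [rewrite gt_eqF//; lra|rewrite ltr_norml; lra].
  exists ((s1 - th) / 2), (s2 / 2); split; [lra|lra|] => s /andP[? ?].
  by split; [rewrite lt_eqF//; lra|rewrite ltr_norml; lra].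
have CD : C < D by lra.
have hexp r s : a / 2 <= r <= b + 1 -> C <= s <= D ->
    exists p k q, expands ray_fun r s p k /\ expands arc_fun r s k q.
  move=> /andP[h _] /hCD[s0 sth]; apply: ray_expands; apply: dg => //.
  by rewrite (lt_le_trans _ h)// divr_gt0.
have AB : a / 2 < b + 1 by lra.
have hSP s : exists F : R -> R, C <= s <= D ->
    (forall x, a / 2 < x < b + 1 -> is_derive x 1 F (c (ray_fun x s))) /\
    forall u v, a / 2 < u -> u < v -> v < b + 1 ->
      (\int[mu]_(x in `[u, v]) (c (ray_fun x s))%:E = (F v - F u)%:E)%E.
  have [sCD|nsCD] := boolP (C <= s <= D); last by exists (fun=> 0).
  have [F hF] := @antiderivative_exists R (fun r => c (ray_fun r s)) _ _ AB
     (fun r hr => let: ex_intro _ (ex_intro _ (ex_intro _ (conj h _))) := hexp r s hr sCD in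
      (expands_continuous h).1).
  by exists F.
have hSQ r : exists F : R -> R, a / 2 <= r <= b + 1 ->
    (forall y, C < y < D -> is_derive y 1 F (c (arc_fun r y))).
  have [rab|nrab] := boolP (a / 2 <= r <= b + 1); last by exists (fun=> 0).
  have [F [hF _]] := @antiderivative_exists R (fun y => c (arc_fun r y)) _ _ CD
     (fun s hs => let: ex_intro _ (ex_intro _ (ex_intro _ (conj _ h))) := hexp r s rab hs in
      (expands_continuous h).2).
  by exists F.
have [SP {}hSP] := choice hSP; have [SQ {}hSQ] := choice hSQ.
have sub (x y z : R) : x < z < y -> x <= z <= y by move=> /andP[? ?]; rewrite !ltW.
have fl := @green_rectangle R (fun r s => c (ray_fun r s)) (fun r s => c (arc_fun r s))
  (fun r s => SP s r) SQ (a / 2) (b + 1) C D.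
have {}fl : flux (fun r s => SP s r) SQ a b s1 s2 = 0.
  apply: fl => //; [| | |lra|lra].
  - by move=> r s hr hs'; have [h _] := hSP s (sub _ _ _ hs'); exact: h.
  - by move=> r s hr hs'; exact: (hSQ r (sub _ _ _ hr)).
  move=> r s hr hs'; have [p [k [q [e1 e2]]]] := hexp r s (sub _ _ _ hr) (sub _ _ _ hs').
  exists (c p), (c q), (c k) => e e0.
  have [d1 d10 {}e1] := e1 e e0; have [d2 d20 {}e2] := e2 e e0.
  exists (Num.min d1 d2); first by rewrite lt_min d10.
  move=> x y; rewrite !lt_min => /andP[x1 x2] /andP[y1 y2]; split.
    by apply: le_trans (e1 x y x1 y1); apply: le_trans (cle _); rewrite !cB cD !cZ.
  by apply: le_trans (e2 x y x2 y2); apply: le_trans (cle _); rewrite !cB cD !cZ.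
have J_SP s J : C <= s <= D -> (\int[mu]_x (c (\1_`[a, b] x *: ray_fun x s))%:E = (c J)%:E)%E ->
    c J = SP s b - SP s a.
  move=> hs' hJ; have [_ h] := hSP s hs'.
  have aa : a / 2 < a by lra.
  have bb : b < b + 1 by lra.
  apply: EFin_inj; rewrite -(h a b aa ab bb) -hJ [RHS]integral_mkcond.
  apply: eq_integral => x _; rewrite patchE indicE.
  by case: (x \in _); rewrite ?scale1r// scale0r c0.
have hs1 : C <= s1 <= D by lra.
have hs2 : C <= s2 <= D by lra.
rewrite (J_SP _ _ hs1 h1) (J_SP _ _ hs2 h2).
move: fl; rewrite /flux => fl.
have bnd r : a / 2 <= r <= b + 1 -> `|SQ r s2 - SQ r s1| <= r * M r * (s2 - s1).
  move=> hr; have r0 : 0 < r by move: hr => /andP[h _]; rewrite (lt_le_trans _ h)// divr_gt0.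
  apply: (@mean_value_bound R _ (fun y => c (arc_fun r y))); first exact: ltW.
    by move=> y hy; apply: hSQ => //; lra.
  move=> y hy; rewrite (le_trans (cle _))// nrm_arc_fun//.
  by have [|_ //] := hCD y; lra.
have -> : SP s1 b - SP s1 a - (SP s2 b - SP s2 a) =
   (SQ a s2 - SQ a s1) - (SQ b s2 - SQ b s1) by lra.
apply: (le_trans (ler_normB _ _)); rewrite mulrDl lerD//; apply: bnd; lra.
Qed.

End component.

Lemma ray_truncated a b s1 s2 : 0 < a -> a < b -> s1 < s2 ->
  (0 < s1 /\ s2 < th) \/ (- th < s1 /\ s2 < 0) -> forall J1 J2 : R[i]^o,
  has_bochner mu (fun r => \1_`[a, b] r *: ray_fun r s1) J1 ->
  has_bochner mu (fun r => \1_`[a, b] r *: ray_fun r s2) J2 ->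
  nC (J1 - J2) <= 2 * ((a * M a + b * M b) * (s2 - s1)).
Proof.
move=> a0 ab s12 hs J1 J2 h1 h2.
rewrite mulr_natl mulr2n (le_trans (nrm_le_ReIm _))// lerD//.
  rewrite (_ : complex.Re (J1 - J2) = complex.Re J1 - complex.Re J2); last by case: (J1) (J2) => ? ? [].
  apply: (@ray_component (@complex.Re R)) h1 h2 => //.
  - by move=> [? ?] [? ?].
  - by move=> [u v] x /=; rewrite mulr0 subr0.
  - by move=> u; exact: Re_le_nrm.
  - by move=> G J /bochner_Re[].
rewrite (_ : complex.Im (J1 - J2) = complex.Im J1 - complex.Im J2); last by case: (J1) (J2) => ? ? [].
apply: (@ray_component (@complex.Im R)) h1 h2 => //.
- by move=> [? ?] [? ?].
- by move=> [u v] x /=; rewrite mulr0 add0r.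
- by move=> u; exact: Im_le_nrm.
- by move=> G J /bochner_Im[].
Qed.

End rays.

(** * Integrals over the half-line *)

Section half_line.
Context (R : realType).
Local Notation mu := (@lebesgue_measure R).
Local Notation hl := (`]0, +oo[%classic : set R).

(** The shift by 2 keeps the interval nondegenerate from n = 0 on. *)
Definition half_trunc (n : nat) : set R := `[n.+2%:R^-1, n.+2%:R].

Lemma half_trunc_lt n : (n.+2%:R^-1 : R) < n.+2%:R.
Proof.
by apply: (@lt_le_trans _ _ 1); [rewrite invf_lt1 ?ltr1n|rewrite ler1n].
Qed.

Lemma half_trunc_sub n : half_trunc n `<=` hl.
Proof.
move=> x; rewrite /half_trunc /= !in_itv /= andbT => /andP[h _].
by rewrite (lt_le_trans _ h).
Qed.

Lemma half_trunc_near x : hl x -> \forall n \near \oo, half_trunc n x.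
Proof.
rewrite /= in_itv /= andbT => x0.
exists (Num.truncn (x + x^-1)).+1 => // n /= hn.
have h : x + x^-1 < n.+2%:R.
  by rewrite (lt_le_trans (truncnS_gt _))// ler_nat; move: hn; case: (Num.truncn _) => [|m]; lia.
have xV : 0 < x^-1 by rewrite invr_gt0.
rewrite /half_trunc /= in_itv /=; apply/andP; split.
  by rewrite -[leRHS]invrK lef_pV2 ?posrE//; lra.
by lra.
Qed.

Lemma half_trunc_nondecreasing : nondecreasing_seq half_trunc.
Proof.
move=> n m nm; apply/subsetPset => x; rewrite /half_trunc /= !in_itv /= => /andP[h1 h2].
apply/andP; split.
  by rewrite (le_trans _ h1)// lef_pV2 ?posrE// ler_nat.
by rewrite (le_trans h2)// ler_nat.
Qed.

Lemma bigcup_half_trunc : \bigcup_n half_trunc n = hl.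
Proof.
apply/seteqP; split=> [x [n _ /half_trunc_sub]//|x /half_trunc_near[n _ h]].
by exists n => //; apply: h => /=.
Qed.

Lemma half_line_integral_le (F h : R -> R) (K : R) :
  (forall r : R, 0 < r -> is_derive r 1 F (h r)) -> (forall r : R, 0 < r -> 0 <= h r) ->
  (forall r : R, 0 < r -> {for r, continuous h}) -> (forall r : R, 0 < r -> `|F r| <= K) ->
  (\int[mu]_(x in hl) (h x)%:E <= (2 * K)%:E)%E.
Proof.
move=> dF h0 ch FK; rewrite -bigcup_half_trunc.
have sub n x : half_trunc n x -> 0 < x.
  by move=> /half_trunc_sub; rewrite /= in_itv /= andbT.
have mh n : measurable_fun (half_trunc n) h.
  apply: subspace_continuous_measurable_fun; first exact: measurable_itv.
  apply: continuous_in_subspaceT => x; rewrite inE => /sub x0; exact: ch.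
have mono : (\int[mu]_(x in half_trunc n) (h x)%:E)%E @[n --> \oo] -->
    (\int[mu]_(x in \bigcup_n half_trunc n) (h x)%:E)%E.
  apply: (@ge0_nondecreasing_set_cvg_integral _ (measurableTypeR R) R half_trunc (EFin \o h) mu).
  - exact: half_trunc_nondecreasing.
  - by move=> n; exact: measurable_itv.
  - by move=> n; apply/measurable_EFinP; exact: mh.
  - by move=> n x /sub x0; rewrite lee_fin h0.
apply: (cvge_to_le mono); apply: nearW => n.
have n0 : 0 < n.+2%:R^-1 :> R by [].
have pos x : n.+2%:R^-1 <= x -> 0 < x by apply: lt_le_trans.
have cF x : n.+2%:R^-1 <= x -> {for x, continuous F}.
  move=> /pos x0; have [dx _] := dF x x0.
  by move/derivable1_diffP: dx => /differentiable_continuous.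
rewrite (@continuous_FTC2 _ h F)//.
- rewrite lee_fin; have := FK _ n0; have := FK n.+2%:R (ltr0Sn _ _).
  by rewrite !ler_norml => /andP[? ?] /andP[? ?]; lra.
- exact: half_trunc_lt.
- apply: continuous_in_subspaceT => x; rewrite inE => /sub x0; exact: ch.
- split.
  + by move=> x; rewrite in_itv /= => /andP[/ltW/pos x0 _]; have [] := dF x x0.
  + by apply: cvg_at_right_filter; exact: cF.
  + by apply: cvg_at_left_filter; apply: cF; exact/ltW/half_trunc_lt.
- move=> x; rewrite in_itv /= => /andP[/ltW/pos x0 _].
  by have [_ e] := dF _ x0; rewrite derive1E.
Qed.

(** The derivative of - 1 / (s (1 + r^s)), hence integrable with a bounded primitive; r times it is
    comparable to the smaller of r^s and r^-s, the decay of [Hinfty0]. *)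
Definition majorant (s r : R) : R := r `^ (s - 1) / (1 + r `^ s) ^+ 2.

Lemma majorant_gt0 s r : 0 < r -> 0 < majorant s r.
Proof.
by move=> r0; rewrite divr_gt0 ?powR_gt0// exprn_gt0// ltr_wpDr ?powR_ge0.
Qed.

Lemma mul_majorant s r : 0 < r -> r * majorant s r = r `^ s / (1 + r `^ s) ^+ 2.
Proof.
move=> r0; rewrite /majorant mulrA -{1}(powRr1 (ltW r0)) -powRD.
  by rewrite addrC subrK.
by rewrite (gt_eqF r0) implybT.
Qed.

Lemma majorant_continuous s r : 0 < r -> {for r, continuous (majorant s)}.
Proof.
move=> r0; have h1 : {for r, continuous (fun x => x `^ (s - 1))}.
  have [d _] := is_derive1_powR (s - 1) r0.
  by move/derivable1_diffP: d => /differentiable_continuous.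
have h2 : {for r, continuous (fun x => x `^ s)}.
  have [d _] := is_derive1_powR s r0.
  by move/derivable1_diffP: d => /differentiable_continuous.
apply: cvgM => //; apply: cvgV.
  by rewrite gt_eqF// exprn_gt0// ltr_wpDr ?powR_ge0.
rewrite expr2; under eq_fun do rewrite expr2.
by apply: cvgM; apply: cvgD => //; exact: cvg_cst.
Qed.

Lemma majorant_integral s : 0 < s ->
  (\int[mu]_(x in hl) (majorant s x)%:E < +oo)%E.
Proof.
move=> s0; pose F r := - ((1 + r `^ s)^-1 / s).
apply: (@le_lt_trans _ _ (2 * s^-1)%:E); last by rewrite ltry.
apply: (@half_line_integral_le F).
- move=> r r0; have p0 : 1 + r `^ s != 0 by rewrite gt_eqF// ltr_wpDr ?powR_ge0.
  have d1 := is_derive1_powR s r0.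
  have d1D (u : R -> R) du : is_derive r 1 u du -> is_derive r 1 (fun x => 1 + u x) du.
    by move=> hu; have := is_deriveD (is_derive_cst (1 : R^o) (r : R^o) (1 : R^o)) hu; rewrite add0r.
  have d2 := d1D _ _ d1.
  have d3 := @is_deriveV _ (fun x => 1 + x `^ s) _ _ _ p0 d2.
  have d4 : is_derive r 1 (fun x => (- s^-1) *: (1 + x `^ s)^-1) ((- s^-1) *: (- (1 + r `^ s) ^- 2 *: (s * r `^ (s - 1)))).
    exact: is_deriveZ.
  have e : F = (fun x => (- s^-1) *: (1 + x `^ s)^-1).
    by apply/funext => x; rewrite /F /GRing.scale /= mulNr mulrC.
  rewrite e; apply: (is_derive_eq d4).
  by rewrite /GRing.scale /= /majorant; field; rewrite p0 gt_eqF.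
- by move=> r /(majorant_gt0 s)/ltW.
- by move=> r /majorant_continuous; apply.
- move=> r r0; rewrite normrN normrM !normfV (gtr0_norm s0).
  have p0 : 1 <= 1 + r `^ s by rewrite lerDl powR_ge0.
  rewrite ger0_norm ?(le_trans ler01)// ler_piMl ?invr_ge0 ?(ltW s0)//.
  by rewrite invf_le1// (lt_le_trans ltr01).
Qed.

Lemma majorant_integralZ (C s : R) : 0 <= C -> 0 < s ->
  (\int[mu]_(x in hl) (C%:E * (majorant s x)%:E) < +oo)%E.
Proof.
move=> C0 s0; rewrite ge0_integralZl//.
- by rewrite lte_mul_pinfty// majorant_integral.
- apply/measurable_EFinP.
  apply: open_continuous_measurable_fun; first exact: interval_open.
  by move=> x; rewrite inE /= in_itv /= andbT; exact: majorant_continuous.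
- by move=> x; rewrite /= in_itv /= andbT lee_fin => /(majorant_gt0 s)/ltW.
Qed.

Lemma min_powR_le s r : 0 < s -> 0 < r ->
  Num.min (r `^ s) (r `^ (- s)) <= 4 * (r * majorant s r).
Proof.
move=> s0 r0; rewrite (mul_majorant s r0) powRN.
set u := r `^ s; have u0 : 0 < u by rewrite powR_gt0.
have p0 : 0 < (1 + u) ^+ 2 by rewrite exprn_gt0// addr_gt0.
rewrite ge_min mulrA !ler_pdivlMr//; case: (leP u 1) => u1.
  by apply/orP; left; nra.
by apply/orP; right; rewrite mulrC ler_pdivrMr//; nra.
Qed.

End half_line.

Section half_line_bochner.
Context (R : realType) (X : normedModType R[i]).
Hypothesis cX : seq_complete X.
Local Notation mu := (@lebesgue_measure R).
Local Notation hl := (`]0, +oo[%classic : set R).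

Lemma nrm_indic (T : Type) (A : set T) (x : T) (v : X) :
  nrm (\1_A x *: v) = \1_A x * nrm v.
Proof.
by rewrite !indicE; case: (_ \in _); rewrite /= ?scale1r ?scale0r ?mul1r ?mul0r ?nrm0.
Qed.

Lemma half_line_bochner (G : R -> X) (C s : R) : 0 <= C -> 0 < s ->
  (forall r : R, 0 < r -> G y @[y --> r] --> G r) ->
  (forall r : R, 0 < r -> nrm (G r) <= C * majorant s r) ->
  exists J, has_bochner mu (fun r => \1_hl r *: G r) J.
Proof.
move=> C0 s0 cG GM.
have sm : smeas mu (fun r => \1_hl r *: G r).
  apply: smeas_continuous; first exact: interval_open.
  by move=> x; rewrite /= in_itv /= andbT; exact: cG.
apply: bochner_exists => //.
apply: (@le_lt_trans _ _ (\int[mu]_(x in hl) (C%:E * (majorant s x)%:E))%E).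
  rewrite [leRHS]integral_mkcond; apply: ge0_le_integral => //.
  - by move=> x _; rewrite lee_fin nrm_ge0.
  - exact: measurable_enrm sm.
  - apply/(measurable_restrictT _ (measurable_itv _)); apply/measurable_EFinP.
    apply: measurable_funM => //; apply: open_continuous_measurable_fun; first exact: interval_open.
    move=> x; rewrite inE /= in_itv /= andbT; exact: majorant_continuous.
  move=> x _; rewrite patchE nrm_indic indicE; case: ifPn => xh; last by rewrite mul0r.
  rewrite mul1r lee_fin; apply: GM.
  by move: xh; rewrite inE /= in_itv /= andbT.
exact: majorant_integralZ.
Qed.

Lemma half_line_truncation (G : R -> X) (J : X) :
  has_bochner mu (fun r => \1_hl r *: G r) J ->
  exists Jn : nat -> X,
    (forall n, has_bochner mu (fun r => \1_(half_trunc n) r *: G r) (Jn n)) /\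
    Jn @ \oo --> J.
Proof.
move=> hJ; have [sm _] := hJ.
have mt n : measurable (half_trunc n : set (measurableTypeR R)) by exact: measurable_itv.
have trE n x : \1_(half_trunc n) x *: (\1_hl x *: G x) = \1_(half_trunc n) x *: G x.
  rewrite !indicE; case: (boolP (x \in half_trunc n)) => hx; last by rewrite !scale0r.
  rewrite (_ : x \in hl) ?scale1r//; apply/mem_set.
  by move/set_mem : hx => /half_trunc_sub.
have smt n : smeas mu (fun x => \1_(half_trunc n) x *: G x).
  by have := smeas_restrict (mt n) sm; under eq_fun do rewrite trE.
have le n x : nrm (\1_(half_trunc n) x *: G x) <= nrm (\1_hl x *: G x).
  rewrite -trE nrm_indic indicE; case: (_ \in _); rewrite ?mul1r// mul0r; exact: nrm_ge0.
have ex n : exists J, has_bochner mu (fun r => \1_(half_trunc n) r *: G r) J.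
  apply: bochner_exists => //.
  apply: le_lt_trans (bochner_lty hJ); apply: ge0_le_integral => //.
  - by move=> x _; rewrite lee_fin nrm_ge0.
  - exact: measurable_enrm (smt n).
  - exact: measurable_enrm sm.
  - by move=> x _; rewrite lee_fin.
have [Jn hJn] := choice ex; exists Jn; split=> //; apply/cvg_nrmP.
have I0 : (\int[mu]_x (nrm (\1_(half_trunc n) x *: G x - \1_hl x *: G x))%:E)%E @[n --> \oo] --> 0%E.
  apply: (@dominated_cvg0 _ _ _ mu _ (fun x => nrm (\1_hl x *: G x))).
  - by move=> n; apply: strongly_measurable_nrm; exact: smeasB.
  - exact: strongly_measurable_nrm sm.
  - move=> n x; rewrite nrm_ge0 /= -trE indicE; case: (_ \in _).
      by rewrite scale1r subrr nrm0 nrm_ge0.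
    by rewrite scale0r sub0r nrmN.
  - exact: bochner_lty hJ.
  move=> x; apply: cvg_near_cst.
  have [xh|xh] := pselect (hl x); last first.
    apply: nearW => n; rewrite -trE [\1_hl x]indicE memNset// scale0r scaler0 subrr.
    exact: nrm0.
  have := half_trunc_near xh; apply: filterS => n hn.
  by rewrite !indicE !mem_set// subrr nrm0.
have /fine_cvgP[fin] := I0; apply: cvg0_le.
apply: filterS fin => n fin; rewrite nrm_ge0 /=.
by rewrite -lee_fin fineK//; exact: nrm_bochner (bochnerB (hJn n) hJ).
Qed.

End half_line_bochner.

Lemma cvg_powR_inv (R : realType) (s : R) : 0 < s ->
  (fun n : nat => n.+2%:R^-1 `^ s : R) @ \oo --> (0 : R).
Proof.
move=> s0; apply/cvgrPdist_lt => e e0.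
have e1 : 0 < e `^ s^-1 by exact: powR_gt0.
exists (Num.truncn (e `^ s^-1)^-1).+1 => // n /= hn.
rewrite sub0r normrN ger0_norm ?powR_ge0//.
have -> : e = (e `^ s^-1) `^ s by rewrite -powRrM mulVf ?gt_eqF// powRr1// ltW.
apply: gt0_ltr_powR => //; rewrite ?nnegrE ?invr_ge0// ?(ltW e1)//.
rewrite -[ltRHS]invrK ltf_pV2 ?posrE ?invr_gt0//.
rewrite (lt_le_trans (truncnS_gt _))// ler_nat.
by move: hn; case: (Num.truncn _) => [|m]; lia.
Qed.

Lemma cvg_mul_dist (R : realType) (L r : R) : 0 < L ->
  (fun x => L * `|x - r|) @ r --> (0 : R).
Proof.
move=> L0; apply/cvgrPdist_lt => e e0; exists (e / L) => /=; first exact: divr_gt0.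
move=> x; rewrite /ball_ /= distrC => h.
rewrite sub0r normrN ger0_norm ?(mulr_ge0 (ltW L0) (normr_ge0 _))//.
by rewrite mulrC -ltr_pdivlMr.
Qed.

Section rays.
Context (R : realType).
Variables (th : R) (g : R[i]^o -> R[i]^o) (C s l : R).
Hypothesis C0 : 0 <= C.
Hypothesis s0 : 0 < s.
Hypothesis dg : forall r phi, 0 < r -> phi != 0 -> `|phi| < th -> derivable g (polar r phi) 1.
Hypothesis dg0 : forall r, 0 < r -> r != l -> derivable g (polar r 0) 1.
Hypothesis gM : forall r phi, 0 < r -> `|phi| < th -> nC (g (polar r phi)) <= C * majorant s r.
Local Notation mu := (@lebesgue_measure R).
Local Notation hl := (`]0, +oo[%classic : set R).

Lemma ray_bochner phi : phi != 0 -> `|phi| < th ->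
  exists J : R[i]^o, has_bochner mu (fun r => \1_hl r *: ray_fun g r phi) J.
Proof.
move=> p0 pth; apply: (@half_line_bochner R R[i]^o (@seq_complete_complex R) _ C s) => //.
  move=> r r0; have [p [k [q [/expands_lip[L L0 [de de0 h]] _]]]] := ray_expands (dg r0 p0 pth).
  apply/cvg_nrmP; apply: (@cvg0_le _ _ _ _ _ (fun x => L * `|x - r|)); last first.
    exact: cvg_mul_dist.
  exists de => //= x; rewrite /ball_ /= distrC => xr; rewrite nrm_ge0 /=.
  by have := h x phi xr; rewrite subrr normr0 addr0; apply.
by move=> r r0; apply: (nrm_ray_fun (th := th) (M := fun r => C * majorant s r)) => // *; exact: gM.
Qed.

(** Between rays on the same side of the axis, the arcs of radii 1 / (n + 2) and n + 2 contribute a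
    multiple of r [majorant] at both ends, which tends to 0. *)
Lemma ray_independent s1 s2 (J1 J2 : R[i]^o) : s1 < s2 ->
  (0 < s1 /\ s2 < th) \/ (- th < s1 /\ s2 < 0) ->
  has_bochner mu (fun r => \1_hl r *: ray_fun g r s1) J1 ->
  has_bochner mu (fun r => \1_hl r *: ray_fun g r s2) J2 -> J1 = J2.
Proof.
move=> s12 hs h1 h2.
have [j1 [hj1 cj1]] := half_line_truncation (@seq_complete_complex R) h1.
have [j2 [hj2 cj2]] := half_line_truncation (@seq_complete_complex R) h2.
have c12 : (fun n => j1 n - j2 n) @ \oo --> J1 - J2 by exact: (cvgB cj1 cj2).
have c0 : (fun n => j1 n - j2 n) @ \oo --> (0 : R[i]^o).
  apply/cvg_nrmP; pose K := 2 * (2 * C * (s2 - s1)).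
  apply: (@cvg0_le _ _ _ _ _ (fun n => K * n.+2%:R^-1 `^ s)); last first.
    rewrite -[X in _ --> X](mulr0 K); apply: cvgM; first exact: cvg_cst.
    exact: cvg_powR_inv.
  apply: nearW => n; rewrite subr0 nrm_ge0 /=.
  have t0 : 0 < n.+2%:R^-1 :> R by [].
  apply: le_trans (@ray_truncated R th g (fun r => C * majorant s r) dg gM _ _ _ _ t0
    (half_trunc_lt R n) s12 hs _ _ (hj1 n) (hj2 n)) _.
  set w := n.+2%:R^-1 `^ s.
  have w0 : 0 < w by exact: powR_gt0.
  have wV : n.+2%:R `^ s = w^-1.
    by rewrite /w -(powR_inv1 (ler0n R n.+2)) -powRrM mulN1r powRN invrK.
  rewrite !(mulrCA _ C) !mul_majorant// -/w wV.
  have b1 : w / (1 + w) ^+ 2 <= w.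
    by rewrite ler_pdivrMr ?exprn_gt0 ?addr_gt0//; nra.
  have b2 : w^-1 / (1 + w^-1) ^+ 2 <= w.
    have wp : 0 < w^-1 by rewrite invr_gt0.
    rewrite ler_pdivrMr ?exprn_gt0 ?addr_gt0//.
    have ww : w * w^-1 = 1 by rewrite divff ?gt_eqF.
    have -> : w * (1 + w^-1) ^+ 2 = w + 2 * (w * w^-1) + (w * w^-1) * w^-1 by ring.
    by rewrite ww; nra.
  have sp : 0 < s2 - s1 by rewrite subr_gt0.
  have -> : K * w = 2 * ((C * w + C * w) * (s2 - s1)) by rewrite /K; ring.
  rewrite ler_pM2l// ler_pM2r// -!mulrDr.
  by apply: ler_wpM2l => //; exact: lerD.
by apply/eqP; rewrite -subr_eq0; apply/eqP; exact: cvg_nrm_unique c12 c0.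
Qed.

(** By [ray_independent] both rays can be turned to the angles nu / (n + 2) and - nu / (n + 2)
    without changing the integrals. There the two integrands approach each other at each r other
    than l, under a common integrable bound. *)
Lemma ray_jump nu (Jp Jm : R[i]^o) : 0 < nu < th ->
  has_bochner mu (fun r => \1_hl r *: ray_fun g r nu) Jp ->
  has_bochner mu (fun r => \1_hl r *: ray_fun g r (- nu)) Jm -> Jm = Jp.
Proof.
move=> /andP[nu0 nuth] hp hm.
pose ph (n : nat) : R := nu / n.+2%:R.
have ph0 n : 0 < ph n by exact: divr_gt0.
have phnu n : ph n < nu by rewrite ltr_pdivrMr// ltr_pMr// ltr1n.
have phth n : `|ph n| < th by rewrite gtr0_norm// (lt_trans (phnu n)).
have hpn n : has_bochner mu (fun r => \1_hl r *: ray_fun g r (ph n)) Jp.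
  have p0 : ph n != 0 by rewrite gt_eqF.
  have [J hJ] := ray_bochner p0 (phth n).
  by rewrite -(ray_independent (phnu n) _ hJ hp)//; left.
have hmn n : has_bochner mu (fun r => \1_hl r *: ray_fun g r (- ph n)) Jm.
  have p0 : - ph n != 0 by rewrite oppr_eq0 gt_eqF.
  have pth : `|- ph n| < th by rewrite normrN.
  have [J hJ] := ray_bochner p0 pth.
  have phnu' : - nu < - ph n by rewrite ltrN2.
  by rewrite (ray_independent phnu' _ hm hJ)//; right; rewrite oppr_lt0 ltrN2.
pose D n r : R[i]^o := \1_hl r *: ray_fun g r (- ph n) - \1_hl r *: ray_fun g r (ph n).
have hD n : has_bochner mu (D n) (Jm - Jp) by exact: (bochnerB (hmn n) (hpn n)).
(* The point l is discarded before dominated convergence: g need not be continuous there. *)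
pose U := [set~ l].
have mU : measurable (U : set (measurableTypeR R)) by apply: measurableC.
pose D' n r : R[i]^o := \1_U r *: D n r.
have D'E n : (\int[mu]_x (nrm (D n x))%:E = \int[mu]_x (nrm (D' n x))%:E)%E.
  apply: ge0_ae_eq_integral => //.
  - exact: measurable_enrm (hD n).1.
  - apply/measurable_EFinP; apply: strongly_measurable_nrm.
    exact: smeas_restrict mU (hD n).1.
  - by move=> x _; rewrite lee_fin nrm_ge0.
  - by move=> x _; rewrite lee_fin nrm_ge0.
  exists [set l]; split; [exact: measurable_set1|exact: lebesgue_measure_set1|].
  move=> x /= h; apply: contrapT => xl; apply: h => _.
  by rewrite /D' indicE mem_set// scale1r.
have M0 r : 0 < r -> 0 <= C * majorant s r by move=> r0; rewrite mulr_ge0// ltW// majorant_gt0.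
have cMm : measurable_fun setT (fun r => \1_hl r * (C * majorant s r)).
  rewrite (_ : (fun r => _) = (fun r => C * majorant s r) \_ hl); last first.
    by apply/funext => r; rewrite patchE indicE; case: ifP; rewrite ?mul1r ?mul0r.
  apply/(measurable_restrictT _ (measurable_itv _)); apply: measurable_funM => //.
  apply: open_continuous_measurable_fun; first exact: interval_open.
  by move=> x; rewrite inE /= in_itv /= andbT; exact: majorant_continuous.
have rb r phi : 0 < r -> `|phi| < th -> nC (ray_fun g r phi) <= C * majorant s r.
  by move=> r0 pth; apply: (nrm_ray_fun (th := th) (M := fun r => C * majorant s r)).
have I0 : (\int[mu]_x (nrm (D' n x))%:E)%E @[n --> \oo] --> 0%E.
  apply: (@dominated_cvg0 _ _ _ mu _ (fun r => 2 * (\1_hl r * (C * majorant s r)))).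
  - move=> n; apply: strongly_measurable_nrm.
    exact: smeas_restrict mU (hD n).1.
  - exact: measurable_funM.
  - move=> n r; rewrite nrm_ge0 /= /D' nrm_indic.
    apply: (@le_trans _ _ (nrm (D n r))).
      by rewrite indicE; case: (_ \in _); rewrite ?mul1r// mul0r nrm_ge0.
    rewrite /D -scalerBr nrm_indic indicE.
    case: (boolP (r \in hl)) => hr; last by rewrite !mul0r mulr0.
    have r0 : 0 < r by move/set_mem : hr; rewrite /= in_itv /= andbT.
    rewrite !mul1r (le_trans (ler_nrmB _ _))// mulr_natl mulr2n lerD//; apply: rb => //.
    by rewrite normrN.
  - under eq_integral do rewrite EFinM.
    rewrite ge0_integralZl//; last 2 first.
    - exact/measurable_EFinP.
    - move=> r _; rewrite lee_fin indicE; case: (boolP (r \in hl)) => hr; last by rewrite mul0r.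
      by rewrite mul1r M0//; move/set_mem : hr; rewrite /= in_itv /= andbT.
    rewrite lte_mul_pinfty//.
    rewrite (_ : (\int[mu]_x _)%E = (\int[mu]_(x in hl) (C%:E * (majorant s x)%:E))%E).
      exact: majorant_integralZ.
    rewrite [RHS]integral_mkcond; apply: eq_integral => x _; rewrite patchE indicE.
    by case: ifP; rewrite ?mul1r ?mul0r.
  move=> r; have [rU|rU] := pselect (U r /\ hl r); last first.
    apply: cvg_near_cst; apply: nearW => n; rewrite /D' /D -scalerBr !nrm_indic !indicE.
    have [|] := pselect (U r) => h1; last by rewrite memNset// mul0r.
    by rewrite [r \in hl]memNset ?mul0r ?mulr0// => h2; apply: rU.
  case: rU => rl; rewrite /= in_itv /= andbT => r0.
  have [p [k [q [/expands_lip[L L0 [de de0 h]] _]]]] := ray_expands (dg0 r0 (introN eqP rl)).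
  have phi0 : ph @ \oo --> (0 : R).
    rewrite -[X in _ --> X](mulr0 nu); apply: cvgM; first exact: cvg_cst.
    have := @cvg_powR_inv R 1 ltr01; rewrite (_ : (fun n => _) = fun n => n.+2%:R^-1)//.
    by apply/funext => n; rewrite powRr1.
  apply: (@cvg0_le _ _ _ _ _ (fun n => 2 * L * ph n)); last first.
    by rewrite -[X in _ --> X](mulr0 (2 * L)); apply: cvgM => //; exact: cvg_cst.
  have /cvgrPdist_lt/(_ _ de0) := phi0; apply: filterS => n; rewrite sub0r normrN => hn.
  rewrite nrm_ge0 /= /D' /D -scalerBr !nrm_indic !indicE !mem_set//=; last by rewrite in_itv /= andbT.
  rewrite !mul1r.
  have hb phi : `|phi| = ph n -> nC (ray_fun g r phi - ray_fun g r 0) <= L * ph n.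
    move=> hphi; have := h r phi; rewrite subrr normr0 subr0 hphi add0r; apply => //.
    by move: hn; rewrite gtr0_norm.
  rewrite (le_trans (ler_nrm_dist (ray_fun g r 0) _ _))// -mulrA mulr_natl mulr2n lerD//.
    by apply: hb; rewrite normrN gtr0_norm.
  by rewrite nrmBC; apply: hb; rewrite gtr0_norm.
apply/eqP; rewrite -subr_eq0; apply/eqP/nrm_eq0; apply/eqP; rewrite eq_le nrm_ge0 andbT.
rewrite -lee_fin; apply: (cvge_to_ge I0).
by apply: nearW => n; rewrite -D'E; exact: nrm_bochner (hD n).
Qed.

End rays.

(** * The integral left by the pole *)

Section kernel.
Context (R : realType).
Local Notation mu := (@lebesgue_measure R).
Local Notation hl := (`]0, +oo[%classic : set R).

(** For c = cos phi the right side is |r e^(i phi) + l|^2; the two sides differ by (1 - c) (r - l)^2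
    / 2. *)
Lemma quadratic_ge (r l c : R) : -1 <= c <= 1 ->
  (r + l) ^+ 2 * ((1 + c) / 2) <= r ^+ 2 + l ^+ 2 + 2 * r * l * c.
Proof.
move=> /andP[c1 c2]; rewrite -subr_ge0.
have -> : r ^+ 2 + l ^+ 2 + 2 * r * l * c - (r + l) ^+ 2 * ((1 + c) / 2) =
  (1 - c) / 2 * (r - l) ^+ 2 by field.
by rewrite mulr_ge0 ?sqr_ge0//; lra.
Qed.

(** Equal to 1 at l, of order z at 0 and 1 / z at infinity, with its only pole at - l, outside every
    sector of angle less than pi. *)
Definition psi (l : R) (z : R[i]) : R[i] := 4 * l%:C * z / (z + l%:C) ^+ 2.

Variables (l nu : R).
Hypothesis l0 : 0 < l.
Hypothesis nupi : 0 < nu < pi.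

Let a := l * cos nu.
Let b := l * sin nu.

Let b0 : 0 < b.
Proof. by rewrite mulr_gt0// sin_gt0_pi// in_itv. Qed.

Let ab : a ^+ 2 + b ^+ 2 = l ^+ 2.
Proof. by rewrite !exprMn -mulrDr cos2Dsin2 mulr1. Qed.

(** With a + i b = l e^(i nu), this is a primitive of [kernel_density], the jump of psi(z) / (z - l)
    between the two rays divided by 2 i. It grows from 0 at 0 to pi at infinity. *)
Definition kernel_primitive r :=
  atan ((r - a) / b) + atan ((r + a) / b) - 2 * b * (r / ((r + a) ^+ 2 + b ^+ 2)).

Definition kernel_density r := b / ((r - a) ^+ 2 + b ^+ 2) +
  b / ((r + a) ^+ 2 + b ^+ 2) -
  2 * b * (l ^+ 2 - r ^+ 2) / ((r + a) ^+ 2 + b ^+ 2) ^+ 2.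

Let q0 x : 0 < x ^+ 2 + b ^+ 2.
Proof. by rewrite ltr_wpDl ?sqr_ge0// exprn_gt0. Qed.

Let is_derive_atan_affine (c r : R) :
  is_derive r 1 (fun x => atan ((x + c) / b)) (b / ((r + c) ^+ 2 + b ^+ 2)).
Proof.
have d1 : is_derive r 1 (fun x : R => b^-1 *: (x + c)) (b^-1 *: (1 + 0)).
  exact: is_deriveZ.
have d2 := @is_derive1_comp R atan (fun x => b^-1 *: (x + c)) r _ _ (is_derive1_atan _) d1.
have -> : (fun x => atan ((x + c) / b)) = atan \o (fun x => b^-1 *: (x + c)).
  by apply/funext => x /=; rewrite /GRing.scale /= mulrC.
apply: (is_derive_eq d2); rewrite /GRing.scale /= addr0 mulr1.
field; rewrite (gt_eqF b0) /= andbT.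
by rewrite -[X in X != 0](_ : (r + c) ^+ 2 + b ^+ 2 = _) ?gt_eqF.
Qed.

Lemma is_derive_kernel_primitive (r : R) :
  is_derive r 1 kernel_primitive (kernel_density r).
Proof.
have d1 := is_derive_atan_affine (- a) r; have d2 := is_derive_atan_affine a r.
have qn : (r + a) ^+ 2 + b ^+ 2 != 0 by rewrite gt_eqF.
have d3 : is_derive r 1 (fun x : R => (x + a) ^+ 2 + b ^+ 2) (2 * (r + a)).
  have -> : (fun x : R => (x + a) ^+ 2 + b ^+ 2) = (fun x => (x + a) * (x + a) + b ^+ 2).
    by apply/funext => x; rewrite expr2.
  have e : is_derive r 1 (fun x : R => x + a) (1 + 0).
    exact: (is_deriveD (is_derive_id (r : R^o) (1 : R^o)) (is_derive_cst (a : R^o) (r : R^o) (1 : R^o))).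
  have ee := is_deriveD (is_deriveM e e) (is_derive_cst (b ^+ 2 : R^o) (r : R^o) (1 : R^o)).
  by apply: (is_derive_eq ee); rewrite /GRing.scale /=; ring.
have d4 := @is_deriveV _ (fun x => (x + a) ^+ 2 + b ^+ 2) _ _ _ qn d3.
have d5 := is_deriveZ (2 * b) (is_deriveM (is_derive_id (r : R^o) (1 : R^o)) d4).
have d6 := is_deriveB (is_deriveD d1 d2) d5.
apply: (is_derive_eq d6); rewrite /kernel_density /GRing.scale /= -ab.
have qa : (r - a) ^+ 2 + b ^+ 2 != 0 by rewrite gt_eqF.
by field; rewrite qn qa.
Qed.

Let wE : polar l nu = a +i* b. Proof. by []. Qed.
Let w'E : polar l (- nu) = a -i* b.
Proof. by rewrite /polar cosN sinN mulrN. Qed.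

(** Factoring e^(i nu) out of z + l and z - l turns each ray into the real variable r, with l
    replaced by w = l e^(i nu) or its conjugate w'; partial fractions in w and w' then give the real
    density. *)
Lemma kernel_densityE r : 0 < r ->
  ray_fun (fun z => psi l z / (z - l%:C)) r (- nu) -
  ray_fun (fun z => psi l z / (z - l%:C)) r nu = 'i%C * (2 * kernel_density r)%:C.
Proof.
move=> r0; rewrite /ray_fun /psi !(polarM r).
set e := polar 1 nu; set e' := polar 1 (- nu).
have ee : e * e' = 1.
  apply/eqP; rewrite eq_complex /e /e' /polar /= cosN sinN !mul1r mulrN opprK.
  by rewrite -!expr2 cos2Dsin2 mulrN mulrC addNr !eqxx.
have en : e != 0.
  by apply/eqP => h; move: ee; rewrite h mul0r => /esym/eqP; rewrite oner_eq0.
have e'n : e' != 0.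
  by apply/eqP => h; move: ee; rewrite h mulr0 => /esym/eqP; rewrite oner_eq0.
pose w := l%:C * e; pose w' := l%:C * e'.
have wab : w = a%:C + 'i%C * b%:C by rewrite /w -polarM wE [LHS]complexE.
have w'ab : w' = a%:C - 'i%C * b%:C.
  by rewrite /w' -polarM w'E [LHS]complexE /= rmorphN mulrN.
have ii : 'i%C * 'i%C = -1 :> R[i].
  by apply/eqP; rewrite eq_complex /=; apply/andP; split; apply/eqP; ring.
have qC (x : R) : (x%:C + w) * (x%:C + w') = ((x + a) ^+ 2 + b ^+ 2)%:C.
  rewrite wab w'ab rmorphD !rmorphXn rmorphD /=.
  have -> : (x%:C + (a%:C + 'i%C * b%:C)) * (x%:C + (a%:C - 'i%C * b%:C)) =
     (x%:C + a%:C) ^+ 2 - ('i%C * 'i%C) * b%:C ^+ 2 by ring.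
  by rewrite ii; ring.
have qC' (x : R) : (x%:C - w) * (x%:C - w') = ((x - a) ^+ 2 + b ^+ 2)%:C.
  rewrite wab w'ab rmorphD !rmorphXn rmorphB /=.
  have -> : (x%:C - (a%:C + 'i%C * b%:C)) * (x%:C - (a%:C - 'i%C * b%:C)) =
     (x%:C - a%:C) ^+ 2 - ('i%C * 'i%C) * b%:C ^+ 2 by ring.
  by rewrite ii; ring.
have qn x : ((x + a) ^+ 2 + b ^+ 2)%:C != 0 :> R[i].
  by rewrite -[0]/(0%:C) (inj_eq (@complexI R)) gt_eqF.
have qn' x : ((x - a) ^+ 2 + b ^+ 2)%:C != 0 :> R[i].
  by rewrite -[0]/(0%:C) (inj_eq (@complexI R)) gt_eqF.
have := qn r; rewrite -qC mulf_eq0 negb_or => /andP[n1 n2].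
have := qn' r; rewrite -qC' mulf_eq0 negb_or => /andP[n3 n4].
have ww : w * w' = (l ^+ 2)%:C.
  by rewrite /w /w' mulrACA ee mulr1 rmorphXn.
have two : (2 : R[i]) = (2 : R)%:C by rewrite rmorph_nat.
have -> : 'i%C * (2 * kernel_density r)%:C = (w - w') *
   (((r%:C - w) * (r%:C - w'))^-1 + ((r%:C + w) * (r%:C + w'))^-1 -
    2 * (w * w' - r%:C ^+ 2) / ((r%:C + w) * (r%:C + w')) ^+ 2).
  have -> : w - w' = 2 * ('i%C * b%:C) by rewrite wab w'ab; ring.
  have cplx (b1 q1 q2 m : R) : (2 * (b1 / q1 + b1 / q2 - 2 * b1 * m / q2 ^+ 2))%:C =
      2 * (b1%:C / q1%:C + b1%:C / q2%:C - 2 * b1%:C * m%:C / q2%:C ^+ 2).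
    by rewrite two !(rmorphM, rmorphB, rmorphD, fmorphV, rmorphXn).
  by rewrite qC qC' ww /kernel_density cplx rmorphB !rmorphXn /=; ring.
have key (x y u P Q : R[i]) : x != 0 -> P != 0 -> Q != 0 ->
    x * (4 * y * (u * x) / (x * P) ^+ 2 / (x * Q)) = 4 * u * (y / x) / (P ^+ 2 * Q).
  by move=> x0 P0 Q0; field; rewrite x0 P0 Q0.
have n5 : r%:C * e + l%:C != 0.
  have -> : r%:C * e + l%:C = e * (r%:C + w') by rewrite mulrDr /w' mulrCA ee mulr1 mulrC.
  by rewrite mulf_neq0.
have n6 : r%:C * e - l%:C != 0.
  have -> : r%:C * e - l%:C = e * (r%:C - w') by rewrite mulrBr /w' mulrCA ee mulr1 mulrC.
  by rewrite mulf_neq0.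
have E1 : e * (4 * l%:C * (r%:C * e) / (r%:C * e + l%:C) ^+ 2 / (r%:C * e - l%:C)) =
    4 * r%:C * w' / ((r%:C + w') ^+ 2 * (r%:C - w')).
  have -> : r%:C * e + l%:C = e * (r%:C + w') by rewrite mulrDr /w' mulrCA ee mulr1 mulrC.
  have -> : r%:C * e - l%:C = e * (r%:C - w') by rewrite mulrBr /w' mulrCA ee mulr1 mulrC.
  rewrite key//; congr (_ * _ / _).
  by rewrite /w' -[e'](mulKf en) ee mulr1.
have E2 : e' * (4 * l%:C * (r%:C * e') / (r%:C * e' + l%:C) ^+ 2 / (r%:C * e' - l%:C)) =
    4 * r%:C * w / ((r%:C + w) ^+ 2 * (r%:C - w)).
  have ee' : e' * e = 1 by rewrite mulrC.
  have -> : r%:C * e' + l%:C = e' * (r%:C + w) by rewrite mulrDr /w mulrCA ee' mulr1 mulrC.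
  have -> : r%:C * e' - l%:C = e' * (r%:C - w) by rewrite mulrBr /w mulrCA ee' mulr1 mulrC.
  rewrite key//; congr (_ * _ / _).
  by rewrite /w -[e](mulKf e'n) ee' mulr1.
rewrite E1 E2; field.
by rewrite n1 n2 n3 n4.
Qed.

Lemma kernel_primitive_cvg0 :
  (fun n : nat => kernel_primitive n.+2%:R^-1) @ \oo --> (0 : R).
Proof.
have -> : (0 : R) = kernel_primitive 0.
  by rewrite /kernel_primitive sub0r add0r mulNr atanN addNr mul0r mulr0 subr0.
apply: (@cvg_comp _ _ _ (fun n : nat => n.+2%:R^-1 : R) kernel_primitive \oo (nbhs (0 : R))).
  have := @cvg_powR_inv R 1 ltr01; rewrite (_ : (fun n => _) = fun n => n.+2%:R^-1)//.
  by apply/funext => n; rewrite powRr1.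
have [d _] := is_derive_kernel_primitive 0.
by move/derivable1_diffP: d => /differentiable_continuous.
Qed.

(** Each arctangent contributes pi / 2. The rational term is of order 1 / r, because (r + a)^2 + b^2
    is at least a positive multiple of r^2 when nu < pi. *)
Lemma kernel_primitive_cvg_pi :
  (fun n : nat => kernel_primitive n.+2%:R) @ \oo --> (pi : R).
Proof.
have natoo : (fun n : nat => n.+2%:R : R) @ \oo --> +oo.
  apply/cvgryPge => A; exists (Num.truncn A).+1 => // n /= hn.
  rewrite ltW// (lt_le_trans (truncnS_gt _))// ler_nat; exact: (leq_trans hn (leqW (leqnSn n))).
have at1 c : (fun n : nat => atan ((n.+2%:R + c) / b)) @ \oo --> (pi / 2 : R).
  have : (fun n : nat => (n.+2%:R + c) / b : R) @ \oo --> +oo.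
    apply/cvgryPge => A; have /cvgryPge/(_ (A * b - c)) := natoo.
    by apply: filterS => n h; rewrite ler_pdivlMr// -lerBlDr.
  by move=> h; exact: (cvg_comp _ _ h (@cvgy_atan R)).
have third : (fun n : nat => 2 * b * (n.+2%:R / ((n.+2%:R + a) ^+ 2 + b ^+ 2))) @ \oo --> (0 : R).
  have c1 : -1 < cos nu.
    by move/andP: nupi => [n0 npi]; rewrite -cospi ltr_cos// ?in_itv /= ?lexx ?pi_ge0 ?ltW.
  have kp : 0 < (1 + cos nu) / 2 by lra.
  pose K := 2 * b / ((1 + cos nu) / 2).
  have K0 : 0 < K by rewrite divr_gt0// mulr_gt0.
  apply: (@cvg0_le _ _ _ _ _ (fun n => K * n.+2%:R^-1 `^ 1)); last first.
    rewrite -[X in _ --> X](mulr0 K); apply: cvgM; first exact: cvg_cst.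
    exact: cvg_powR_inv.
  apply: nearW => n; rewrite powRr1//.
  set x : R := n.+2%:R; have x0 : 0 < x by [].
  have h : x ^+ 2 * ((1 + cos nu) / 2) <= (x + a) ^+ 2 + b ^+ 2.
    have cc : -1 <= cos nu <= 1 by rewrite ltW//= cos_le1.
    have := quadratic_ge x l cc; have -> : (x + a) ^+ 2 + b ^+ 2 = x ^+ 2 + l ^+ 2 + 2 * x * l * cos nu.
      by rewrite -ab /a; ring.
    apply: le_trans; rewrite ler_pM2r// ler_pXn2r ?nnegrE ?(addr_ge0 (ltW x0) (ltW l0)) ?(ltW x0)//.
    by rewrite lerDl (ltW l0).
  apply/andP; split.
    by apply: mulr_ge0; [apply: mulr_ge0 => //; exact: ltW|apply: divr_ge0; [exact: ltW|exact: ltW (q0 _)]].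
  have -> : K / x = 2 * b * (((1 + cos nu) / 2)^-1 / x) by rewrite /K -!mulrA.
  apply: ler_wpM2l; first by apply: mulr_ge0 => //; exact: ltW.
  rewrite ler_pdivrMr//.
  have {1}-> : x = (((1 + cos nu) / 2)^-1 / x) * (x ^+ 2 * ((1 + cos nu) / 2)).
    by field; rewrite !gt_eqF//; lra.
  by rewrite -[X in X <= _]/(((1 + cos nu) / 2)^-1 / x * _) ler_wpM2l// divr_ge0 ?invr_ge0 ?(ltW kp) ?(ltW x0).
have pp : pi / 2 + pi / 2 = pi :> R by field.
have h := cvgB (cvgD (at1 (- a)) (at1 a)) third; rewrite subr0 pp in h.
exact: h.
Qed.

Lemma kernel_jump (J : R[i]^o) :
  has_bochner mu (fun r => \1_hl r *:
    (ray_fun (fun z => psi l z / (z - l%:C)) r (- nu) -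
     ray_fun (fun z => psi l z / (z - l%:C)) r nu : R[i]^o)) J ->
  J = 0 +i* (2 * pi).
Proof.
pose D r : R[i]^o := ray_fun (fun z => psi l z / (z - l%:C)) r (- nu) -
     ray_fun (fun z => psi l z / (z - l%:C)) r nu.
move=> hJ; have [Jn [hJn cJn]] :=
  @half_line_truncation R R[i]^o (@seq_complete_complex R) D J hJ.
have DE r : 0 < r -> D r = 0 +i* (2 * kernel_density r).
  move=> r0; rewrite /D kernel_densityE//.
  by apply/eqP; rewrite eq_complex /=; apply/andP; split; apply/eqP; ring.
have tr0 n r : half_trunc n r -> 0 < r by move=> /half_trunc_sub; rewrite /= in_itv /= andbT.
have JnE n : Jn n = 0 +i* (2 * (kernel_primitive n.+2%:R - kernel_primitive n.+2%:R^-1)).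
  have [_ hRe] := bochner_Re (hJn n).
  have [_ hIm] := bochner_Im (hJn n).
  apply/eqP; rewrite eq_complex /=; apply/andP; split; apply/eqP.
    apply: EFin_inj; rewrite -hRe; apply: integral0_eq => x _; rewrite indicE.
    case: (boolP (x \in half_trunc n)) => [/set_mem/tr0 x0|_]; last by rewrite scale0r.
    by rewrite scale1r DE.
  apply: EFin_inj; rewrite -hIm.
  transitivity (\int[mu]_(x in half_trunc n) (2 * kernel_density x)%:E)%E.
    rewrite [RHS]integral_mkcond; apply: eq_integral => x _; rewrite patchE indicE.
    case: (boolP (x \in half_trunc n)) => [/set_mem/tr0 x0|_]; last by rewrite scale0r.
    by rewrite scale1r DE.
  have dH (x : R) : is_derive x 1 (fun x : R => 2 *: kernel_primitive x) (2 *: kernel_density x).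
    by apply: is_deriveZ; exact: is_derive_kernel_primitive.
  have cH (x : R) : {for x, continuous (fun x : R => 2 *: kernel_primitive x)}.
    by have [d _] := dH x; move/derivable1_diffP: d => /differentiable_continuous.
  
  rewrite (@continuous_FTC2 _ _ (fun x => 2 *: kernel_primitive x))//.
  - by rewrite mulrBr.
  - exact: half_trunc_lt.
  - apply: continuous_in_subspaceT => x _.
    have cq c : {for x, continuous (fun y : R => (y + c) ^+ 2 + b ^+ 2)}.
      have c1 : {for x, continuous (fun y : R => y + c)} by apply: cvgD => //; exact: cvg_cst.
      exact: (cvgD (cvgM c1 c1) (cvg_cst _)).
    apply: cvgM; first exact: cvg_cst.
    apply: cvgB; first apply: cvgD.
    + apply: cvgM; first exact: cvg_cst.
      by apply: cvgV; [rewrite gt_eqF|exact: (cq (- a))].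
    + apply: cvgM; first exact: cvg_cst.
      by apply: cvgV; [rewrite gt_eqF|exact: cq].
    + apply: cvgM.
        apply: cvgM; first exact: cvg_cst.
        apply: cvgB; first exact: cvg_cst.
        exact: (cvgM cvg_id cvg_id).
      apply: cvgV; first by rewrite expf_neq0// gt_eqF.
      exact: (cvgM (cq a) (cq a)).
  - split.
    + by move=> x _; have [] := dH x.
    + by apply: cvg_at_right_filter; exact: cH.
    + by apply: cvg_at_left_filter; exact: cH.
  - by move=> x _; have [_ e] := dH x; rewrite derive1E e.
apply: cvg_nrm_unique cJn _.
apply/cvg_nrmP; under eq_fun do rewrite JnE.
have cH : (fun n : nat => 2 * (kernel_primitive n.+2%:R - kernel_primitive n.+2%:R^-1)) @ \oo --> 2 * pi.
  rewrite -[in X in _ --> X](subr0 pi); apply: cvgM; first exact: cvg_cst.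
  by apply: cvgB; [exact: kernel_primitive_cvg_pi|exact: kernel_primitive_cvg0].
apply/cvgrPdist_lt => e e0; have /cvgrPdist_lt/(_ _ e0) := cH.
apply: filterS => n; rewrite sub0r normrN distrC.
by rewrite /nrm normc_def /= subrr expr0n add0r sqrtr_sqr normr_id.
Qed.

End kernel.

Lemma bochner_eq d (T : measurableType d) (R : realType)
    (Y : normedModType R[i]) (mu : {measure set T -> \bar R}) (f g : T -> Y) (J : Y) :
  f =1 g -> has_bochner mu f J -> has_bochner mu g J.
Proof. by move=> /funext ->. Qed.

Lemma ratio_le_min (R : realType) (v : R) : 0 < v ->
  v / (1 + v) ^+ 2 <= Num.min v v^-1.
Proof.
move=> v0; have p : 0 < (1 + v) ^+ 2 by rewrite exprn_gt0// addr_gt0.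
have vv : v * v^-1 = 1 by rewrite divff ?gt_eqF.
have vV : 0 < v^-1 by rewrite invr_gt0.
rewrite le_min !ler_pdivrMr//; apply/andP; split.
  rewrite -subr_ge0; have -> : v * (1 + v) ^+ 2 - v = 2 * v ^+ 2 + v ^+ 3 by ring.
  by rewrite addr_ge0 ?mulr_ge0 ?exprn_ge0 ?(ltW v0).
have -> : v^-1 * (1 + v) ^+ 2 = v^-1 + 2 * (v * v^-1) + (v * v^-1) * v by ring.
by rewrite vv; lra.
Qed.

(** * Cauchy's formula for f(z) / (z - l) *)

Section cauchy.
Context (R : realType).
Local Notation mu := (@lebesgue_measure R).
Local Notation hl := (`]0, +oo[%classic : set R).

Lemma derivable_complexM (f g : R[i]^o -> R[i]^o) z : derivable f z 1 -> derivable g z 1 ->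
  derivable (fun w => f w * g w : R[i]^o) z 1.
Proof. exact: derivableM. Qed.

Lemma derivable_complexB (f g : R[i]^o -> R[i]^o) z : derivable f z 1 -> derivable g z 1 ->
  derivable (fun w => f w - g w : R[i]^o) z 1.
Proof. exact: derivableB. Qed.

Lemma derivable_complexV (f : R[i]^o -> R[i]^o) z : f z != 0 -> derivable f z 1 ->
  derivable (fun w => (f w)^-1 : R[i]^o) z 1.
Proof. exact: derivableV. Qed.

Lemma derivable_complex_shift (c : R[i]) (z : R[i]^o) :
  derivable (fun w : R[i]^o => w + c : R[i]^o) z 1.
Proof.
exact: (derivableD (@derivable_id _ R[i]^o z 1) (@derivable_cst _ R[i]^o R[i]^o c z 1)).
Qed.

Lemma nrm_complex_sqr (z : R[i]) : nC z ^+ 2 = complex.Re z ^+ 2 + complex.Im z ^+ 2.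
Proof.
by case: z => a b; rewrite /nrm normc_def /= sqr_sqrtr// addr_ge0 ?sqr_ge0.
Qed.

Lemma nrm_polarD (r l phi c : R) : 0 < r -> 0 < l -> -1 <= c <= cos phi ->
  (r + l) * Num.sqrt ((1 + c) / 2) <= nC (polar r phi + l%:C).
Proof.
move=> r0 l0 /andP[c1 cp].
have cc : 0 <= (1 + c) / 2 by lra.
rewrite -(ler_pXn2r (n := 2))// ?nnegrE ?nrm_ge0 ?mulr_ge0 ?sqrtr_ge0 ?addr_ge0 ?(ltW r0) ?(ltW l0)//.
rewrite exprMn sqr_sqrtr// nrm_complex_sqr /= addr0.
have cp1 : -1 <= cos phi <= 1 by rewrite cos_geN1 cos_le1.
have -> : (r * cos phi + l) ^+ 2 + (r * sin phi) ^+ 2 = r ^+ 2 + l ^+ 2 + 2 * r * l * cos phi.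
  have s2 := cos2Dsin2 phi; have -> : (r * cos phi + l) ^+ 2 + (r * sin phi) ^+ 2 =
    r ^+ 2 * (cos phi ^+ 2 + sin phi ^+ 2) + l ^+ 2 + 2 * r * l * cos phi by ring.
  by rewrite s2 mulr1.
apply: le_trans (quadratic_ge r l cp1).
by rewrite ler_wpM2l ?sqr_ge0//; lra.
Qed.

Lemma nrm_polarB (r l phi c : R) : 0 < r -> 0 < l -> cos phi <= c <= 1 ->
  (r + l) * Num.sqrt ((1 - c) / 2) <= nC (polar r phi - l%:C).
Proof.
move=> r0 l0 /andP[cp c1].
have cc : 0 <= (1 - c) / 2 by lra.
rewrite -(ler_pXn2r (n := 2))// ?nnegrE ?nrm_ge0 ?mulr_ge0 ?sqrtr_ge0 ?addr_ge0 ?(ltW r0) ?(ltW l0)//.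
rewrite exprMn sqr_sqrtr// nrm_complex_sqr /= oppr0 addr0.
have cp1 : -1 <= - cos phi <= 1 by rewrite lerN2 cos_le1 lerNl cos_geN1.
have -> : (r * cos phi - l) ^+ 2 + (r * sin phi) ^+ 2 = r ^+ 2 + l ^+ 2 + 2 * r * l * - cos phi.
  have s2 := cos2Dsin2 phi; have -> : (r * cos phi - l) ^+ 2 + (r * sin phi) ^+ 2 =
    r ^+ 2 * (cos phi ^+ 2 + sin phi ^+ 2) + l ^+ 2 + 2 * r * l * - cos phi by ring.
  by rewrite s2 mulr1.
apply: le_trans (quadratic_ge r l cp1).
by rewrite ler_wpM2l ?sqr_ge0//; lra.
Qed.

Lemma min_powR_mono (s s' r : R) : 0 < s -> s <= s' -> 0 < r ->
  Num.min (r `^ s') (r `^ (- s')) <= Num.min (r `^ s) (r `^ (- s)).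
Proof.
move=> s0 ss r0; rewrite le_min; case: (leP r 1) => r1.
  have r01 : 0 < r <= 1 by rewrite r0.
  have h1 : r `^ s' <= r `^ s by exact: ger_powR.
  have h2 : r `^ s <= r `^ (- s) by apply: ger_powR => //; lra.
  by rewrite !ge_min h1 (le_trans h1 h2).
have h1 : r `^ (- s') <= r `^ (- s) by apply: ler_powR; [exact: ltW|lra].
have h2 : r `^ (- s) <= r `^ s by apply: ler_powR; [exact: ltW|lra].
by rewrite !ge_min h1 (le_trans h1 h2) !orbT.
Qed.

Definition decay (s r : R) := r * majorant s r.

(** [psi l] is naturally a function of z / l. This trades decay in r / l for decay in r, so that f
    and [psi l] share one majorant. *)
Lemma decay_scale s r l : 0 < r -> 0 < l ->
  decay s (r / l) <= (l^-1 `^ s + (l^-1 `^ s)^-1) * decay s r.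
Proof.
move=> r0 l0; have lV : 0 < l^-1 by rewrite invr_gt0.
rewrite /decay !mul_majorant ?divr_gt0// powRM ?(ltW r0) ?(ltW lV)//.
set u := r `^ s; set k := l^-1 `^ s.
have u0 : 0 < u by exact: powR_gt0.
have k0 : 0 < k by exact: powR_gt0.
have uk0 : 0 < u * k by exact: mulr_gt0.
have p1 : 0 < (1 + u * k) ^+ 2 by rewrite exprn_gt0// addr_gt0.
have p2 : 0 < (1 + u) ^+ 2 by rewrite exprn_gt0// addr_gt0.
rewrite ler_pdivrMr// mulrA mulrAC ler_pdivlMr//.
have kk : k * k^-1 = 1 by rewrite divff ?gt_eqF.
have kV : 0 < k^-1 by rewrite invr_gt0.
rewrite -subr_ge0.
have -> : (k + k^-1) * u * (1 + u * k) ^+ 2 - u * k * (1 + u) ^+ 2 =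
  u * (k^-1 + 2 * (k * k^-1) * u + (k * k^-1) * k * u ^+ 2 +
  k * (2 * u * k + u ^+ 2 * k ^+ 2 - 2 * u - u ^+ 2)) by ring.
rewrite kk; apply: mulr_ge0; first exact: ltW.
have -> : k^-1 + 2 * 1 * u + 1 * k * u ^+ 2 + k * (2 * u * k + u ^+ 2 * k ^+ 2 - 2 * u - u ^+ 2) =
  k^-1 + 2 * u * (1 - k + k ^+ 2) + k ^+ 3 * u ^+ 2 by ring.
have h : 0 <= 1 - k + k ^+ 2 by nra.
by rewrite !addr_ge0 ?mulr_ge0 ?exprn_ge0 ?(ltW kV) ?(ltW u0) ?(ltW k0).
Qed.

Variable th : R.
Hypothesis thpi : 0 < th < pi.

Let c0 := Num.sqrt ((1 + cos th) / 2).

Let c0_gt0 : 0 < c0.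
Proof.
move/andP: thpi => [n0 npi]; rewrite sqrtr_gt0.
have : -1 < cos th by rewrite -cospi ltr_cos// in_itv /= ?lexx ?pi_ge0 ?(ltW n0) ?(ltW npi).
by lra.
Qed.

Let cos_th phi : `|phi| < th -> -1 <= cos th <= cos phi.
Proof.
move/andP: thpi => [n0 npi] pth; rewrite cos_geN1 /= -(cos_norm phi).
by rewrite ltW// ltr_cos// in_itv /= ?normr_ge0 ?(ltW n0) ?(ltW npi)// (ltW (lt_trans pth npi)).
Qed.

Lemma psi_decay (l s : R) : 0 < l -> 0 < s <= 1 -> exists2 K : R, 0 <= K &
  forall r phi, 0 < r -> `|phi| < th -> nC (psi l (polar r phi)) <= K * decay s r.
Proof.
move=> l0 /andP[s0 s1]; exists (16 * (l^-1 `^ s + (l^-1 `^ s)^-1) / c0 ^+ 2).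
  apply: divr_ge0; last exact: sqr_ge0.
  by apply: mulr_ge0 => //; apply: addr_ge0; rewrite ?invr_ge0 powR_ge0.
move=> r phi r0 pth.
have rl : 0 < r + l by rewrite addr_gt0.
have h := nrm_polarD r0 l0 (cos_th pth); rewrite -/c0 in h.
have h0 : 0 < (r + l) * c0 by rewrite mulr_gt0.
have n4 : nC (4 : R[i]) = 4.
  by rewrite (_ : (4 : R[i]) = (4 : R)%:C) ?nrm_realC ?ger0_norm// rmorph_nat.
rewrite /psi expr2 !(nrm_complexM, nrm_complexV) n4 nrm_realC nrm_polar !gtr0_norm//.
set n := nC _ in h *; have n0 : 0 < n := lt_le_trans h0 h.
apply: (@le_trans _ _ (4 * l * r / ((r + l) * c0 * ((r + l) * c0)))).
  rewrite ler_pM2l ?mulr_gt0// lef_pV2 ?posrE ?mulr_gt0//.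
  by apply: ler_pM => //; exact: ltW.
pose v := r / l; have v0 : 0 < v by exact: divr_gt0.
have h1 : v / (1 + v) ^+ 2 <= 4 * decay s v.
  apply: le_trans (min_powR_le s0 v0); apply: le_trans (min_powR_mono s0 s1 v0).
  by rewrite powRr1 ?(ltW v0)// powR_inv1 ?(ltW v0)// ratio_le_min.
have -> : 4 * l * r / ((r + l) * c0 * ((r + l) * c0)) = 4 / c0 ^+ 2 * (v / (1 + v) ^+ 2).
  by rewrite /v; field; rewrite !gt_eqF//= addr_gt0.
apply: (@le_trans _ _ (4 / c0 ^+ 2 * (4 * decay s v))).
  by rewrite ler_pM2l// divr_gt0// exprn_gt0.
have := decay_scale s r0 l0; rewrite -/v => h2.
have -> : 16 * (l^-1 `^ s + (l^-1 `^ s)^-1) / c0 ^+ 2 * decay s r =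
  4 / c0 ^+ 2 * (4 * ((l^-1 `^ s + (l^-1 `^ s)^-1) * decay s r)) by ring.
by rewrite ler_pM2l ?divr_gt0 ?exprn_gt0// ler_pM2l.
Qed.

(** The exponent is lowered to at most 1 because [psi] decays only to first order at 0 and at
    infinity, and the same exponent must serve both functions. *)
Lemma Hinfty0_decay (f : R[i]^o -> R[i]^o) : Hinfty0 th f ->
  exists C s : R, [/\ 0 <= C, 0 < s <= 1 &
    forall r phi, 0 < r -> `|phi| < th -> nC (f (polar r phi)) <= C * decay s r].
Proof.
move=> [_ _ [C [s [C0 s0 h]]]]; exists (4 * C), (Num.min s 1).
have m0 : 0 < Num.min s 1 by rewrite lt_min s0 ltr01.
split; [by rewrite mulr_ge0// ltW|by rewrite m0 ge_min lexx orbT|].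
move=> r phi r0 pth; have hs : sector th (polar r phi) by exists r, phi.
apply: (le_trans (h _ hs)); rewrite nrm_polar gtr0_norm// (mulrC 4) -mulrA ler_pM2l//.
apply: le_trans (min_powR_le m0 r0); apply: min_powR_mono => //.
by rewrite ge_min lexx.
Qed.

Lemma polarC (r : R) : polar r 0 = r%:C.
Proof. by rewrite /polar cos0 sin0 mulr1 mulr0. Qed.

Lemma polar_subC_neq0 (r phi l : R) : 0 < r -> 0 < l -> `|phi| < pi ->
  (phi != 0) || (r != l) -> polar r phi - l%:C != 0.
Proof.
move=> r0 l0 ppi; apply: contraTneq => /eqP; rewrite subr_eq0 eq_complex /= => /andP[/eqP h1 /eqP h2].
have s0 : sin phi = 0 by move/eqP: h2; rewrite mulf_eq0 gt_eqF//= => /eqP.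
have p0 : phi = 0.
  apply/eqP; rewrite -normr_eq0 eq_le normr_ge0 andbT leNgt; apply/negP => pp.
  have : 0 < sin `|phi| by rewrite sin_gt0_pi// pp.
  by case: (ger0P phi) => _; rewrite ?sinN s0 ?oppr0 ltxx.
by rewrite negb_or !negbK p0 eqxx /=; apply/eqP; rewrite -h1 p0 cos0 mulr1.
Qed.

Variables (f : R[i]^o -> R[i]^o) (nu l : R).
Hypothesis hf : Hinfty0 th f.
Hypothesis nuth : 0 < nu < th.
Hypothesis l0 : 0 < l.

Let thpi' (phi : R) : `|phi| < th -> `|phi| < pi.
Proof. by move/andP: thpi => [_ h] /lt_trans; apply. Qed.

Let derivable_f (r phi : R) : 0 < r -> `|phi| < th -> derivable f (polar r phi) 1.
Proof. by move=> r0 pth; case: hf => h _ _; apply: h; exists r, phi. Qed.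

(** Subtracting f(l) psi makes the numerator vanish at l and preserves the decay at 0 and at
    infinity. *)
Let numer (z : R[i]^o) : R[i]^o := f z - f l%:C * psi l z.
Let g (z : R[i]^o) : R[i]^o := numer z / (z - l%:C).

Let derivable_numer (r phi : R) : 0 < r -> `|phi| < th -> derivable numer (polar r phi) 1.
Proof.
move=> r0 pth; apply: derivable_complexB; first exact: derivable_f.
apply: derivable_complexM; first exact: derivable_cst.
have n0 : polar r phi + l%:C != 0.
  apply/eqP => h; have := nrm_polarD r0 l0 (cos_th pth).
  by rewrite h nrm0 leNgt mulr_gt0// addr_gt0.
apply: derivable_complexM.
  by apply: derivable_complexM; [exact: derivable_cst|exact: derivable_id].
apply: derivable_complexV; first by rewrite expf_neq0.
by apply: derivable_complexM; exact: derivable_complex_shift.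
Qed.

Let derivable_quot (h : R[i]^o -> R[i]^o) (z : R[i]^o) : z - l%:C != 0 ->
  derivable h z 1 -> derivable (fun z : R[i]^o => h z / (z - l%:C) : R[i]^o) z 1.
Proof.
move=> zl dh; apply: derivable_complexM; first exact: dh.
by apply: derivable_complexV; [exact: zl|exact: derivable_complex_shift].
Qed.

Let derivable_g (r phi : R) : 0 < r -> `|phi| < th -> (phi != 0) || (r != l) ->
  derivable g (polar r phi) 1.
Proof.
move=> r0 pth h; apply: derivable_quot; first exact: (polar_subC_neq0 r0 l0 (thpi' pth)).
exact: derivable_numer.
Qed.

Let numer_l : numer l%:C = 0.
Proof.
rewrite /numer /psi.
have -> : 4 * l%:C * l%:C / (l%:C + l%:C) ^+ 2 = 1 :> R[i].
  have ln : l%:C != 0 :> R[i] by rewrite -[0]/(0%:C) (inj_eq (@complexI R)) gt_eqF.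
  have -> : (l%:C + l%:C) ^+ 2 = 4 * l%:C * l%:C by ring.
  by rewrite divff// !mulf_neq0// pnatr_eq0.
by rewrite mulr1 subrr.
Qed.

(** Away from l, r is at most a multiple of |z - l|, which turns the decay r [majorant] of the
    numerator into [majorant]. Near l the quotient is bounded by |d| + 1, with d the derivative of
    the numerator, and [majorant] is at least half its value at l. *)
Let g_bound : exists C s : R, [/\ 0 <= C, 0 < s &
  forall r phi, 0 < r -> `|phi| < th -> nC (g (polar r phi)) <= C * majorant s r].
Proof.
have [C1 [s [C10 s01 h1]]] := Hinfty0_decay hf.
have [K K0 hK] := psi_decay l0 s01.
have /andP[s0 s1] := s01.
have [th0 _] := andP thpi.
have z0 : `|0 : R| < th by rewrite normr0.
have dn : derivable numer l%:C 1 by rewrite -polarC; exact: derivable_numer.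
have [d hd] := complex_expansion dn.
have [d1 d10 {}hd] := hd 1 ltr01.
have m0 := majorant_gt0 s l0.
have m2 : 0 < majorant s l / 2 by rewrite divr_gt0.
have /cvgrPdist_lt/(_ _ m2) [d2 /= d20 hm] := majorant_continuous l0 (s := s).
pose de := Num.min d1 d2; have de0 : 0 < de by rewrite lt_min d10.
pose A := (C1 + nC (f l%:C) * K) * (1 + l / de).
pose B := (nC d + 1) / (majorant s l / 2).
have A0 : 0 <= A.
  apply: mulr_ge0; apply: addr_ge0 => //; first by apply: mulr_ge0 => //; exact: nrm_ge0.
  by apply: divr_ge0; exact: ltW.
have B0 : 0 <= B by rewrite divr_ge0 ?addr_ge0 ?nrm_ge0 ?(ltW m2)//.
exists (A + B), s; split=> //; first exact: addr_ge0.
move=> r phi r0 pth; set z := polar r phi.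
have Mr0 := majorant_gt0 s r0.
have rz : `|r - l| <= nC (z - l%:C).
  have := ler_dist_nrm (z : R[i]^o) (l%:C : R[i]^o).
  by rewrite nrm_polar nrm_realC (gtr0_norm r0) (gtr0_norm l0).
have rz' : r <= nC (z - l%:C) + l.
  by rewrite -lerBlDr (le_trans (ler_norm _)).
rewrite /g nrm_complexM nrm_complexV.
have [zde|zde] := leP de (nC (z - l%:C)).
  have zp : 0 < nC (z - l%:C) := lt_le_trans de0 zde.
  apply: (@le_trans _ _ (A * majorant s r)); last by rewrite ler_pM2r// lerDl.
  rewrite ler_pdivrMr//.
  have hn : nC (numer z) <= (C1 + nC (f l%:C) * K) * decay s r.
    rewrite (le_trans (ler_nrmB _ _))// mulrDl lerD ?h1// nrm_complexM -mulrA.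
    by rewrite ler_wpM2l ?nrm_ge0// hK.
  apply: (le_trans hn); rewrite /A /decay.
  have rle : r <= (1 + l / de) * nC (z - l%:C).
    rewrite mulrDl mul1r (le_trans rz')// lerD2l mulrAC ler_pdivlMr//.
    by rewrite ler_pM2l.
  have cc : 0 <= C1 + nC (f l%:C) * K by rewrite addr_ge0// mulr_ge0// nrm_ge0.
  set Ms := majorant s r in Mr0 *.
  rewrite (_ : _ * (1 + l / de) * Ms * nC (z - l%:C) =
    (C1 + nC (f l%:C) * K) * ((1 + l / de) * nC (z - l%:C) * Ms)); last by ring.
  by apply: ler_wpM2l => //; rewrite ler_pM2r.
apply: (@le_trans _ _ (B * majorant s r)); last by rewrite ler_pM2r// lerDr.
move: zde; rewrite lt_min => /andP[z1 z2].
have mr : majorant s l / 2 <= majorant s r.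
  have := hm r; rewrite /ball_ /= distrC => /(_ (le_lt_trans rz z2)).
  by rewrite ltr_norml => /andP[_ h]; lra.
have {}hd := hd z z1; rewrite numer_l subr0 mul1r in hd.
apply: (@le_trans _ _ (nC d + 1)); last first.
  rewrite /B mulrAC ler_pdivlMr// ler_wpM2l// addr_ge0// nrm_ge0//.
have [zl|zl] := eqVneq (nC (z - l%:C)) 0.
  by rewrite zl invr0 mulr0 addr_ge0// nrm_ge0.
have zp : 0 < nC (z - l%:C) by rewrite lt_neqAle eq_sym zl nrm_ge0.
rewrite ler_pdivrMr// -[numer z](subrK (d * (z - l%:C))).
by rewrite (le_trans (ler_nrmD _ _))// mulrDl mul1r addrC nrm_complexM lerD.
Qed.

Let quot_bochner phi : phi != 0 -> `|phi| < th -> exists J : R[i]^o,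
  has_bochner mu (fun r => \1_hl r *:
    ray_fun (fun z : R[i]^o => f z / (z - l%:C)) r phi) J.
Proof.
move=> p0 pth; have [C [s [C0 /andP[s0 s1] h]]] := Hinfty0_decay hf.
have pp := thpi' pth.
have cp : cos phi < 1.
  by rewrite -cos_norm -cos0 ltr_cos ?normr_gt0// in_itv /= ?lexx ?pi_ge0 ?normr_ge0 ?(ltW pp).
pose k := Num.sqrt ((1 - cos phi) / 2).
have k0 : 0 < k by rewrite sqrtr_gt0; lra.
apply: (@half_line_bochner R R[i]^o (@seq_complete_complex R) _ (C / k) s) => //.
- by rewrite divr_ge0// ltW.
- move=> r r0.
  have dq : derivable (fun z : R[i]^o => f z / (z - l%:C) : R[i]^o) (polar r phi) 1.
    apply: derivable_quot; last exact: derivable_f.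
    by apply: polar_subC_neq0 => //; rewrite p0.
  have [p [k' [q [/expands_lip[L L0 [de de0 hL]] _]]]] := ray_expands dq.
  apply/cvg_nrmP; apply: (@cvg0_le _ _ _ _ _ (fun x => L * `|x - r|)); last exact: cvg_mul_dist.
  exists de => //= x; rewrite /ball_ /= distrC => xr; rewrite nrm_ge0 /=.
  by have := hL x phi xr; rewrite subrr normr0 addr0; apply.
move=> r r0; rewrite /ray_fun !nrm_complexM nrm_polar normr1 mul1r nrm_complexV.
have hk : (r + l) * k <= nC (polar r phi - l%:C).
  by apply: nrm_polarB; rewrite ?lexx ?cos_le1.
have rk : 0 < r * k by rewrite mulr_gt0.
have rk' : r * k <= nC (polar r phi - l%:C).
  by apply: le_trans hk; rewrite ler_pM2r// lerDl ltW.
apply: (@le_trans _ _ (C * decay s r / (r * k))).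
  apply: ler_pM; rewrite ?nrm_ge0 ?invr_ge0 ?nrm_ge0 ?h//.
  by rewrite lef_pV2 ?posrE// (lt_le_trans rk).
by rewrite /decay; apply: eqW; field; rewrite !gt_eqF.
Qed.

(** The function f(z) / (z - l) is g plus f(l) psi(z) / (z - l). The part g has no jump by
    [ray_jump], and the explicit kernel supplies 2 pi i. *)
Lemma cauchy_sector : exists Jp Jm : R[i]^o,
  [/\ has_bochner mu (fun r => \1_hl r *:
        ray_fun (fun z : R[i]^o => f z / (z - l%:C)) r nu) Jp,
      has_bochner mu (fun r => \1_hl r *:
        ray_fun (fun z : R[i]^o => f z / (z - l%:C)) r (- nu)) Jm &
      Jm - Jp = (0 +i* (2 * pi)) * f l%:C].
Proof.
have /andP[nu0 nth] := nuth; have /andP[th0 tpi] := thpi.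
have np : nu != 0 by rewrite gt_eqF.
have nm : - nu != 0 by rewrite oppr_eq0.
have tp : `|nu| < th by rewrite gtr0_norm.
have tm : `|- nu| < th by rewrite normrN.
have [Jp hp] := quot_bochner np tp; have [Jm hm] := quot_bochner nm tm.
exists Jp, Jm; split; [exact: hp|exact: hm|].
have [C [s [C0 s0 hC]]] := g_bound.
have dg1 r phi : 0 < r -> phi != 0 -> `|phi| < th -> derivable g (polar r phi) 1.
  by move=> r0 p0 pth; apply: derivable_g => //; rewrite p0.
have dg2 r : 0 < r -> r != l -> derivable g (polar r 0) 1.
  by move=> r0 rl; apply: derivable_g; rewrite ?normr0 ?rl ?orbT.
have [Gp gp] := ray_bochner C0 s0 dg1 hC np tp.
have [Gm gm] := ray_bochner C0 s0 dg1 hC nm tm.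
have GG := ray_jump C0 s0 dg1 dg2 hC nuth gp gm.
have split_ray r phi : ray_fun (fun z : R[i]^o => f z / (z - l%:C)) r phi - ray_fun g r phi =
    f l%:C * ray_fun (fun z => psi l z / (z - l%:C)) r phi.
  by rewrite /ray_fun /g /numer; ring.
have hD := bochnerB (bochnerB hm gm) (bochnerB hp gp).
have {}hD : has_bochner mu (fun r => f l%:C *: (\1_hl r *:
    (ray_fun (fun z => psi l z / (z - l%:C)) r (- nu) -
     ray_fun (fun z => psi l z / (z - l%:C)) r nu : R[i]^o)) : R[i]^o) (Jm - Jp).
  have -> : Jm - Jp = Jm - Gm - (Jp - Gp) by rewrite GG opprB addrA subrK.
  apply: bochner_eq hD => r.
  have gen (c a1 a2 b1 b2 k1 k2 w : R[i]) : a1 - b1 = w * k1 -> a2 - b2 = w * k2 ->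
      c * a1 - c * b1 - (c * a2 - c * b2) = w * (c * (k1 - k2)).
    move=> e1 e2; have -> : c * a1 - c * b1 - (c * a2 - c * b2) = c * (a1 - b1 - (a2 - b2)) by ring.
    by rewrite e1 e2; ring.
  exact: gen (split_ray r (- nu)) (split_ray r nu).
(* The kernel integral is isolated by dividing by f(l), so f(l) = 0 is treated apart. *)
have [f0|fn0] := eqVneq (f l%:C) 0.
  rewrite f0 mulr0; apply: bochner_unique hD _.
  rewrite f0; under eq_fun do rewrite scale0r.
  exact: bochner0.
have hK := bochnerZ (f l%:C)^-1 hD.
have {}hK : has_bochner mu (fun r => \1_hl r *:
    (ray_fun (fun z => psi l z / (z - l%:C)) r (- nu) -
     ray_fun (fun z => psi l z / (z - l%:C)) r nu : R[i]^o) : R[i]^o) ((f l%:C)^-1 *: (Jm - Jp)).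
  apply: bochner_eq hK => r.
  by rewrite scalerA mulVf// scale1r.
have nupi : 0 < nu < pi by rewrite nu0 (lt_trans nth).
have := kernel_jump l0 nupi hK => <-.
by rewrite /GRing.scale /= mulrAC mulVf// mul1r.
Qed.

End cauchy.

(** * Calculus of a spectral resolution *)

Section sector.
Context (R : realType).

Lemma atan_le_id (x : R) : `|atan x| <= `|x|.
Proof.
have h (u : R) : 0 <= u -> `|atan u - atan 0| <= 1 * (u - 0).
  move=> u0; apply: (@mean_value_bound R _ (fun x => (1 + x ^+ 2)^-1)) => // z _.
  have p : 1 <= 1 + z ^+ 2 by rewrite lerDl sqr_ge0.
  rewrite ger0_norm; first by rewrite invf_le1// (lt_le_trans ltr01).
  by rewrite invr_ge0 (le_trans ler01).
have [x0|x0] := leP 0 x.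
  by have := h x x0; rewrite atan0 !subr0 mul1r (ger0_norm x0).
have nx : 0 <= - x by rewrite oppr_ge0 ltW.
by have := h _ nx; rewrite atan0 !subr0 mul1r atanN normrN (ltr0_norm x0).
Qed.

Lemma polar_atan (a b : R) : 0 < a ->
  a +i* b = polar (Num.sqrt (a ^+ 2 + b ^+ 2)) (atan (b / a)).
Proof.
move=> a0; set t := b / a; have s0 : 0 < Num.sqrt (1 + t ^+ 2).
  by rewrite sqrtr_gt0 ltr_pwDl// sqr_ge0.
have -> : Num.sqrt (a ^+ 2 + b ^+ 2) = a * Num.sqrt (1 + t ^+ 2).
  rewrite -{2}(gtr0_norm a0) -sqrtr_sqr -sqrtrM ?sqr_ge0//; congr Num.sqrt.
  by rewrite /t; field; rewrite gt_eqF.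
have cn : cos (atan t) != 0 by rewrite cos_atan invr_neq0// gt_eqF.
have st : sin (atan t) = t / Num.sqrt (1 + t ^+ 2).
  have := atanK t; rewrite /tan => h.
  by rewrite -[LHS](divfK cn) h cos_atan.
rewrite /polar st cos_atan -mulrA divff ?gt_eqF// mulr1; congr (_ +i* _).
rewrite mulrA mulrAC mulfK ?gt_eqF// /t mulrC divfK ?gt_eqF//.
Qed.

(** If |z - l| is below this fraction of |z| for some l > 0, the bound 1 / 4 gives Re z >= |z| / 2
    and the bound nu / 2 gives |Im z| < nu |z| / 2, hence |arg z| < nu. *)
Definition sector_gap (nu : R) : R := Num.min 4^-1 (nu / 2).

Lemma sector_gap_gt0 nu : 0 < nu -> 0 < sector_gap nu.
Proof. by move=> nu0; rewrite lt_min invr_gt0 divr_gt0//= ltr0n. Qed.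

Lemma near_sector nu (z : R[i]) l : 0 < nu -> 0 < l ->
  nC (z - l%:C) < sector_gap nu * nC z -> sector nu z.
Proof.
move=> nu0 l0; set d := sector_gap nu => h.
have d4 : d <= 4^-1 by rewrite ge_min lexx.
have dn : d <= nu / 2 by rewrite ge_min lexx orbT.
have d0 : 0 < d by exact: sector_gap_gt0.
have z0 : 0 < nC z by have := le_lt_trans (nrm_ge0 _) h; rewrite pmulr_rgt0.
have hr := Re_le_nrm (z - l%:C); have hi := Im_le_nrm (z - l%:C).
have zl : nC z - l <= nC (z - l%:C).
  have := ler_dist_nrm (z : R[i]^o) (l%:C : R[i]^o); rewrite nrm_realC (gtr0_norm l0).
  exact/le_trans/ler_norm.
case: z h z0 hr hi zl => a b; set n := nC (a +i* b) => h z0 /=; rewrite oppr0 addr0 => hr hi zl.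
have dn4 : d * n <= n / 4 by rewrite (mulrC n) ler_pM2r.
have a2 : n / 2 <= a by move: hr; rewrite ler_norml => /andP[hr _]; lra.
have a0 : 0 < a by rewrite (lt_le_trans _ a2)// divr_gt0.
exists (Num.sqrt (a ^+ 2 + b ^+ 2)), (atan (b / a)); split.
- by rewrite sqrtr_gt0 ltr_pwDl ?sqr_ge0// exprn_gt0.
- rewrite (le_lt_trans (atan_le_id _))// normrM normfV (gtr0_norm a0) ltr_pdivrMr//.
  rewrite (le_lt_trans hi)// (lt_le_trans h)//.
  apply: (@le_trans _ _ (nu / 2 * n)); first by rewrite ler_pM2r.
  by rewrite -mulrA ler_pM2l// mulrC.
- exact: polar_atan.
Qed.

Lemma closure_sector0 nu : 0 < nu -> closure (sector nu : set R[i]^o) 0.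
Proof.
move=> nu0 B /nbhs_ballP[e /= e0 eB].
have eE : e = (complex.Re e)%:C by move: e0; case: (e) => a b /andP[/= /eqP -> _].
have e0' : 0 < complex.Re e by rewrite -ltcR -eE.
exists (polar (complex.Re e / 2) 0); split.
  by exists (complex.Re e / 2), 0; rewrite normr0 divr_gt0.
apply: eB; rewrite -ball_normE /ball_ /= sub0r normrN nrmE eE ltcR nrm_polar gtr0_norm ?divr_gt0//.
by rewrite ltr_pdivrMr// ltr_pMr// ltr1n.
Qed.

Lemma not_closure_sector nu (z : R[i]^o) : 0 < nu -> ~ closure (sector nu) z ->
  0 < nC z /\ forall l, 0 < l -> sector_gap nu * nC z <= nC (z - l%:C).
Proof.
move=> nu0 zn; split.
  rewrite lt_neqAle nrm_ge0 andbT eq_sym; apply/eqP => /nrm_eq0 z0.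
  by apply: zn; rewrite z0; exact: closure_sector0.
move=> l l0; rewrite leNgt; apply/negP => h; apply: zn; apply: subset_closure.
exact: near_sector h.
Qed.

Lemma expands_cvg (F : R -> R -> R[i]) (r s : R) (p k : R[i]) : expands F r s p k ->
  (fun x => F x s : R[i]^o) @ r --> (F r s : R[i]^o).
Proof.
move=> /expands_lip[L L0 [de de0 h]]; apply/cvg_nrmP.
apply: (@cvg0_le _ _ _ _ _ (fun x => L * `|x - r|)); last exact: cvg_mul_dist.
exists de => //= x; rewrite /ball_ /= distrC => xr; rewrite nrm_ge0 /=.
by have := h x s xr; rewrite subrr normr0 addr0; apply.
Qed.

Lemma expR_expansion (e : R) : 0 < e -> exists2 de, 0 < de & forall h, `|h| < de ->
  `|expR h - 1 - h| <= e * `|h|.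
Proof.
move=> e0; have de : derivable (expR : R^o -> R^o) 0 1 by exact: derivable_expR.
have [d d0 hd] := derivable_expansion de e0; exists d => // h hh.
have dE : 'D_1 (expR : R^o -> R^o) 0 = 1 by rewrite -[RHS]expR0; apply: derive_val.
by have := hd h; rewrite subr0 expR0 dE mul1r; apply.
Qed.

End sector.

(** * Resolvent, contour integral and generator *)

Section functional_calculus.
Context (R : realType) (X : normedModType R[i]).
Hypothesis cX : seq_complete X.
Variables (E : int -> X -> X) (C0 : R).
Hypothesis H : spectral_resolution E C0.
Variable lam : int -> R.
Hypothesis lam_gt0 : forall k, 0 < lam k.
Local Notation M := (multiplier E).
Local Notation D := (Delta E).
Local Notation A := (spectral_graph E lam).

Let nrm_M m (B : R) x : 0 <= B -> (forall k, nC (m k) <= B) ->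
  nrm (M m x) <= 2 * C0 * B * nrm x.
Proof.
by move=> B0 mB; exact: (nrm_multiplier cX H B0 mB).
Qed.

Let D_M m (B : R) k x : 0 <= B -> (forall k, nC (m k) <= B) -> D k (M m x) = m k *: D k x.
Proof.
by move=> B0 mB; exact: (Delta_multiplier cX H B0 mB).
Qed.

Let D_inj x y : (forall k, D k x = D k y) -> x = y.
Proof. exact: (Delta_inj H). Qed.

Let M_unique m (B : R) x y : 0 <= B -> (forall k, nC (m k) <= B) ->
  (forall k, D k y = m k *: D k x) -> M m x = y.
Proof. by move=> B0 mB h; apply: D_inj => k; rewrite (D_M k x B0 mB) h. Qed.

Let DZ k (a : R[i]) x : D k (a *: x) = a *: D k x.
Proof. exact: (DeltaZ H). Qed.

Let DD k x y : D k (x + y) = D k x + D k y.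
Proof. exact: (DeltaD H). Qed.

Let DB k x y : D k (x - y) = D k x - D k y.
Proof. exact: (DeltaB H). Qed.

Let nrm_D k x : nrm (D k x) <= 2 * nrm x.
Proof. exact: (nrm_Delta H). Qed.

Let M_cvg (I : Type) (F : set_system I) (FF : Filter F)
    (mt : I -> int -> R[i]) m (B : R) x : 0 <= B ->
  (forall i k, nC (mt i k) <= B) -> (forall k, nC (m k) <= B) ->
  (forall k, (fun i => nC (mt i k - m k)) @ F --> (0 : R)) ->
  (fun i => M (mt i) x) @ F --> M m x.
Proof.
move=> B0 mtB mB h.
exact: (multiplier_cvg cX H B0 mtB mB h).
Qed.

Let resolventE (z : R[i]) (e : R) y : 0 < e -> (forall k, e <= nC (z - (lam k)%:C)) ->
  resolvent A z y = M (fun k => (z - (lam k)%:C)^-1) y.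
Proof.
exact: (spectral_resolventE cX H).
Qed.

Let invB (z : R[i]) (e : R) : 0 < e -> (forall k, e <= nC (z - (lam k)%:C)) ->
  0 <= e^-1 /\ forall k, nC ((z - (lam k)%:C)^-1) <= e^-1.
Proof.
move=> e0 h; split=> [|k]; first by rewrite invr_ge0 ltW.
by rewrite nrm_complexV lef_pV2 ?posrE// (lt_le_trans e0).
Qed.

Let nrm_resolvent (z : R[i]) (e : R) y : 0 < e -> (forall k, e <= nC (z - (lam k)%:C)) ->
  nrm (resolvent A z y) <= 2 * C0 * e^-1 * nrm y.
Proof. by move=> e0 h; rewrite (resolventE y e0 h); have [h1 h2] := invB e0 h; exact: nrm_M. Qed.

Let gap_dist nu (z : R[i]^o) : 0 < nu -> ~ closure (sector nu) z ->
  0 < sector_gap nu * nC z /\ forall k, sector_gap nu * nC z <= nC (z - (lam k)%:C).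
Proof.
move=> nu0 /(not_closure_sector nu0)[z0 h]; split; last by move=> k; exact: h.
by rewrite mulr_gt0// sector_gap_gt0.
Qed.

Lemma spectral_sectorial_of_type (omega : R) : 0 < omega < pi -> sectorial_of_type A omega.
Proof.
move=> hw; have /andP[w0 wpi] := hw; split=> //.
- exact: (spectral_graph_closed_densely_defined H).
- move=> z; apply: contra_notP => /(gap_dist w0)[e0 he]; split.
    move=> y; exists (M (fun k => (z - (lam k)%:C)^-1) y).
    have gr x := spectral_graph_resolvent cX H x y e0 he.
    by split=> [|x /gr ->//]; apply/gr.
  by exists (2 * C0 * (sector_gap omega * nC z)^-1) => y; exact: nrm_resolvent.
move=> nu /andP[wnu _]; have nu0 := lt_trans w0 wnu.
exists (2 * C0 / sector_gap nu) => z x zn; have [e0 he] := gap_dist nu0 zn.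
have [z0 _] := not_closure_sector nu0 zn.
rewrite nrmZ; apply: (@le_trans _ _ (nC z * (2 * C0 * (sector_gap nu * nC z)^-1 * nrm x))).
  by rewrite ler_pM2l//; exact: nrm_resolvent.
apply: eqW; field.
by rewrite (gt_eqF z0) gt_eqF// sector_gap_gt0.
Qed.

Lemma spectral_sectorial : sectorial A.
Proof.
exists (pi / 2); apply: spectral_sectorial_of_type.
by have := pi_gt0 R => p0; apply/andP; split; lra.
Qed.

Let angle_lb : lbound [set omega | sectorial_of_type A omega] 0.
Proof. by move=> w [/andP[/ltW]]. Qed.

Lemma spectral_angle_ge0 : 0 <= sectoriality_angle A.
Proof. by apply: lb_le_inf; [exact: spectral_sectorial|exact: angle_lb]. Qed.

Lemma spectral_angle_lt (theta : R) : 0 < theta < pi -> sectoriality_angle A < theta.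
Proof.
move=> /andP[t0 tp]; apply: (@le_lt_trans _ _ (theta / 2)); last by lra.
apply: inf_lbound; first by exists 0; exact: angle_lb.
by apply: spectral_sectorial_of_type; apply/andP; split; lra.
Qed.

Section Hinfty.
Variables (th nu : R) (f : R[i]^o -> R[i]^o).
Hypothesis thpi : 0 < th < pi.
Hypothesis nuth : 0 < nu < th.
Hypothesis hf : Hinfty0 th f.
Local Notation mu := (@lebesgue_measure R).
Local Notation hl := (`]0, +oo[%classic : set R).

Let resolvent_ray (phi r : R) x := resolvent A (polar r phi) x.

Let gap (phi : R) : R := Num.sqrt ((1 - cos phi) / 2).

Let gap_gt0 (phi : R) : phi != 0 -> `|phi| < th -> 0 < gap phi.
Proof.
move=> p0 pth; have /andP[_ tp] := thpi; rewrite sqrtr_gt0.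
have : cos phi < 1.
  rewrite -cos_norm -cos0 ltr_cos ?normr_gt0// in_itv /= ?lexx ?pi_ge0 ?normr_ge0//.
  by rewrite ltW// (lt_trans pth).
by lra.
Qed.

Let gap_le (phi r l : R) : 0 < r -> 0 < l -> r * gap phi <= nC (polar r phi - l%:C).
Proof.
move=> r0 l0; have h := @nrm_polarB R r l phi (cos phi) r0 l0.
apply: (@le_trans _ _ ((r + l) * gap phi)).
  by rewrite ler_wpM2r ?sqrtr_ge0// lerDl ltW.
by apply: h; rewrite lexx cos_le1.
Qed.

Let resolvent_ray_continuous (phi : R) x (r : R) : phi != 0 -> `|phi| < th -> 0 < r ->
  (fun y => resolvent_ray phi y x) @ r --> resolvent_ray phi r x.
Proof.
move=> p0 pth r0; have g0 := gap_gt0 p0 pth.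
have r2 : 0 < r / 2 by rewrite divr_gt0.
(* [M_cvg] needs a bound valid for all parameters, while the resolvent blows up as y tends to 0;
   this replaces y by a radius bounded below that agrees with y near r. *)
pose t y := Num.max y (r / 2).
have t0 y : 0 < t y by rewrite lt_max r2 orbT.
have tr : t r = r by apply/max_idPl; lra.
have e0 : 0 < r / 2 * gap phi by rewrite mulr_gt0.
have te y k : r / 2 * gap phi <= nC (polar (t y) phi - (lam k)%:C).
  by apply: le_trans (gap_le phi (t0 y) (lam_gt0 k)); rewrite ler_pM2r// le_max lexx orbT.
have resE y : resolvent A (polar (t y) phi) x = M (fun k => (polar (t y) phi - (lam k)%:C)^-1) x.
  exact: (resolventE x e0 (te y)).
have [ei _] := invB e0 (te r).
have bnd y k : nC ((polar (t y) phi - (lam k)%:C)^-1) <= (r / 2 * gap phi)^-1.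
  by have [_] := invB e0 (te y).
have c : (fun y => M (fun k => (polar (t y) phi - (lam k)%:C)^-1) x) @ r -->
    M (fun k => (polar (t r) phi - (lam k)%:C)^-1) x.
  apply: (@M_cvg _ _ _ (fun y k => (polar (t y) phi - (lam k)%:C)^-1) _ _ x ei) => // k.
  pose L := (r / 2 * gap phi)^-1 * (r / 2 * gap phi)^-1.
  have L0 : 0 < L by rewrite mulr_gt0 ?invr_gt0.
  apply: (@cvg0_le _ _ _ _ _ (fun y => L * `|y - r|)); last exact: cvg_mul_dist.
  apply: nearW => y; rewrite nrm_ge0 /=.
  have nz y' : polar (t y') phi - (lam k)%:C != 0.
    by apply/eqP => h; have := te y' k; rewrite h nrm0 leNgt e0.
  have -> : (polar (t y) phi - (lam k)%:C)^-1 - (polar (t r) phi - (lam k)%:C)^-1 =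
    (polar (t y) phi - (lam k)%:C)^-1 * (polar (t r) phi - (lam k)%:C)^-1 * (polar (t r) phi - polar (t y) phi).
    by field; rewrite nz nz.
  rewrite !nrm_complexM; apply: ler_pM; rewrite ?mulr_ge0 ?nrm_ge0//.
    by apply: ler_pM; rewrite ?nrm_ge0.
  rewrite !(polarM (t _)) -mulrBl -rmorphB nrm_complexM nrm_realC nrm_polar normr1 mulr1 tr.
  rewrite distrC /t; case: (leP y (r / 2)) => // hy.
  by rewrite ler_normr; apply/orP; right; rewrite ler_norml; apply/andP; split; lra.
rewrite /resolvent_ray; rewrite -!resE tr in c.
apply: cvg_trans c; apply: near_eq_cvg.
exists (r / 2) => //= y; rewrite /ball_ /= => hy.
have ty : t y = y by apply/max_idPl; move: hy; rewrite ltr_norml; lra.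
by rewrite -[LHS]resE ty.
Qed.

Let fdecay := Hinfty0_decay hf.

Let ray_vec (phi : R) (x : X) (r : R) : X := polar 1 phi *: (f (polar r phi) *: resolvent A (polar r phi) x).

Let ray_vec_bochner (phi : R) x : phi != 0 -> `|phi| < th ->
  exists J, has_bochner mu (fun r => \1_hl r *: ray_vec phi x r) J.
Proof.
move=> p0 pth; have g0 := gap_gt0 p0 pth.
have [C [s [Cge /andP[s0 s1] hC]]] := fdecay.
apply: (@half_line_bochner R X cX _ (C * (2 * C0 * nrm x) / gap phi) s) => //.
- by rewrite divr_ge0 ?mulr_ge0 ?nrm_ge0 ?(sr_C0 H) ?(ltW g0).
- move=> r r0; rewrite /ray_vec; under eq_fun do rewrite scalerA.
  rewrite scalerA; apply: cvgZ; last exact: resolvent_ray_continuous.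
  have df : derivable f (polar r phi) 1 by case: hf => h _ _; apply: h; exists r, phi.
  by have [p [k [q [h _]]]] := ray_expands df; exact: expands_cvg h.
move=> r r0; rewrite /ray_vec !nrmZ nrm_polar normr1 mul1r.
have e0 : 0 < r * gap phi by rewrite mulr_gt0.
have he k : r * gap phi <= nC (polar r phi - (lam k)%:C) by exact: gap_le.
apply: (@le_trans _ _ (C * decay s r * (2 * C0 * (r * gap phi)^-1 * nrm x))).
  by apply: ler_pM; rewrite ?nrm_ge0//; [exact: hC|exact: nrm_resolvent].
by rewrite /decay; apply: eqW; field; rewrite !gt_eqF.
Qed.

(** Delta_k is bounded, so it passes under the integral, and it turns the resolvent into the scalar
    1 / (z - lam k). The contour integral of operators becomes the scalar one of [cauchy_sector]. *)
Let D_ray (phi : R) x J k (j : R[i]^o) : phi != 0 -> `|phi| < th ->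
  has_bochner mu (fun r => \1_hl r *: ray_vec phi x r) J ->
  has_bochner mu (fun r => \1_hl r *:
     ray_fun (fun z : R[i]^o => f z / (z - (lam k)%:C)) r phi) j ->
  D k J = j *: D k x.
Proof.
move=> p0 pth hJ hj; have g0 := gap_gt0 p0 pth.
have h1 := bochner_linear_map (DD k) (DZ k) (nrm_D k) hJ.
have h2 := bochner_scale_vector (D k x) hj.
apply: bochner_unique h2; apply: bochner_eq h1 => r.
rewrite DZ !indicE; case: (boolP (r \in hl)) => hr; last by rewrite !scale0r.
have r0 : 0 < r by move/set_mem : hr; rewrite /= in_itv /= andbT.
have e0 : 0 < r * gap phi by rewrite mulr_gt0.
have he i : r * gap phi <= nC (polar r phi - (lam i)%:C) by exact: gap_le.
rewrite !scale1r /ray_vec !DZ (resolventE x e0 he); have [i1 i2] := invB e0 he.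
by rewrite (D_M k x i1 i2) !scalerA /ray_fun -!mulrA.
Qed.

Lemma spectral_Hinfty_op x : Hinfty_op A nu f x = M (fun k => f (lam k)%:C) x.
Proof.
have /andP[nu0 nth] := nuth.
have np : nu != 0 by rewrite gt_eqF.
have nm : - nu != 0 by rewrite oppr_eq0.
have tp : `|nu| < th by rewrite gtr0_norm.
have tm : `|- nu| < th by rewrite normrN.
have [Jp hp] := ray_vec_bochner x np tp; have [Jm hm] := ray_vec_bochner x nm tm.
rewrite /Hinfty_op /sector_integral (bochnerE hm) (bochnerE hp).
have [_ [B hB] _] := hf.
have fB k : nC (f (lam k)%:C) <= Num.max 0 B.
  rewrite le_max hB ?orbT//; exists (lam k), 0; split; rewrite ?normr0//.
    by have /andP[] := thpi.
  by rewrite polarC.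
have B0 : 0 <= Num.max 0 B by rewrite le_max lexx.
apply/esym/(M_unique B0 fB) => k.
have [jp [jm [hjp hjm jE]]] := cauchy_sector thpi hf nuth (lam_gt0 k).
rewrite DZ DB (D_ray np tp hp hjp) (D_ray nm tm hm hjm) -scalerBl jE scalerA mulrA.
rewrite mulVf ?mul1r//.
by rewrite eq_complex /= eqxx /= mulf_neq0// gt_eqF// pi_gt0.
Qed.

End Hinfty.

Lemma spectral_bounded_Hinfty_calculus (theta : R) : 0 < theta < pi ->
  bounded_Hinfty_calculus A theta.
Proof.
move=> hth; have /andP[t0 _] := hth; split.
- exact: spectral_sectorial.
- exact: spectral_angle_lt.
exists (2 * C0); first by rewrite mulr_ge0// (sr_C0 H).
move=> f nu x hf /andP[anu nuth].
have nu0 : 0 < nu := le_lt_trans spectral_angle_ge0 anu.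
have hnu : 0 < nu < theta by rewrite nu0.
rewrite (spectral_Hinfty_op hth hnu hf).
have fle k : nC (f (lam k)%:C) <= Hinfty_norm theta f.
  apply: ub_le_sup.
    by case: hf => _ [B hB] _; exists B => _ [z hz <-]; exact: hB.
  by exists (lam k)%:C => //; exists (lam k), 0; rewrite normr0 polarC.
apply: nrm_M => //; exact: le_trans (nrm_ge0 _) (fle 0).
Qed.

(** If the difference quotient converges, applying Delta_k identifies the limit. Conversely, on the
    domain the quotient is the multiplier (1 - e^(-t lam)) / (t lam) applied to - y, which is
    bounded by 1 and tends to 1. *)
Lemma spectral_generator (U : R -> X -> X) :
  (forall t x, 0 < t -> U t x = M (fun k => (expR (- (t * lam k)))%:C) x) ->
  forall x y, generator U x (- y) <-> A x y.
Proof.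
move=> hU x y.
have eB (t : R) k : 0 < t -> nC ((expR (- (t * lam k)))%:C : R[i]) <= 1.
  move=> t0; rewrite nrm_realC ger0_norm ?expR_ge0//.
  by rewrite -expR0 ler_expR oppr_le0 mulr_ge0// ltW.
have DU t k : 0 < t -> D k ((t%:C)^-1 *: (U t x - x)) =
    ((expR (- (t * lam k)) - 1) / t)%:C *: D k x.
  move=> t0; rewrite hU// DZ DB (D_M k x ler01 (fun k => eB t k t0)).
  rewrite -[X in _ - X]scale1r -scalerBl scalerA; congr (_ *: _).
  by rewrite rmorphM rmorphB fmorphV rmorph1 mulrC.
have quot k (e : R) : 0 < e -> exists2 de, 0 < de & forall t, 0 < t -> t < de ->
    `|(expR (- (t * lam k)) - 1) / t + lam k| <= e.
  move=> e0; have el : 0 < e / lam k by rewrite divr_gt0.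
  have [de de0 h] := expR_expansion el; exists (de / lam k); first by rewrite divr_gt0.
  move=> t t0; rewrite ltr_pdivlMr// => tde.
  have := h (- (t * lam k)); rewrite normrN gtr0_norm ?mulr_gt0// => /(_ tde) {}h.
  have -> : (expR (- (t * lam k)) - 1) / t + lam k =
    (expR (- (t * lam k)) - 1 - - (t * lam k)) / t by field; rewrite gt_eqF.
  rewrite normrM normfV (gtr0_norm t0) ler_pdivrMr// (le_trans h)//.
  apply: eqW; field; rewrite gt_eqF//.
split=> [g k|gxy].
- apply/eqP; rewrite -subr_eq0; apply/eqP/nrm_eq0/eqP; rewrite eq_le nrm_ge0 andbT.
  apply/ler_addgt0Pr => e e0; rewrite add0r.
  have e4 : 0 < e / (4 * (1 + nrm (D k x))).
    by rewrite divr_gt0// mulr_gt0// ltr_pwDl// nrm_ge0.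
  have [de de0 hde] := quot k _ e4.
  have e8 : 0 < e / 4 by rewrite divr_gt0.
  have /cvg_nrmP/cvgrPdist_lt/(_ _ e8) := g.
  move=> [d' /= d'0 hd'].
  pose t := Num.min de d' / 2.
  have m0 : 0 < Num.min de d' by rewrite lt_min de0.
  have t0 : 0 < t by rewrite divr_gt0.
  have tm : t < Num.min de d' by rewrite /t; lra.
  have := tm; rewrite lt_min => /andP[t1 t2].
  have := hd' t; rewrite /ball_ /= sub0r normrN (gtr0_norm t0) => /(_ t2 t0).
  rewrite sub0r normrN ger0_norm ?nrm_ge0// opprK => hy.
  have hx := hde t t0 t1.
  have := nrm_D k ((t%:C)^-1 *: (U t x - x) + y); rewrite DD DU// => hz.
  have -> : D k y - (lam k)%:C *: D k x =
     (((expR (- (t * lam k)) - 1) / t)%:C *: D k x + D k y) -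
     ((expR (- (t * lam k)) - 1) / t + lam k)%:C *: D k x.
    by rewrite rmorphD scalerDl opprD addrACA subrr add0r.
  rewrite (le_trans (ler_nrmB _ _))// nrmZr.
  have hw : `|(expR (- (t * lam k)) - 1) / t + lam k| * nrm (D k x) <= e / 4.
    apply: (@le_trans _ _ (e / (4 * (1 + nrm (D k x))) * (1 + nrm (D k x)))).
      by apply: ler_pM; rewrite ?nrm_ge0// lerDr.
    apply: eqW; field.
    by rewrite gt_eqF// ltr_pwDl// nrm_ge0.
  by lra.
(* The value 1 for t <= 0 makes the bound hold for every parameter, as [M_cvg] asks. *)
pose ph t k : R[i] := if 0 < t then ((1 - expR (- (t * lam k))) / (t * lam k))%:C else 1.
have phB t k : nC (ph t k) <= 1.
  rewrite /ph; case: ifP => t0; last by rewrite (_ : (1 : R[i]) = 1%:C)// nrm_realC normr1.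
  have u0 : 0 < t * lam k by rewrite mulr_gt0.
  have h := expR_ge1Dx (- (t * lam k)).
  have h' : expR (- (t * lam k)) <= 1 by rewrite -expR0 ler_expR oppr_le0 ltW.
  rewrite nrm_realC ger0_norm; last by rewrite divr_ge0 ?subr_ge0 ?(ltW u0).
  by rewrite ler_pdivrMr// mul1r; lra.
have B1 (k : int) : nC (1 : R[i]) <= 1 by rewrite (_ : (1 : R[i]) = 1%:C)// nrm_realC normr1.
have E1 : M (fun=> 1) (- y) = - y.
  by apply: (M_unique ler01 B1) => k; rewrite scale1r.
have c : (fun t => M (ph t) (- y)) @ 0^'+ --> M (fun=> 1) (- y).
  apply: (@M_cvg _ _ _ ph _ _ (- y) ler01 phB B1) => k.
  apply/cvgrPdist_le => e e0; have el : 0 < e * lam k by rewrite mulr_gt0.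
  have [de de0 h] := quot k _ el.
  exists de => //= t; rewrite /ball_ /= sub0r normrN => tde t0.
  rewrite (gtr0_norm t0) in tde; have {}h := h t t0 tde.
  rewrite sub0r normrN ger0_norm ?nrm_ge0// /ph t0 (_ : (1 : R[i]) = 1%:C)// -rmorphB nrm_realC.
  have -> : (1%R - expR (- (t * lam k))) / (t * lam k) - 1 =
    - ((expR (- (t * lam k)) - 1) / t + lam k) / lam k.
    by field; rewrite !gt_eqF.
  by rewrite normrM normrN normfV (gtr0_norm (lam_gt0 k)) ler_pdivrMr.
rewrite E1 in c; apply: cvg_trans c; apply: near_eq_cvg.
exists 1 => //= t _ t0; apply: D_inj => k.
rewrite (D_M k _ ler01 (phB t)) DU// /ph t0 -[- y]sub0r DB (gxy k).
rewrite /Delta -/(Delta E k x) (_ : E k 0 - E (k - 1) 0 = 0); last first.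
  have E00 j : E j 0 = 0 by exact: (E0 H).
  by rewrite !E00 subrr.
rewrite sub0r scalerN scalerA -scaleNr; congr (_ *: _).
rewrite -rmorphM -rmorphN; congr (_%:C).
by field; rewrite !gt_eqF.
Qed.

End functional_calculus.

(** * Dyadic averages *)

Section conditioned_probability.
Context d (T : measurableType d) (R : realType) (mu : {measure set T -> \bar R}).
Variables (B : set T) (mB : measurable B) (b : R) (b0 : 0 < b) (muB : mu B = b%:E) (o : T).

(** [dirac o] is what [mnormalize] would return for total mass 0 or infinity, which [muB] and [b0]
    exclude. *)
Let P : probability T R := mnormalize (mrestr mu mB) (dirac o : probability T R).

Lemma conditioned_probabilityE (A : set T) : P A = ((b^-1)%:E * mu (A `&` B))%E.
Proof.
rewrite /P /= /mnormalize /= /mrestr setTI muB.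
rewrite ifF; first by rewrite /= muleC.
by apply/negbTE; rewrite negb_or eqe (gt_eqF b0).
Qed.

Lemma integral_conditioned_probability (g : T -> \bar R) :
  measurable_fun setT g -> (forall x, 0 <= g x)%E -> (forall x, ~ B x -> g x = 0%E) ->
  (\int[P]_x g x = (b^-1)%:E * \int[mu]_x g x)%E.
Proof.
move=> mg g0 gB; have bV : 0 <= b^-1 by rewrite invr_ge0 ltW.
have onB (m : {measure set T -> \bar R}) : (\int[m]_x g x = \int[m]_(x in B) g x)%E.
  rewrite [RHS]integral_mkcond; apply: eq_integral => x _; rewrite patchE.
  by case: ifPn => //; rewrite notin_setE => /gB.
rewrite !onB (@eq_measure_integral _ _ _ _ (mscale (NngNum bV) mu)); last first.
  by move=> A mA /setIidPl AB; have := conditioned_probabilityE A; rewrite AB.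
rewrite ge0_integral_mscale//; exact: measurable_funS mg.
Qed.

Lemma BNorm_conditioned_probability (Y : normedModType R[i]) (p : R) (F : T -> Y) : 0 < p ->
  smeas mu F -> (forall x, ~ B x -> F x = 0) ->
  BNorm P p F = ((b^-1 `^ p^-1)%:E * BNorm mu p F)%E.
Proof.
move=> p0 mF FB; have bV : 0 <= b^-1 by rewrite invr_ge0 ltW.
rewrite !BNormE /pint integral_conditioned_probability.
- rewrite poweRM ?lee_fin// ?poweR_EFin//.
  by apply: integral_ge0 => x _; rewrite lee_fin powR_ge0.
- exact: (measurable_nrmX p mF).
- by move=> x; rewrite lee_fin powR_ge0.
- by move=> x /FB ->; rewrite nrm0 powR0// gt_eqF.
Qed.

End conditioned_probability.

Section layers.
Context d (T : measurableType d) (R : realType) (mu : {measure set T -> \bar R}).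
Context (Y : normedModType R[i]).
Hypothesis cY : seq_complete Y.

(** Layer-cake integration against a kernel g given as a sum of indicators with nonnegative weights:
    the increasing partial sums of the kernel let monotone convergence give integrability and
    dominated convergence give the limit. *)
Lemma bochner_layers (A : nat -> set T) (a b : nat -> R) (C : R) (g : T -> R)
    (f : T -> Y) (v : nat -> Y) :
  (forall i, measurable (A i)) -> (forall i, 0 <= a i) ->
  smeas mu f ->
  (forall i, has_bochner mu (fun x => \1_(A i) x *: f x) (v i)) ->
  (forall i, (\int[mu]_(x in A i) (nrm (f x))%:E <= (b i)%:E)%E) ->
  (forall n, \sum_(i < n) a i * b i <= C) ->
  (forall x, (fun n => \sum_(i < n) a i * \1_(A i) x) @ \oo --> g x) ->
  exists2 w, has_bochner mu (fun x => (g x)%:C *: f x) w &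
    (fun n => \sum_(i < n) (a i)%:C *: v i) @ \oo --> w.
Proof.
move=> mA a0 mf hv hb hC hg.
pose G n x : R := \sum_(i < n) a i * \1_(A i) x.
have mnf : measurable_fun setT (fun x => nrm (f x)) := strongly_measurable_nrm mf.
have mG n : measurable_fun setT (G n).
  rewrite /G; elim: n => [|n IH].
    under eq_fun do rewrite big_ord0; exact: measurable_cst.
  under eq_fun do rewrite big_ord_recr /=; apply: measurable_funD => //.
  by apply: measurable_funM => //; exact: measurable_cst.
have G0 n x : 0 <= G n x by rewrite /G sumr_ge0// => i _; rewrite mulr_ge0.
have ndG x : nondecreasing_seq (G ^~ x).
  apply/nondecreasing_seqP => n; rewrite /G big_ord_recr /= lerDl mulr_ge0//.
have Gg n x : G n x <= g x.
  have c : cvgn (G ^~ x) by apply/cvg_ex; exists (g x); exact: hg.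
  have <- : limn (G ^~ x) = g x by apply: (cvg_lim (@Rhausdorff R)); exact: hg.
  exact: nondecreasing_cvgn_le.
have g0 x : 0 <= g x by exact: le_trans (G0 0%N x) (Gg _ _).
have mg : measurable_fun setT g.
  by apply: (@measurable_fun_cvg _ _ _ setT G) => // x _; exact: hg.
pose F n x := (G n x)%:C *: f x.
have hF n : has_bochner mu (F n) (\sum_(i < n) (a i)%:C *: v i).
  elim: n => [|n IH].
    rewrite big_ord0; apply: bochner_eq (bochner0 Y mu) => x.
    by rewrite /F /G big_ord0 scale0r.
  rewrite big_ord_recr /= addrC.
  apply: bochner_eq (bochnerDZ (a n)%:C (hv n) IH) => x.
  rewrite /F /G big_ord_recr /= rmorphD /= scalerDl addrC scalerA; congr (_ + _ *: _).
  rewrite rmorphM /=; congr (_ * _); rewrite !indicE.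
  by case: (_ \in _); rewrite ?rmorph1 ?rmorph0.
have mF : smeas mu (fun x => (g x)%:C *: f x).
  have [s [sS sf]] := mf.
  exists (fun n => flatten [seq [seq (c.1, (a i)%:C *: c.2) | c <- sfun_restrict (A i) (s n)] | i <- iota 0 n]).
  split.
    move=> n c /flatten_mapP[i _ /mapP[c' c's ->]] /=.
    exact: (sfun_over_restrict (mA i) (sS n)).
  move=> x; have h : (fun n => (G n x)%:C *: seval (s n) x) @ \oo --> (g x)%:C *: f x.
    apply: cvgZ; last exact: sf.
    apply/(@cvg_nrmP R R[i]^o).
    under eq_fun do rewrite -rmorphB nrm_real.
    have := hg x; rewrite -/(G ^~ x) => /cvgrPdist_le h; apply/cvgrPdist_le => e /h.
    by apply: filterS => n; rewrite sub0r normrN normr_id distrC.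
  apply: cvg_trans h; apply: near_eq_cvg; apply: nearW => n.
  rewrite /sfun_eval big_flatten /= big_map /G -(big_mkord xpredT (fun i => a i * \1_(A i) x)).
  rewrite /index_iota subn0 rmorph_sum /= scaler_suml; apply: eq_bigr => i _.
  rewrite big_map rmorphM /= -scalerA; have := seval_restrict (A i) (s n) x.
  rewrite /sfun_eval => h2.
  transitivity ((a i)%:C *: \sum_(b0 <- sfun_restrict (A i) (s n)) \1_(b0.1) x *: b0.2).
    rewrite h2; congr (_ *: (_ *: _)); rewrite !indicE.
    by case: (_ \in _); rewrite ?rmorph1 ?rmorph0.
  by rewrite scaler_sumr; apply: eq_bigr => c _; rewrite /= !scalerA mulrC.
have intG n : (\int[mu]_x (G n x * nrm (f x))%:E <= C%:E)%E.
  apply: le_trans (_ : (\sum_(i < n) a i * b i)%:E <= C%:E)%E; last by rewrite lee_fin.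
  elim: n => [|n IH].
    rewrite big_ord0 integral0_eq// => x _; by rewrite /G big_ord0 mul0r.
  under eq_integral do rewrite /G big_ord_recr /= mulrDl EFinD.
  have ma : measurable_fun setT (fun x => (a n * \1_(A n) x * nrm (f x))%:E).
    apply/measurable_EFinP; apply: measurable_funM => //.
    by apply: measurable_funM => //; exact: measurable_cst.
  rewrite ge0_integralD//.
  - rewrite big_ord_recr /= EFinD; apply: leeD; first exact: IH.
    under eq_integral do rewrite -mulrA EFinM.
    rewrite ge0_integralZl//.
    + rewrite EFinM; apply: lee_wpmul2l; first by rewrite lee_fin.
      apply: le_trans (hb n); rewrite [leRHS]integral_mkcond.
      apply: eqW; apply: eq_integral => x _.
      by rewrite patchE indicE; case: (_ \in _); rewrite ?mul1r ?mul0r.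
    + by apply/measurable_EFinP; exact: measurable_funM.
    + by move=> x _; rewrite lee_fin mulr_ge0// nrm_ge0.
    + by rewrite lee_fin.
  - by move=> x _; rewrite lee_fin mulr_ge0 ?nrm_ge0// G0.
  - by apply/measurable_EFinP; apply: measurable_funM => //; exact: mG.
  - by move=> x _; rewrite lee_fin mulr_ge0 ?nrm_ge0// mulr_ge0.
have intg : (\int[mu]_x (g x * nrm (f x))%:E <= C%:E)%E.
  have h : (\int[mu]_x (G n x * nrm (f x))%:E)%E @[n --> \oo] --> (\int[mu]_x (g x * nrm (f x))%:E)%E.
    rewrite (_ : (fun x => (g x * nrm (f x))%:E) =
        fun x => limn (fun n => (G n x * nrm (f x))%:E)); last first.
      apply/funext => x; apply/esym/cvg_lim => //.
      apply: cvg_EFin; first exact: nearW.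
      by apply: cvgM; [exact: hg|exact: cvg_cst].
    apply: cvg_monotone_convergence => //.
    - by move=> n; apply/measurable_EFinP; exact: measurable_funM.
    - by move=> n x _; rewrite lee_fin mulr_ge0 ?nrm_ge0.
    - by move=> x _ m n mn; rewrite lee_fin ler_wpM2r ?nrm_ge0// ndG.
  by rewrite -(cvg_lim _ h)//; apply: lime_le; [exact: cvgP h|exact: nearW].
have nrmF x : nrm ((g x)%:C *: f x) = g x * nrm (f x) by rewrite nrmZr ger0_norm.
have [w hw] : exists w, has_bochner mu (fun x => (g x)%:C *: f x) w.
  apply: bochner_exists => //.
  by under eq_integral do rewrite nrmF; apply: le_lt_trans intg _; rewrite ltry.
exists w => //.
have d0 : (\int[mu]_x ((g x - G n x) * nrm (f x))%:E)%E @[n --> \oo] --> 0%E.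
  apply: (@dominated_cvg0 _ _ _ mu _ (fun x => g x * nrm (f x))).
  - by move=> n; apply: measurable_funM => //; exact: measurable_funB.
  - exact: measurable_funM.
  - move=> n x; rewrite mulr_ge0 ?nrm_ge0 ?subr_ge0//= ler_wpM2r ?nrm_ge0//.
    by rewrite lerBlDr lerDl.
  - by apply: le_lt_trans intg _; rewrite ltry.
  move=> x; rewrite -(mul0r (nrm (f x))); apply: cvgM; last exact: cvg_cst.
  by rewrite -(subrr (g x)); apply: cvgB; [exact: cvg_cst|exact: hg].
apply/cvg_nrmP.
have le n : ((nrm (\sum_(i < n) (a i)%:C *: v i - w))%:E <= \int[mu]_x ((g x - G n x) * nrm (f x))%:E)%E.
  have := nrm_bochner (bochnerB (hF n) hw).
  move=> /le_trans; apply; apply: eqW.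
  apply: eq_integral => x _; rewrite /F -scalerBl -rmorphB nrmZr distrC ger0_norm//.
  by rewrite subr_ge0.
have c0 : (fun n => (nrm (\sum_(i < n) (a i)%:C *: v i - w))%:E) @ \oo --> 0%E.
  apply: (squeeze_cvge _ (cvg_cst 0%E) d0); apply: nearW => n; rewrite le//.
  by rewrite lee_fin nrm_ge0.
by have /fine_cvgP[_] := c0.
Qed.

End layers.

(** A tree of balls in which a larger k means a smaller ball, of measure N^-k. [dy_regular] is the
    only trace of the topology: outer regularity by sets that are unions of balls. *)
Record dyadic_structure d (T : measurableType d) (R : realType)
    (mu : {measure set T -> \bar R}) (ball : int -> T -> set T) (N : R) : Prop := {
  dy_gt1 : 1 < N;
  dy_measurable : forall k x, measurable (ball k x);
  dy_refl : forall k x, ball k x x;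
  dy_eq : forall k x y, ball k x y -> ball k y = ball k x;
  dy_sub : forall k x, ball (k + 1) x `<=` ball k x;
  dy_measure : forall k x, mu (ball k x) = (N ^ (- k))%:E;
  dy_cover : exists s : nat -> T, forall k x, exists i, ball k (s i) x;
  dy_exhaust : forall x y, exists m : nat, ball (- m%:Z) x y;
  dy_regular : forall A, measurable A -> (mu A < +oo)%E -> forall e : R, 0 < e ->
    exists U, [/\ measurable U, A `<=` U, (mu (U `\` A) < e%:E)%E &
      forall x, U x -> exists m : nat, ball m%:Z x `<=` U] }.

(** Jensen's inequality for the mean t of g. Young's inequality between g(x) and t^(p - 1) gives the
    tangent bound p t^(p - 1) g(x) <= g(x)^p + (p - 1) t^p, which is then integrated over the
    ball. *)
Lemma jensen_ball d (T : measurableType d) (R : realType) (mu : {measure set T -> \bar R})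
    (p : R) (g : T -> R) (B : set T) (b t : R) : 1 < p ->
  measurable_fun setT g -> (forall x, 0 <= g x) -> measurable B ->
  mu B = b%:E -> 0 < b -> 0 <= t -> (\int[mu]_(x in B) (g x)%:E = (t * b)%:E)%E ->
  ((t `^ p * b)%:E <= \int[mu]_(x in B) (g x `^ p)%:E)%E.
Proof.
move=> p1 mg g0 mB muB b0 t0 ig.
have p0 : 0 < p := lt_trans ltr01 p1.
have pm1 : 0 < p - 1 by rewrite subr_gt0.
have mgB := measurable_funS measurableT (@subsetT _ B) mg.
have mgp : measurable_fun B (fun x => (g x `^ p)%:E).
  apply/measurable_EFinP; apply: (@measurableT_comp _ _ _ _ _ _ (@powR R ^~ p)) => //.
pose q := p / (p - 1); have q0 : 0 < q by exact: divr_gt0.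
have pq : p^-1 + q^-1 = 1 by rewrite /q; field; rewrite !gt_eqF.
have tq : (t `^ (p - 1)) `^ q = t `^ p.
  by rewrite -powRrM /q mulrCA divff ?mulr1// gt_eqF.
have tt : t `^ (p - 1) * t = t `^ p.
  move: t0; rewrite le_eqVlt => /predU1P[<-|t0].
    by rewrite mulr0 powR0// gt_eqF.
  by rewrite -{2}(powRr1 (ltW t0)) -powRD ?subrK// (gt_eqF t0) implybT.
have yng x : p * t `^ (p - 1) * g x <= g x `^ p + (p - 1) * t `^ p.
  have := conjugate_powR (g0 x) (powR_ge0 t (p - 1)) p0 q0 pq.
  rewrite tq -(ler_pM2l p0) => h.
  have -> : p * t `^ (p - 1) * g x = p * (g x * t `^ (p - 1)) by ring.
  apply: (le_trans h); apply: eqW.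
  by rewrite /q; field; rewrite !gt_eqF.
have c0 : 0 <= p * t `^ (p - 1) by rewrite mulr_ge0 ?powR_ge0// ltW.
have h : ((p * t `^ (p - 1) * (t * b))%:E <=
    \int[mu]_(x in B) (g x `^ p)%:E + ((p - 1) * t `^ p * b)%:E)%E.
  have -> : (((p - 1) * t `^ p * b)%:E = \int[mu]_(x in B) ((p - 1) * t `^ p)%:E)%E.
    by rewrite integral_cst// muB EFinM.
  rewrite -ge0_integralD//; last 2 first.
  - by move=> x _; rewrite lee_fin powR_ge0.
  - by move=> x _; rewrite lee_fin mulr_ge0 ?powR_ge0// ltW.
  have -> : ((p * t `^ (p - 1) * (t * b))%:E =
     \int[mu]_(x in B) ((p * t `^ (p - 1))%:E * (g x)%:E))%E.
    rewrite ge0_integralZl//.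
    - by rewrite ig -EFinM.
    - exact/measurable_EFinP.
    - by move=> x _; rewrite lee_fin.
  apply: ge0_le_integral => //.
  - by move=> x _; rewrite -EFinM lee_fin mulr_ge0.
  - by apply/measurable_EFinP; apply: measurable_funM => //; exact: measurable_cst.
  - by apply: emeasurable_funD => //; exact: measurable_cst.
  - by move=> x _; rewrite -EFinM -EFinD lee_fin.
move: h; rewrite (_ : p * t `^ (p - 1) * (t * b) = t `^ p * b + (p - 1) * t `^ p * b).
  by rewrite EFinD leeD2rE.
by rewrite -mulrA (mulrA _ t) tt; ring.
Qed.

(** * Averages over balls *)

Section averages.
Context d (T : measurableType d) (R : realType) (mu : {measure set T -> \bar R}).
Variables (ball : int -> T -> set T) (N : R).
Hypothesis Dy : dyadic_structure mu ball N.

Lemma dy_N0 : 0 < N.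
Proof. exact: lt_trans ltr01 (dy_gt1 Dy). Qed.

Lemma dy_wgt0 k : 0 < N ^ k.
Proof. exact/exprz_gt0/dy_N0. Qed.

Lemma dy_lty k x : (mu (ball k x) < +oo)%E.
Proof. by rewrite (dy_measure Dy) ltry. Qed.

Lemma dy_subset j k x : (j <= k)%R -> ball k x `<=` ball j x.
Proof.
move=> jk; have -> : k = j + (absz (k - j))%:Z by lia.
elim: (absz (k - j)) => [|n IH]; first by rewrite addr0.
have -> : j + n.+1%:Z = j + n%:Z + 1 by lia.
by move=> y /(dy_sub Dy)/IH.
Qed.

Lemma dy_sym k x y : ball k x y -> ball k y x.
Proof. by move=> /(dy_eq Dy) ->; exact: dy_refl Dy _ _. Qed.

Lemma dy_disjoint k x y z : ball k x z -> ball k y z -> ball k x = ball k y.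
Proof. by move=> /(dy_eq Dy) <- /(dy_eq Dy) <-. Qed.

(** Subtracting from each ball of a countable cover the earlier ones leaves either the whole ball or
    nothing, since balls of one level coincide or are disjoint. *)
Lemma dy_cells k : exists (s : nat -> T) (cell : nat -> set T), [/\
  forall i, measurable (cell i), trivIset setT cell, \bigcup_i cell i = setT &
  forall i x, cell i x -> cell i = ball k (s i)].
Proof.
have [s hs] := dy_cover Dy.
exists s, (seqDU (fun i => ball k (s i))); split.
- move=> i; apply: measurableD; first exact: dy_measurable Dy _ _.
  by apply: bigsetU_measurable => j _; exact: dy_measurable Dy _ _.
- exact: trivIset_seqDU.
- rewrite -seqDU_bigcup_eq; apply/seteqP; split=> // x _.
  by have [i hi] := hs k x; exists i.
move=> i x [xi nx]; apply/seteqP; split=> [y []//|y yi]; split=> // hy; apply: nx.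
move: hy; rewrite -!(bigcup_mkord i (fun j => ball k (s j))) => -[j ji yj]; exists j => //.
by rewrite (dy_disjoint yj yi).
Qed.

Section Banach.
Context (Y : normedModType R[i]).
Hypothesis cY : seq_complete Y.
Variable p : R.
Hypothesis p1 : 1 < p.

Definition avg k (F : T -> Y) x : Y := (N ^ k)%:C *: bochner mu (ball k x) F.

Let p1' : 1 <= p := ltW p1.

Lemma ball_integral_lty k x (F : T -> Y) : F \in BLfun mu p ->
  (\int[mu]_(y in ball k x) (nrm (F y))%:E < +oo)%E.
Proof.
move=> FL; have mF := BLfun_sm FL.
have mB := dy_measurable Dy k x.
apply: (@le_lt_trans _ _ (\int[mu]_(y in ball k x) ((1)%:E + (nrm (F y) `^ p)%:E))%E).
  apply: ge0_le_integral => //.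
  - by move=> y _; rewrite lee_fin nrm_ge0.
  - apply/measurable_EFinP; apply: measurable_funS (strongly_measurable_nrm mF) => //.
  - apply: emeasurable_funD; first exact: measurable_cst.
    exact: measurable_funS (measurable_nrmX p mF).
  move=> y _; rewrite -EFinD lee_fin; set u := nrm (F y).
  have u0 : 0 <= u by exact: nrm_ge0.
  have [u1|u1] := leP u 1; first by rewrite (le_trans u1)// lerDl powR_ge0.
  rewrite -[leLHS](powRr1 u0) (@le_trans _ _ (u `^ p))// ?lerDr//.
  by apply: ler_powR; exact: ltW.
rewrite ge0_integralD//; last 2 first.
- by move=> y _; rewrite lee_fin powR_ge0.
- exact: measurable_funS (measurable_nrmX p mF).
rewrite integral_cst// mul1e lte_add_pinfty// ?dy_lty//.
have := FL; move/asboolP => [_]; rewrite BNorm_lty//; apply: le_lt_trans.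
apply: ge0_subset_integral => //.
- exact: (measurable_nrmX p mF).
- by move=> y _; rewrite lee_fin powR_ge0.
Qed.

Lemma integral_indic_nrm (B : set T) (F : T -> Y) :
  (\int[mu]_y (nrm (\1_B y *: F y))%:E = \int[mu]_(y in B) (nrm (F y))%:E)%E.
Proof.
rewrite [RHS]integral_mkcond; apply: eq_integral => y _; rewrite patchE nrm_indic indicE.
by case: ifP; rewrite ?mul1r ?mul0r.
Qed.

Lemma ball_bochner k x (F : T -> Y) : F \in BLfun mu p ->
  has_bochner mu (fun y => \1_(ball k x) y *: F y) (bochner mu (ball k x) F).
Proof.
move=> FL; have mF := BLfun_sm FL; have mB := dy_measurable Dy k x.
have [v hv] : exists v, has_bochner mu (fun y => \1_(ball k x) y *: F y) v.
  apply: bochner_exists => //; first exact: smeas_restrict.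
  by rewrite integral_indic_nrm; exact: ball_integral_lty.
by rewrite (bochnerE hv).
Qed.

Lemma avg_const k x y (F : T -> Y) : ball k x y -> avg k F y = avg k F x.
Proof. by move=> /(dy_eq Dy) e; rewrite /avg e. Qed.

Lemma avgDZ k x (a : R[i]) (F G : T -> Y) : F \in BLfun mu p -> G \in BLfun mu p ->
  avg k (fun y => a *: F y + G y) x = a *: avg k F x + avg k G x.
Proof.
move=> FL GL; rewrite /avg scalerA mulrC -scalerA -scalerDr; congr (_ *: _).
apply: bochnerE.
have := bochnerDZ a (ball_bochner k x FL) (ball_bochner k x GL).
by apply: bochner_eq => y; rewrite scalerDr !scalerA mulrC.
Qed.

Lemma nrm_avg_le k x (F : T -> Y) : F \in BLfun mu p -> exists t : R, [/\ 0 <= t,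
  (\int[mu]_(y in ball k x) (nrm (F y))%:E = (t * N ^ (- k))%:E)%E & nrm (avg k F x) <= t].
Proof.
move=> FL; have I0 := ball_integral_lty k x FL.
have Ige : (0 <= \int[mu]_(y in ball k x) (nrm (F y))%:E)%E.
  by apply: integral_ge0 => y _; rewrite lee_fin nrm_ge0.
pose I := fine (\int[mu]_(y in ball k x) (nrm (F y))%:E)%E.
have IE : (\int[mu]_(y in ball k x) (nrm (F y))%:E = I%:E)%E.
  by rewrite /I fineK// ge0_fin_numE.
have w0 := dy_wgt0 k.
exists (N ^ k * I); split.
- by rewrite mulr_ge0 ?(ltW w0)// fine_ge0.
- by rewrite IE mulrAC -expfzDr ?(gt_eqF dy_N0)// subrr expr0z mul1r.
- rewrite /avg nrmZr (gtr0_norm w0) ler_pM2l// -lee_fin -IE -integral_indic_nrm.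
  exact: nrm_bochner (ball_bochner k x FL).
Qed.

Lemma avg_smeas k (F : T -> Y) : F \in BLfun mu p ->
  smeas mu (avg k F).
Proof.
move=> FL; have [s [cell [mc tc bc hc]]] := dy_cells k.
exists (fun n => [seq (cell i, avg k F (s i)) | i <- iota 0 n]); split.
  move=> n a /mapP[i _ ->] /=; split; first exact: mc.
  have [->|/set0P[x /hc ->]] := eqVneq (cell i) set0; first by rewrite measure0.
  exact: dy_lty.
move=> x; have : [set: T] x by []. rewrite -bc => -[i0 _ xi0].
apply: cvg_near_cst; exists i0.+1 => // n /= hn.
rewrite /sfun_eval big_map (bigD1_seq i0) ?mem_iota ?iota_uniq//= big1.
  rewrite addr0 indicE mem_set// scale1r; apply: esym; apply: avg_const.
  by rewrite -(hc _ _ xi0).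
move=> j ji; rewrite indicE memNset ?scale0r// => xj.
by move/negP: ji; apply; apply/eqP; apply: (tc j i0) => //; exists x.
Qed.

Lemma avg_pint k (F : T -> Y) : F \in BLfun mu p -> (pint mu p (avg k F) <= pint mu p F)%E.
Proof.
move=> FL; have [s [cell [mc tc bc hc]]] := dy_cells k.
have mA := avg_smeas k FL; have mF := BLfun_sm FL.
have mAp := measurable_nrmX p mA; have mFp := measurable_nrmX p mF.
have split_int (G : T -> Y) : measurable_fun setT (fun x => ((nrm (G x)) `^ p)%:E) ->
    (pint mu p G = \sum_(i <oo) \int[mu]_(x in cell i) ((nrm (G x)) `^ p)%:E)%E.
  move=> mG; rewrite /pint -{1}bc ge0_integral_bigcup//.
  - exact: measurable_funS mG.
  - by move=> x _; rewrite lee_fin powR_ge0.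
rewrite (split_int _ mAp) (split_int _ mFp); apply: lee_nneseries => [i *|i _].
  by apply: integral_ge0 => x _; rewrite lee_fin powR_ge0.
have [->|/set0P[x0 /hc ->]] := eqVneq (cell i) set0; first by rewrite !integral_set0.
have [t [t0 It avt]] := nrm_avg_le k (s i) FL.
have mB := dy_measurable Dy k (s i).
have h := jensen_ball p1 (strongly_measurable_nrm mF) (fun x => nrm_ge0 (F x)) mB
  (dy_measure Dy k (s i)) (dy_wgt0 _) t0 It.
apply: le_trans h.
rewrite (eq_integral (fun=> (nrm (avg k F (s i)) `^ p)%:E)).
  rewrite integral_cst// (dy_measure Dy) -EFinM lee_fin ler_pM2r ?dy_wgt0//.
  by apply: ge0_ler_powR; rewrite ?nnegrE ?nrm_ge0// (le_trans ler01).
by move=> x; rewrite inE => /avg_const ->.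
Qed.

Lemma avg_BNorm k (F : T -> Y) : F \in BLfun mu p -> (BNorm mu p (avg k F) <= BNorm mu p F)%E.
Proof.
move=> FL; rewrite !BNormE; apply: gt0_ler_poweR.
- by rewrite invr_ge0 (le_trans ler01).
- by rewrite in_itv /= leey andbT pint_ge0.
- by rewrite in_itv /= leey andbT pint_ge0.
- exact: avg_pint.
Qed.

Lemma avg_BLfun k (F : T -> Y) : F \in BLfun mu p -> avg k F \in BLfun mu p.
Proof.
move=> FL; apply/asboolP; split; first exact: avg_smeas.
by apply: le_lt_trans (avg_BNorm k FL) _; move/asboolP: FL => [].
Qed.

Lemma avg_ae k (F G : T -> Y) : F \in BLfun mu p -> G \in BLfun mu p ->
  {ae mu, forall x, F x = G x} -> avg k F = avg k G.
Proof.
move=> FL GL FG; apply/funext => x; rewrite /avg; congr (_ *: _).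
have h := bochnerB (ball_bochner k x FL) (ball_bochner k x GL).
have := nrm_bochner h.
rewrite (_ : (\int[mu]_y _)%E = 0%E).
  rewrite lee_fin => h0; apply/eqP; rewrite -subr_eq0; apply/eqP/nrm_eq0.
  by apply/eqP; rewrite eq_le h0 nrm_ge0.
rewrite (@ge0_ae_eq_integral _ _ _ mu setT _ (cst 0%E)) ?integral0//.
- exact: measurable_enrm h.1.
- by move=> y _; rewrite lee_fin nrm_ge0.
apply: filterS FG => y -> _.
by rewrite subrr nrm0.
Qed.

Local Notation X := (BLp Y mu p1').

Definition condE k (u : X) : X :=
  BLclass (toBL p1' (avg_BLfun k (BLval_BLfun (repr u)))).

Lemma in_class_condE k u (F : T -> Y) : F \in BLfun mu p -> in_class u F ->
  in_class (condE k u) (avg k F).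
Proof.
move=> FL uF; have ur : in_class u (repr u).
  by rewrite -{1}(sep_reprK u); exact: in_class_BLclass.
have e := in_class_ae_eq uF ur.
rewrite /condE; have := in_class_toBL p1' (avg_BLfun k (BLval_BLfun (repr u))).
by rewrite (avg_ae k FL (BLval_BLfun (repr u)) e).
Qed.

Lemma condE_linear k (a : R[i]) u v : condE k (a *: u + v) = a *: condE k u + condE k v.
Proof.
have [f [fL uf]] := in_class_exists u; have [g [gL vg]] := in_class_exists v.
have h := in_classDZ a uf vg.
have hL : (fun x => a *: f x + g x) \in BLfun mu p.
  by have := BLfun_submod_closed Y mu p1' => -[_]; apply.
have h1 := in_class_condE k hL h.
apply: (in_class_inj h1).
have := in_classDZ a (in_class_condE k fL uf) (in_class_condE k gL vg).
by under eq_fun do rewrite -avgDZ//.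
Qed.

Lemma condE_contraction k u : nrm (condE k u) <= nrm u.
Proof.
have [f [fL uf]] := in_class_exists u.
rewrite -lee_fin (nrm_in_class uf (BLfun_sm fL)).
rewrite (nrm_in_class (in_class_condE k fL uf) (avg_smeas k fL)).
exact: avg_BNorm.
Qed.

Local Notation bs := (seq ((int * T) * Y)).
Local Notation E := condE.
Let N0 := dy_N0.

Definition bsf (l : bs) : Defs.sfun Y T := [seq (ball b.1.1 b.1.2, b.2) | b <- l].

Lemma bsf_over l : sfun_over measurable mu (bsf l).
Proof.
move=> a /mapP[b _ ->] /=; split; [exact: dy_measurable Dy _ _|exact: dy_lty _ _].
Qed.

(** Finite combinations of indicators of balls are stable under averaging, with explicit
    coefficients: a ball of level m > k spreads over the ball of level k around it with weight N^(k
    - m), a larger ball is left alone. Relations between averages are checked here and extended by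
    density. *)
Definition bs_avg k (l : bs) : bs :=
  [seq ((Order.min k b.1.1, b.1.2), (N ^ (Order.min k b.1.1 - b.1.1))%:C *: b.2) | b <- l].


Lemma sfun_BLfun_sub (s : Defs.sfun Y T) : sfun_over measurable mu s -> seval s \in BLfun mu p.
Proof. exact: sfun_BLfun p1' _. Qed.

Lemma avg_ball k m z (y : Y) x :
  avg k (fun w => \1_(ball m z) w *: y) x =
  \1_(ball (Order.min k m) z) x *: ((N ^ (Order.min k m - m))%:C *: y).
Proof.
have hB : has_bochner mu (fun w => \1_(ball k x) w *: (\1_(ball m z) w *: y))
    ((fine (mu (ball m z `&` ball k x)))%:C *: y).
  have ov : sfun_over measurable mu ([:: (ball m z `&` ball k x, y)] : Defs.sfun Y T).
    move=> a; rewrite inE => /eqP -> /=; split.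
      by apply: measurableI; exact: dy_measurable Dy _ _.
    apply: le_lt_trans (dy_lty k x); apply: le_measure; rewrite ?inE.
    - by apply: measurableI; exact: dy_measurable Dy _ _.
    - exact: dy_measurable Dy _ _.
    - exact: subIsetr.
  have := bochner_sfun ov.
  rewrite /sfun_integral big_seq1; apply: bochner_eq => w.
  rewrite /sfun_eval big_seq1 scalerA; congr (_ *: _).
  by rewrite !indicE in_setI; case: (_ \in _); case: (_ \in _); rewrite /= ?mulr0 ?mulr1.
rewrite /avg (bochnerE hB) scalerA -rmorphM [RHS]scalerA.
congr (_ *: _); case: (leP k m) => km.
  rewrite indicE; case: (boolP (x \in _)) => hx.
    rewrite mul1r (_ : _ `&` _ = ball m z); first by rewrite (dy_measure Dy) /= -expfzDr// gt_eqF.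
    apply/setIidPl => w hw; move/set_mem : hx => hx.
    by rewrite (dy_eq Dy hx); exact: dy_subset _ _ _ km _ hw.
  rewrite mul0r (_ : _ `&` _ = set0) ?measure0 ?mulr0//.
  apply/seteqP; split=> // w [hw xw]; move/negP: hx; apply; apply/mem_set.
  have := dy_subset km hw => zw.
  by rewrite (dy_disjoint zw xw); exact: dy_refl Dy _ _.
rewrite subrr expr0z mulr1 indicE; case: (boolP (x \in _)) => hx.
  rewrite (_ : _ `&` _ = ball k x).
    by rewrite (dy_measure Dy) /= -expfzDr ?gt_eqF// subrr expr0z.
  apply/setIidPr => w hw; move/set_mem : hx => hx.
  by rewrite -(dy_eq Dy hx); exact: dy_subset _ _ _ (ltW km) _ hw.
rewrite (_ : _ `&` _ = set0) ?measure0 ?mulr0//.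
apply/seteqP; split=> // w [hw xw]; move/negP: hx; apply; apply/mem_set.
have := dy_subset (ltW km) xw => mxw.
by rewrite (dy_disjoint hw mxw); exact: dy_refl Dy _ _.
Qed.

Lemma avg_bs k l : avg k (seval (bsf l)) = seval (bsf (bs_avg k l)).
Proof.
elim: l => [|b l IH]; apply/funext => x.
  rewrite /avg (_ : bochner _ _ _ = 0) ?scaler0 ?/sfun_eval ?big_nil//.
  apply: bochnerE; apply: bochner_eq (bochner0 Y mu) => w.
  by rewrite /sfun_eval big_nil scaler0.
rewrite /= seval_cons -IH /= -avg_ball.
have L1 : (fun w => \1_(ball b.1.1 b.1.2) w *: b.2) \in BLfun mu p.
  have := sfun_BLfun_sub (@bsf_over [:: b]).
  rewrite (_ : seval _ = fun w => \1_(ball b.1.1 b.1.2) w *: b.2)//.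
  by apply/funext => w; rewrite /sfun_eval big_seq1.
have := avgDZ k x 1 L1 (sfun_BLfun_sub (@bsf_over l)).
rewrite scale1r => <-; congr (avg _ _ _); apply/funext => w.
by rewrite seval_cons scale1r.
Qed.

Definition bs_class (l : bs) : X := BLclass (toBL p1' (sfun_BLfun_sub (@bsf_over l))).

Lemma in_class_bs l : in_class (bs_class l) (seval (bsf l)).
Proof. exact: in_class_toBL. Qed.

Lemma condE_bs k l : E k (bs_class l) = bs_class (bs_avg k l).
Proof.
apply: (@in_class_inj _ _ _ _ _ _ _ _ _ (seval (bsf (bs_avg k l)))); last exact: in_class_bs.
by rewrite -avg_bs; apply: in_class_condE; [exact: sfun_BLfun_sub (@bsf_over l)|exact: in_class_bs].
Qed.

Lemma bs_class_cons b l : bs_class (b :: l) = bs_class [:: b] + bs_class l.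
Proof.
have := in_classDZ 1 (in_class_bs [:: b]) (in_class_bs l); rewrite scale1r => h.
apply: in_class_inj (in_class_bs _) _.
apply: in_class_ae h _; apply: aeW => x; rewrite scale1r.
by rewrite /= !seval_cons seval_nil addr0.
Qed.

Lemma bs_avg_comp j k l : bs_avg j (bs_avg k l) = bs_avg (Order.min j k) l.
Proof.
rewrite /bs_avg -map_comp; apply: eq_map => -[[m z] y] /=.
rewrite minA scalerA -rmorphM -expfzDr ?gt_eqF//.
by rewrite addrA subrK.
Qed.

Lemma bs_avg_id l : exists n0 : nat, forall n : nat, (n0 <= n)%N -> bs_avg n%:Z l = l.
Proof.
elim: l => [|[[m z] y] l [n0 IH]]; first by exists 0%N.
exists (maxn n0 (absz m)) => n; rewrite geq_max => /andP[/IH /= -> mn].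
have -> : Order.min n%:Z m = m by apply/min_idPr; lia.
by rewrite subrr expr0z scale1r.
Qed.

Lemma pint_indic (B : set T) (v : Y) : measurable B ->
  pint mu p (fun x => \1_B x *: v) = ((nrm v `^ p)%:E * mu B)%E.
Proof.
move=> mB; rewrite /pint -(integral_cst mu mB); rewrite [RHS]integral_mkcond.
apply: eq_integral => x _; rewrite patchE nrm_indic indicE; case: ifP => _; first by rewrite mul1r.
by rewrite mul0r powR0// gt_eqF// (lt_trans ltr01).
Qed.

Lemma pint_diff_indic (A V : set T) (v : Y) : measurable A -> measurable V ->
  (pint mu p (fun x => (\1_A x - \1_V x) *: v) <= (nrm v `^ p)%:E * (mu (A `\` V) + mu (V `\` A)))%E.
Proof.
move=> mA mV.
have mAV : measurable (A `\` V) by exact: measurableD.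
have mVA : measurable (V `\` A) by exact: measurableD.
have tI : [disjoint A `\` V & V `\` A]%classic.
  by rewrite disj_set2E; apply/eqP/seteqP; split=> // x [[? ?] [? ?]].
rewrite -measureU//; last by apply/eqP; rewrite -disj_set2E.
rewrite -pint_indic; last exact: measurableU.
apply: eqW; apply: eq_integral => x _.
congr (_ `^ p)%:E; rewrite nrmZ [RHS]nrm_indic; congr (_ * _).
rewrite !indicE in_setU !in_setD; case: (x \in A); case: (x \in V) => /=.
- by rewrite subrr nrm0.
- by rewrite subr0 (nrm_real 1) normr1.
- by rewrite sub0r nrmN (nrm_real 1) normr1.
- by rewrite subrr nrm0.
Qed.

(** One third of the error is spent on each of three steps: from A to U by outer regularity, from U
    to the union of its balls of one level, and from that union to finitely many of them. *)
Lemma ball_approx (A : set T) (e : R) : measurable A -> (mu A < +oo)%E -> 0 < e ->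
  exists (l : seq (int * T)) (V : set T), [/\ measurable V,
    forall x, \sum_(b <- l) \1_(ball b.1 b.2) x = \1_V x :> R[i] &
    (mu (A `\` V) + mu (V `\` A) <= e%:E)%E].
Proof.
move=> mA Alt e0; have e3 : 0 < e / 3 by rewrite divr_gt0.
have [U [mU AU UA Ub]] := dy_regular Dy mA Alt e3.
have Ult : (mu U < +oo)%E.
  rewrite (_ : U = A `|` (U `\` A)); last by rewrite setDUK.
  apply: (@le_lt_trans _ _ (mu A + mu (U `\` A))%E); first by apply: measureU2 => //; exact: measurableD.
  by rewrite lte_add_pinfty// (lt_trans UA) ?ltry.
(* [V <= W] up to [e / 3], for an increasing sequence with union [W] *)
have approx (F : nat -> set T) (W : set T) : (forall n, measurable (F n)) -> nondecreasing_seq F ->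
    \bigcup_n F n = W -> (mu W < +oo)%E -> exists n, (mu (W `\` F n) <= (e / 3)%:E)%E.
  move=> mF ndF FW Wlt; have mW : measurable W by rewrite -FW; exact: bigcup_measurable.
  have c : mu \o F @ \oo --> mu W.
    by rewrite -FW; apply: nondecreasing_cvg_mu => //; rewrite FW.
  have Wfin : mu W \is a fin_num by rewrite ge0_fin_numE.
  move: c; rewrite -{1}(fineK Wfin) => /fine_cvgP[fin /cvgrPdist_le/(_ _ e3) h].
  have [n _ /(_ n (leqnn n)) [h1 h2]] : \forall n \near \oo, mu (F n) \is a fin_num /\
      `|fine (mu W) - fine (mu (F n))| <= e / 3 by apply: filterS2 fin h => n.
  exists n; have WF : W `&` F n = F n.
    by apply/setIidPr => x Fx; rewrite -FW; exists n.
  rewrite measureD// WF.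
  have : ((fine (mu W) - fine (mu (F n)))%:E <= (e / 3)%:E)%E.
    by rewrite lee_fin (le_trans (ler_norm _) h2).
  by rewrite EFinB !fineK.
pose Um (m : nat) := [set x | ball m%:Z x `<=` U].
have Umc m : exists (s : nat -> T) (cell : nat -> set T), [/\ forall i, measurable (cell i), trivIset setT cell,
    forall i x, cell i x -> cell i = ball m%:Z (s i) &
    \bigcup_i (cell i : set T) = Um m].
  have [s [cell [mc tc bc hc]]] := dy_cells m%:Z.
  exists s, (fun i => if `[< cell i `<=` U >] then cell i else set0); split.
  - by move=> i; case: ifP.
  - move=> i j _ _ [x []]; case: ifP => // _ xi; case: ifP => // _ xj.
    by apply: tc => //; exists x.
  - by move=> i x; case: ifP => // _; exact: hc.
  apply/seteqP; split=> [x [i _]|x Ux].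
    case: asboolP => // ciU xi; rewrite /Um /=; have cE := hc i x xi.
    by rewrite cE in ciU xi; rewrite (dy_eq Dy xi).
  have : [set: T] x by []. rewrite -bc => -[i _ xi]; exists i => //.
  have cE := hc i x xi; rewrite asboolT//; move: Ux; rewrite /Um /= cE.
  by rewrite cE in xi; rewrite (dy_eq Dy xi).
have mUm m : measurable (Um m).
  by have [s [cell [mc _ _ <-]]] := Umc m; exact: bigcup_measurable.
have UmU m : Um m `<=` U by move=> x; apply; exact: dy_refl Dy _ _.
have ndU : nondecreasing_seq Um.
  move=> m n mn; apply/subsetPset => x h y hy; apply: h.
  by apply: dy_subset _ _ _ _ _ hy; rewrite lez_nat.
have bU : \bigcup_m Um m = U.
  apply/seteqP; split=> [x [m _ /UmU]//|x /Ub[m hm]]; by exists m.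
have [m hm] := approx Um U mUm ndU bU Ult.
have [s [cell [mc tc hc cU]]] := Umc m.
pose V n := \big[setU/set0]_(i < n) cell i.
have mV n : measurable (V n) by apply: bigsetU_measurable.
have ndV : nondecreasing_seq V.
  by move=> a b ab; apply/subsetPset; exact: subset_bigsetU.
have bV : \bigcup_n V n = Um m.
  rewrite -cU; apply/seteqP; split=> [x [n _]|x [i _ xi]].
    by rewrite /V -(bigcup_mkord n cell) => -[i _ xi]; exists i.
  by exists i.+1 => //; rewrite /V -(bigcup_mkord i.+1 cell); exists i => /=.
have Umlt : (mu (Um m) < +oo)%E.
  by apply: le_lt_trans Ult; apply: le_measure; rewrite ?inE.
have [n hn] := approx V (Um m) mV ndV bV Umlt.
exists [seq (m%:Z, s i) | i <- iota 0 n & cell i != set0], (V n); split=> //.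
  move=> x; rewrite big_map big_filter.
  have indc i : cell i != set0 -> \1_(ball m%:Z (s i)) x = \1_(cell i) x :> R[i].
    by move=> /set0P[y yi]; rewrite (hc i y yi).
  under eq_bigr => i ci do rewrite indc//.
  rewrite [RHS]indicE; case: (boolP (x \in V n)) => [/set_mem|xV].
    rewrite /V -(bigcup_mkord n cell) => -[i0 /= i0n xi].
    rewrite -big_filter (bigD1_seq i0)/=; last 2 first.
    - rewrite mem_filter; apply/andP; split; last by rewrite mem_iota.
      by apply/set0P; exists x.
    - by rewrite filter_uniq// iota_uniq.
    rewrite big1 ?addr0; first by rewrite indicE mem_set.
    move=> j ji; rewrite indicE memNset// => xj.
    by move/negP: ji; apply; apply/eqP; apply: (tc j i0) => //; exists x.
  rewrite big_seq_cond big1// => i /andP[]; rewrite mem_iota add0n => /andP[_ ni] _.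
  rewrite indicE memNset// => xi; move/negP: xV; apply; apply/mem_set.
  by rewrite /V -(bigcup_mkord n cell); exists i.
have VU : V n `<=` U by move=> x Vx; apply: (UmU m); rewrite -bV; exists n.
have s1 : A `\` V n `<=` (U `\` Um m) `|` (Um m `\` V n).
  move=> x [Ax nV]; have [Ux|nU] := pselect (Um m x); first by right.
  by left; split=> //; exact: AU.
have -> : e%:E = ((e / 3)%:E + (e / 3)%:E + (e / 3)%:E)%E by rewrite -!EFinD; congr _%:E; field.
apply: leeD.
  have mD1 : measurable (U `\` Um m) by exact: measurableD.
  have mD2 : measurable (Um m `\` V n) by exact: measurableD.
  apply: (@le_trans _ _ (mu (U `\` Um m `|` Um m `\` V n))); last first.
    apply: (@le_trans _ _ (mu (U `\` Um m) + mu (Um m `\` V n))%E); last exact: leeD.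
    exact: measureU2.
  by apply: le_measure => //; rewrite inE; [exact: measurableD|exact: measurableU].
apply: le_trans (ltW UA); apply: le_measure; rewrite ?inE; [exact: measurableD|exact: measurableD|].
by move=> x [/VU].
Qed.

Lemma bs_dense (u : X) (e : R) : 0 < e -> exists l, nrm (u - bs_class l) <= e.
Proof.
move=> e0; have e2 : 0 < e / 2 by rewrite divr_gt0.
have [s [sS hs]] := simple_approx_class u e2.
suff [l hl] : exists l, forall G, in_class G (seval s) -> nrm (G - bs_class l) <= e / 2.
  exists l; have [G GG] : exists G : X, in_class G (seval s).
    by exists (BLclass (toBL p1' (sfun_BLfun_sub sS))); exact: in_class_toBL.
  by rewrite (le_trans (ler_nrm_dist G _ _))// (splitr e) lerD ?hs ?hl.
elim: s sS (e / 2) e2 {hs} => [|[A y] s IH] sS e' e'0.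
  exists [::] => G GG.
  rewrite (in_class_inj GG (in_class_bs [::])) subrr nrm0; exact: ltW.
have [/= mA Alt sS'] := sfun_over_cons sS.
have e'2 : 0 < e' / 2 by rewrite divr_gt0.
have [l1 hl1] := IH sS' _ e'2.
have p0 : 0 < p := lt_trans ltr01 p1.
(* A measure error of c costs at most |y|^p c <= (e' / 2)^p in the p-th power of the norm. *)
pose c := (e' / 2) `^ p / (1 + nrm y `^ p).
have c0 : 0 < c by rewrite divr_gt0 ?powR_gt0// ltr_pwDl// powR_ge0.
have [l [V [mV hV hm]]] := ball_approx mA Alt c0.
pose l2 : bs := [seq (b, y) | b <- l].
have l2E x : seval (bsf l2) x = \1_V x *: y.
  rewrite -hV /sfun_eval /bsf /l2 -map_comp big_map scaler_suml.
  by apply: eq_bigr.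
exists (l2 ++ l1) => G GG.
have [f [fL _]] : exists f, f \in BLfun mu p /\ f = seval s.
  by exists (seval s); split=> //; exact: sfun_BLfun_sub.
pose G1 := BLclass (toBL p1' (sfun_BLfun_sub sS')) : X.
have G1c : in_class G1 (seval s) by exact: in_class_toBL.
have sS1 : sfun_over measurable mu ([:: (A, y)] : Defs.sfun Y T).
  by move=> a; rewrite inE => /eqP ->.
pose G2 := BLclass (toBL p1' (sfun_BLfun_sub sS1)) : X.
have G2c : in_class G2 (fun x => \1_A x *: y).
  apply: in_class_ae (in_class_toBL p1' (sfun_BLfun_sub sS1)) _; apply: aeW => x.
  by rewrite /sfun_eval big_seq1.
have GE : G = G2 + G1.
  apply: in_class_inj GG _; have := in_classDZ 1 G2c G1c; rewrite scale1r => h.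
  by apply: in_class_ae h _; apply: aeW => x; rewrite scale1r seval_cons.
have lE : bs_class (l2 ++ l1) = bs_class l2 + bs_class l1.
  elim: (l2) => [|b l' IHl]; last by rewrite cat_cons bs_class_cons IHl addrA -bs_class_cons.
  apply: (addIr (- bs_class l1)); rewrite addrK subrr.
  apply: (@in_class_inj _ _ _ _ _ _ _ _ _ (seval (bsf [::]))); last exact: in_class_bs.
  have := in_classB (in_class_bs l1) (in_class_bs l1); rewrite subrr => h.
  by apply: in_class_ae h _; apply: aeW => x; rewrite subrr /sfun_eval big_nil.
rewrite GE lE opprD addrACA (le_trans (ler_nrmD _ _))// (splitr e') lerD//; last exact: hl1.
have hc := in_classB G2c (in_class_bs l2).
have dL : smeas mu (fun x => \1_A x *: y - seval (bsf l2) x).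
  apply: smeasB; last exact: smeas_sfun (@bsf_over l2).
  have := smeas_sfun sS1.
  rewrite (_ : seval _ = fun x => \1_A x *: y)//.
  by apply/funext => x; rewrite /sfun_eval big_seq1.
rewrite -lee_fin (nrm_in_class hc dL) BNorm_le// ?(ltW e'2)//.
under eq_fun do rewrite l2E -scalerBl.
apply: le_trans (pint_diff_indic y mA mV) _.
apply: (@le_trans _ _ ((nrm y `^ p)%:E * c%:E)%E).
  by apply: lee_wpmul2l => //; rewrite lee_fin powR_ge0.
have q0 : 0 < 1 + nrm y `^ p by rewrite ltr_pwDl// powR_ge0.
rewrite -EFinM lee_fin /c mulrCA ger_pMr ?powR_gt0//.
by rewrite ler_pdivrMr// mul1r lerDr.
Qed.

(** Extension by density from combinations of balls, phrased for a functional with a Lipschitz-type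
    bound, which covers both operator identities and the UMD inequality. *)
Lemma bs_limit (P : X -> R) (c : R) : 0 <= c ->
  (forall u v, P u <= P v + c * nrm (u - v)) -> (forall l, P (bs_class l) <= 0) ->
  forall u, P u <= 0.
Proof.
move=> c0 hP hl u; apply/ler_addgt0Pr => e e0; rewrite add0r.
have c1 : 0 < c + 1 by rewrite ltr_wpDl.
have [l ul] := bs_dense u (divr_gt0 e0 c1).
apply: le_trans (hP u (bs_class l)) _.
have h : c * nrm (u - bs_class l) <= e.
  apply: (@le_trans _ _ ((c + 1) * (e / (c + 1)))).
    by apply: ler_pM => //; [exact: nrm_ge0|rewrite lerDl].
  by rewrite mulrC divfK// gt_eqF.
by rewrite -[leRHS]add0r lerD.
Qed.

Lemma condEB k u v : E k (u - v) = E k u - E k v.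
Proof.
by have := condE_linear k (-1) v u; rewrite !scaleN1r addrC => ->; rewrite addrC.
Qed.

Lemma condE_min j k u : E j (E k u) = E (Order.min j k) u.
Proof.
apply/eqP; rewrite -subr_eq0; apply/eqP/nrm_eq0/eqP; rewrite eq_le nrm_ge0 andbT.
move: u; apply: (@bs_limit (fun u => nrm (E j (E k u) - E (Order.min j k) u)) 2) => //.
  move=> u v.
  have -> : E j (E k u) - E (Order.min j k) u = (E j (E k v) - E (Order.min j k) v) +
      (E j (E k (u - v)) - E (Order.min j k) (u - v)).
    rewrite !condEB; set a := E j (E k u); set b := E j (E k v).
    set a' := E _ u; set b' := E _ v.
    rewrite [X in _ = _ + X](_ : _ = (a - a') - (b - b')); last first.
      by rewrite !opprD !opprK addrACA.
    by rewrite [RHS]addrC subrK.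
  rewrite (le_trans (ler_nrmD _ _))// lerD2l (le_trans (ler_nrmB _ _))//.
  have h1 := condE_contraction j (E k (u - v)).
  have h2 := condE_contraction k (u - v).
  have h3 := condE_contraction (Order.min j k) (u - v).
  by lra.
by move=> l; rewrite !condE_bs bs_avg_comp subrr nrm0.
Qed.

Lemma condE_up u : E n%:Z u @[n --> \oo] --> u.
Proof.
apply/cvg_nrmP/cvgrPdist_le => e e0.
have e2 : 0 < e / 2 by rewrite divr_gt0.
have [l ul] := bs_dense u e2.
have [n0 hn] := bs_avg_id l.
exists n0 => // n /= n0n; rewrite sub0r normrN ger0_norm ?nrm_ge0//.
have -> : E n%:Z u - u = E n%:Z (u - bs_class l) + (bs_class l - u).
  by rewrite condEB condE_bs hn// addrA subrK.
rewrite (le_trans (ler_nrmD _ _))// (splitr e) lerD//; last by rewrite nrmBC.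
by rewrite (le_trans (condE_contraction _ _)).
Qed.

Lemma nrm_bs1 k z y : nrm (bs_class [:: ((k, z), y)]) = nrm y * (N ^ (- k)) `^ p^-1.
Proof.
have p0 : 0 < p := lt_trans ltr01 p1.
apply: EFin_inj.
rewrite (nrm_in_class (in_class_bs _) (smeas_sfun (@bsf_over _))) BNormE.
have -> : seval (bsf [:: ((k, z), y)]) = fun x => \1_(ball k z) x *: y.
  by apply/funext => x; rewrite /sfun_eval big_seq1.
rewrite pint_indic; last exact: dy_measurable Dy _ _.
rewrite (dy_measure Dy) -EFinM poweR_EFin powRM ?powR_ge0 ?(ltW (dy_wgt0 _))//.
by rewrite -powRrM divff ?powRr1 ?nrm_ge0// gt_eqF.
Qed.

Lemma condE_down u : E (- n%:Z) u @[n --> \oo] --> (0 : X).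
Proof.
have nrm0l : bs_class [::] = 0.
  have := in_classB (in_class_bs [::]) (in_class_bs [::]); rewrite subrr => h.
  apply/esym; apply: in_class_inj (in_class_bs [::]); apply: in_class_ae h _; apply: aeW => x.
  by rewrite subrr /sfun_eval big_nil.
have h l : (fun n => nrm (E (- n%:Z) (bs_class l))) @ \oo --> (0 : R).
  elim: l => [|[[m z] y] l IH].
    under eq_fun do rewrite condE_bs /bs_avg /= nrm0l nrm0.
    exact: cvg_cst.
  (* This is N^(1/p - 1), the factor by which the norm of the average of the indicator of a ball
     shrinks at each coarser level; it is below 1 because p > 1. *)
  pose r := N ^ (-1) * N `^ p^-1.
  have r0 : 0 <= r by rewrite mulr_ge0 ?powR_ge0// ltW// (dy_wgt0).
  have r1 : r < 1.
    rewrite /r -invr_expz expr1z -powR_inv1 ?ltW// -powRD ?(gt_eqF N0) ?implybT//.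
    rewrite /powR (gt_eqF N0) -[ltRHS]expR0 ltr_expR nmulr_rlt0 ?ln_gt0 ?(dy_gt1 Dy)//.
    by rewrite addrC subr_lt0 invf_lt1// (lt_trans ltr01).
  have rc : (fun n => (N ^ (- m) * nrm y) * r ^+ n) @ \oo --> (0 : R).
    rewrite -(mulr0 (N ^ (- m) * nrm y)); apply: cvgM; first exact: cvg_cst.
    by apply: cvg_expr; rewrite ger0_norm.
  have s := @cvgD _ _ _ \oo eventually_filter _ _ _ _ rc IH; rewrite addr0 in s.
  apply: cvg0_le s; exists (absz m) => // n /= mn; rewrite nrm_ge0 /=.
  rewrite bs_class_cons (_ : E _ (_ + _) = E (- n%:Z) (bs_class [:: ((m, z), y)]) + E (- n%:Z) (bs_class l)).
    rewrite (le_trans (ler_nrmD _ _))// lerD2r condE_bs /bs_avg /=.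
    have -> : Order.min (- n%:Z) m = - n%:Z by apply/min_idPl; lia.
    rewrite nrm_bs1 nrmZr gtr0_norm ?(dy_wgt0)// opprK.
    apply: eqW.
    rewrite addrC expfzDr ?gt_eqF// -!mulrA; congr (_ * _).
    rewrite mulrCA; congr (_ * _); rewrite /r exprMn; congr (_ * _).
      by rewrite -!invr_expz expr1z exprVn.
    by rewrite -exprnP -(powR_mulrn n (ltW N0)) -(powR_mulrn n (powR_ge0 _ _)) -!powRrM mulrC.
  have := condE_linear (- n%:Z) 1 (bs_class [:: ((m, z), y)]) (bs_class l).
  by rewrite !scale1r.
apply/cvg_nrmP/cvgrPdist_le => e e0.
have e2 : 0 < e / 2 by rewrite divr_gt0.
have [l ul] := bs_dense u e2.
have /cvgrPdist_le/(_ _ e2) := h l; apply: filterS => n.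
rewrite !sub0r !normrN !ger0_norm ?nrm_ge0// => hn; rewrite subr0.
have -> : E (- n%:Z) u = E (- n%:Z) (u - bs_class l) + E (- n%:Z) (bs_class l).
  by rewrite condEB subrK.
rewrite (le_trans (ler_nrmD _ _))// (splitr e) lerD//.
by rewrite (le_trans (condE_contraction _ _)).
Qed.

Lemma seval_bs (l : bs) x : seval (bsf l) x = \sum_(b <- l) \1_(ball b.1.1 b.1.2) x *: b.2.
Proof. by rewrite /sfun_eval /bsf big_map. Qed.

(** A single ball must carry the combination together with all its averages of level at least a, so
    that the restricted measure can be normalized to a probability. *)
Lemma common_ball (o : T) (a : int) (l : bs) : exists M : nat,
  forall b, b \in l -> ball (Order.min a b.1.1) b.1.2 `<=` ball (- M%:Z) o.
Proof.
elim: l => [|[[m z] y] l [M hM]]; first by exists 0%N.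
have [M' oz] := dy_exhaust Dy o z.
pose M1 := (M + M' + absz a + absz m)%N.
exists M1 => b; rewrite inE => /predU1P[->/=|bl].
  have oz1 : ball (- M1%:Z) o z by apply: dy_subset _ _ _ _ _ oz; rewrite /M1; lia.
  rewrite -(dy_eq Dy oz1); apply: dy_subset _ _ _ _; rewrite /M1.
  by case: leP; lia.
apply: subset_trans (hM b bl) _; apply: dy_subset _ _ _ _; rewrite /M1; lia.
Qed.

(** * The dyadic martingale inside one large ball *)

Section martingale.
Variables (o : T) (a : int) (l : bs) (M : nat).
Hypothesis hM : forall b, b \in l -> ball (Order.min a b.1.1) b.1.2 `<=` ball (- M%:Z) o.

Let B := ball (- M%:Z) o.
Let mB : measurable B := dy_measurable Dy _ _.
Let muB : mu B = (N ^ M%:Z)%:E. Proof. by rewrite (dy_measure Dy) opprK. Qed.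
Let b0 : 0 < N ^ M%:Z := dy_wgt0 _.
Let P : probability T R := mnormalize (mrestr mu mB) (dirac o : probability T R).
Let f (k : nat) := bsf (bs_avg (a + k%:Z) l).
(** The measurable unions of balls of level a + k. *)
Let Fil (k : nat) := [set A : set T | measurable A /\ forall x y, ball (a + k%:Z) x y -> A x -> A y].

Let Plty A : measurable A -> (P A < +oo)%E.
Proof. by move=> mA; apply: le_lt_trans (probability_le1 P mA) _; rewrite ltry. Qed.

Lemma dyadic_filtration : is_filtration Fil.
Proof.
split=> [k|k A [mA hA]]; last first.
  split=> // x y xy; apply: hA; apply: dy_subset _ _ _ _ _ xy; lia.
split; last by move=> A [].
split=> /=.
- by split=> //; exact: measurable0.
- move=> A [mA hA]; split; first exact: measurableD.
  move=> x y xy [_ nA]; split=> // Ay; apply: nA; apply: hA Ay; exact: dy_sym _ _ _ xy.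
move=> A hA; split; first by apply: bigcup_measurable => i _; exact: (hA i).1.
by move=> x y xy [i _ Ax]; exists i => //; exact: (hA i).2 xy Ax.
Qed.

Let f_over k : sfun_over (Fil k) P (f k).
Proof.
move=> b /mapP[c /mapP[[[m z] y] _ -> ->]] /=.
have mb := dy_measurable Dy (Order.min (a + k%:Z) m) z.
split; last exact: Plty.
split=> // x w xw zx; rewrite -(dy_eq Dy zx).
by apply: dy_subset _ _ _ _ _ xw; rewrite ge_min lexx.
Qed.

Let ball_in_B k b : b \in l -> ball (Order.min (a + k%:Z) b.1.1) b.1.2 `<=` B.
Proof.
move=> /hM; apply: subset_trans; apply: dy_subset _ _ _ _.
by case: (leP a b.1.1); case: leP => //; lia.
Qed.

Let f_off k x : ~ B x -> seval (f k) x = 0.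
Proof.
move=> Bx; rewrite seval_bs big_map big_seq big1// => b bl /=.
by rewrite indicE memNset ?scale0r// => /(ball_in_B bl).
Qed.

Let P_ball k z : ball k z `<=` B -> P (ball k z) = ((N ^ M%:Z)^-1 * N ^ (- k))%:E.
Proof.
by move=> /setIidPl h; rewrite (conditioned_probabilityE mB b0 muB) h (dy_measure Dy).
Qed.

Let f_avg k A : Fil k A -> bochner P A (seval (f k.+1)) = bochner P A (seval (f k)).
Proof.
move=> [mA hA].
have hb j : bochner P A (seval (f j)) = sfun_integral P (sfun_restrict A (f j)).
  apply: bochnerE.
  have fo : sfun_over measurable P (f j).
    by move=> c /f_over[[]].
  have := bochner_sfun (sfun_over_restrict mA fo).
  by apply: bochner_eq => x; rewrite seval_restrict.
rewrite !hb /sfun_integral /sfun_restrict /f /bsf /bs_avg !big_map !big_seq.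
apply: eq_bigr => -[[m z] y] bl /=; rewrite !scalerA -!rmorphM; congr (_%:C *: _).
have ak : a + k.+1%:Z = a + k%:Z + 1 by lia.
set c := a + k%:Z in ak hA *.
(* A ball at least as large as the level-c balls is untouched by both averages. Otherwise [A]
   contains the ball of level c around z or misses it, and the coefficients compensate the ratio of
   the two measures. *)
case: (leP m c) => mc.
  have h1 : Order.min c m = m by apply/min_idPr.
  by rewrite ak (_ : Order.min (c + 1) m = m) //; apply/min_idPr; lia.
have h1 : Order.min c m = c by apply/min_idPl/ltW.
have h2 : Order.min (c + 1) m = c + 1 by apply/min_idPl; lia.
have B0 := @ball_in_B k _ bl; have B1 := @ball_in_B k.+1 _ bl; rewrite ak /= -/c in B0 B1.
rewrite ak h1 h2 in B0 B1 *.
have [Az|nAz] := pselect (A z).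
  have s0 : ball c z `&` A = ball c z.
    by apply/setIidPl => x zx; exact: hA zx Az.
  have s1 : ball (c + 1) z `&` A = ball (c + 1) z.
    by apply/setIidPl => x /(dy_sub Dy) zx; exact: hA zx Az.
  rewrite s0 s1 (P_ball B0) (P_ball B1) /= -!mulrA -!expfzDr ?gt_eqF//.
  by congr (_ * N ^ _); lia.
have s0 : ball c z `&` A = set0.
  apply/seteqP; split=> // x [zx Ax]; apply: nAz; apply: hA Ax; exact: dy_sym _ _ _ zx.
have s1 : ball (c + 1) z `&` A = set0.
  apply/seteqP; split=> // x [/(dy_sub Dy) zx Ax]; apply: nAz; apply: hA Ax.
  exact: dy_sym _ _ _ zx.
by rewrite s0 s1 measure0 /= !mul0r.
Qed.

Lemma dyadic_martingale : Lp_martingale P p Fil (fun k => seval (f k)).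
Proof.
split=> [k|k A]; last exact: f_avg.
split.
  exists (fun=> f k); split; first by move=> _; exact: f_over.
  by move=> x; exact: cvg_cst.
have fo : sfun_over measurable P (f k) by move=> c /f_over[[]].
by have := sfun_BLfun p1' fo => /asboolP[].
Qed.

Let fsum_BNorm n (eps : nat -> R[i]) :
  BNorm P p (fun w => \sum_(k < n) eps k *: (seval (f k.+1) w - seval (f k) w)) =
  (((N ^ M%:Z)^-1 `^ p^-1)%:E *
    (nrm (\sum_(k < n) eps k *: (E (a + k.+1%:Z) (bs_class l) - E (a + k%:Z) (bs_class l))))%:E)%E.
Proof.
have cls : in_class (\sum_(k < n) eps k *: (E (a + k.+1%:Z) (bs_class l) - E (a + k%:Z) (bs_class l)))
    (fun w => \sum_(k < n) eps k *: (seval (f k.+1) w - seval (f k) w)).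
  elim: n => [|n IH].
    have := in_classB (in_class_bs ([::] : bs)) (in_class_bs ([::] : bs)); rewrite subrr => h.
    rewrite big_ord0; apply: in_class_ae h _; apply: aeW => x.
    by rewrite subrr big_ord0.
  rewrite big_ord_recr /=.
  have h := in_classB (in_class_bs (bs_avg (a + n.+1%:Z) l)) (in_class_bs (bs_avg (a + n%:Z) l)).
  rewrite -!condE_bs in h; rewrite addrC; apply: in_class_ae (in_classDZ (eps n) h IH) _.
  by apply: aeW => x; rewrite big_ord_recr /= addrC.
have sm : smeas mu
    (fun w => \sum_(k < n) eps k *: (seval (f k.+1) w - seval (f k) w)).
  elim: (n) => [|m IH].
    under eq_fun do rewrite big_ord0; exact: strongly_measurable0.
  under eq_fun do rewrite big_ord_recr /= addrC.
  apply: (strongly_measurableDZ (eps m)) IH; apply: smeasB.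
    exact: smeas_sfun (bsf_over (l := _)).
  exact: smeas_sfun (bsf_over (l := _)).
rewrite (BNorm_conditioned_probability mB b0 muB) ?(lt_trans ltr01)//.
  by rewrite (nrm_in_class cls sm).
by move=> x Bx; rewrite big1// => k _; rewrite !f_off// subrr scaler0.
Qed.

(** Normalizing the measure multiplies both sides of the UMD inequality by the same factor. The
    unsigned sum telescopes to a difference of two contractions, hence the 2; the maximum with 0
    makes the constant nonnegative. *)
Lemma bs_umd (beta : R) n (eps : nat -> bool) :
  (forall d (T : measurableType d) (P : probability T R)
    (Fil : nat -> set (set T)) (f : nat -> T -> Y) (N : nat) (eps : nat -> bool),
  is_filtration Fil -> Lp_martingale P p Fil f ->
  (BNorm P p (fun w => (\sum_(k < N) (-1) ^+ eps k *: (f k.+1 w - f k w))%R) <=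
   beta%:E * BNorm P p (fun w => (\sum_(k < N) (f k.+1 w - f k w))%R))%E) ->
  nrm (\sum_(k < n) (-1) ^+ eps k *: (E (a + k.+1%:Z) (bs_class l) - E (a + k%:Z) (bs_class l)))
  <= 2 * Num.max 0 beta * nrm (bs_class l).
Proof.
move=> hU; set u := bs_class l.
have := hU _ _ P Fil (fun k => seval (f k)) n eps dyadic_filtration dyadic_martingale.
have -> : (fun w : T => \sum_(k < n) (seval (f k.+1) w - seval (f k) w)) =
    (fun w : T => \sum_(k < n) 1 *: (seval (f k.+1) w - seval (f k) w)).
  by apply/funext => w; apply: eq_bigr => k _; rewrite scale1r.
rewrite (fsum_BNorm n (fun k => (-1) ^+ eps k)) (fsum_BNorm n (fun=> 1)).
set c := _ `^ _; have c0 : 0 < c by rewrite powR_gt0// invr_gt0.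
rewrite -!EFinM lee_fin mulrCA ler_pM2l// => h; apply: (le_trans h).
have -> : \sum_(k < n) 1 *: (E (a + k.+1%:Z) u - E (a + k%:Z) u) = E (a + n%:Z) u - E a u.
  elim: (n) => [|m IH]; first by rewrite big_ord0 addr0 subrr.
  by rewrite big_ord_recr /= IH scale1r addrC subrKA.
apply: (@le_trans _ _ (Num.max 0 beta * (2 * nrm u))); last by rewrite mulrCA mulrA.
apply: (@le_trans _ _ (Num.max 0 beta * nrm (E (a + n%:Z) u - E a u))).
  by rewrite ler_wpM2r ?nrm_ge0// le_max lexx orbT.
rewrite ler_wpM2l ?le_max ?lexx// (le_trans (ler_nrmB _ _))//.
have := condE_contraction (a + n%:Z) u.
by have := condE_contraction a u; lra.
Qed.

End martingale.

Lemma condE_spectral_resolution : UMD Y -> exists C0, spectral_resolution E C0.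
Proof.
move=> /(_ p p1) [beta hU]; exists (2 * Num.max 0 beta).
have C0 : 0 <= 2 * Num.max 0 beta by rewrite mulr_ge0// le_max lexx.
split=> //.
- by move=> k c x y; exact: condE_linear.
- by move=> k x; exact: condE_contraction.
- by move=> j k x jk; rewrite !condE_min (min_l jk) (min_r jk).
- exact: condE_up.
- exact: condE_down.
move=> a n eps x; rewrite -subr_le0; move: x.
pose S x := \sum_(k < n) (-1) ^+ eps k *: Delta E (a + k%:Z) x.
have SB u v : S u - S v = S (u - v).
  rewrite /S -sumrB; apply: eq_bigr => k _; rewrite -scalerBr; congr (_ *: _).
  by rewrite /Delta !condEB !opprB addrACA [RHS]addrACA [- _ - _]addrC.
have S2 u : nrm (S u) <= (2 * n)%:R * nrm u.
  rewrite /S; elim: (n) => [|m IH]; first by rewrite big_ord0 nrm0 muln0 mul0r.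
  rewrite big_ord_recr /= (le_trans (ler_nrmD _ _))//.
  have h : nrm ((-1) ^+ eps m *: Delta E (a + m%:Z) u) <= 2 * nrm u.
    have -> : nrm ((-1) ^+ eps m *: Delta E (a + m%:Z) u) = nrm (Delta E (a + m%:Z) u).
      by case: (eps m); rewrite ?expr1 ?expr0 ?scaleN1r ?scale1r ?nrmN.
    rewrite (le_trans (ler_nrmB _ _))//.
    have := condE_contraction (a + m%:Z) u.
    by have := condE_contraction (a + m%:Z - 1) u; lra.
  by move: IH; rewrite mulnS natrD mulrDl; lra.
(* This constant grows with n, but serves only to pass to the limit with n fixed. *)
apply: (@bs_limit _ ((2 * n)%:R + 2 * Num.max 0 beta)).
- by rewrite addr_ge0.
- move=> u v; rewrite -/(S u) -/(S v).
  have h1 : nrm (S u) <= nrm (S v) + nrm (S (u - v)).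
    by rewrite -SB -{1}(subrK (S v) (S u)) addrC (le_trans (ler_nrmD _ _))// addrC.
  have h2 := S2 (u - v).
  have h3 : 2 * Num.max 0 beta * nrm v <= 2 * Num.max 0 beta * (nrm u + nrm (u - v)).
    by rewrite ler_wpM2l// nrmBC -{1}(subrK u v) addrC (le_trans (ler_nrmD _ _)).
  by move: h1 h2 h3; rewrite !mulrDr mulrDl; lra.
move=> l; rewrite subr_le0.
have [s _] := dy_cover Dy.
(* The level starts at a - 1 because Delta_a involves E_(a - 1). *)
have [M hM] := common_ball (s 0%N) (a - 1) l.
have := bs_umd hM n eps hU; apply: le_trans.
apply: eqW; congr (nrm _); apply: eq_bigr => k _.
congr (_ *: (E _ _ - E _ _)); lia.
Qed.

Definition ball_constant (Z : Type) k (h : T -> Z) := forall x y, ball k x y -> h y = h x.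

(** Countably many cells of level k suffice to write the product as a limit of simple functions. It
    serves to multiply by characters, which are constant on small balls. *)
Lemma smeas_ball_constant k (h : T -> R[i]) (f : T -> Y) : ball_constant k h ->
  smeas mu f ->
  smeas mu (fun x => h x *: f x).
Proof.
move=> hk [s [sS sf]]; have [t [cell [mc tc bc hc]]] := dy_cells k.
exists (fun n => flatten [seq [seq (c.1, h (t i) *: c.2) | c <- sfun_restrict (cell i) (s n)] | i <- iota 0 n]).
split.
  move=> n c /flatten_mapP[i _ /mapP[c' c's ->]] /=.
  exact: (sfun_over_restrict (mc i) (sS n)).
move=> x; have h0 : (fun n => h x *: seval (s n) x) @ \oo --> h x *: f x.
  by apply: cvgZ; [exact: cvg_cst|exact: sf].
apply: cvg_trans h0; apply: near_eq_cvg.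
have : [set: T] x by []. rewrite -bc => -[i0 _ xi0].
exists i0.+1 => // n /= hn.
have E i : \sum_(j <- [seq (c.1, h (t i) *: c.2) | c <- sfun_restrict (cell i) (s n)]) \1_(j.1) x *: j.2
    = h (t i) *: (\1_(cell i) x *: seval (s n) x).
  rewrite -seval_restrict /sfun_eval big_map scaler_sumr.
  by apply: eq_bigr => c _; rewrite /= !scalerA mulrC.
transitivity (\sum_(i <- iota 0 n) h (t i) *: (\1_(cell i) x *: seval (s n) x)); last first.
  rewrite [RHS]/sfun_eval big_flatten /= big_map; apply/esym.
  exact: (eq_bigr _ (fun i _ => E i)).
rewrite (bigD1_seq i0) ?mem_iota ?iota_uniq//= big1 ?addr0.
  rewrite indicE mem_set// scale1r; congr (_ *: _).
  by apply: hk; rewrite -(hc _ _ xi0).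
move=> j ji; rewrite indicE memNset ?scale0r ?scaler0// => xj.
by move/negP: ji; apply; apply/eqP; apply: (tc j i0) => //; exists x.
Qed.

Definition ball_partition j k (o : T) (s : seq T) :=
  [/\ pairwise (fun c c' => ~~ `[< ball k c c' >]) s, forall c, c \in s -> ball j o c &
  forall x, ball j o x -> exists2 c, c \in s & ball k c x].

Lemma ball_partition_sfun j k o s (h : T -> Y) : (j <= k)%R ->
  ball_partition j k o s -> ball_constant k h ->
  (fun x => \1_(ball j o) x *: h x) = seval [seq (ball k c, h c) | c <- s].
Proof.
move=> jk [sep sub cov] hk; apply/funext => x; rewrite /sfun_eval big_map indicE.
case: (boolP (x \in _)) => [/set_mem|] xo; last first.
  rewrite scale0r big_seq big1// => c /sub oc; rewrite indicE memNset ?scale0r// => cx.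
  move/negP: xo; apply; apply/mem_set; rewrite -(dy_eq Dy oc).
  exact: dy_subset _ _ _ jk _ cx.
rewrite scale1r; have [c0 c0s c0x] := cov x xo.
elim: s c0s sep {sub cov} => // c s IH; rewrite inE big_cons /=.
case/predU1P => [<-|c0s] /andP[/allP sep /IH {}IH].
  rewrite indicE mem_set// scale1r big_seq big1 ?addr0; first exact: hk.
  move=> c' c's; rewrite indicE memNset ?scale0r// => c'x.
  have /negP := sep _ c's; apply; apply/asboolP.
  by rewrite (dy_disjoint c0x c'x); exact: dy_refl Dy _ _.
rewrite -IH// indicE memNset ?scale0r ?add0r// => cx.
have /negP := sep _ c0s; apply; apply/asboolP.
by rewrite (dy_disjoint cx c0x); exact: dy_refl Dy _ _.
Qed.

Lemma ball_partition_over j k o s (h : T -> Y) : ball_partition j k o s ->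
  sfun_over measurable mu [seq (ball k c, h c) | c <- s].
Proof.
by move=> _ a /mapP[c _ ->] /=; split; [exact: dy_measurable Dy _ _|exact: dy_lty _ _].
Qed.

Lemma ball_partition_bochner j k o s (h : T -> Y) : (j <= k)%R ->
  ball_partition j k o s -> ball_constant k h ->
  has_bochner mu (fun x => \1_(ball j o) x *: h x)
    (\sum_(c <- s) (N ^ (- k))%:C *: h c).
Proof.
move=> jk hs hk; have := bochner_sfun (@ball_partition_over j k o s h hs).
rewrite -(ball_partition_sfun jk hs hk) /sfun_integral big_map.
by under eq_bigr do rewrite (dy_measure Dy) /=.
Qed.


(** Jensen on a ball of measure N^-k bounds the mean t of |F| by t^p N^-k <= the p-th power of the
    norm of F. So averages grow at most like N^(k/p), the rate against which the heat kernel is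
    summed. *)
Let avg_bound k x (F : T -> Y) : F \in BLfun mu p ->
  exists t : R, [/\ (\int[mu]_(y in ball k x) (nrm (F y))%:E = (t * N ^ (- k))%:E)%E,
    nrm (avg k F x) <= t & t <= (N ^ k) `^ p^-1 * fine (BNorm mu p F)].
Proof.
move=> FL; have [t [t0 It avt]] := nrm_avg_le k x FL.
have p0 : 0 < p := lt_trans ltr01 p1.
have mF := BLfun_sm FL; have /asboolP[_ Flt] := FL.
have w0 : 0 < N ^ k := dy_wgt0 _.
have h := jensen_ball p1 (strongly_measurable_nrm mF) (fun x => nrm_ge0 (F x))
  (dy_measurable Dy k x) (dy_measure Dy k x) (dy_wgt0 _) t0 It.
have h2 : ((t `^ p * N ^ (- k))%:E <= pint mu p F)%E.
  apply: (le_trans h); apply: ge0_subset_integral => //; first exact: dy_measurable Dy _ _.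
  - exact: (measurable_nrmX p mF).
  - by move=> y _; rewrite lee_fin powR_ge0.
exists t; split => //.
have BE : BNorm mu p F = (fine (BNorm mu p F))%:E.
  by rewrite fineK// ge0_fin_numE// BNorm_ge0.
have B0 : 0 <= fine (BNorm mu p F) by rewrite fine_ge0// BNorm_ge0.
rewrite -(BNorm_powR mu (ltW p1)) BE poweR_EFin lee_fin -invr_expz ler_pdivrMr// in h2.
have inv (r : R) : 0 <= r -> (r `^ p) `^ p^-1 = r.
  by move=> r0; rewrite -powRrM divff ?gt_eqF// powRr1.
rewrite -[leLHS](inv t t0) -[X in _ * X](inv _ B0) mulrC -powRM ?powR_ge0 ?(ltW w0)//.
by apply: ge0_ler_powR; rewrite ?nnegrE ?mulr_ge0 ?powR_ge0 ?invr_ge0 ?(ltW w0)// ltW.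
Qed.

Lemma nrm_avg_le_BNorm k x (F : T -> Y) : F \in BLfun mu p ->
  nrm (avg k F x) <= (N ^ k) `^ p^-1 * fine (BNorm mu p F).
Proof. by move=> /(avg_bound k x)[t [_ h1 h2]]; exact: le_trans h1 h2. Qed.

Lemma ball_integral_le_BNorm k x (F : T -> Y) : F \in BLfun mu p ->
  (\int[mu]_(y in ball k x) (nrm (F y))%:E <=
    ((N ^ k) `^ p^-1 * fine (BNorm mu p F) * N ^ (- k))%:E)%E.
Proof.
move=> /(avg_bound k x)[t [-> _ h]].
by rewrite lee_fin ler_wpM2r// ltW// (dy_wgt0).
Qed.

Lemma BLfunB (F G : T -> Y) : F \in BLfun mu p -> G \in BLfun mu p ->
  (fun x => F x - G x) \in BLfun mu p.
Proof.
move=> FL GL; have [_ hc] := BLfun_submod_closed Y mu (ltW p1).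
have := hc (-1) G F GL FL; rewrite (_ : -1 *: G + F = fun x => F x - G x)//.
by apply/funext => x; rewrite addrC -[LHS]/(F x + -1 *: G x) scaleN1r.
Qed.

Lemma avgB k x (F G : T -> Y) : F \in BLfun mu p -> G \in BLfun mu p ->
  avg k (fun y => F y - G y) x = avg k F x - avg k G x.
Proof.
move=> FL GL; have := avgDZ k x (-1) GL FL; rewrite scaleN1r addrC => <-.
by congr (avg _ _ _); apply/funext => y; rewrite scaleN1r addrC.
Qed.

Lemma avg_cvg (u : nat -> T -> Y) (F : T -> Y) k x : F \in BLfun mu p ->
  (\forall m \near \oo, u m \in BLfun mu p) ->
  BNorm mu p (fun y => u m y - F y) @[m --> \oo] --> 0%E ->
  avg k (u m) x @[m --> \oo] --> avg k F x.
Proof.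
move=> FL uL /fine_cvgP[_ u0].
have lim : (fun m => (N ^ k) `^ p^-1 * fine (BNorm mu p (fun y => u m y - F y))) @ \oo --> (0 : R).
  by rewrite -(mulr0 ((N ^ k) `^ p^-1)); apply: cvgM; [exact: cvg_cst|exact: u0].
apply/cvg_nrmP; apply: cvg0_le lim; apply: filterS uL => m umL.
rewrite nrm_ge0 /= -(avgB k x umL FL); apply: nrm_avg_le_BNorm; exact: BLfunB.
Qed.

Lemma avgE k x (F : T -> Y) v : has_bochner mu (fun y => \1_(ball k x) y *: F y) v ->
  avg k F x = (N ^ k)%:C *: v.
Proof. by move=> h; rewrite /avg (bochnerE h). Qed.

Lemma avg_restrict k x (B : set T) (F : T -> Y) : ball k x `<=` B ->
  avg k (fun y => \1_B y *: F y) x = avg k F x.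
Proof.
move=> xB; rewrite /avg /bochner; congr (_ *: xget _ _); apply/funext => v /=.
congr (has_bochner _ _ _); apply/funext => y.
rewrite [in LHS]indicE; case: (boolP (y \in ball k x)) => [/set_mem xy|xy].
  by rewrite scale1r !indicE !mem_set ?scale1r//; exact: xB.
by rewrite !indicE (negbTE xy) !scale0r.
Qed.

End Banach.
End averages.

(** * Balls of K^n *)

Section ultrametric_balls.
Context (R : realType) (K : topFieldType).
Hypothesis hK : nonarchimedean_local_field R K.
Variable nu : {measure set (borel K) -> \bar R}.
Hypothesis hnu : Haar_measure nu.
Variable beta : K.
Hypothesis hbeta : prime_element R beta.
Hypothesis b0 : beta != 0.
Local Notation mod := (@modulus R K).
Local Notation rho := (mod beta).
Let rho0 : 0 < rho := modulus_gt0 hK hnu b0.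
Let rho1 : rho < 1 := modulus_prime_lt1 hK hnu hbeta.
Let mod_ge0 := modulus_ge0 hK hnu.

Lemma rhoz_gt0 (k : int) : 0 < rho ^ k.
Proof. exact: exprz_gt0. Qed.

Lemma rhoz_le (j k : int) : (rho ^ k <= rho ^ j) = (j <= k)%R.
Proof. have r1 : 1 < rho^-1 by rewrite invf_gt1.
have h (i : int) : rho ^ i = rho^-1 ^ (- i) by rewrite exprz_inv opprK.
by rewrite !h (ler_eXz2l r1) lerN2. Qed.

(** A small power a^j maps the compact unit ball into U; every x with |x| <= |a^j| is a^j times a
    point of the unit ball. *)
Lemma nbhs0_modulus_sub (U : set K) : nbhs 0 U -> exists m : nat,
  forall x, mod x <= rho ^ m%:Z -> U x.
Proof.
move=> U0; have [hausK lcK ndK _] := hK.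
have [a [V [a0 V0 cV [V1 aVV] aV]]] := topologically_nilpotent hausK lcK ndK.
have W0 := compact_small_mul (@modulus_le_compact _ _ hK _ hnu _ hbeta b0 1) U0.
have [j /(_ j 1 (leqnn _) V1)/=] := aV _ W0; rewrite mulr1 => hj.
have aj0 : a ^+ j != 0 by rewrite expf_neq0.
have [m rm] := small_power hK hnu hbeta b0 (modulus_gt0 hK hnu aj0).
exists m => x xm; rewrite -(mulVKf aj0 x); apply: hj.
rewrite (modulusM hK hnu) (modulusV hK hnu) mulrC ler_pdivrMr ?(modulus_gt0 hK hnu)// mul1r.
by rewrite (le_trans xm)// ltW.
Qed.

Variable n : nat.
Local Notation Kn := 'rV[K]_n.
Local Notation vn := (@vnorm R K n).

Lemma vnorm_ge0 (x : Kn) : 0 <= vn x.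
Proof. by rewrite /vnorm; elim/big_ind: _ => // a b ? ?; rewrite le_max; apply/orP; left. Qed.

Lemma vnorm_leP (x : Kn) (c : R) : 0 <= c -> (forall i, mod (x ord0 i) <= c) <-> vn x <= c.
Proof.
move=> c0; split=> [h|h i].
  by rewrite /vnorm; elim/big_ind: _ => // a b ? ?; rewrite ge_max; apply/andP.
by apply: le_trans h; rewrite /vnorm (bigD1 i)//= le_max lexx.
Qed.

Lemma vnorm0 : vn 0 = 0.
Proof.
apply/eqP; rewrite eq_le vnorm_ge0 andbT; apply/vnorm_leP => // i.
by rewrite mxE modulus0.
Qed.

Lemma vnormN x : vn (- x) = vn x.
Proof. by rewrite /vnorm; apply: eq_bigr => i _; rewrite mxE (modulusN hK hnu). Qed.

Lemma vnormD x y : vn (x + y) <= Num.max (vn x) (vn y).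
Proof.
apply/vnorm_leP => [|i]; first by rewrite le_max vnorm_ge0.
rewrite mxE (le_trans (ultrametric hK _ _))// ge_max !le_max.
have h (z : Kn) : mod (z ord0 i) <= vn z := (vnorm_leP z (vnorm_ge0 z)).2 (lexx _) i.
by rewrite !h orbT.
Qed.

Lemma vnormZ (a : K) x : vn (a *: x) = mod a * vn x.
Proof.
rewrite /vnorm; elim/big_rec2: _ => [|i u v _ ->]; first by rewrite mulr0.
by rewrite mxE (modulusM hK hnu) maxr_pMr.
Qed.

Definition vball (k : int) (x : Kn) : set Kn := [set y | vn (y - x) <= rho ^ k].

Lemma vball_refl k x : vball k x x.
Proof. by rewrite /vball /= subrr vnorm0 ltW// rhoz_gt0. Qed.

Lemma vballD k x y : vn x <= rho ^ k -> vn y <= rho ^ k -> vn (x + y) <= rho ^ k.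
Proof. by move=> hx hy; rewrite (le_trans (vnormD _ _))// ge_max hx. Qed.

Lemma vball_eq k x y : vball k x y -> vball k y = vball k x.
Proof.
rewrite /vball /= => xy; apply/seteqP; split=> z /= h.
  by rewrite -(subrK y z) -addrA vballD.
by rewrite -(subrK x z) -addrA vballD// -vnormN opprB.
Qed.

Lemma vball_sub k x : vball (k + 1) x `<=` vball k x.
Proof. by move=> y /le_trans; apply; rewrite rhoz_le; lia. Qed.

Lemma vball_exhaust x y : exists m : nat, vball (- m%:Z) x y.
Proof.
have h : 0 < (1 + vn (y - x))^-1 by rewrite invr_gt0 ltr_pwDl// vnorm_ge0.
have [m hm] := small_power hK hnu hbeta b0 h; exists m.
rewrite /vball /= -invr_expz -exprnP.
have r0 : 0 < rho ^+ m by rewrite exprn_gt0.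
rewrite -(@ler_pM2r _ (rho ^+ m))// mulVf ?gt_eqF//.
move/ltW: hm; have v1 : 0 < 1 + vn (y - x) by rewrite ltr_pwDl// vnorm_ge0.
rewrite -div1r ler_pdivlMr// mulrC; apply: le_trans.
by rewrite mulrDl mul1r lerDr ltW.
Qed.

Lemma nbhs_vball (x : Kn) (k : int) : nbhs x (vball k x).
Proof.
exists (fun i j => [set z | mod (z - x i j) <= rho ^ k]).
  move=> i j; have := nbhs0_modulus_le hK hnu hbeta b0 (rhoz_gt0 k).
  have h : (fun z => - x i j + z) @ x i j --> - x i j + x i j by exact: addl_continuous.
  rewrite addNr in h; move=> /h h'.
  have : nbhs (x i j) [set z | mod (- x i j + z) <= rho ^ k] by exact: h'.
  by apply: filterS => z /=; rewrite addrC.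
move=> y /= h; apply/vnorm_leP; first exact/ltW/rhoz_gt0.
by move=> i; rewrite !mxE; exact: h.
Qed.

Lemma vball_open k x : open (vball k x).
Proof.
rewrite openE => y xy; rewrite -(vball_eq xy); exact: nbhs_vball.
Qed.

Lemma nbhs_vball_sub (x : Kn) (U : set Kn) : nbhs x U -> exists m : nat, vball m%:Z x `<=` U.
Proof.
move=> [P hP PU].
have /choice[f hf] (i : 'I_n) : exists m : nat, forall z, mod z <= rho ^ m%:Z -> P ord0 i (x ord0 i + z).
  by apply: nbhs0_modulus_sub; apply: nbhs_shift; exact: hP.
exists (\max_i f i)%N => y xy; apply: PU => i0 i; rewrite (ord1 i0).
have h : mod (y ord0 i - x ord0 i) <= rho ^ (f i)%:Z.
  apply: (@le_trans _ _ (rho ^ (\max_i f i)%N%:Z)).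
    have /vnorm_leP := xy; move=> /(_ (ltW (rhoz_gt0 _)))/(_ i); by rewrite !mxE.
  by rewrite rhoz_le lez_nat leq_bigmax.
by have := hf i _ h; rewrite addrC subrK.
Qed.

(* finitely many balls of radius [rho ^ k] cover [vball j 0] *)
Lemma vball_finite_cover (j k : int) : exists s : seq Kn,
  forall x, vball j 0 x -> exists2 c, c \in s & vball k c x.
Proof.
have U0 := nbhs0_modulus_le hK hnu hbeta b0 (rhoz_gt0 k).
have [s hs] := finite_translates (@modulus_le_compact _ _ hK _ hnu _ hbeta b0 (rho ^ j)) U0.
exists [seq \row_i nth 0 s (f i) | f : {ffun 'I_n -> 'I_(size s)}] => x.
rewrite /vball /= subr0 => /vnorm_leP - /(_ (ltW (rhoz_gt0 _))) xj.
have /choice[f hf] (i : 'I_n) : exists a : 'I_(size s), mod (x ord0 i - nth 0 s a) <= rho ^ k.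
  have [c cs hc] := hs (x ord0 i) (xj i).
  have ci : (index c s < size s)%N by rewrite index_mem.
  by exists (Ordinal ci); rewrite /= nth_index.
exists (\row_i nth 0 s ([ffun i => f i] i)); first by apply/mapP; exists [ffun i => f i]; rewrite ?mem_enum.
apply/vnorm_leP; first exact/ltW/rhoz_gt0.
by move=> i; rewrite !mxE ffunE.
Qed.

Lemma vball_countable_cover : exists s : nat -> Kn, forall k x, exists i, vball k (s i) x.
Proof.
have /choice[L hL] (mk : nat * nat) : exists s : seq Kn,
    forall x, vball (- mk.1%:Z) 0 x -> exists2 c, c \in s & vball mk.2%:Z c x.
  exact: vball_finite_cover.
pose s (i : nat) : Kn := if @unpickle (nat * nat * nat)%type i is Some a then nth 0 (L a.1) a.2 else 0.
exists s => k x; have [m xm] := vball_exhaust 0 x.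
have [c cs hc] := hL (m, absz k) x xm.
exists (pickle (m, absz k, index c (L (m, absz k)))); rewrite /s pickleK /= nth_index//.
apply: le_trans hc _; rewrite /= rhoz_le; lia.
Qed.

Lemma vball_le (j k : int) x : (j <= k)%R -> vball k x `<=` vball j x.
Proof. by move=> jk y /le_trans; apply; rewrite rhoz_le. Qed.

Definition separated k (s : seq Kn) := pairwise (fun c c' => ~~ `[< vball k c c' >]) s.

Lemma vball_partition (j k : int) : (j <= k)%R -> exists s : seq Kn, [/\ separated k s, forall c, c \in s -> vball j 0 c &
  forall x, vball j 0 x -> exists2 c, c \in s & vball k c x].
Proof.
move=> jk; have [s hs] := vball_finite_cover j k.
have {}hs x : vball j 0 x -> exists2 c, c \in [seq c <- s | `[< vball j 0 c >]] & vball k c x.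
  move=> x0; have [c cs cx] := hs x x0; exists c => //; rewrite mem_filter cs andbT.
  apply/asboolP; have c0x : vball j c x by apply: vball_le cx.
  by rewrite -(vball_eq x0) (vball_eq c0x); exact: vball_refl.
have : forall c, c \in [seq c <- s | `[< vball j 0 c >]] -> vball j 0 c.
  by move=> c; rewrite mem_filter => /andP[/asboolP].
move: ([seq c <- s | _]) hs => {}s hs s0.
(* Greedy selection: a centre is kept unless a ball already kept contains it. *)
suff [s' [sep sub cov]] : exists s', [/\ separated k s', {subset s' <= s} &
    forall x, (exists2 c, c \in s & vball k c x) -> exists2 c, c \in s' & vball k c x].
  by exists s'; split=> [//|c /sub/s0//|x /hs/cov].
elim: s {hs s0} => [|c s [s' [sep sub cov]]]; first by exists [::]; split=> // x [].
have [[c' c's' cc']|nc] := pselect (exists2 c', c' \in s' & vball k c' c).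
  exists s'; split=> // [a /sub as_|x [a]]; first by rewrite inE as_ orbT.
  rewrite inE => /predU1P[->|as_ ax]; last by apply: cov; exists a.
  by rewrite (vball_eq cc') => cx; exists c'.
exists (c :: s'); split.
- rewrite /separated /= -/(separated k s') sep andbT; apply/allP => c' c's'.
  apply/asboolPn => h; apply: nc; exists c' => //; rewrite (vball_eq h); exact: vball_refl.
- by move=> a; rewrite !inE => /predU1P[->|/sub ->]; rewrite ?eqxx ?orbT.
move=> x [a]; rewrite inE => /predU1P[->|as_] ax.
  by exists c; rewrite ?inE ?eqxx.
have [|c' c's' cx] := cov x; first by exists a.
by exists c' => //; rewrite inE c's' orbT.
Qed.

Local Notation T := (borel Kn).
Variable mu : {measure set T -> \bar R}.
Hypothesis hmu : Haar_measure mu.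
Hypothesis hmu1 : mu (integers_n R K n) = 1%E.
Hypothesis hn : (1 <= n)%N.

Let mvball k x : measurable (vball k x : set T).
Proof. by apply: sub_sigma_algebra; exact: vball_open. Qed.

Let mu_vball_transl k x : mu (vball k x : set T) = mu (vball k 0 : set T).
Proof.
case: hmu => inv _ _ _ _; rewrite -(inv x _ (mvball k 0)); congr (mu _).
apply/seteqP; split=> [y xy|_ [y + <-]].
  by exists (y - x); rewrite /vball /= ?subr0// addrC subrK.
by rewrite /vball /= subr0 addrAC subrr add0r.
Qed.

Let beta0 k : beta ^ k != 0.
Proof. by rewrite expfz_neq0. Qed.

Lemma vball_scale k m c x :
  vball (k + m) (beta ^ k *: c) (beta ^ k *: x) <-> vball m c x.
Proof.
rewrite /vball /= -scalerBr vnormZ (modulusXz hK hnu) expfzDr ?gt_eqF//.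
by rewrite ler_pM2l// rhoz_gt0.
Qed.

Let mem_cover k (s : seq Kn) x :
  (\big[setU/set0]_(c <- s) vball (k + 1) (beta ^ k *: c)) (beta ^ k *: x) <->
  exists2 c, c \in s & vball 1 c x.
Proof.
rewrite -bigcup_seq; split=> [[c /= cs /vball_scale h]|[c cs h]]; first by exists c.
by exists c => //; exact/vball_scale.
Qed.

(** N counts the balls of level 1 in the ball of level 0. Scaling by beta^k carries this partition
    to every level, so each level divides the measure by N, starting from measure 1 for the integral
    points. *)
Lemma vball_measure : exists N : nat, (1 < N)%N /\
  forall k x, mu (vball k x : set T) = (N%:R ^ (- k))%:E.
Proof.
have [s [sep s0 cov]] := @vball_partition 0 1 isT; pose N := size s.
have step k : mu (vball k 0 : set T) = (N%:R%:E * mu (vball (k + 1) 0 : set T))%E.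
  have -> : vball k 0 = \big[setU/set0]_(c <- s) vball (k + 1) (beta ^ k *: c).
    apply/seteqP; split=> x; rewrite -[x](scalerK (beta0 (- k))) -invr_expz invrK.
      rewrite -[X in vball k X](scaler0 _ (beta ^ k)) -[X in vball X](addr0 k).
      by move=> /vball_scale/cov h; apply/mem_cover.
    move=> /mem_cover[c cs cx].
    rewrite -[X in vball k X](scaler0 _ (beta ^ k)) -[X in vball X](addr0 k).
    apply/vball_scale; rewrite -(vball_eq (s0 c cs)); exact: vball_sub.
  rewrite /N; elim: (s) sep => [|c s' IH] /=.
    by move=> _; rewrite big_nil measure0 mul0e.
  move=> /andP[/allP cs' /IH {}IH]; rewrite big_cons measureU.
  - transitivity (mu (vball (k + 1) 0 : set T) + (size s')%:R%:E * mu (vball (k + 1) 0 : set T))%E.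
      by congr (_ + _)%E; [exact: mu_vball_transl|exact: IH].
    by rewrite -natr1 EFinD ge0_muleDl ?lee_fin// mul1e addeC.
  - exact: mvball.
  - by apply: bigsetU_measurable => c' _; exact: mvball.
  apply/seteqP; split=> // x [cx]; rewrite -bigcup_seq => -[c' /= c's' c'x].
  have /negP := cs' _ c's'; apply; apply/asboolP; apply/(vball_scale k).
  rewrite -(vball_eq cx) (vball_eq c'x); exact: vball_refl.
(* The points 0 and (1, ..., 1) both lie in the unit ball, but not in a common ball of level 1; this
   is where n >= 1 is used. *)
have N1 : (1 < N)%N.
  have z0 : vball 0 0 (0 : Kn) by exact: vball_refl.
  have o0 : vball 0 0 (const_mx 1 : Kn).
    rewrite /vball /= subr0; apply/vnorm_leP => // i.
    by rewrite mxE (modulus1 hK hnu).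
  rewrite /N; case: (s) cov => [|c [|//]] cov; first by have [] := cov _ z0.
  have [c1] := cov _ z0; rewrite inE => /eqP -> c0.
  have [c2] := cov _ o0; rewrite inE => /eqP ->; rewrite -(vball_eq c0).
  rewrite /vball /= subr0 => /vnorm_leP; move=> /(_ (ltW (rhoz_gt0 _)))/(_ (Ordinal hn)).
  by rewrite mxE (modulus1 hK hnu) expr1z leNgt rho1.
exists N; split=> // k x; rewrite mu_vball_transl {x}.
have Nn : (N%:R : R) != 0 by rewrite pnatr_eq0; lia.
have b00 : mu (vball 0 0 : set T) = 1%E.
  rewrite -hmu1; congr (mu _); apply/seteqP; split=> x; rewrite /vball /= subr0.
    by move=> /vnorm_leP; apply.
  by move=> h; apply/vnorm_leP.
have pos (j : nat) : mu (vball j%:Z 0 : set T) = (N%:R ^ (- j%:Z))%:E.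
  elim: j => [|j IH]; first by rewrite b00 oppr0 expr0z.
  have : (N%:R^-1%:E * mu (vball j%:Z 0 : set T))%E = mu (vball (j%:Z + 1) 0 : set T).
    by rewrite step muleA -EFinM mulVf// mul1e.
  have -> : j%:Z + 1 = j.+1%:Z by lia.
  move=> <-; rewrite IH -EFinM; congr (_%:E).
  have -> : - j.+1%:Z = -1 + - j%:Z by lia.
  by rewrite expfzDr// -invr_expz expr1z.
have neg (j : nat) : mu (vball (- j%:Z) 0 : set T) = (N%:R ^ j%:Z)%:E.
  elim: j => [|j IH]; first by rewrite oppr0 b00 expr0z.
  rewrite step; have -> : - j.+1%:Z + 1 = - j%:Z by lia.
  rewrite IH -EFinM; congr (_%:E).
  have -> : j.+1%:Z = 1 + j%:Z by lia.
  by rewrite expfzDr// expr1z.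
case: k => k; first exact: pos.
by rewrite NegzE neg opprK.
Qed.

Lemma vball_regular (A : set T) : measurable A -> (mu A < +oo)%E -> forall e : R, 0 < e ->
  exists U : set T, [/\ measurable U, A `<=` U, (mu (U `\` A) < e%:E)%E &
    forall x, U x -> exists m : nat, vball m%:Z x `<=` U].
Proof.
move=> mA Alt e e0; case: hmu => _ _ _ hout _.
have fA : mu A \is a fin_num by rewrite ge0_fin_numE.
have [_ [U [oU AU] <-] Ult] : exists2 v, [set mu U | U in [set U : set Kn | open U /\ A `<=` U]] v &
    (v < mu A + e%:E)%E.
  apply: ereal_inf_lt; rewrite -(hout A mA) lteDl//.
have mU : measurable (U : set T) by exact: sub_sigma_algebra.
exists U; split=> //.
  rewrite measureD//; last by rewrite (lt_trans Ult)// lte_add_pinfty// ltry.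
  rewrite (_ : U `&` A = A); last exact/setIidPr.
  by rewrite lteBlDl.
by move=> x Ux; apply: nbhs_vball_sub; exact: open_nbhs_nbhs.
Qed.

Lemma vball_dyadic : exists N : nat,
  dyadic_structure mu (vball : int -> T -> set T) N%:R.
Proof.
have [N [N1 hN]] := vball_measure; exists N; split.
- by rewrite ltr1n.
- exact: mvball.
- exact: vball_refl.
- by move=> k x y; exact: vball_eq.
- exact: vball_sub.
- exact: hN.
- exact: vball_countable_cover.
- exact: vball_exhaust.
- exact: vball_regular.
Qed.

End ultrametric_balls.

(** * Tensors *)

Section limit_class.
Context d (T : measurableType d) (R : realType) (Y : normedModType R[i]).
Variables (mu : {measure set T -> \bar R}) (p : R) (p1 : 1 <= p).
Local Notation X := (BLp Y mu p1).

Let limit_rep (U : nat -> X) (V : X) (u : nat -> T -> Y) :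
  (forall n, in_class (U n) (u n)) -> (forall n, smeas mu (u n)) ->
  U @ \oo --> V -> exists f, [/\ in_class V f, smeas mu f &
    BNorm mu p (fun x => u n x - f x) @[n --> \oo] --> 0%E].
Proof.
move=> Uu mu_ /cvg_nrmP UV; have [f [fL Vf]] := in_class_exists V.
exists f; split; [exact: Vf|exact: BLfun_sm fL|].
have h : (fun n => (nrm (U n - V))%:E) @ \oo --> 0%E.
  by apply: cvg_EFin; [exact: nearW|exact: UV].
apply: cvg_trans h; apply: near_eq_cvg; apply: nearW => n.
by rewrite (nrm_in_class (in_classB (Uu n) Vf))//; exact: smeasB (mu_ n) (BLfun_sm fL).
Qed.

Lemma in_class_limit (U : nat -> X) (V : X) (u : nat -> T -> Y) (w : T -> Y) :
  (forall n, in_class (U n) (u n)) -> (forall n, smeas mu (u n)) ->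
  U @ \oo --> V -> (forall x, u n x @[n --> \oo] --> w x) -> in_class V w.
Proof.
move=> Uu mu_ UV uw; have [f [Vf mf uf]] := limit_rep Uu mu_ UV.
by apply: in_class_ae Vf _; apply: (Lp_limit_ae p1 mu_ mf uf); exact: aeW.
Qed.

Lemma in_class_limit_Lq (q : R) (U : nat -> X) (V : X) (u : nat -> T -> Y) (w : T -> Y) :
  1 <= q -> (forall n, in_class (U n) (u n)) ->
  (forall n, smeas mu (u n)) -> smeas mu w ->
  U @ \oo --> V -> BNorm mu q (fun x => u n x - w x) @[n --> \oo] --> 0%E -> in_class V w.
Proof.
move=> q1 Uu mu_ mw UV uw; have [f [Vf mf uf]] := limit_rep Uu mu_ UV.
by apply: in_class_ae Vf _; exact: (Lp_Lq_limit_ae p1 q1 mu_ mf mw uf uw).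
Qed.

Lemma in_class_sum n (G : nat -> X) (g : nat -> T -> Y) : (forall i, in_class (G i) (g i)) ->
  in_class (\sum_(i < n) G i) (fun x => \sum_(i < n) g i x).
Proof.
move=> h; elim: n => [|n IH].
  have := in_classB (h 0%N) (h 0%N); rewrite subrr big_ord0 => h0.
  by apply: in_class_ae h0 _; apply: aeW => x; rewrite subrr big_ord0.
rewrite big_ord_recr /=; have := in_classDZ 1 IH (h n); rewrite scale1r => h1.
by apply: in_class_ae h1 _; apply: aeW => x; rewrite scale1r big_ord_recr.
Qed.

End limit_class.

Section tensors.
Context d (T : measurableType d) (R : realType) (mu : {measure set T -> \bar R}).
Variables (ball : int -> T -> set T) (N : R).
Hypothesis Dy : dyadic_structure mu ball N.
Context (Y : normedModType R[i]).
Hypothesis cY : seq_complete Y.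
Local Notation C := (R[i]^o).
Local Notation bavg := (avg mu ball N).
Let cC := @seq_complete_complex R.

Lemma smeas_tensor (phi : T -> C) (y : Y) :
  smeas mu phi ->
  smeas mu (fun x => phi x *: y).
Proof.
move=> [s [sS sphi]]; exists (fun n => [seq (b.1, b.2 *: y) | b <- s n]); split.
  by move=> n a /mapP[b bs ->] /=; exact: (sS n b bs).
move=> x; have h : (fun n => seval (s n) x *: y) @ \oo --> phi x *: y.
  apply/cvg_nrmP; move/cvg_nrmP: (sphi x) => h.
  have h2 : (fun n => nrm (seval (s n) x - phi x) * nrm y) @ \oo --> (0 : R).
    by rewrite -(mul0r (nrm y)); apply: cvgM => //; exact: cvg_cst.
  apply: cvg_trans h2; apply: near_eq_cvg; apply: nearW => n.
  by rewrite -scalerBl nrmZ.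
apply: cvg_trans h; apply: near_eq_cvg; apply: nearW => n.
rewrite /sfun_eval big_map scaler_suml; apply: eq_bigr => b _ /=.
by rewrite scalerA.
Qed.

Lemma BNorm_tensor (p : R) (phi : T -> C) (y : Y) : 1 <= p ->
  smeas mu phi ->
  BNorm mu p (fun x => phi x *: y) = (BNorm mu p phi * (nrm y)%:E)%E.
Proof.
move=> p1 mphi; have p0 : 0 < p := lt_le_trans ltr01 p1.
have -> : (nrm y)%:E = ((nrm y `^ p)%:E `^ p^-1)%E.
  by rewrite poweR_EFin -powRrM divff ?gt_eqF// powRr1// nrm_ge0.
rewrite !BNormE -poweRM ?pint_ge0 ?lee_fin ?powR_ge0//; congr (poweR _ _).
rewrite /pint muleC -ge0_integralZl ?lee_fin ?powR_ge0//.
- apply: eq_integral => x _; rewrite -EFinM mulrC -powRM ?nrm_ge0//.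
  by rewrite nrmZ.
- exact: measurable_nrmX mphi.
- by move=> x _; rewrite lee_fin powR_ge0.
Qed.

Lemma BLfun_tensor (p : R) (phi : T -> C) (y : Y) : 1 <= p -> phi \in BLfun mu p ->
  (fun x => phi x *: y) \in BLfun mu p.
Proof.
move=> p1 /asboolP[mphi lphi]; apply/asboolP; split; first exact: smeas_tensor.
by rewrite BNorm_tensor// lte_mul_pinfty ?BNorm_ge0 ?lee_fin ?nrm_ge0 ?ltry// ge0_fin_numE ?BNorm_ge0.
Qed.

Variable p : R.
Hypothesis p1 : 1 < p.
Let p1' : 1 <= p := ltW p1.
Local Notation X := (BLp Y mu p1').
Local Notation E := (condE Dy cY (p1 := p1)).

Lemma avg_tensor k (phi : T -> C) (y : Y) x : phi \in BLfun mu p ->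
  bavg k (fun x => phi x *: y) x = bavg k phi x *: y.
Proof.
move=> phiL; rewrite /avg -scalerA; congr (_ *: _); apply: bochnerE.
have := bochner_scale_vector y (ball_bochner Dy cC p1 k x phiL).
by apply: bochner_eq => w; rewrite scalerA.
Qed.

Definition avg_diff k (phi : T -> C) x : C := bavg k phi x - bavg (k - 1) phi x.

Definition avg_partial_sum (m : int -> R[i]) (n : nat) (phi : T -> C) x : C :=
  \sum_(i < 2 * n) m (1 - n%:Z + i%:Z) *: avg_diff (1 - n%:Z + i%:Z) phi x.

Lemma avg_diff_smeas k (phi : T -> C) : phi \in BLfun mu p ->
  smeas mu (avg_diff k phi).
Proof.
by move=> phiL; apply: smeasB; exact: (avg_smeas Dy _ phiL).
Qed.

Lemma avg_partial_sum_smeas m n (phi : T -> C) : phi \in BLfun mu p ->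
  smeas mu (avg_partial_sum m n phi).
Proof.
move=> phiL; apply: (@smeas_sum _ _ _ _ _ _ _
  (fun (i : 'I_(2 * n)) x => m (1 - n%:Z + i%:Z) *: avg_diff (1 - n%:Z + i%:Z) phi x)) => i.
have := strongly_measurableDZ (m (1 - n%:Z + i%:Z)) (avg_diff_smeas (1 - n%:Z + i%:Z) phiL)
  (strongly_measurable0 C mu).
by rewrite (_ : _ *: _ + _ = fun x => m (1 - n%:Z + i%:Z) *: avg_diff (1 - n%:Z + i%:Z) phi x)//;
  apply/funext => x; rewrite -[LHS]/(_ *: _ + 0) addr0.
Qed.

Lemma in_class_partial_sum m n (F : X) (phi : T -> C) (y : Y) : phi \in BLfun mu p ->
  in_class F (fun x => phi x *: y) ->
  in_class (partial_sum E m n F) (fun x => avg_partial_sum m n phi x *: y).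
Proof.
move=> phiL Fphi; have tL := BLfun_tensor y p1' phiL.
have cls k : in_class (m k *: Delta E k F) (fun x => (m k *: avg_diff k phi x) *: y).
  have := in_classZ (m k) (in_classB (in_class_condE Dy cY k tL Fphi) (in_class_condE Dy cY (k - 1) tL Fphi)).
  move=> h; apply: in_class_ae h _; apply: aeW => x.
  by rewrite !avg_tensor// -scalerBl scalerA.
have h := in_class_sum (2 * n) (fun i => cls (1 - n%:Z + i%:Z)).
by apply: in_class_ae h _; apply: aeW => x; rewrite -scaler_suml.
Qed.

Variable C0 : R.
Hypothesis H : spectral_resolution E C0.
Let cX : seq_complete X := Lp_complete cY.

Variables (m : int -> R[i]) (B : R).
Hypothesis B0 : 0 <= B.
Hypothesis mB : forall k, nrm (m k : C) <= B.

Let M_cvg F : partial_sum E m n F @[n --> \oo] --> multiplier E m F.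
Proof.
exact: (multiplierP cX H B0 mB).
Qed.

Lemma multiplier_tensor (F : X) (phi psi : T -> C) (y : Y) : phi \in BLfun mu p ->
  in_class F (fun x => phi x *: y) ->
  (forall x, avg_partial_sum m n phi x @[n --> \oo] --> psi x) ->
  in_class (multiplier E m F) (fun x => psi x *: y).
Proof.
move=> phiL Fphi hpsi.
apply: (in_class_limit (fun n => in_class_partial_sum m n phiL Fphi) _ (@M_cvg F)).
  by move=> n; apply: smeas_tensor; exact: avg_partial_sum_smeas.
move=> x; apply/cvg_nrmP; move/cvg_nrmP: (hpsi x) => h.
have h2 : (fun n => nrm (avg_partial_sum m n phi x - psi x) * nrm y) @ \oo --> (0 : R).
  by rewrite -(mul0r (nrm y)); apply: cvgM => //; exact: cvg_cst.
apply: cvg_trans h2; apply: near_eq_cvg; apply: nearW => n.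
by rewrite -scalerBl nrmZ.
Qed.

Lemma avg_truncation_cvg (q : R) (psi : T -> C) : 1 < q -> psi \in BLfun mu q ->
  BNorm mu q (fun x => bavg n%:Z psi x - bavg (- n%:Z) psi x - psi x) @[n --> \oo] --> 0%E.
Proof.
move=> q1 psiL; pose Eq := condE Dy cC (p1 := q1).
pose u := BLclass (toBL (ltW q1) psiL); have uc : in_class u psi by exact: in_class_toBL.
have h : Eq n%:Z u - Eq (- n%:Z) u @[n --> \oo] --> u.
  by rewrite -[X in _ --> X]subr0; apply: cvgB; [exact: condE_up|exact: condE_down].
have {}h : (fun n => (nrm (Eq n%:Z u - Eq (- n%:Z) u - u))%:E) @ \oo --> 0%E.
  by apply: cvg_EFin; [exact: nearW|exact/cvg_nrmP].
apply: cvg_trans h; apply: near_eq_cvg; apply: nearW => n.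
have c1 := in_class_condE Dy cC n%:Z psiL uc; have c2 := in_class_condE Dy cC (- n%:Z) psiL uc.
rewrite (nrm_in_class (in_classB (in_classB c1 c2) uc))//.
apply: smeasB; last exact: BLfun_sm psiL.
by apply: smeasB; exact: (avg_smeas Dy _ psiL).
Qed.

(** Here [psi] is known only through its averages. By hypothesis the partial sums for [phi]
    telescope to E_n psi - E_(-n) psi; they tend to [psi] in L^q, and their tensors with y tend in
    L^p to the multiplier applied to [F]. *)
Lemma multiplier_tensor_Lq (q : R) (F : X) (phi psi : T -> C) (y : Y) : 1 < q ->
  phi \in BLfun mu p -> psi \in BLfun mu q ->
  (forall k x, avg_diff k psi x = m k *: avg_diff k phi x) ->
  in_class F (fun x => phi x *: y) -> in_class (multiplier E m F) (fun x => psi x *: y).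
Proof.
move=> q1 phiL psiL hd Fphi.
have tele n x : avg_partial_sum m n phi x = bavg n%:Z psi x - bavg (- n%:Z) psi x.
  rewrite /avg_partial_sum; under eq_bigr do rewrite -hd.
  have t l : \sum_(i < l) avg_diff (1 - n%:Z + i%:Z) psi x = bavg (l%:Z - n%:Z) psi x - bavg (- n%:Z) psi x.
    elim: l => [|l IH]; first by rewrite big_ord0 sub0r subrr.
    rewrite big_ord_recr /= IH /avg_diff addrC.
    have -> : 1 - n%:Z + l%:Z - 1 = l%:Z - n%:Z by lia.
    have -> : 1 - n%:Z + l%:Z = l.+1%:Z - n%:Z by lia.
    have gen (a b c : C) : a - b + (b - c) = a - c by rewrite addrA subrK.
    exact: gen.
  rewrite t; have -> : (2 * n)%N%:Z - n%:Z = n%:Z by lia.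
  by [].
apply: (in_class_limit_Lq (ltW q1) (fun n => in_class_partial_sum m n phiL Fphi) _ _ (@M_cvg F)).
- by move=> n; apply: smeas_tensor; exact: avg_partial_sum_smeas.
- by apply: smeas_tensor; exact: BLfun_sm psiL.
have h : (fun n => (BNorm mu q (fun x => bavg n%:Z psi x - bavg (- n%:Z) psi x - psi x)%R * (nrm y)%:E)%E) @ \oo --> 0%E.
  by rewrite -(mul0e (nrm y)%:E); apply: cvgeZr => //; exact: avg_truncation_cvg.
apply: cvg_trans h; apply: near_eq_cvg; apply: nearW => n.
rewrite -(BNorm_tensor _ (ltW q1)).
  have -> : (fun x => (bavg n%:Z psi x - bavg (- n%:Z) psi x - psi x) *: y) =
      (fun x => avg_partial_sum m n phi x *: y - psi x *: y).
    by apply/funext => x; rewrite tele; exact: scalerBl.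
  by [].
apply: smeasB; last exact: BLfun_sm psiL.
by apply: smeasB; exact: (avg_smeas Dy _ psiL).
Qed.

End tensors.

(** * Heat semigroup *)

Lemma geometric_sum_le (R : realType) (q : R) n : 0 <= q < 1 -> \sum_(i < n) q ^+ i <= (1 - q)^-1.
Proof.
move=> /andP[q0 q1]; have d : 0 < 1 - q by rewrite subr_gt0.
rewrite -div1r ler_pdivlMr//.
have -> : (\sum_(i < n) q ^+ i) * (1 - q) = 1 - q ^+ n.
  elim: n => [|n IH]; first by rewrite big_ord0 mul0r expr0 subrr.
  by rewrite big_ord_recr /= mulrDl IH exprSr; ring.
by rewrite lerBlDr lerDl exprn_ge0.
Qed.

Lemma sum_two_sided (V : zmodType) (F : int -> V) n :
  \sum_(i < 2 * n) F (i%:Z - n%:Z) = \sum_(i < n) F i%:Z + \sum_(i < n) F (- i.+1%:Z).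
Proof.
elim: n => [|n IH]; first by rewrite muln0 !big_ord0 addr0.
rewrite mulnS !addSn add0n big_ord_recl big_ord_recr /= !big_ord_recr /=.
rewrite (eq_bigr (fun i : 'I_(2 * n) => F (i%:Z - n%:Z))); last first.
  by move=> i _; congr F; rewrite /bump /=; lia.
rewrite IH; set P := \sum_(i < n) F i; set Q := \sum_(i < n) F (- i.+1%:Z).
have -> : 0%N%:Z - n.+1%:Z = - n.+1%:Z by lia.
have -> : (bump 0 (2 * n))%:Z - n.+1%:Z = n%:Z by rewrite /bump /=; lia.
by rewrite [LHS]addrC [P + Q + _]addrAC !addrA.
Qed.

Section heat_sums.
Context (R : realType).
Variables (A t : R).
Hypothesis A1 : 1 < A.
Hypothesis t0 : 0 < t.

Definition heat_value (k : int) : R := expR (- (t * A ^ k)).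
(** With A^k for |xi|^alpha on the k-th shell, the drops are the weights in the layer-cake formula:
    e^(-t |xi|^alpha) is the sum of the drops of index at least k, that is, over the balls that
    contain xi. *)
Definition heat_drop (k : int) : R := heat_value k - heat_value (k + 1).

Let A0 : 0 < A := lt_trans ltr01 A1.

Lemma heat_value_ge0 k : 0 <= heat_value k. Proof. exact: expR_ge0. Qed.

Lemma heat_value_le1 k : heat_value k <= 1.
Proof. by rewrite /heat_value -expR0 ler_expR oppr_le0 mulr_ge0 ?(ltW t0)// exprz_ge0// ltW. Qed.

Lemma heat_drop_ge0 k : 0 <= heat_drop k.
Proof.
rewrite subr_ge0 ler_expR lerN2 ler_pM2l// (ler_eXz2l A1); lia.
Qed.

Lemma heat_drop_le k : heat_drop k <= heat_value k.
Proof. by rewrite lerBlDr lerDl heat_value_ge0. Qed.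

(** Choose M with A^M > r and put x = t A^n / M. From e^x >= x the heat value is at most x^-M, a
    constant times A^(-M n), which beats r^n geometrically. *)
Lemma heat_decay (r : R) : 0 < r -> exists K q : R, [/\ 0 <= K, 0 <= q < 1 &
  forall n : nat, heat_value n%:Z * r ^+ n <= K * q ^+ n].
Proof.
move=> r0; have [M hM] : exists M : nat, r < A ^+ M.
  have : (fun k => A^-1 ^+ k) @ \oo --> (0 : R).
    by apply: cvg_expr; rewrite ger0_norm ?invr_ge0 ?(ltW A0)// invf_lt1.
  have ri : 0 < r^-1 by rewrite invr_gt0.
  move=> /cvgrPdist_lt /(_ _ ri)[k _ /(_ k (leqnn k)) /=].
  rewrite sub0r normrN ger0_norm; last by rewrite exprn_ge0// invr_ge0 ltW.
  by rewrite exprVn ltf_pV2 ?posrE ?exprn_gt0// => h; exists k.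
exists ((M%:R / t) ^+ M), (r / A ^+ M).
have AM : 0 < A ^+ M by rewrite exprn_gt0.
split; first by rewrite exprn_ge0// divr_ge0// ltW.
  by rewrite divr_ge0 ?(ltW r0) ?(ltW AM)//= ltr_pdivrMr// mul1r.
move=> n; rewrite [(r / _) ^+ n]expr_div_n mulrCA mulrC ler_pM2l ?exprn_gt0//.
have An : 0 < A ^+ n by rewrite exprn_gt0.
case: M AM hM => [|M] AM hM.
  by rewrite !expr0 mul1r expr1n invr1 heat_value_le1.
pose x := t * A ^+ n / M.+1%:R.
have x0 : 0 < x by rewrite divr_gt0// mulr_gt0.
have -> : heat_value n%:Z = (expR x ^+ M.+1)^-1.
  rewrite /heat_value expRN; congr (_^-1); rewrite -expRM_natl /x [_ / _]mulrC mulVKf ?pnatr_eq0//.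
have -> : (M.+1%:R / t) ^+ M.+1 / (A ^+ M.+1) ^+ n = (x ^+ M.+1)^-1.
  have -> : (A ^+ M.+1) ^+ n = (A ^+ n) ^+ M.+1 by rewrite -!exprM mulnC.
  rewrite -[RHS]exprVn -[X in _ * X]exprVn -[LHS]exprMn; apply: (congr1 (fun z => z ^+ M.+1)).
  by rewrite /x; field; rewrite !gt_eqF.
rewrite lef_pV2 ?posrE ?exprn_gt0 ?expR_gt0//.
rewrite lerXn2r ?nnegrE ?(ltW x0) ?expR_ge0//.
by rewrite (le_trans _ (expR_ge1Dx x))// lerDr.
Qed.

Lemma heat_sum_bounded (r : R) : 1 < r -> exists K : R, forall n,
  \sum_(i < 2 * n) heat_drop (i%:Z - n%:Z) * r ^ (i%:Z - n%:Z) <= K.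
Proof.
move=> r1; have r0 : 0 < r := lt_trans ltr01 r1.
have [K [q [K0 q01 hq]]] := heat_decay r0.
have ri : 0 <= r^-1 < 1 by rewrite invr_ge0 (ltW r0)/= invf_lt1.
exists (K * (1 - q)^-1 + (1 - r^-1)^-1) => n.
rewrite (sum_two_sided (fun k => heat_drop k * r ^ k)); apply: lerD.
  apply: (@le_trans _ _ (K * \sum_(i < n) q ^+ i)); last by rewrite ler_wpM2l// geometric_sum_le.
  rewrite mulr_sumr; apply: ler_sum => i _; apply: le_trans (hq i).
  by rewrite -exprnP ler_wpM2r ?exprn_ge0 ?(ltW r0)// heat_drop_le.
apply: le_trans (geometric_sum_le n ri); apply: ler_sum => i _.
apply: (@le_trans _ _ (1 * r^-1 ^+ i)); last by rewrite mul1r.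
apply: ler_pM; rewrite ?heat_drop_ge0 ?exprz_ge0 ?(ltW r0)//.
  by rewrite (le_trans (heat_drop_le _))// heat_value_le1.
rewrite -invr_expz -exprnP -exprVn exprS ger_pMl ?exprn_gt0 ?invr_gt0//.
by case/andP: ri => _ /ltW.
Qed.

Lemma heat_value_cvg0 (r : R) : 0 < r -> (fun n : nat => heat_value n%:Z * r ^+ n) @ \oo --> (0 : R).
Proof.
move=> r0; have [K [q [K0 q01 hq]]] := heat_decay r0.
have h : (fun n => K * q ^+ n) @ \oo --> (0 : R).
  rewrite -(mulr0 K); apply: cvgM; first exact: cvg_cst.
  by apply: cvg_expr; rewrite ger0_norm; case/andP: q01.
apply: cvg0_le h; apply: nearW => n; rewrite hq andbT mulr_ge0 ?heat_value_ge0//.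
by rewrite exprn_ge0// ltW.
Qed.

Lemma heat_value_cvg1 : (fun n : nat => heat_value (- n%:Z)) @ \oo --> (1 : R).
Proof.
rewrite -[X in _ --> X]expR0; apply: (@cvg_comp _ _ _ (fun n : nat => - (t * A ^ (- n%:Z))) expR); last exact: continuous_expR.
rewrite -oppr0 -(mulr0 t); apply: cvgN; apply: cvgM; first exact: cvg_cst.
under eq_fun do rewrite -invr_expz -exprnP -exprVn.
by apply: cvg_expr; rewrite ger0_norm ?invr_ge0 ?(ltW A0)// invf_lt1.
Qed.

Lemma heat_drop_telescope (j : int) (n : nat) :
  \sum_(i < n) heat_drop (j + i%:Z) = heat_value j - heat_value (j + n%:Z).
Proof.
elim: n => [|n IH]; first by rewrite big_ord0 addr0 subrr.
rewrite big_ord_recr /= IH /heat_drop addrA subrK; congr (_ - heat_value _); lia.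
Qed.

End heat_sums.

Section two_sided_layers.
Context d (T : measurableType d) (R : realType) (mu : {measure set T -> \bar R}).
Context (Y : normedModType R[i]).
Hypothesis cY : seq_complete Y.

(** [bochner_layers] is applied to the nonnegative and the negative indices separately; each half of
    the kernel converges because it increases and stays below g. *)
Lemma bochner_two_sided_layers (A : int -> set T) (a b : int -> R) (C : R) (g : T -> R)
    (f : T -> Y) (v : int -> Y) :
  (forall i, measurable (A i)) -> (forall i, 0 <= a i) -> (forall i, 0 <= b i) ->
  smeas mu f ->
  (forall i, has_bochner mu (fun x => \1_(A i) x *: f x) (v i)) ->
  (forall i, (\int[mu]_(x in A i) (nrm (f x))%:E <= (b i)%:E)%E) ->
  (forall n, \sum_(i < 2 * n) a (i%:Z - n%:Z) * b (i%:Z - n%:Z) <= C) ->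
  (forall x, (fun n => \sum_(i < 2 * n) a (i%:Z - n%:Z) * \1_(A (i%:Z - n%:Z)) x) @ \oo --> g x) ->
  exists2 w, has_bochner mu (fun x => (g x)%:C *: f x) w &
    (fun n => \sum_(i < 2 * n) (a (i%:Z - n%:Z))%:C *: v (i%:Z - n%:Z)) @ \oo --> w.
Proof.
move=> mA a0 b0 mf hv hb hC hg.
pose P n x : R := \sum_(i < n) a i%:Z * \1_(A i%:Z) x.
pose Q n x : R := \sum_(i < n) a (- i.+1%:Z) * \1_(A (- i.+1%:Z)) x.
have PQ n x : \sum_(i < 2 * n) a (i%:Z - n%:Z) * \1_(A (i%:Z - n%:Z)) x = P n x + Q n x.
  by rewrite (sum_two_sided (fun k => a k * \1_(A k) x)).
have t0 k x : 0 <= a k * \1_(A k) x :> R by rewrite mulr_ge0.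
have P0 n x : 0 <= P n x by exact: sumr_ge0.
have Q0 n x : 0 <= Q n x by exact: sumr_ge0.
have ndP x : nondecreasing_seq (P ^~ x).
  by apply/nondecreasing_seqP => n; rewrite /P big_ord_recr /= lerDl.
have ndQ x : nondecreasing_seq (Q ^~ x).
  by apply/nondecreasing_seqP => n; rewrite /Q big_ord_recr /= lerDl.
have PQg n x : P n x + Q n x <= g x.
  have h : (fun n => P n x + Q n x) @ \oo --> g x.
    by have := hg x; under eq_fun do rewrite PQ.
  have c : cvgn (fun n => P n x + Q n x) by apply/cvg_ex; exists (g x).
  rewrite -(cvg_lim (@Rhausdorff R) h).
  apply: (@nondecreasing_cvgn_le _ (fun n => P n x + Q n x)) => //.
  by move=> i j ij; rewrite lerD ?ndP ?ndQ.
have cvgP_ x : cvgn (P ^~ x).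
  apply: nondecreasing_is_cvgn => //; exists (g x) => _ [n _ <-].
  by rewrite (le_trans _ (PQg n x))// lerDl.
have cvgQ_ x : cvgn (Q ^~ x).
  apply: nondecreasing_is_cvgn => //; exists (g x) => _ [n _ <-].
  by rewrite (le_trans _ (PQg n x))// lerDr.
have ab0 k : 0 <= a k * b k by rewrite mulr_ge0.
have hCn n : \sum_(i < n) a i%:Z * b i%:Z <= C /\ \sum_(i < n) a (- i.+1%:Z) * b (- i.+1%:Z) <= C.
  have := hC n; rewrite (sum_two_sided (fun k => a k * b k)) => h; split.
    by rewrite (le_trans _ h)// lerDl sumr_ge0.
  by rewrite (le_trans _ h)// lerDr sumr_ge0.
have [w1 h1 c1] := bochner_layers cY (fun i : nat => mA i%:Z) (fun i => a0 i%:Z) mf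
  (fun i => hv i%:Z) (fun i => hb i%:Z) (fun n => (hCn n).1) cvgP_.
have [w2 h2 c2] := bochner_layers cY (fun i : nat => mA (- i.+1%:Z)) (fun i => a0 (- i.+1%:Z)) mf
  (fun i => hv (- i.+1%:Z)) (fun i => hb (- i.+1%:Z)) (fun n => (hCn n).2) cvgQ_.
exists (w1 + w2); last first.
  under eq_fun do rewrite (sum_two_sided (fun k => (a k)%:C *: v k)).
  exact: cvgD.
have := bochnerDZ 1 h1 h2; rewrite scale1r; apply: bochner_eq => x.
rewrite scale1r -scalerDl -rmorphD; congr (_%:C *: _).
have h : (fun n => P n x + Q n x) @ \oo --> limn (P ^~ x) + limn (Q ^~ x) by exact: cvgD.
apply: (@cvg_unique _ (@Rhausdorff R) _ _ _ _ h).
by have := hg x; under eq_fun do rewrite PQ.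
Qed.

End two_sided_layers.

(** * Fejer kernels *)

Lemma fubini_rectangle d1 d2 (T1 : measurableType d1) (T2 : measurableType d2) (R : realType)
    (m1 : {sigma_finite_measure set T1 -> \bar R}) (m2 : {sigma_finite_measure set T2 -> \bar R})
    (A : set T1) (B : set T2) (k : T1 * T2 -> R) (G : R) :
  measurable A -> measurable B -> (m1 A < +oo)%E -> (m2 B < +oo)%E -> measurable_fun setT k ->
  (forall x y, A x -> B y -> `|k (x, y)| <= G) ->
  [/\ m1.-integrable A (fun x => \int[m2]_(y in B) (k (x, y))%:E)%E,
   measurable_fun B (fun y => \int[m1]_(x in A) (k (x, y))%:E)%E &
  (\int[m1]_(x in A) \int[m2]_(y in B) (k (x, y))%:E =
   \int[m2]_(y in B) \int[m1]_(x in A) (k (x, y))%:E)%E].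
Proof.
move=> mA mB A_lty B_lty mk kG; have mAB := measurableX mA mB.
pose f := (EFin \o k) \_ (A `*` B).
have fint : (m1 \x m2)%E.-integrable setT f.
  apply/(integrable_mkcond _ mAB).1/measurable_bounded_integrable => //.
  - rewrite [ltLHS](product_measure1E m1 m2)//.
    by rewrite lte_mul_pinfty// ge0_fin_numE.
  - exact: measurable_funS mk.
  exists G; split; first exact: num_real.
  by move=> M GM [x y] [/= Ax By]; exact: le_trans (kG _ _ Ax By) (ltW GM).
have fE x y : f (x, y) = if x \in A then (if y \in B then (k (x, y))%:E else 0%E) else 0%E.
  by rewrite /f patchE in_setX; case: (x \in A) => //=; case: (y \in B).
have e1 x : fubini_F m2 f x = if x \in A then (\int[m2]_(y in B) (k (x, y))%:E)%E else 0%E.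
  rewrite /fubini_F; under eq_integral do rewrite fE.
  by case: (x \in A); rewrite ?integral0// [RHS]integral_mkcond.
have e2 y : fubini_G m1 f y = if y \in B then (\int[m1]_(x in A) (k (x, y))%:E)%E else 0%E.
  rewrite /fubini_G; under eq_integral do rewrite fE.
  case: (y \in B); first by rewrite [RHS]integral_mkcond.
  by apply: integral0_eq => x _; case: (x \in A).
split.
- have h := integrableS measurableT mA (@subsetT _ A) (integrable_fubini_F fint).
  by apply: eq_integrable h => // x xA; rewrite e1 xA.
- have h := measurable_funS measurableT (@subsetT _ B) (measurable_fubini_G fint).
  by apply: eq_measurable_fun h => y yB; rewrite e2 yB.
rewrite (integral_mkcond A) (integral_mkcond B); have := Fubini fint.
rewrite -/(fubini_F m2 f) -/(fubini_G m1 f) => e.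
transitivity (\int[m1]_x fubini_F m2 f x)%E; first by apply: eq_integral => x _; rewrite patchE e1.
transitivity (\int[m2]_y fubini_G m1 f y)%E; first exact: e.
by apply: eq_integral => y _; rewrite patchE e2.
Qed.

Section fejer.
Context (R : realType).
Local Notation mu := (@lebesgue_measure R).

Definition fejer_weight (L xi : R) : R := 1 - xi / L.

(** The Cesaro mean of the inverse cosine transform. Its closed form (1 - cos(u L)) / (L u^2) is
    nonnegative, so an upper bound of a smeared integral controls a value at a point. *)
Definition fejer_kernel (L u : R) : R :=
  fine (\int[mu]_(xi in `[0%R, L]) (fejer_weight L xi * cos (u * xi))%:E)%E.

Lemma fejer_integrand_continuous L u : continuous (fun xi => fejer_weight L xi * cos (u * xi)).
Proof.
move=> x; apply: cvgM.
  by apply: cvgB; [exact: cvg_cst|apply: cvgMl; exact: cvg_id].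
apply: (@continuous_comp _ _ _ (fun z => u * z) (@cos R)); last exact: continuous_cos.
by apply: cvgMr; exact: cvg_id.
Qed.

Lemma fejer_kernel_integral L u :
  (\int[mu]_(xi in `[0%R, L]) (fejer_weight L xi * cos (u * xi))%:E = (fejer_kernel L u)%:E)%E.
Proof.
rewrite /fejer_kernel fineK//; apply: integrable_fin_num => //.
apply: continuous_compact_integrable; first exact: segment_compact.
by apply: continuous_subspaceT => x; exact: fejer_integrand_continuous.
Qed.

Lemma fejer_kernelE (L u : R) : 0 < L -> u != 0 -> fejer_kernel L u = (1 - cos (u * L)) / (L * u ^+ 2).
Proof.
move=> L0 u0; apply: EFin_inj; rewrite -fejer_kernel_integral.
pose F (xi : R) : R := (1 - xi / L) * (sin (u * xi) / u) - cos (u * xi) / (L * u ^+ 2).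
have dF (xi : R) : is_derive xi 1 F (fejer_weight L xi * cos (u * xi)).
  have da : is_derive xi 1 (fun x : R => u *: x) (u *: 1) by exact: is_deriveZ.
  have d1 := @is_derive1_comp R sin _ xi _ _ (is_derive_sin _) da.
  have d2 := @is_derive1_comp R cos _ xi _ _ (is_derive_cos _) da.
  have d3 : is_derive xi 1 (fun x : R => 1 - L^-1 *: x) (0 - L^-1 *: 1).
    exact: (is_deriveB (is_derive_cst (1 : R^o) (xi : R^o) (1 : R^o)) (is_deriveZ L^-1 (is_derive_id (xi : R^o) (1 : R^o)))).
  have d4 := is_deriveB (is_deriveM d3 (is_deriveZ u^-1 d1)) (is_deriveZ (L * u ^+ 2)^-1 d2).
  have -> : F = (fun x : R => 1 - L^-1 *: x) * (u^-1 *: (sin \o (fun x : R => u *: x))) -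
      (L * u ^+ 2)^-1 *: (cos \o (fun x : R => u *: x)).
    apply/funext => x; rewrite /F -[RHS]/((1 - L^-1 * x) * (u^-1 * sin (u * x)) - (L * u ^+ 2)^-1 * cos (u * x)).
    by rewrite (mulrC x) (mulrC (sin _)) (mulrC (cos _)).
  apply: (is_derive_eq d4); rewrite /fejer_weight.
  rewrite -[LHS]/((1 - L^-1 * xi) * (u^-1 * (cos (u * xi) * (u * 1))) +
    (u^-1 * sin (u * xi)) * (0 - L^-1 * 1) - (L * u ^+ 2)^-1 * (- sin (u * xi) * (u * 1))).
  by field; rewrite u0 gt_eqF.
have cF : continuous F.
  by move=> xi; apply: differentiable_continuous; apply/derivable1_diffP; have [] := dF xi.
rewrite (@continuous_FTC2 _ _ F)//.
- have FE xi : F xi = (1 - xi / L) * (sin (u * xi) / u) - cos (u * xi) / (L * u ^+ 2) by [].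
  have F0 : F 0 = - (1 / (L * u ^+ 2)) by rewrite FE mulr0 sin0 cos0 !mul0r mulr0 sub0r.
  have FL : F L = - (cos (u * L) / (L * u ^+ 2)) by rewrite FE divff ?gt_eqF// subrr mul0r sub0r.
  by rewrite F0 FL -EFinB; apply: (congr1 EFin); rewrite opprK addrC -mulrBl.
- by apply: continuous_subspaceT => x; exact: fejer_integrand_continuous.
- split; first by move=> x _; have [] := dF x.
    by apply: cvg_at_right_filter; exact: cF.
  by apply: cvg_at_left_filter; exact: cF.
- by move=> x _; rewrite derive1E; apply: derive_val.
Qed.

Lemma fejer_weight_itv L xi : 0 < L -> `[0, L]%classic xi -> 0 <= fejer_weight L xi <= 1.
Proof.
move=> L0; rewrite /= in_itv /= => /andP[x0 xL]; rewrite /fejer_weight subr_ge0 ler_pdivrMr// mul1r xL /=.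
by rewrite gerBl divr_ge0// ltW.
Qed.

Lemma fejer_kernel_ge0 (L u : R) : 0 < L -> 0 <= fejer_kernel L u.
Proof.
move=> L0; have [->|u0] := eqVneq u 0.
  rewrite /fejer_kernel fine_ge0//; apply: integral_ge0 => xi h.
  by rewrite mul0r cos0 mulr1 lee_fin; have /andP[] := fejer_weight_itv L0 h.
by rewrite fejer_kernelE// divr_ge0 ?(mulr_ge0 (ltW L0) (sqr_ge0 u))// subr_ge0 cos_le1.
Qed.

Lemma fejer_kernel_far (L u d : R) : 0 < L -> 0 < d -> d <= `|u| -> fejer_kernel L u <= 2 / (L * d ^+ 2).
Proof.
move=> L0 d0 du; have u0 : 0 < `|u| by exact: lt_le_trans du.
rewrite fejer_kernelE//; last by rewrite -normr_gt0.
apply: ler_pM; rewrite ?invr_ge0 ?(mulr_ge0 (ltW L0) (sqr_ge0 u))//.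
by have := cos_geN1 (u * L); lra.
have u2 : 0 < u ^+ 2 by rewrite -real_normK ?num_real// exprn_gt0.
rewrite lef_pV2 ?posrE ?(mulr_gt0 L0 u2) ?(mulr_gt0 L0 (exprn_gt0 2 d0))//.
by rewrite ler_pM2l// -[leRHS]real_normK ?num_real// ler_pXn2r ?nnegrE ?(ltW d0)// ltW.
Qed.

Lemma fejer_kernel_near (L u : R) : 0 < L -> L^-1 <= u <= 2 / L ->
  L * ((1 - cos 1) / 4) <= fejer_kernel L u.
Proof.
move=> L0 /andP[u1 u2]; have u0 : 0 < u by rewrite (lt_le_trans _ u1)// invr_gt0.
have uL1 : 1 <= u * L by rewrite -ler_pdivrMr// mul1r.
have uL2 : u * L <= 2 by rewrite -ler_pdivlMr.
have pi2 := @pi_ge2 R.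
have c : cos (u * L) <= cos 1.
  have [->//|/eqP n1] := eqVneq (u * L) 1.
  by apply: ltW; rewrite ltr_cos ?in_itv /=; [lra|apply/andP; split; lra..].
rewrite fejer_kernelE ?gt_eqF// ler_pdivlMr ?mulr_gt0 ?exprn_gt0//.
have -> : L * ((1 - cos 1) / 4) * (L * u ^+ 2) = (1 - cos 1) * ((u * L) ^+ 2 / 4) by field.
rewrite (@le_trans _ _ ((1 - cos 1) * 1))//; last by rewrite mulr1 lerD2l lerN2.
by rewrite ler_wpM2l ?subr_ge0 ?cos_le1//; nra.
Qed.

(** This is 2 / c with c = (1 - cos 1) / 4, where L c bounds the kernel from below for 1 / L <= u <=
    2 / L. *)
Definition peak_constant : R := 8 / (1 - cos 1).

Lemma cos1_lt1 : cos 1 < 1 :> R.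
Proof.
have pi2 := @pi_ge2 R.
by rewrite -[ltRHS]cos0 ltr_cos ?ltr01// in_itv /=; apply/andP; split; lra.
Qed.

Lemma peak_constant_gt0 : 0 < peak_constant.
Proof. by rewrite divr_gt0// subr_gt0 cos1_lt1. Qed.

(** Let v = h(x0) > 0. On the interval from x0 + 1 / L to x0 + 2 / L the integrand is at least (v /
    2) L c; elsewhere near x0 it is nonnegative, and far away it is O(1 / L). Letting L grow gives v
    c / 2 <= Q. *)
Lemma fejer_peak (h : R -> R) a b x0 G0 Q : a < x0 < b -> {for x0, continuous h} ->
  (forall x, `|h x| <= G0) -> 0 <= Q ->
  (forall L, 0 < L -> mu.-integrable `[a, b] (fun x => (h x * fejer_kernel L (x - x0))%:E)) ->
  (forall L, 0 < L -> (\int[mu]_(x in `[a, b]) (h x * fejer_kernel L (x - x0))%:E <= Q%:E)%E) ->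
  h x0 <= peak_constant * Q.
Proof.
move=> /andP[ax0 x0b] ch hG Q0 hint hQ; have c0 : 0 < 1 - cos 1 :> R by rewrite subr_gt0 cos1_lt1.
have [v0|v0] := leP (h x0) 0; first by rewrite (le_trans v0)// mulr_ge0// ltW// peak_constant_gt0.
set v := h x0 in v0 *; pose c : R := (1 - cos 1) / 4.
have cp : 0 < c by rewrite divr_gt0.
have G00 : 0 <= G0 by exact: le_trans (hG 0).
have [dl dl0 hdl] : exists2 dl : R, 0 < dl & forall x, `|x0 - x| < dl -> v / 2 <= h x /\ a <= x <= b.
  have : \forall x \near x0, v / 2 <= h x /\ a <= x <= b.
    have hx0 : x0 \in `]a, b[ by rewrite in_itv /= ax0.
    near=> x; split.
    have : `|v - h x| < v / 2 by near: x; move/cvgrPdist_lt: ch; apply; rewrite divr_gt0.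
    by rewrite ltr_norml => /andP[]; lra.
    have : x \in `]a, b[ by near: x; exact: near_in_itvoo hx0.
    by rewrite in_itv /= => /andP[/ltW -> /ltW ->].
  move=> /nbhs_ballP[dl /= dl0 hb]; exists dl => // x xd; exact: hb.
have key L : 0 < L -> 2 / L < dl -> v * c / 2 <= Q + 2 * G0 * (b - a) / dl ^+ 2 / L.
  move=> L0 Ld; pose J : set R := `[x0 + L^-1, x0 + 2 / L]%classic.
  pose k1 := v / 2 * (L * c); pose k2 := G0 * (2 / (L * dl ^+ 2)).
  have k10 : 0 <= k1 by rewrite !mulr_ge0// ltW// divr_gt0.
  have k20 : 0 <= k2 by rewrite !mulr_ge0// ?invr_ge0 ?mulr_ge0 ?sqr_ge0// ltW.
  have iL : 0 < L^-1 by rewrite invr_gt0.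
  have JI : J `<=` `[a, b]%classic.
    move=> x; rewrite /J /= !in_itv /= => /andP[x1 x2]; apply: (hdl x _).2.
    by rewrite ltr_distlC; apply/andP; split; lra.
  have pt x : `[a, b]%classic x -> k1 * \1_J x - k2 <= h x * fejer_kernel L (x - x0).
    move=> _; have [xd|xd] := ltP `|x0 - x| dl; last first.
      have -> : \1_J x = 0 :> R.
        rewrite indicE memNset// /J /= in_itv /= => /andP[x1 x2].
        by move: xd; rewrite leNgt ltr_distlC => /negP; apply; apply/andP; split; lra.
      rewrite mulr0 sub0r.
      have h1 : `|h x * fejer_kernel L (x - x0)| <= k2.
        rewrite normrM (ger0_norm (fejer_kernel_ge0 _ L0)) ler_pM ?fejer_kernel_ge0//.
        by apply: fejer_kernel_far => //; rewrite distrC.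
      by move: h1; rewrite ler_norml => /andP[].
    have [hv _] := hdl x xd; have kp := fejer_kernel_ge0 (x - x0) L0.
    have : v / 2 * fejer_kernel L (x - x0) <= h x * fejer_kernel L (x - x0) by rewrite ler_wpM2r.
    apply: le_trans; rewrite indicE; case: (boolP (x \in J)) => [/set_mem|_].
      rewrite /J /= in_itv /= => /andP[x1 x2].
      have kn : L * c <= fejer_kernel L (x - x0) by apply: fejer_kernel_near => //; apply/andP; split; lra.
      rewrite mulr1 (@le_trans _ _ k1) ?gerBl// /k1 ler_wpM2l//.
      by rewrite divr_ge0// ltW.
    by rewrite mulr0 sub0r (@le_trans _ _ 0) ?oppr_le0// mulr_ge0// divr_ge0// ltW.
  have mJ : measurable J by exact: measurable_itv.
  have muJ : mu J = (L^-1)%:E.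
    rewrite /J lebesgue_measure_itv /= lte_fin ltrD2l ltr_pMl// ltr1n -EFinB; congr EFin; ring.
  have muI : mu `[a, b]%classic = (b - a)%:E.
    by rewrite lebesgue_measure_itv /= lte_fin (lt_trans ax0 x0b) -EFinB.
  have i1 : mu.-integrable `[a, b] (fun x => (\1_J x)%:E).
    by apply: (integrableS measurableT) => //; rewrite /J; exact: integrable_indic_itv.
  have iJ : mu.-integrable `[a, b] (fun x => (k1 * \1_J x)%:E).
    by apply: eq_integrable (integrableZl _ k1 i1) => // x _; rewrite EFinM.
  have ik : mu.-integrable `[a, b] (fun x => k2%:E).
    apply: (@continuous_compact_integrable R (cst k2)); first exact: segment_compact.
    by apply: continuous_subspaceT => x; exact: cst_continuous.
  have e : (\int[mu]_(x in `[a, b]) (k1 * \1_J x - k2)%:E = (k1 / L - k2 * (b - a))%:E)%E.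
    under eq_integral do rewrite EFinB.
    rewrite integralB// integral_cst// (_ : (_ * _)%E = (k2 * (b - a))%:E); last first.
      by etransitivity; [exact: (congr1 (fun z => (k2%:E * z)%E) muI)|rewrite EFinM].
    under eq_integral do rewrite EFinM.
    rewrite integralZl//.
    rewrite integral_indic// (setIidl JI) [X in (_ * X - _)%E](_ : _ = (L^-1)%:E)//.
  have : ((k1 / L - k2 * (b - a))%:E <= Q%:E)%E.
    rewrite -e; apply: le_trans (hQ L L0); apply: le_integral => //.
    - by apply: eq_integrable (integrableB _ iJ ik) => // x _; rewrite EFinB.
    - exact: hint.
    - by move=> x /set_mem xI; rewrite lee_fin pt.
  rewrite lee_fin /k1 /k2; have -> : v / 2 * (L * c) / L = v * c / 2 by field; rewrite gt_eqF.
  have -> : G0 * (2 / (L * dl ^+ 2)) * (b - a) = 2 * G0 * (b - a) / dl ^+ 2 / L.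
    by field; rewrite !gt_eqF.
  by rewrite lerBlDr.
have h1 : v * c / 2 <= Q.
  rewrite leNgt; apply/negP => hlt; set D := 2 * G0 * (b - a) / dl ^+ 2 in key.
  have D0 : 0 <= D.
    rewrite /D mulr_ge0 ?invr_ge0 ?sqr_ge0// mulr_ge0 ?mulr_ge0// subr_ge0 ltW//.
    exact: lt_trans x0b.
  pose e := v * c / 2 - Q; have e0 : 0 < e by rewrite subr_gt0.
  (* Large enough to keep the interval of the peak within [dl] of x0 and to make the far
     contribution D / L smaller than e. *)
  pose L := 2 / dl + D / e + 1.
  have p1 : 0 <= D / e by rewrite divr_ge0// ltW.
  have p2 : 0 < 2 / dl by rewrite divr_gt0.
  have L0 : 0 < L by rewrite /L; lra.
  have l1 : 2 / L < dl by rewrite ltr_pdivrMr// mulrC -ltr_pdivrMr// /L; lra.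
  have l2 : D / L < e by rewrite ltr_pdivrMr// mulrC -ltr_pdivrMr// /L; lra.
  by have := key L L0 l1; rewrite -lerBlDl -/e leNgt l2.
rewrite /peak_constant mulrAC ler_pdivlMr//.
by move: h1; rewrite /c; lra.
Unshelve. all: by end_near. Qed.

Lemma cosine_integrable (h : R -> R) a b x0 xi : continuous h ->
  mu.-integrable `[a, b] (fun x => (h x * cos ((x - x0) * xi))%:E).
Proof.
move=> ch; apply: (@continuous_compact_integrable R (fun x => h x * cos ((x - x0) * xi))).
  exact: segment_compact.
apply: continuous_subspaceT => x; apply: cvgM; first exact: ch.
apply: (@continuous_comp _ _ _ (fun z => (z - x0) * xi) (@cos R)); last exact: continuous_cos.
by apply: cvgMl; apply: cvgB; [exact: cvg_id|exact: cvg_cst].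
Qed.

(** Fubini writes the smeared integral as an integral over [0, L] of the cosine transform against
    weights between 0 and 1, so it is at most Q; the bound from below comes from applying the same
    to - h. *)
Lemma sup_bound_of_cosine_transform (h r : R -> R) a b x0 G0 Q : a < x0 < b -> continuous h ->
  (forall x, `|h x| <= G0) -> 0 <= Q -> measurable_fun setT r ->
  (forall xi, (`|\int[mu]_(x in `[a, b]) (h x * cos ((x - x0) * xi))%:E| <= (r xi)%:E)%E) ->
  (forall L, 0 < L -> (\int[mu]_(xi in `[0%R, L]) (r xi)%:E <= Q%:E)%E) ->
  `|h x0| <= peak_constant * Q.
Proof.
wlog suff main : h / (continuous h -> (forall x, `|h x| <= G0) ->
    (forall xi, (`|\int[mu]_(x in `[a, b]) (h x * cos ((x - x0) * xi))%:E| <= (r xi)%:E)%E) ->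
    a < x0 < b -> 0 <= Q -> measurable_fun setT r ->
    (forall L, 0 < L -> (\int[mu]_(xi in `[0%R, L]) (r xi)%:E <= Q%:E)%E) ->
    h x0 <= peak_constant * Q).
  move=> hx ch hG Q0 mr hr hL; rewrite ler_norml lerNl; apply/andP; split; last exact: main.
  apply: (main (fun x => - h x)) => //.
  - by move=> x; apply: cvgN; exact: ch.
  - by move=> x; rewrite normrN.
  move=> xi; apply: le_trans (hr xi); under eq_integral do rewrite mulNr EFinN.
  by rewrite integralN ?abseN//; apply: integrable_add_def => //; exact: cosine_integrable.
move=> ch hG hr hx Q0 mr hL; have G00 : 0 <= G0 by exact: le_trans (hG 0).
have mh : measurable_fun setT h by exact: continuous_measurable_fun.
have muI : (mu `[a, b]%classic < +oo)%E.
  by have /andP[ax0 x0b] := hx; rewrite lebesgue_measure_itv /= lte_fin (lt_trans ax0 x0b) -EFinB ltry.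
have fub L : 0 < L -> let k := fun z : R * R => h z.1 * (fejer_weight L z.2 * cos ((z.1 - x0) * z.2)) in
    [/\ mu.-integrable `[a, b] (fun x => (h x * fejer_kernel L (x - x0))%:E),
     measurable_fun `[0%R, L] (fun xi => \int[mu]_(x in `[a, b]) (k (x, xi))%:E)%E &
     (\int[mu]_(x in `[a, b]) (h x * fejer_kernel L (x - x0))%:E =
      \int[mu]_(xi in `[0%R, L]) \int[mu]_(x in `[a, b]) (k (x, xi))%:E)%E].
  move=> L0 k.
  have muL : (mu `[0%R, L]%classic < +oo)%E.
    by rewrite lebesgue_measure_itv /= lte_fin L0 -EFinB ltry.
  have mw : measurable_fun setT (fejer_weight L).
    apply: measurable_funB => //; apply: measurable_funM => //.
  have mk : measurable_fun setT k.
    apply: measurable_funM; first exact: (measurableT_comp mh measurable_fst).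
    apply: measurable_funM; first exact: (measurableT_comp mw measurable_snd).
    apply: measurableT_comp; first by apply: continuous_measurable_fun; exact: continuous_cos.
    by apply: measurable_funM => //; apply: measurable_funB.
  have kG x xi : `[a, b]%classic x -> `[0%R, L]%classic xi -> `|k (x, xi)| <= G0.
    move=> _ xiL; have /andP[w0 w1] := fejer_weight_itv L0 xiL.
    rewrite /k /= normrM -[leRHS]mulr1 ler_pM// normrM -[leRHS]mulr1 ler_pM ?cos_max//.
    by rewrite ger0_norm.
  have inner x : (\int[mu]_(xi in `[0%R, L]) (k (x, xi))%:E = (h x * fejer_kernel L (x - x0))%:E)%E.
    rewrite EFinM -fejer_kernel_integral -integralZl//.
    apply: (@continuous_compact_integrable R (fun xi => fejer_weight L xi * cos ((x - x0) * xi))).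
      exact: segment_compact.
    by apply: continuous_subspaceT => y; exact: fejer_integrand_continuous.
  pose sf : {sigma_finite_measure set (measurableTypeR R) -> \bar R} := mu.
  have [i1 i2 e1] := fubini_rectangle (m1 := sf) (m2 := sf) (measurable_itv _) (measurable_itv _) muI muL mk kG.
  
  split; [|exact: i2|].
  - by apply: eq_integrable i1 => // x _; exact: inner.
  - by rewrite -[RHS]e1; apply: eq_integral => x _; rewrite inner.
apply: (fejer_peak hx (ch x0) hG Q0) => L L0; first by have [] := fub L L0.
have [_ mi2 ->] := fub L L0; apply: le_trans (hL L L0).
refine (le_trans (le_trans (lee_abs _) (le_abse_integral mu (measurable_itv `[0%R, L]) mi2)) _).
apply: ge0_le_integral => //.
- exact: measurableT_comp.
- by apply/measurable_EFinP; exact: measurable_funS mr.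
move=> xi xiL; have /andP[w0 w1] := fejer_weight_itv L0 xiL.
have e : (\int[mu]_(x in `[a, b]) (h x * (fejer_weight L xi * cos ((x - x0) * xi)))%:E =
    (fejer_weight L xi)%:E * \int[mu]_(x in `[a, b]) (h x * cos ((x - x0) * xi))%:E)%E.
  rewrite -integralZl//; last exact: cosine_integrable.
  by apply: eq_integral => x _; rewrite -EFinM mulrCA.
rewrite [X in (`|X| <= _)%E]e abseM /= (ger0_norm w0); apply: le_trans (hr xi).
by rewrite -[leRHS]mul1e lee_wpmul2r// lee_fin.
Qed.

End fejer.

(** * From Sobolev norms to bounds of the supremum *)

Section weighted_average.
Context (R : realType).
Local Notation mu := (@lebesgue_measure R).
Variable q : R -> R.
Hypothesis cq : continuous q.
Hypothesis q0 : forall xi, 0 <= q xi.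

Lemma measurable_half_sum : measurable_fun setT (fun xi => (q xi + q (- xi)) / 2).
Proof.
have mq : measurable_fun setT q by exact: continuous_measurable_fun.
apply: measurable_funM => //; apply: measurable_funD => //.
by apply: (measurableT_comp mq); exact: oppr_measurable.
Qed.

(** Cauchy-Schwarz against 1 / (1 + xi^2) in its pointwise form: q is at most (1 + xi^2) q^2 / (2 M)
    plus M / (2 (1 + xi^2)). The weight dominates 1 + xi^2 because s >= 1, and 1 / (1 + xi^2) has
    the arctangent as primitive. *)
Lemma half_line_average_le (s M L : R) : 1 <= s -> 0 < M -> 0 < L ->
  (\int[mu]_xi ((1 + xi ^+ 2) `^ s * (q xi * q xi))%:E <= (M ^+ 2)%:E)%E ->
  (\int[mu]_(xi in `[0%R, L]) ((q xi + q (- xi)) / 2)%:E <= (2 * M)%:E)%E.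
Proof.
move=> s1 M0 L0 IW.
pose w (xi : R) := (1 + xi ^+ 2) `^ s.
have w1 (xi : R) : 1 <= 1 + xi ^+ 2 by rewrite lerDl sqr_ge0.
have w0 xi : 0 < w xi by rewrite powR_gt0// (lt_le_trans ltr01 (w1 xi)).
have cw : continuous w.
  move=> xi; apply: (@continuous_comp _ _ _ (fun z : R => 1 + z ^+ 2) (fun z => z `^ s)).
    by apply: cvgD; [exact: cvg_cst|exact: exprn_continuous].
  have [+ _] := is_derive1_powR s (lt_le_trans ltr01 (w1 xi)).
  by move/derivable1_diffP/differentiable_continuous.
pose W xi := w xi * (q xi * q xi).
have cW : continuous W by move=> xi; apply: cvgM; [exact: cw|apply: cvgM; exact: cq].
have W0 xi : 0 <= W xi by rewrite mulr_ge0 ?mulr_ge0// ltW.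
have W_half (D : set R) : measurable D -> (\int[mu]_(xi in D) (W xi)%:E <= (M ^+ 2)%:E)%E.
  move=> mD; apply: le_trans IW; apply: ge0_subset_integral => //.
  - by apply/measurable_EFinP; exact: continuous_measurable_fun.
  - by move=> xi _; rewrite lee_fin.
have W_opp : (\int[mu]_(xi in `[0%R, L]) (W (- xi))%:E <= (M ^+ 2)%:E)%E.
  have e := integration_by_substitution_oppr (ltW L0) (continuous_subspaceT (A := `[- L, - 0]%classic) cW).
  have := W_half `[- L, - 0]%classic (measurable_itv _).
  by rewrite e.
have mcont (h : R -> R) : continuous h -> measurable_fun `[0%R, L]%classic (fun xi => (h xi)%:E).
  by move=> ch; apply/measurable_EFinP; apply: measurable_funS (continuous_measurable_fun ch).
have cN (h : R -> R) : continuous h -> continuous (fun xi => h (- xi)).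
  by move=> ch xi; apply: (@continuous_comp _ _ _ (fun z : R => - z) h); [exact: oppr_continuous|exact: ch].
pose V (xi : R) := (1 + xi ^+ 2)^-1.
have cV : continuous V.
  move=> xi; apply: cvgV; first by rewrite gt_eqF// (lt_le_trans ltr01 (w1 xi)).
  by apply: cvgD; [exact: cvg_cst|exact: exprn_continuous].
have V0 xi : 0 <= V xi by rewrite invr_ge0 (le_trans ler01 (w1 xi)).
have IV : (\int[mu]_(xi in `[0%R, L]) (V xi)%:E <= 2%:E)%E.
  have iV : mu.-integrable `[0%R, L] (fun xi => (V xi)%:E).
    apply: continuous_compact_integrable; first exact: segment_compact.
    exact: continuous_subspaceT.
  have := integral0_oneDsqr (ltW L0); rewrite /Rintegral => e.
  rewrite -[leLHS]fineK; last exact: integrable_fin_num.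
  rewrite lee_fin [leLHS]e.
  have a2 := @atan_ltpi2 R L; have p4 := @pihalf_lt2 R.
  by lra.
have young xi : q xi <= W xi / (2 * M) + M / 2 * V xi.
  pose P := 1 + xi ^+ 2; have P0 : 0 < P := lt_le_trans ltr01 (w1 xi).
  have Pw : P <= w xi by rewrite -[leLHS]powRr1 ?(ltW P0)// /w ler_powR// w1.
  apply: (@le_trans _ _ (P * (q xi * q xi) / (2 * M) + M / 2 * V xi)).
    rewrite -subr_ge0; have -> : P * (q xi * q xi) / (2 * M) + M / 2 * V xi - q xi = (P * q xi - M) ^+ 2 / (2 * M * P).
      by rewrite /V -/P; field; rewrite !gt_eqF.
    by rewrite divr_ge0 ?sqr_ge0// !mulr_ge0// ltW.
  by rewrite lerD2r ler_pM2r ?invr_gt0 ?mulr_gt0// ler_wpM2r// mulr_ge0.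
pose r xi : R := (4 * M)^-1 * W xi + ((4 * M)^-1 * W (- xi) + M / 2 * V xi).
apply: (@le_trans _ _ (\int[mu]_(xi in `[0%R, L]) (r xi)%:E)%E).
  apply: ge0_le_integral => //.
  - by move=> xi _; rewrite lee_fin divr_ge0// addr_ge0.
  - apply: (mcont (fun xi => (q xi + q (- xi)) / 2)) => xi; apply: cvgMl; apply: cvgD; first exact: cq.
    exact: (cN q).
  - apply: (mcont r) => xi; apply: cvgD; first by apply: cvgMr; exact: cW.
    by apply: cvgD; apply: cvgMr; [exact: (cN W)|exact: cV].
  move=> xi _; rewrite lee_fin.
  have h1 := young xi; have := young (- xi); rewrite {1}/V sqrrN -/(V xi) => h2.
  rewrite ler_pdivrMr//; apply: (le_trans (lerD h1 h2)).
  by rewrite /r; apply: eqW; field; rewrite gt_eqF.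
have i0 : 0 <= (4 * M)^-1 by rewrite invr_ge0 mulr_ge0// ltW.
have m0 : 0 <= M / 2 by rewrite divr_ge0// ltW.
have -> : (\int[mu]_(xi in `[0%R, L]) (r xi)%:E = \int[mu]_(xi in `[0%R, L])
    ((4 * M)^-1%:E * (W xi)%:E + ((4 * M)^-1%:E * (W (- xi))%:E + (M / 2)%:E * (V xi)%:E)))%E.
  by apply: eq_integral => xi _; rewrite /r !EFinD !EFinM.
have mW := mcont W cW; have mWN := mcont _ (cN W cW); have mV := mcont V cV.
have mZ (c : R) (h : R -> R) : measurable_fun `[0%R, L]%classic (fun xi => (h xi)%:E) ->
    measurable_fun `[0%R, L]%classic (fun xi => (c%:E * (h xi)%:E)%E).
  by move=> mh; exact: measurable_funeM.
have nZ (c : R) (h : R -> R) : 0 <= c -> (forall xi, 0 <= h xi) ->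
    forall xi, `[0%R, L]%classic xi -> (0 <= c%:E * (h xi)%:E)%E.
  by move=> c0 h0 xi _; rewrite mule_ge0// lee_fin.
rewrite ge0_integralD//; [|exact: nZ|exact: mZ|by move=> xi _; rewrite adde_ge0// mule_ge0// lee_fin|
  by apply: emeasurable_funD; exact: mZ].
rewrite ge0_integralD//; [|exact: (nZ _ (fun xi => W (- xi)))|exact: (mZ _ (fun xi => W (- xi)))|exact: nZ|exact: mZ].
rewrite !ge0_integralZl//; try by move=> xi _; rewrite lee_fin.
(* The 3 is what completes the total to 2 M; the arctangent integral is at most 2. *)
have -> : 2 * M = (4 * M)^-1 * M ^+ 2 + ((4 * M)^-1 * M ^+ 2 + M / 2 * 3).
  by field; rewrite gt_eqF.
rewrite !EFinD !EFinM; apply: leeD; first by rewrite lee_wpmul2l// W_half.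
apply: leeD; first by rewrite lee_wpmul2l.
rewrite lee_wpmul2l//; apply: le_trans IV _; rewrite lee_fin; lra.
Qed.

End weighted_average.

Section sobolev.
Context (R : realType).
Local Notation mu := (@lebesgue_measure R).
Local Notation C := (R[i]^o).

Definition conj_exp (u : R) : R[i] := cos u -i* sin u.

Lemma conj_expD u v : conj_exp (u + v) = conj_exp u * conj_exp v.
Proof.
by rewrite /conj_exp cosD sinD; apply/eqP; rewrite eq_complex /=; apply/andP; split; apply/eqP; ring.
Qed.

Lemma conj_exp_cos u : conj_exp u + conj_exp (- u) = (2 * cos u)%:C.
Proof.
rewrite /conj_exp cosN sinN; apply/eqP; rewrite eq_complex /=.
by apply/andP; split; apply/eqP; ring.
Qed.

Lemma nrm_conj_exp u : nrm (conj_exp u : C) = 1.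
Proof.
apply/eqP; rewrite -(eqrXn2 (n := 2)) ?nrm_ge0// nrm_complex_sqr expr1n /=.
by rewrite sqrrN cos2Dsin2.
Qed.

Lemma conj_exp_lip u v : nrm (conj_exp u - conj_exp v : C) <= 2 * `|u - v|.
Proof.
apply: le_trans (nrm_le_ReIm _) _.
wlog vu : u v / v <= u.
  move=> W; case: (leP v u) => [|/ltW] h; first exact: W.
  have e (x y : C) : `|complex.Re (x - y)| + `|complex.Im (x - y)| = `|complex.Re (y - x)| + `|complex.Im (y - x)|.
    by rewrite !raddfB /= distrC (distrC (complex.Im x)).
  by rewrite e (distrC u v); exact: W.
have h1 : `|cos u - cos v| <= 1 * (u - v).
  apply: (@mean_value_bound R cos (fun x => - sin x)) => [|x _]; first exact: vu.
  by rewrite normrN sin_max.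
have h2 : `|sin u - sin v| <= 1 * (u - v).
  apply: (@mean_value_bound R sin (fun x => cos x)) => [|x _]; first exact: vu.
  by rewrite cos_max.
rewrite !raddfB /= opprK addrC (ger0_norm (_ : 0 <= u - v)) ?subr_ge0//.
have -> : `|- sin u + sin v| = `|sin u - sin v| by rewrite -normrN opprD opprK.
by move: h1 h2; lra.
Qed.

Variables (a b B : R) (g : R -> C) (G : R).
Hypothesis aB : forall x, a <= x <= b -> `|x| <= B.
Hypothesis ab : a < b.
Hypothesis cg : continuous g.
Hypothesis gG : forall x, nrm (g x) <= G.
Hypothesis g0 : forall x, ~ a <= x <= b -> g x = 0.

Let G0 : 0 <= G. Proof. exact: le_trans (nrm_ge0 _) (gG 0). Qed.

Lemma indicator_integral (c : R) : 0 <= c ->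
  (\int[mu]_x (c * \1_(`[a, b]%classic) x)%:E = (c * (b - a))%:E)%E.
Proof.
move=> c0; under eq_integral do rewrite EFinM.
rewrite ge0_integralZl//; last by apply/measurable_EFinP.
have muI : mu `[a, b]%classic = (b - a)%:E by rewrite lebesgue_measure_itv /= lte_fin ab -EFinB.
by rewrite integral_indic// setIT EFinM; exact: (congr1 (fun z => (c%:E * z)%E) muI).
Qed.

Lemma conj_exp_continuous (xi : R) : continuous (fun x : R => conj_exp (x * xi) : C).
Proof.
move=> x; apply/cvg_nrmP.
have h : (fun y : R => 2 * `|y * xi - x * xi|) @ x --> (0 : R).
  rewrite -(mulr0 2); apply: cvgMr; apply/norm_cvg0P/subr_cvg0.
  by apply: cvgMl; exact: cvg_id.
by apply: cvg0_le h; apply: nearW => y; rewrite nrm_ge0 conj_exp_lip.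
Qed.

Lemma fourier_R_bochner (xi : R) :
  has_bochner mu (fun x : R => conj_exp (x * xi) * g x : C) (fourier_R g xi).
Proof.
have cF : continuous (fun x : R => conj_exp (x * xi) * g x : C).
  by move=> x; apply: cvgM; [exact: conj_exp_continuous|exact: cg].
have sm : smeas mu (fun x : R => conj_exp (x * xi) * g x : C).
  have := smeas_continuous openT (fun x _ => cF x).
  by under eq_fun do rewrite indicT scale1r.
have [y hy] : exists y, has_bochner mu (fun x : R => conj_exp (x * xi) * g x : C) y.
  apply: bochner_exists => //; first exact: seq_complete_complex.
  apply: (@le_lt_trans _ _ (\int[mu]_x (G * \1_(`[a, b]%classic) x)%:E)%E); last first.
    by rewrite indicator_integral// ltry.
  apply: ge0_le_integral => //.
  - by move=> x _; rewrite lee_fin nrm_ge0.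
  - exact: measurable_enrm sm.
  - by apply/measurable_EFinP; exact: measurable_funM.
  move=> x _; rewrite lee_fin nrm_complexM nrm_conj_exp mul1r indicE.
  case: (boolP (x \in _)) => [_|/negP xn]; first by rewrite mulr1.
  by rewrite g0 ?nrm0 ?mulr0// => h; apply: xn; apply: mem_set; rewrite /= in_itv.
by rewrite (_ : fourier_R g xi = y)//; exact: bochnerTE.
Qed.

Lemma nrm_fourier_R_continuous : continuous (fun xi : R => nrm (fourier_R g xi)).
Proof.
have B0 : 0 <= B by apply: le_trans (aB (x := a) _); rewrite ?normr_ge0// lexx ltW.
have lip xi eta : nrm (fourier_R g xi - fourier_R g eta) <= 2 * B * G * (b - a) * `|xi - eta|.
  have hB := bochnerB (fourier_R_bochner xi) (fourier_R_bochner eta).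
  pose c := 2 * B * G * `|xi - eta|.
  have c0 : 0 <= c by rewrite !mulr_ge0.
  rewrite -lee_fin; have -> : 2 * B * G * (b - a) * `|xi - eta| = c * (b - a) by rewrite /c mulrAC.
  rewrite -indicator_integral//; apply: (nrm_bochner_le hB); first exact: measurable_funM.
  move=> x; rewrite -mulrBl nrm_complexM indicE.
  case: (boolP (x \in _)) => [/set_mem /=|/negP xn]; last first.
    by rewrite g0 ?nrm0 ?mulr0// => h; apply: xn; apply: mem_set; rewrite /= in_itv.
  rewrite in_itv /= => /aB xB; rewrite mulr1.
  apply: (@le_trans _ _ ((2 * `|x * xi - x * eta|) * G)).
    by apply: ler_pM; rewrite ?nrm_ge0 ?conj_exp_lip.
  rewrite -mulrBr normrM /c.
  have -> : 2 * (`|x| * `|xi - eta|) * G = 2 * G * `|xi - eta| * `|x| by ring.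
  have -> : 2 * B * G * `|xi - eta| = 2 * G * `|xi - eta| * B by ring.
  by rewrite ler_wpM2l// !mulr_ge0.
set D := 2 * B * G * (b - a) in lip.
have D0 : 0 <= D by rewrite /D !mulr_ge0// subr_ge0 ltW.
move=> xi; apply/cvgrPdist_le => e e0.
have D1 : 0 < D + 1 by rewrite ltr_wpDl.
near=> eta; apply: le_trans (ler_dist_nrm _ _) _; apply: le_trans (lip _ _) _.
apply: (@le_trans _ _ ((D + 1) * `|xi - eta|)); first by rewrite ler_wpM2r// lerDl.
rewrite mulrC -ler_pdivlMr//; apply: ltW.
near: eta; apply: (@cvgr_dist_lt _ _ _ (nbhs xi) _ id xi); first exact: cvg_id.
exact: divr_gt0 e0 D1.
Unshelve. all: by end_near. Qed.

(** The cosine is the mean of e^(i (x - x0) xi) and its conjugate, so the integral is a mean of the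
    Fourier transform at xi and - xi, up to factors of modulus 1. [P] is the real or the imaginary
    part. *)
Lemma cosine_transform_le (P : C -> R) (x0 xi : R) :
  (forall (h : R -> C) y, has_bochner mu h y ->
    (\int[mu]_x (P (h x))%:E = (P y)%:E)%E) ->
  (forall (r : R) z, P (r%:C * z) = r * P z) -> (forall z, `|P z| <= nrm z) ->
  (`|\int[mu]_(x in `[a, b]) (P (g x) * cos ((x - x0) * xi))%:E| <=
   ((nrm (fourier_R g xi) + nrm (fourier_R g (- xi))) / 2)%:E)%E.
Proof.
move=> Pint PZ Pnrm.
pose z : C := (2^-1)%:C * (conj_exp (- (x0 * xi)) * fourier_R g xi + conj_exp (x0 * xi) * fourier_R g (- xi)).
have hz : has_bochner mu (fun x : R => (cos ((x - x0) * xi))%:C * g x : C) z.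
  have h1 := bochnerZ (conj_exp (- (x0 * xi))) (fourier_R_bochner xi).
  have h2 := bochnerZ (conj_exp (x0 * xi)) (fourier_R_bochner (- xi)).
  have h := bochnerZ (2^-1)%:C (bochnerD h1 h2).
  apply: bochner_eq h => x.
  rewrite -[LHS]/((2^-1)%:C * (conj_exp (- (x0 * xi)) * (conj_exp (x * xi) * g x) +
    conj_exp (x0 * xi) * (conj_exp (x * - xi) * g x))).
  rewrite !(mulrA (conj_exp _)) -!conj_expD -mulrDl.
  have -> : x0 * xi + x * - xi = - (- (x0 * xi) + x * xi) by ring.
  rewrite conj_exp_cos mulrA -rmorphM mulKf//.
  by congr ((cos _)%:C * _); ring.
have e := Pint _ _ hz.
have -> : (\int[mu]_(x in `[a, b]) (P (g x) * cos ((x - x0) * xi))%:E = (P z)%:E)%E.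
  rewrite -e integral_mkcond; apply: eq_integral => x _; rewrite patchE PZ mulrC.
  case: ifPn => // /negP xn; rewrite g0.
    by have := Pnrm 0; rewrite nrm0 normr_le0 => /eqP ->; rewrite mulr0.
  by move=> h; apply: xn; apply: mem_set; rewrite /= in_itv.
rewrite lee_fin; apply: le_trans (Pnrm z) _.
rewrite nrm_complexM nrm_real ger0_norm ?invr_ge0// mulrC ler_pM2r ?invr_gt0//.
have gen (u v w z' : C) : nrm u = 1 -> nrm v = 1 -> nrm (u * w + v * z' : C) <= nrm w + nrm z'.
  by move=> hu hv; apply: le_trans (ler_nrmD _ _) _; rewrite !nrm_complexM hu hv !mul1r.
by apply: gen; exact: nrm_conj_exp.
Qed.

Lemma fourier_R_integral_le (s M L : R) : 1 <= s -> 0 < M -> 0 < L ->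
  (sobolev_norm s g <= M%:E)%E ->
  (\int[mu]_(xi in `[0%R, L]) ((nrm (fourier_R g xi) + nrm (fourier_R g (- xi))) / 2)%:E <= (2 * M)%:E)%E.
Proof.
move=> s1 M0 L0 hM; apply: (half_line_average_le nrm_fourier_R_continuous _ s1 M0 L0).
  by move=> xi; exact: nrm_ge0.
have p2 : 1 <= 2 :> R by rewrite ler1n.
move: hM; rewrite /sobolev_norm (BNorm_le mu p2 _ (ltW M0)) powR_mulrn ?(ltW M0)//.
apply: le_trans; rewrite /pint; apply: eqW; apply: eq_integral => xi _.
rewrite nrm_complexM nrm_real ger0_norm ?powR_ge0// powRM ?powR_ge0 ?nrm_ge0//.
by rewrite -powRrM divfK// (powR_mulrn 2 (nrm_ge0 (fourier_R g xi))) expr2.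
Qed.

(** Of the factor 4, one 2 comes from [fourier_R_integral_le] and the other from adding the real and
    imaginary parts. *)
Lemma sobolev_sup_bound (s M x0 : R) : a < x0 < b -> 1 <= s -> 0 < M -> (sobolev_norm s g <= M%:E)%E ->
  nrm (g x0) <= 4 * peak_constant R * M.
Proof.
move=> hx s1 M0 hM; pose r xi := (nrm (fourier_R g xi) + nrm (fourier_R g (- xi))) / 2.
have mr : measurable_fun setT r.
  exact: measurable_half_sum nrm_fourier_R_continuous.
have M2 : 0 <= 2 * M by rewrite mulr_ge0// ltW.
have part (P : C -> R) : (forall z, `|P z| <= nrm z) -> (forall z z', P (z - z') = P z - P z') ->
    (forall (h : R -> C) y, has_bochner mu h y -> (\int[mu]_x (P (h x))%:E = (P y)%:E)%E) ->
    (forall (t : R) z, P (t%:C * z) = t * P z) -> `|P (g x0)| <= peak_constant R * (2 * M).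
  move=> Pn PB Pi PZ.
  apply: (@sup_bound_of_cosine_transform R (fun x => P (g x)) r a b x0 G (2 * M)) => //.
  - move=> x; have cgx : g y @[y --> x] --> g x := @cg x.
    apply/cvgrPdist_le => e e0; move/cvg_nrmP/cvgrPdist_le: cgx => /(_ e e0).
    apply: filterS => y; rewrite sub0r normrN ger0_norm ?nrm_ge0// -PB => h.
    by rewrite (le_trans (Pn _))// nrmBC.
  - by move=> x; exact: le_trans (Pn _) (gG x).
  - by move=> xi; exact: cosine_transform_le.
  - by move=> L L0; exact: (fourier_R_integral_le s1 M0 L0 hM).
have hRe := part (@complex.Re R) (@Re_le_nrm R) (raddfB _) (fun h y hy => (bochner_Re hy).2).
have hIm := part (@complex.Im R) (@Im_le_nrm R) (raddfB _) (fun h y hy => (bochner_Im hy).2).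
apply: le_trans (nrm_le_ReIm _) _.
have -> : 4 * peak_constant R * M = peak_constant R * (2 * M) + peak_constant R * (2 * M) by ring.
apply: lerD.
  by apply: hRe => t [u v] /=; rewrite mul0r subr0.
by apply: hIm => t [u v] /=; rewrite mul0r addr0.
Qed.

End sobolev.

Lemma hormander_norm_ge0 (R : realType) (eta : R -> R) (s : R) (f : R -> R[i]) :
  (0 <= hormander_norm eta s f)%E.
Proof.
apply: (@le_trans _ _ (sobolev_norm s (fun x => (eta x)%:C * f (1 * x)))); first exact: BNorm_ge0.
by apply: ereal_sup_ubound; exists 1 => //; exact: ltr01.
Qed.

(** Fix x0 with eta(x0) nonzero. The dilation by t = lam / x0 moves the value f(lam) to x0, where
    the Sobolev norm of eta f(t .) controls eta(x0) f(lam). *)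
Lemma hormander_sup_bound (R : realType) (eta : R -> R) (s : R) : bump_function eta -> 1 <= s ->
  exists2 D : R, 0 <= D & forall f, hormander_space eta s f -> forall lam, 0 < lam ->
    nrm (f lam : R[i]^o) <= D * fine (hormander_norm eta s f).
Proof.
move=> [eta_smooth [a [b [a0 eta_supp]]] [x0 etax0]] s1.
have Ceta : continuous eta.
  by move=> x; have /derivable1_diffP/differentiable_continuous := eta_smooth 0%N x.
have /andP[ax0 x0b] := eta_supp x0 etax0.
have x00 : 0 < x0 by exact: lt_le_trans ax0.
have n0 : 0 < `|eta x0| by rewrite normr_gt0.
exists (4 * peak_constant R / `|eta x0|).
  by rewrite divr_ge0 ?mulr_ge0// ltW// peak_constant_gt0.
move=> f [cf flty] lam lam0; pose t := lam / x0; have t0 : 0 < t by exact: divr_gt0.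
pose g (x : R) : R[i]^o := (eta x)%:C * f (t * x).
set H := fine (hormander_norm eta s f).
have HE : hormander_norm eta s f = H%:E.
  by rewrite fineK// ge0_fin_numE// hormander_norm_ge0.
have gz x : ~ a <= x <= b -> g x = 0.
  move=> nx; rewrite /g; have [->|/eta_supp//] := eqVneq (eta x) 0.
  by rewrite mul0r.
have cg : continuous g.
  move=> x; have [xa|ax] := ltP x a.
    have cst0 : \forall y \near x, g y = 0.
      near=> y; rewrite gz// => /andP[ay _].
      have : y < a by near: y; exact: lt_nbhsl.
      by rewrite ltNge ay.
    have gx0 : g x = 0 by apply: gz => /andP[]; rewrite leNgt xa.
    rewrite /continuous_at gx0.
    exact: cvg_near_cst.
  have x1 : 0 < x by exact: lt_le_trans ax.
  have h1 : (fun y : R => (eta y)%:C : R[i]^o) @ x --> ((eta x)%:C : R[i]^o).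
    have h : (fun y => `|eta y - eta x|) @ x --> (0 : R) by apply/norm_cvg0P/subr_cvg0; exact: Ceta.
    apply/cvg_nrmP; apply: cvg_trans h; apply: near_eq_cvg; apply: nearW => y /=.
    by rewrite -nrm_real rmorphB.
  have h2 : (fun y : R => f (t * y) : R[i]^o) @ x --> (f (t * x) : R[i]^o).
    apply: (@continuous_comp _ _ _ (fun z : R => t * z) (f : R -> R[i]^o)); last by apply: cf; exact: mulr_gt0.
    by apply: cvgMr; exact: cvg_id.
  by rewrite /continuous_at; exact: cvgM h1 h2.
(* The interval is widened so that x0 is interior, and its left end stays positive. *)
pose a' := a / 2; pose b' := b + 1.
have gz' x : ~ a' <= x <= b' -> g x = 0.
  move=> nx; apply: gz => /andP[ax xb]; apply: nx; apply/andP; split; rewrite /a' /b'; lra.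
have x0' : a' < x0 < b' by apply/andP; split; rewrite /a' /b'; lra.
have ab' : a' < b' by have /andP[h1 h2] := x0'; exact: lt_trans h2.
have absB x : a' <= x <= b' -> `|x| <= b'.
  by move=> /andP[h1 h2]; rewrite ger0_norm// (le_trans _ h1)// /a'; lra.
have [G gG] : exists G : R, forall x, nrm (g x) <= G.
  have cn : continuous (fun x => nrm (g x)).
    move=> x; apply/cvgrPdist_le => e e0; have cgx : g y @[y --> x] --> g x := @cg x.
    move/cvg_nrmP/cvgrPdist_le: cgx => /(_ e e0); apply: filterS => y.
    rewrite sub0r normrN ger0_norm ?nrm_ge0// => h.
    by rewrite (le_trans (ler_dist_nrm _ _))// nrmBC.
  have [c _ hc] := EVT_max (ltW ab') (continuous_subspaceT cn).
  exists (nrm (g c)) => x; have [xI|xI] := boolP (a' <= x <= b').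
    by apply: hc; rewrite in_itv.
  by rewrite gz' ?nrm0 ?nrm_ge0//; exact/negP.
have bound M : 0 < M -> H <= M -> nrm (f lam : R[i]^o) <= 4 * peak_constant R / `|eta x0| * M.
  move=> M0 HM; have hs : (sobolev_norm s g <= M%:E)%E.
    apply: (@le_trans _ _ (hormander_norm eta s f)); last by rewrite HE lee_fin.
    by apply: ereal_sup_ubound; exists t.
  have := sobolev_sup_bound absB ab' cg gG gz' x0' s1 M0 hs.
  rewrite /g nrm_complexM nrm_real /t divfK ?gt_eqF// => h.
  by rewrite mulrAC ler_pdivlMr// mulrC.
(* [bound] needs a positive M, but H may be 0; hence M = H + e / D. *)
apply/ler_addgt0Pr => e e0; pose D := 4 * peak_constant R / `|eta x0|.
have D0 : 0 < D by rewrite divr_gt0// mulr_gt0// peak_constant_gt0.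
have H0 : 0 <= H by rewrite fine_ge0// hormander_norm_ge0.
have := bound (H + e / D) _ _; rewrite -/D mulrDr mulrCA divff ?gt_eqF// mulr1; apply.
  by rewrite ltr_wpDl// divr_gt0.
by rewrite lerDl divr_ge0// ltW.
Unshelve. all: by end_near. Qed.

(** * The Taibleson operator *)

Lemma powR_exprz (R : realType) (a s : R) (k : int) : 0 <= a -> (a ^ k) `^ s = (a `^ s) ^ k.
Proof. by move=> a0; rewrite -(powR_intmul k a0) powRAC powR_intmul// powR_ge0. Qed.

Lemma complex_limit_of_real (R : realType) (u : nat -> R) (w : R[i]^o) :
  (fun n => (u n)%:C : R[i]^o) @ \oo --> w -> u @ \oo --> complex.Re w /\ w = (complex.Re w)%:C.
Proof.
move=> /cvg_nrmP h.
have hre : (fun n => u n - complex.Re w) @ \oo --> (0 : R).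
  apply/norm_cvg0P; apply: cvg0_le h; apply: nearW => n; rewrite normr_ge0 /=.
  by have := Re_le_nrm ((u n)%:C - w : R[i]^o); rewrite raddfB.
split; first exact/subr_cvg0.
have him : (fun n : nat => `|complex.Im w|) @ \oo --> (0 : R).
  apply: cvg0_le h; apply: nearW => n; rewrite normr_ge0 /=.
  by have := Im_le_nrm ((u n)%:C - w : R[i]^o); rewrite raddfB /= sub0r normrN.
have : `|complex.Im w| = 0 by exact: (@cvg_unique _ (@Rhausdorff R) _ _ _ _ (cvg_cst _) him).
by case: (w) => a b /= /eqP; rewrite normr_eq0 => /eqP ->.
Qed.

Lemma summation_by_parts_step (R : realType) (V : lmodType R[i]) (h h0 h1 : R) (a b u s : V) :
  (h%:C *: a - h0%:C *: b + s) + h1%:C *: (u - a) =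
  (h1%:C *: u - h0%:C *: b) + (s + (h - h1)%:C *: a).
Proof. by rewrite rmorphB scalerBr scalerBl [LHS](AC (3*2) ((4*2)*(3*(1*5)))). Qed.

Lemma bochner_ae_unique d (T : measurableType d) (R : realType)
    (mu : {measure set T -> \bar R}) (Y : normedModType R[i]) (f g : T -> Y) y z :
  has_bochner mu f y -> has_bochner mu g z ->
  {ae mu, forall x, f x = g x} -> y = z.
Proof.
move=> hf hg fg; apply/eqP; rewrite -subr_eq0; apply/eqP; apply: nrm_eq0; apply/eqP.
rewrite eq_le nrm_ge0 andbT -lee_fin.
have hB := bochnerB hf hg.
apply: le_trans (nrm_bochner hB) _.
rewrite (_ : (\int[mu]_x _)%E = 0%E)//.
rewrite (@ge0_ae_eq_integral _ _ _ mu setT _ (cst 0%E)) ?integral0//.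
- exact: measurable_enrm (bochner_smeas hB).
- by move=> x _; rewrite lee_fin nrm_ge0.
- by apply: filterS fg => x fg _; rewrite fg subrr nrm0.
Qed.

Lemma ae_imply d (T : measurableType d) (R : realType) (mu : {measure set T -> \bar R})
  (P Q : T -> Prop) : (forall x, P x -> Q x) -> {ae mu, forall x, P x} -> {ae mu, forall x, Q x}.
Proof. by move=> PQ; apply: filterS. Qed.

Lemma linear_exists (R : realType) (X Z : lmodType R[i]) (f : X -> Z) : linear f ->
  exists U : {linear X -> Z}, forall x, U x = f x.
Proof.
move=> hf; pose aux := GRing.isLinear.Build R[i] X Z *:%R f hf.
by exists (HB.pack f aux : {linear X -> Z}).
Qed.

Lemma bounded_linear_continuous (R : realType) (X : normedModType R[i]) (U : {linear X -> X}) (c : R) :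
  (forall x, nrm (U x) <= c * nrm x) -> continuous U.
Proof.
move=> hU x; apply/cvg_nrmP.
have h : (fun y : X => c * nrm (y - x)) @ x --> (0 : R).
  by rewrite -(mulr0 c); apply: cvgMr; apply/cvg_nrmP; exact: cvg_id.
apply: cvg0_le h; apply: nearW => y; rewrite nrm_ge0 /=.
by rewrite -raddfB hU.
Qed.

Section tensor_uniqueness.
Context d (T : measurableType d) (R : realType) (Y : normedModType R[i]).
Variables (mu : {measure set T -> \bar R}) (p : R) (p1 : 1 <= p).
Local Notation X := (BLp Y mu p1).
Local Notation C := (R[i]^o).

(** [heat_semigroup] prescribes its operators only on tensors. Continuity and the density of simple
    functions, which are sums of tensors, determine them, and hence the generator. *)
Lemma linear_eq_on_tensors (U V : {linear X -> X}) : continuous U -> continuous V ->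
  (forall (phi : T -> C) (y : Y) F, phi \in BLfun mu p -> in_class F (fun x => phi x *: y) -> U F = V F) ->
  forall F, U F = V F.
Proof.
move=> cU cV UV.
have simple (s : Defs.sfun Y T) : sfun_over measurable mu s -> forall F, in_class F (seval s) -> U F = V F.
  elim: s => [|[A y] s IH] sS F Fs.
    have -> : F = 0.
      have z0 : in_class (0 : X) (seval ([::] : Defs.sfun Y T)).
        have := in_classB Fs Fs; rewrite subrr => h; apply: in_class_ae h _; apply: aeW => x.
        by rewrite seval_nil subrr.
      exact: in_class_inj Fs z0.
    by rewrite !linear0.
  have [mA Ay sS'] := sfun_over_cons sS.
  have oS : sfun_over measurable mu ([:: (A, 1)] : Defs.sfun C T).
    by move=> b; rewrite inE => /eqP ->.
  have phiL := sfun_BLfun p1 oS.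
  have tL := BLfun_tensor y p1 phiL.
  have F1c := in_class_toBL p1 tL; have F2c := in_class_toBL p1 (sfun_BLfun p1 sS').
  set F1 := BLclass _ in F1c; set F2 := BLclass _ in F2c.
  have -> : F = 1 *: F1 + F2.
    apply: (in_class_inj Fs); have h := in_classDZ 1 F1c F2c; apply: in_class_ae h _; apply: aeW => x.
    have e : seval [:: (A, 1 : C)] x = \1_A x.
      by rewrite seval_cons seval_nil addr0; exact: mulr1.
    by rewrite scale1r e seval_cons.
  by rewrite !linearP (UV _ _ _ phiL F1c) (IH sS' _ F2c).
move=> F; have e0 n : 0 < n.+1%:R^-1 :> R by rewrite invr_gt0.
have /choice[s hs] n := simple_approx_class F (e0 n).
pose S n := BLclass (toBL p1 (sfun_BLfun p1 (hs n).1)).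
have Sc n : in_class (S n) (seval (s n)) by exact: in_class_toBL.
have SF : S @ \oo --> F.
  apply/cvg_nrmP; have h := @cvg_harmonic R.
  by apply: cvg0_le h; apply: nearW => n; rewrite nrm_ge0 nrmBC (hs n).2.
have h1 : U (S n) @[n --> \oo] --> U F by apply: continuous_cvg => //; exact: cU.
have h2 : V (S n) @[n --> \oo] --> V F by apply: continuous_cvg => //; exact: cV.
apply: (@cvg_nrm_unique _ _ (fun n => U (S n))) => //.
have e : (fun n => U (S n)) = (fun n => V (S n)).
  by apply/funext => n; exact: simple (hs n).1 _ (Sc n).
by rewrite e.
Qed.

End tensor_uniqueness.

Section taibleson_operator.
Context (R : realType) (K : topFieldType).
Hypothesis hK : nonarchimedean_local_field R K.
Variable nu : {measure set (borel K) -> \bar R}.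
Hypothesis hnu : Haar_measure nu.
Variable beta : K.
Hypothesis hbeta : prime_element R beta.
Hypothesis b0 : beta != 0.
Variable chi : K -> R[i].
Hypothesis hchi : unitary_character chi.
Hypothesis hchi_integers : forall x, integers R x -> chi x = 1.
Hypothesis hchi_nontrivial : exists2 x, integers R x & chi (beta^-1 * x) != 1.
Variable n : nat.
Variable mu : {measure set (borel 'rV[K]_n) -> \bar R}.
Variable N : R.
Local Notation Kn := 'rV[K]_n.
Local Notation T := (borel Kn).
Local Notation ball := (@vball R K beta n : int -> T -> set T).
Hypothesis Dy : dyadic_structure mu ball N.
Local Notation mod := (@modulus R K).
Local Notation rho := (mod beta).
Local Notation vn := (@vnorm R K n).
Local Notation C := (R[i]^o).
Let rho0 : 0 < rho := modulus_gt0 hK hnu b0.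
Let N0 := dy_N0 Dy.
Let mod_ge0 := modulus_ge0 hK hnu.
Let rhoz k : 0 < rho ^ k := rhoz_gt0 hK hnu b0 k.
Let vn0 (z : Kn) : 0 <= vn z := vnorm_ge0 hK hnu z.

Lemma vdotC (x y : Kn) : vdot x y = vdot y x.
Proof. by apply: eq_bigr => i _; rewrite mulrC. Qed.

Lemma vdotDr (x y z : Kn) : vdot x (y + z) = vdot x y + vdot x z.
Proof. by rewrite -big_split; apply: eq_bigr => i _; rewrite mxE mulrDr. Qed.

Lemma vdotNl (x y : Kn) : vdot (- x) y = - vdot x y.
Proof. by rewrite -sumrN; apply: eq_bigr => i _; rewrite mxE mulNr. Qed.

Lemma modulus_vdot (x y : Kn) : mod (vdot x y) <= vn x * vn y.
Proof.
rewrite /vdot; elim/big_ind: _ => [|a c ha hc|i _].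
- by rewrite modulus0 mulr_ge0 ?vn0.
- by rewrite (le_trans (ultrametric hK _ _))// ge_max ha.
rewrite (modulusM hK hnu) ler_pM//; first exact: (vnorm_leP x (vn0 x)).2 (lexx _) i.
exact: (vnorm_leP y (vn0 y)).2 (lexx _) i.
Qed.

Lemma chi0 : chi 0 = 1.
Proof. by apply: hchi_integers; rewrite /integers /= modulus0. Qed.

Lemma chiD x y : chi (x + y) = chi x * chi y.
Proof. by case: hchi. Qed.

Lemma nrm_chi x : nrm (chi x : C) = 1.
Proof. by case: hchi => _ _ h; rewrite /nrm h. Qed.

Lemma chi_neq0 x : chi x != 0.
Proof. by apply/eqP => h; have := nrm_chi x; rewrite h nrm0 => /eqP; rewrite eq_sym oner_eq0. Qed.

Lemma chi_conj x : (chi x)^* = chi (- x).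
Proof.
apply: (mulfI (chi_neq0 x)); rewrite -chiD subrr chi0 -normCK.
by case: hchi => _ _ ->; rewrite expr1n.
Qed.

Lemma chi_ball_constant (j : int) (x : Kn) : vn x <= rho ^ j ->
  ball_constant ball (- j) (fun xi : T => chi (vdot x xi)).
Proof.
move=> xj xi eta /= h; rewrite -[eta](subrK xi) addrC vdotDr chiD.
rewrite (hchi_integers (_ : integers R (vdot x (eta - xi)))) ?mulr1//.
rewrite /integers /= (le_trans (modulus_vdot _ _))//.
apply: (@le_trans _ _ (rho ^ j * rho ^ (- j))).
  by apply: ler_pM => //; exact: vn0.
by rewrite -expfzDr ?gt_eqF// subrr expr0z.
Qed.

Lemma vnorm_bounded (x : Kn) : exists m : nat, vn x <= rho ^ (- m%:Z).
Proof.
by have [m] := vball_exhaust hK hnu hbeta b0 0 x; rewrite /vball /= subr0; exists m.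
Qed.

Lemma ball0E (k : int) (x : Kn) : ball k 0 x = (vn x <= rho ^ k) :> Prop.
Proof. by rewrite /vball /= subr0. Qed.

Lemma ball_partition0 (j k : int) : (j <= k)%R -> exists s : seq T, ball_partition ball j k 0 s.
Proof. by move=> /(vball_partition hK hnu hbeta b0 n)[s]; exists s. Qed.

Lemma ball_partition_translate (j k : int) s (a : T) : ball_partition ball j k 0 s ->
  ball j 0 a -> ball_partition ball j k 0 [seq (c + a : Kn) | c <- s].
Proof.
move=> [sep sub cov] ja; have tr m (x y : Kn) : vball R beta m (x + a) (y + a) = vball R beta m x y.
  by rewrite /vball /= opprD addrACA subrr addr0.
have tr0 (x : Kn) : vball R beta j 0 (x + a) <-> vball R beta j 0 x.
  move: ja; rewrite !ball0E => ja; split=> h; last exact: (vballD hK hnu).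
  by rewrite -(addrK a x) (vballD hK hnu)// (vnormN hK hnu).
split.
- rewrite pairwise_map; apply: sub_pairwise sep => x y /=.
  by rewrite (tr k x y).
- by move=> _ /mapP[c /sub jc ->]; exact/tr0.
move=> x jx; have [|c cs cx] := cov (x - a : Kn).
  by apply/tr0; rewrite subrK.
by exists (c + a : Kn); [exact: map_f|rewrite -(subrK a x) tr].
Qed.

(** The Fourier transform of a ball is a multiple of the dual ball. Inside the dual ball the
    character is 1. Outside, some xi0 in the ball has chi(x . xi0) different from 1, and translating
    a partition by xi0 multiplies the integral by this number, so it vanishes. *)
Lemma chi_ball_integral (k : int) (x : Kn) :
  has_bochner mu (fun xi : T => \1_(ball (- k) 0) xi *: (chi (vdot x xi) : C))
    (\1_(ball k 0) x *: ((N ^ k)%:C : C)).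
Proof.
have nondep (s : seq T) m : (- k <= m)%R -> ball_partition ball (- k) m 0 s ->
    vn x <= rho ^ (- m) ->
    has_bochner mu (fun xi : T => \1_(ball (- k) 0) xi *: (chi (vdot x xi) : C))
      (\sum_(c <- s) (N ^ (- m))%:C *: (chi (vdot x c) : C)).
  move=> km hs xm; apply: (ball_partition_bochner Dy km hs).
  by have := chi_ball_constant xm; rewrite opprK.
rewrite indicE; case: (boolP (x \in _)) => [/set_mem|] xk.
  rewrite scale1r.
  have ov : sfun_over measurable mu ([:: (ball (- k) 0, 1)] : Defs.sfun C T).
    move=> a; rewrite inE => /eqP -> /=; split; [exact: dy_measurable Dy _ _|exact: dy_lty Dy _ _].
  have := bochner_sfun ov.
  rewrite /sfun_integral big_seq1 /= (dy_measure Dy) opprK /= [_ *: 1]mulr1.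
  apply: bochner_eq => xi; rewrite /sfun_eval big_seq1 /= !indicE.
  case: (boolP (xi \in _)) => [/set_mem|_]; last by rewrite !scale0r.
  rewrite ball0E => xik; rewrite !scale1r hchi_integers//.
  rewrite /integers /= (le_trans (modulus_vdot _ _))//.
  apply: (@le_trans _ _ (rho ^ k * rho ^ (- k))).
    by apply: ler_pM; rewrite ?vn0//; move: xk; rewrite ball0E.
  by rewrite -expfzDr ?gt_eqF// subrr expr0z.
rewrite scale0r.
have [xi0 [xi0k chixi0]] : exists xi0 : Kn, vn xi0 <= rho ^ (- k) /\ chi (vdot x xi0) != 1.
  have [i xi] : exists i, rho ^ k < mod (x ord0 i).
    apply: contrapT => h; move/negP: xk; apply; apply/mem_set; rewrite ball0E.
    apply/vnorm_leP => [|i]; first exact: ltW.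
    by rewrite leNgt; apply/negP => h2; apply: h; exists i.
  have xi0 : x ord0 i != 0.
    by apply/eqP => h; move: xi; rewrite h modulus0 ltNge ltW.
  have [z hz chiz] := hchi_nontrivial.
  (* All of x . xi0 is put on one coordinate of x larger than rho^k, so that x . xi0 = beta^-1 z;
     discreteness of the modulus keeps xi0 in the ball. *)
  exists (\row_j (if j == i then beta^-1 * z / x ord0 i else 0)); split.
    apply/vnorm_leP => [|j]; first exact: ltW.
    rewrite mxE; case: eqP => _; last by rewrite modulus0 ltW.
    rewrite !(modulusM hK hnu) !(modulusV hK hnu).
    have [m xm] := value_group hK hnu hbeta b0 xi0.
    have km : (m + 1 <= k)%R.
      by rewrite xm ltNge (rhoz_le hK hnu hbeta b0) -ltNge in xi; lia.
    rewrite xm; apply: (@le_trans _ _ (rho^-1 * 1 / rho ^ m)).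
      by rewrite ler_pM2r ?invr_gt0// ler_pM2l ?invr_gt0//; exact: hz.
    rewrite mulr1 -invfM -{1}(expr1z rho) -expfzDr ?gt_eqF// invr_expz.
    by rewrite (rhoz_le hK hnu hbeta b0) lerN2 addrC.
  rewrite /vdot (bigD1 i)//= big1 ?addr0.
    by rewrite mxE eqxx mulrC divfK.
  by move=> j /negbTE ji; rewrite mxE ji mulr0.
have [m xm] := vnorm_bounded x.
(* A level fine enough for the character to be constant on its balls. *)
pose J := Order.max (m%:Z) (- k).
have xJ : vn x <= rho ^ (- J).
  by apply: (le_trans xm); rewrite (rhoz_le hK hnu hbeta b0) lerN2 le_max lexx.
have kJ : (- k <= J)%R by rewrite le_max lexx orbT.
have [s hs] := ball_partition0 kJ.
have I1 := nondep s J kJ hs xJ.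
have hs' : ball_partition ball (- k) J 0 [seq (c + xi0 : Kn) | c <- s].
  by apply: ball_partition_translate => //; rewrite ball0E.
have I2 := nondep _ J kJ hs' xJ.
have e := bochner_unique I1 I2.
set v := \sum_(c <- s) _ in I1 e.
have e2 : v = chi (vdot x xi0) * v.
  rewrite {1}e big_map /v mulr_sumr; apply: eq_bigr => c _.
  rewrite -[LHS]/((N ^ (- J))%:C * chi _) -[X in _ = _ * X]/((N ^ (- J))%:C * chi _).
  by rewrite vdotDr chiD mulrA mulrC.
have v0 : v = 0.
  apply: contrapT => /eqP vz; move: chixi0; rewrite -(inj_eq (mulIf vz)) mul1r.
  by rewrite -e2 eqxx.
by rewrite -v0.
Qed.

Local Notation four := (fourier mu chi).

(** * Fourier transform and averages *)

Section integrable.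
Variable u : T -> C.
Hypothesis u1 : u \in BLfun mu 1.

Let mu_u : smeas mu u := BLfun_sm u1.

Let iu : (\int[mu]_x (nrm (u x))%:E < +oo)%E.
Proof.
have /asboolP[_] := u1; rewrite BNorm_lty// /pint.
by under eq_integral do rewrite powRr1 ?nrm_ge0//.
Qed.

Let nrm_chiM xi x : nrm (chi (vdot x xi) * u x : C) = nrm (u x).
Proof. by rewrite nrm_complexM nrm_chi mul1r. Qed.

Lemma smeas_chiM xi (h : T -> C) : smeas mu h ->
  smeas mu (fun x : T => chi (vdot x xi) * h x : C).
Proof.
move=> mh; have [m xm] := vnorm_bounded xi.
have c : ball_constant ball (- - m%:Z) (fun x : T => chi (vdot x xi)).
  by move=> x y /= xy; rewrite !(vdotC _ xi); exact: chi_ball_constant xm _ _ xy.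
exact: (smeas_ball_constant Dy c mh).
Qed.

Lemma fourier_has_integral xi :
  has_bochner mu (fun x : T => chi (vdot x xi) * u x : C) (four u xi).
Proof.
have [v hv] : exists v, has_bochner mu (fun x : T => chi (vdot x xi) * u x : C) v.
  apply: bochner_exists; first exact: seq_complete_complex.
    exact: smeas_chiM.
  by under eq_integral do rewrite nrm_chiM.
by rewrite /fourier (bochnerTE hv).
Qed.

(** For a function supported in the ball of level - j the Fourier transform is constant on balls of
    level j, which turns integrals over a ball into finite sums. *)
Definition ball_truncation (j : int) (x : T) : C := \1_(ball (- j) 0) x *: u x.

Lemma ball_truncation_L1 j : ball_truncation j \in BLfun mu 1.
Proof.
have mt : smeas mu (ball_truncation j).
  by apply: smeas_restrict => //; exact: dy_measurable Dy _ _.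
apply/asboolP; split=> //; rewrite BNorm_lty//.
apply: (@le_lt_trans _ _ (pint mu 1 u)); last by have /asboolP[_] := u1; rewrite BNorm_lty.
apply: pint_mono; [exact: lexx|exact: mt|exact: mu_u|move=> x].
rewrite /ball_truncation nrm_indic indicE; case: (_ \in _); first by rewrite mul1r.
by rewrite mul0r nrm_ge0.
Qed.

End integrable.

Lemma fourier_truncation_constant (u : T -> C) (j : int) :
  ball_constant ball j (four (ball_truncation u j)).
Proof.
move=> xi eta h; rewrite /fourier; congr (bochner _ _ _); apply/funext => x.
rewrite /ball_truncation indicE; case: (boolP (x \in _)) => [/set_mem|_]; last by rewrite scale0r !mulr0.
rewrite ball0E => xj; congr (_ * _).
by have := chi_ball_constant xj; rewrite opprK; apply.
Qed.

Definition tail (u : T -> C) (j : int) : R :=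
  fine (\int[mu]_x (nrm (u x - ball_truncation u j x))%:E)%E.

Lemma tailE (u : T -> C) j : u \in BLfun mu 1 ->
  ((tail u j)%:E = \int[mu]_x (nrm (u x - ball_truncation u j x))%:E)%E.
Proof.
move=> u1; rewrite /tail fineK// ge0_fin_numE; last first.
  by apply: integral_ge0 => x _; rewrite lee_fin nrm_ge0.
have h := bochnerB (fourier_has_integral u1 0) (fourier_has_integral (ball_truncation_L1 u1 j) 0).
have := bochner_lty h; apply: le_lt_trans.
apply: eqW; apply: eq_integral => x _.
by rewrite -mulrBr nrm_complexM nrm_chi mul1r.
Qed.

Lemma fourier_truncation_dist (u : T -> C) j xi : u \in BLfun mu 1 ->
  nrm (four u xi - four (ball_truncation u j) xi) <= tail u j.
Proof.
move=> u1; rewrite -lee_fin (tailE _ u1).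
have h := bochnerB (fourier_has_integral u1 xi) (fourier_has_integral (ball_truncation_L1 u1 j) xi).
apply: le_trans (nrm_bochner h) _.
apply: eqW; apply: eq_integral => x _.
by rewrite -mulrBr nrm_complexM nrm_chi mul1r.
Qed.

Lemma ball_exhaust_near (x : T) : \forall j \near \oo, ball (- j%:Z) 0 x.
Proof.
have [m xm] := dy_exhaust Dy 0 x; exists m => // j /= mj.
apply: dy_subset Dy _ _ _ _ _ xm; lia.
Qed.

Lemma tail_cvg0 (u : T -> C) : u \in BLfun mu 1 -> (fun j : nat => tail u j%:Z) @ \oo --> (0 : R).
Proof.
move=> u1; have mf := BLfun_sm u1.
have mt (j : nat) : smeas mu (ball_truncation u j%:Z).
  exact: BLfun_sm (ball_truncation_L1 u1 _).
have h : (\int[mu]_x (nrm (u x - ball_truncation u j%:Z x))%:E)%E @[j --> \oo] --> 0%E.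
  apply: (@dominated_cvg0 _ _ _ mu _ (fun x => nrm (u x))).
  - move=> j; exact: (strongly_measurable_nrm (smeasB mf (mt j))).
  - exact: strongly_measurable_nrm mf.
  - move=> j x; rewrite nrm_ge0 /=/ball_truncation indicE.
    by case: (_ \in _); rewrite ?scale1r ?scale0r ?subr0// subrr nrm0 nrm_ge0.
  - have /asboolP[_] := u1; rewrite BNorm_lty// /pint.
    by under eq_integral do rewrite powRr1 ?nrm_ge0//.
  move=> x; apply: cvg_trans (@cvg_cst _ (0 : R) _ \oo _); apply: near_eq_cvg.
  apply: filterS (ball_exhaust_near x) => j xj.
  by rewrite /ball_truncation indicE mem_set// scale1r subrr nrm0.
have : (fun j : nat => (tail u j%:Z)%:E) @ \oo --> 0%E.
  by under eq_fun do rewrite tailE//.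
by move=> /fine_cvgP[].
Qed.

(** The transforms of the truncations are constant on balls, hence simple on each large ball, and
    they converge uniformly because the L^1 tails tend to 0. *)
Lemma fourier_smeas (u : T -> C) : u \in BLfun mu 1 ->
  smeas mu (four u).
Proof.
move=> u1.
have /choice[s hs] (j : nat) : exists s : seq T, ball_partition ball (- j%:Z) j%:Z 0 s.
  by apply: ball_partition0; lia.
exists (fun j => [seq (ball j%:Z c, four (ball_truncation u j%:Z) c) | c <- s j]); split.
  move=> j; exact: (@ball_partition_over _ _ _ _ _ _ Dy C _ _ _ _ (four (ball_truncation u j%:Z)) (hs j)).
move=> x; apply/cvg_nrmP; apply: cvg0_le (tail_cvg0 u1).
apply: filterS (ball_exhaust_near x) => j xj; rewrite nrm_ge0 /=.
have jj : (- j%:Z <= j%:Z)%R by lia.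
rewrite -(ball_partition_sfun Dy jj (hs j) (@fourier_truncation_constant u j%:Z)).
by rewrite indicE mem_set// scale1r nrmBC fourier_truncation_dist.
Qed.

(** Fourier inversion on a ball for a truncated function. The outer integral is a finite sum over
    balls of level j, so the exchange of integrals is additivity, and the inner sum over the
    characters is [chi_ball_integral]. *)
Lemma avg_fourier_truncation (u : T -> C) (k : int) (x : T) (j : int) : u \in BLfun mu 1 ->
  (- k <= j)%R -> ball (- j) 0 x ->
  has_bochner mu (fun xi : T => \1_(ball (- k) 0) xi *:
      (chi (vdot (- (x : Kn)) xi) * four (ball_truncation u j) xi : C))
    (avg mu ball N k (ball_truncation u j) x).
Proof.
move=> u1 kj xj; set uj := ball_truncation u j.
have uj1 : uj \in BLfun mu 1 by exact: ball_truncation_L1.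
have [s hs] := ball_partition0 kj.
have cst : ball_constant ball j (fun xi : T => chi (vdot (- (x : Kn)) xi) * four uj xi : C).
  move=> xi eta h.
  have xj' : vn (- (x : Kn)) <= rho ^ (- j) by rewrite (vnormN hK hnu) -ball0E.
  have := chi_ball_constant xj'; rewrite opprK => /(_ xi eta h) ->.
  by rewrite /uj (@fourier_truncation_constant u j xi eta h).
have := ball_partition_bochner Dy kj hs cst.
set v := \sum_(c <- s) _ => hv; suff -> : avg mu ball N k uj x = v by [].
have h1 : has_bochner mu (fun w : T => \sum_(c <- s) ((N ^ (- j))%:C * chi (vdot (- (x : Kn)) c)) *:
    (chi (vdot w c) * uj w : C)) v.
  have -> : v = \sum_(c <- s) ((N ^ (- j))%:C * chi (vdot (- (x : Kn)) c)) *: four uj c.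
    by apply: eq_bigr => c _; rewrite -scalerA.
  have hs1 (c : T) : c \in s -> has_bochner mu
      (fun w : T => ((N ^ (- j))%:C * chi (vdot (- (x : Kn)) c)) *: (chi (vdot w c) * uj w : C))
      (((N ^ (- j))%:C * chi (vdot (- (x : Kn)) c)) *: four uj c).
    by move=> _; exact: bochnerZ (fourier_has_integral uj1 c).
  exact: (bochner_sum hs1).
have h2 : has_bochner mu (fun w : T => (N ^ k)%:C *: (\1_(ball k x) w *: (uj w : C))) v.
  apply: bochner_eq h1 => w.
  transitivity ((\sum_(c <- s) (N ^ (- j))%:C *: (chi (vdot ((w : Kn) - (x : Kn)) c) : C)) * uj w).
    rewrite mulr_suml; apply: eq_bigr => c _.
    rewrite [in RHS]vdotC vdotDr chiD (vdotC c w) (vdotC c (- (x : Kn))).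
    rewrite -[LHS]/(_ * chi _ * (chi _ * uj w)) -[RHS]/((N ^ (- j))%:C * _ * uj w).
    by rewrite -!mulrA; congr (_ * _); rewrite mulrCA.
  rewrite /uj /ball_truncation indicE; case: (boolP (w \in _)) => [/set_mem|_]; last first.
    by rewrite scale0r mulr0 !scaler0.
  rewrite ball0E => wj; rewrite scale1r.
  have wx : vn ((w : Kn) - (x : Kn)) <= rho ^ (- j).
    by rewrite (vballD hK hnu)// (vnormN hK hnu) -ball0E.
  have c1 : ball_constant ball j (fun xi : T => chi (vdot ((w : Kn) - (x : Kn)) xi) : C).
    by have := chi_ball_constant wx; rewrite opprK.
  have := bochner_unique (ball_partition_bochner Dy kj hs c1) (chi_ball_integral k ((w : Kn) - (x : Kn))).
  move=> ->; rewrite scalerA mulrC.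
  have -> : \1_(ball k 0) ((w : Kn) - (x : Kn)) = \1_(ball k x) w :> R[i].
    by rewrite !indicE; congr ((_ : bool)%:R); rewrite /vball; apply/idP/idP => /set_mem h; apply/mem_set; move: h => /=; rewrite subr0.
  by rewrite -[RHS]/(_ * _ * u w) mulrC [in RHS](mulrC (N ^ k)%:C).
rewrite /avg.
have -> : bochner mu (ball k x) uj = ((N ^ k)%:C)^-1 *: v.
  apply: bochnerE; apply: bochner_eq (bochnerZ ((N ^ k)%:C)^-1 h2) => w.
  rewrite scalerA mulVf ?scale1r//.
  by apply/eqP => /complexI; apply/eqP; rewrite gt_eqF// (dy_wgt0 Dy).
rewrite scalerA mulfV ?scale1r//.
by apply/eqP => /complexI; apply/eqP; rewrite gt_eqF// (dy_wgt0 Dy).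
Qed.

(** The k-th average is the inverse transform cut off to |xi| <= rho^-k. The truncated identity
    passes to the limit because the transforms differ by at most the L^1 tail, uniformly on a ball
    of finite measure. *)
Lemma avg_fourier (u : T -> C) (k : int) (x : T) : u \in BLfun mu 1 ->
  has_bochner mu (fun xi : T => \1_(ball (- k) 0) xi *:
      (chi (vdot (- (x : Kn)) xi) * four u xi : C))
    (avg mu ball N k u x).
Proof.
move=> u1.
have mB : measurable (ball (- k) 0 : set T) by exact: dy_measurable Dy _ _.
have mF : smeas mu (fun xi : T => \1_(ball (- k) 0) xi *:
      (chi (vdot (- (x : Kn)) xi) * four u xi : C)).
  apply: smeas_restrict => //.
  have := smeas_chiM (- (x : Kn)) (fourier_smeas u1).
  by under eq_fun do rewrite vdotC.
have dist (j : nat) xi : nrm (\1_(ball (- k) 0) xi *: (chi (vdot (- (x : Kn)) xi) * four u xi : C)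
    - \1_(ball (- k) 0) xi *: (chi (vdot (- (x : Kn)) xi) * four (ball_truncation u j%:Z) xi : C))
    <= \1_(ball (- k) 0) xi * tail u j%:Z.
  rewrite -scalerBr nrm_indic ler_wpM2l// -mulrBr nrm_complexM nrm_chi mul1r.
  exact: fourier_truncation_dist.
have t0 (j : nat) : 0 <= tail u j%:Z.
  by rewrite -lee_fin tailE//; apply: integral_ge0 => y _; rewrite lee_fin nrm_ge0.
have icst (c : R) : 0 <= c -> (\int[mu]_xi (\1_(ball (- k) 0) xi * c)%:E = (N ^ k * c)%:E)%E.
  move=> c0; rewrite (_ : (fun xi => _) = (fun xi => c%:E * (\1_(ball (- k) 0) xi)%:E)%E); last first.
    by apply/funext => xi; rewrite -EFinM mulrC.
  rewrite ge0_integralZl//.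
  - by rewrite integral_indic// setIT (dy_measure Dy) opprK -EFinM mulrC.
  - by apply/measurable_EFinP.
have near_avg : \forall j \near \oo, avg mu ball N k (ball_truncation u j%:Z) x = avg mu ball N k u x.
  have h : \forall j \near \oo, (k >= - j%:Z)%R by exists (absz k) => // j /= kj; lia.
  apply: filterS2 (ball_exhaust_near x) h => j xj kj; apply: avg_restrict.
  by rewrite -(dy_eq Dy xj); exact: dy_subset Dy _ _ _ kj.
have hvj : \forall j \near \oo, has_bochner mu (fun xi : T => \1_(ball (- k) 0) xi *:
      (chi (vdot (- (x : Kn)) xi) * four (ball_truncation u j%:Z) xi : C))
    (avg mu ball N k u x).
  have h : \forall j \near \oo, (- k <= j%:Z)%R by exists (absz k) => // j /= kj; lia.
  near=> j; have <- : avg mu ball N k (ball_truncation u j%:Z) x = avg mu ball N k u x by near: j.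
  by apply: avg_fourier_truncation => //; near: j => //; exact: ball_exhaust_near.
have [v hv] : exists v, has_bochner mu (fun xi : T => \1_(ball (- k) 0) xi *:
      (chi (vdot (- (x : Kn)) xi) * four u xi : C)) v.
  apply: bochner_exists => //; first exact: seq_complete_complex.
  have [m _ /(_ m (leqnn m)) hm] := hvj.
  have := bochner_lty hm => hm'.
  apply: (@le_lt_trans _ _ (\int[mu]_xi (nrm (\1_(ball (- k) 0) xi *:
      (chi (vdot (- (x : Kn)) xi) * four (ball_truncation u m%:Z) xi : C)))%:E +
      \int[mu]_xi (\1_(ball (- k) 0) xi * tail u m%:Z)%:E)%E); last first.
    by rewrite icst// lte_add_pinfty// ltry.
  have m1 : measurable_fun setT (fun xi : T => \1_(ball (- k) 0) xi * tail u m%:Z).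
    by apply: measurable_funM => //; exact: measurable_cst.
  rewrite -ge0_integralD//.
  - apply: ge0_le_integral => //.
    + by move=> y _; rewrite lee_fin nrm_ge0.
    + exact: measurable_enrm mF.
    + apply: emeasurable_funD; apply/measurable_EFinP => //.
      exact: strongly_measurable_nrm hm.1.
    move=> y _; rewrite -EFinD lee_fin.
    have tri (a b : C) : nrm b <= nrm a + nrm (b - a).
      by rewrite addrC -{1}(subrK a b) ler_nrmD.
    apply: le_trans (tri (\1_(ball (- k) 0) y *:
      (chi (vdot (- (x : Kn)) y) * four (ball_truncation u m%:Z) y : C)) _) _.
    by rewrite lerD2l; exact: dist.
  - by move=> y _; rewrite lee_fin nrm_ge0.
  - exact: measurable_enrm hm.1.
  - by move=> y _; rewrite lee_fin mulr_ge0.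
  - exact/measurable_EFinP.
suff <- : v = avg mu ball N k u x by [].
have lim : (fun j : nat => N ^ k * tail u j%:Z) @ \oo --> (0 : R).
  by rewrite -(mulr0 (N ^ k)); apply: cvgM; [exact: cvg_cst|exact: tail_cvg0].
apply/eqP; rewrite -subr_eq0; apply/eqP/nrm_eq0.
have h0 : (fun j : nat => nrm (v - avg mu ball N k u x)) @ \oo --> (0 : R).
  apply: cvg0_le lim; apply: filterS hvj => j hj; rewrite nrm_ge0 /= -lee_fin -icst//.
  apply: nrm_bochner_le (bochnerB hv hj) _ (dist j).
  by apply: measurable_funM => //; exact: measurable_cst.
exact: (@cvg_unique _ (@Rhausdorff R) _ _ _ _ (cvg_cst _) h0).
Unshelve. all: by end_near.
Qed.

Let p2 : 1 < 2 :> R. Proof. by rewrite ltr1n. Qed.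

Lemma chiM_L2 (x : Kn) (h : T -> C) : h \in BLfun mu 2 ->
  (fun xi : T => chi (vdot x xi) * h xi : C) \in BLfun mu 2 /\
  BNorm mu 2 (fun xi : T => chi (vdot x xi) * h xi : C) = BNorm mu 2 h.
Proof.
move=> /asboolP[mh lh].
have e : BNorm mu 2 (fun xi : T => chi (vdot x xi) * h xi : C) = BNorm mu 2 h.
  rewrite !BNormE /pint; congr (poweR _ _); apply: eq_integral => xi _.
  by rewrite nrm_complexM nrm_chi mul1r.
split; last exact: e.
apply/asboolP; split; last by rewrite e.
have := smeas_chiM x mh.
by under eq_fun do rewrite vdotC.
Qed.

(** The right side is written as an average at 0, so that both sides are continuous in L^2 by
    [avg_cvg] and the identity extends from L^1 approximants. *)
Lemma avg_fourier_L2 (phi g : T -> C) (k : int) (x : T) : fourier_L2 mu chi phi g ->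
  avg mu ball N k phi x =
  (N ^ k)%:C *: avg mu ball N (- k) (fun xi : T => chi (vdot (- (x : Kn)) xi) * g xi : C) 0.
Proof.
move=> [phi2 g2 [u [u12 uphi ug]]].
have cC := @seq_complete_complex R.
pose J (h : T -> C) := (N ^ k)%:C *: avg mu ball N (- k) (fun xi : T => chi (vdot (- (x : Kn)) xi) * h xi : C) 0.
have Ju m : avg mu ball N k (u m) x = J (four (u m)).
  rewrite /J (avgE N (avg_fourier k x (u12 m).1)); move: (avg mu ball N k (u m) x) => a.
  by rewrite scalerA -rmorphM -expfzDr ?gt_eqF// subrr expr0z scale1r.
have l1 : avg mu ball N k (u m) x @[m --> \oo] --> avg mu ball N k phi x.
  apply: (@avg_cvg _ _ _ _ _ _ Dy C cC _ p2 u phi k x phi2); last exact: uphi.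
  by apply: nearW => m; exact: (u12 m).2.
have fsm m := fourier_smeas (u12 m).1.
have four2 : \forall m \near \oo, four (u m) \in BLfun mu 2.
  have /fine_cvgP[fin _] := ug; apply: filterS fin => m fm.
  have dL : (fun y => four (u m) y - g y) \in BLfun mu 2.
    apply/asboolP; split; first exact: smeasB (fsm m) (BLfun_sm g2).
    by rewrite -ge0_fin_numE ?BNorm_ge0.
  have [_ hc] := BLfun_submod_closed C mu (ltW p2).
  have := hc 1 _ _ dL g2; rewrite scale1r.
  rewrite (_ : _ + g = four (u m))//.
  by apply/funext => y; rewrite -[LHS]/(four (u m) y - g y + g y) subrK.
have l2 : avg mu ball N (- k) (fun xi : T => chi (vdot (- (x : Kn)) xi) * four (u m) xi : C) 0 @[m --> \oo]
    --> avg mu ball N (- k) (fun xi : T => chi (vdot (- (x : Kn)) xi) * g xi : C) 0.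
  apply: (@avg_cvg _ _ _ _ _ _ Dy C cC _ p2
    (fun m (xi : T) => chi (vdot (- (x : Kn)) xi) * four (u m) xi) _ (- k) 0
    (chiM_L2 (- (x : Kn)) g2).1).
    by apply: filterS four2 => m /(chiM_L2 (- (x : Kn)))[].
  apply: cvg_trans ug; apply: near_eq_cvg; apply: nearW => m.
  rewrite !BNormE /pint; congr (poweR _ _); apply: eq_integral => y _.
  by rewrite -mulrBr nrm_complexM nrm_chi mul1r.
apply: (@cvg_nrm_unique _ _ (fun m => avg mu ball N k (u m) x)); first exact: l1.
have -> : (fun m => avg mu ball N k (u m) x) = (fun m => J (four (u m))) by apply/funext.
by apply: cvgZr; exact: l2.
Qed.

(** * Heat kernel and spectral multipliers *)

Variable alpha : R.
Hypothesis alpha0 : 0 < alpha.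
Local Notation bavg := (avg mu ball N).
Let cC := @seq_complete_complex R.
Let rho1 : rho < 1 := modulus_prime_lt1 hK hnu hbeta.
Let N1 := dy_gt1 Dy.

Definition eigenratio : R := rho^-1 `^ alpha.
Local Notation A := eigenratio.

Lemma eigenratio_gt1 : 1 < A.
Proof.
rewrite /eigenratio /powR gt_eqF ?invr_gt0// -[ltLHS]expR0 ltr_expR mulr_gt0//.
by rewrite ln_gt0// invf_gt1.
Qed.

Lemma vnorm_powR (xi : Kn) (k : int) : vn xi = rho ^ (- k) -> vn xi `^ alpha = A ^ k.
Proof.
move=> ->; rewrite -powR_exprz ?invr_ge0 ?(ltW rho0)//; congr (_ `^ _).
by rewrite exprz_inv.
Qed.

Lemma vnorm_values (xi : Kn) : vn xi = 0 \/ exists k : int, vn xi = rho ^ (- k).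
Proof.
rewrite /vnorm; elim/big_ind: _ => [|x y hx hy|i _]; first by left.
  by rewrite /Num.max; case: ifP.
have [->|x0] := eqVneq (xi ord0 i) 0; first by left; rewrite modulus0.
have [k ->] := value_group hK hnu hbeta b0 x0; right.
by exists (- k); rewrite opprK.
Qed.

Section heat.
Variable t : R.
Hypothesis t0 : 0 < t.
Local Notation hv := (heat_value A t).
Local Notation hd := (heat_drop A t).

(** The indicators select the drops from the shell of xi on, and these telescope; at xi = 0 all
    drops count and sum to 1. *)
Lemma heat_layers (xi : Kn) :
  (fun l : nat => \sum_(i < 2 * l) hd (i%:Z - l%:Z) * \1_(ball (- (i%:Z - l%:Z)) 0) xi) @ \oo -->
  expR (- t * vn xi `^ alpha).
Proof.
have hv0 : (fun l : nat => hv l%:Z) @ \oo --> (0 : R).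
  have := heat_value_cvg0 eigenratio_gt1 t0 ltr01.
  by under eq_fun do rewrite expr1n mulr1.
rewrite mulNr; have [v0|[k vk]] := vnorm_values xi.
  rewrite v0 powR0 ?gt_eqF// mulr0 oppr0 expR0 -[X in _ --> X](subr0 1).
  have h : (fun l : nat => hv (- l%:Z) - hv l%:Z) @ \oo --> (1 - 0 : R).
    by apply: cvgB; [exact: (heat_value_cvg1 _ eigenratio_gt1)|exact: hv0].
  apply: cvg_trans h; apply: near_eq_cvg; apply: nearW => l.
  have e := heat_drop_telescope eigenratio_gt1 t0 (- l%:Z) (2 * l).
  have e2 : - l%:Z + (2 * l)%N%:Z = l%:Z by lia.
  rewrite e2 in e; rewrite -e; apply: eq_bigr => i _.
  have xi0 : ball (- (i%:Z - l%:Z)) 0 xi by rewrite ball0E v0 ltW// (rhoz_gt0 hK hnu b0).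
  have -> : - l%:Z + i%:Z = i%:Z - l%:Z by lia.
  by rewrite indicE mem_set// mulr1.
rewrite (vnorm_powR vk) -/(hv k) -[X in _ --> X]subr0.
have h : (fun l : nat => hv k - hv l%:Z) @ \oo --> (hv k - 0).
  by apply: cvgB; [exact: cvg_cst|exact: hv0].
apply: cvg_trans h; apply: near_eq_cvg; exists (absz k) => // l /= kl.
have ind j : \1_(ball (- j) 0) xi = ((k <= j)%R : nat)%:R :> R.
  rewrite indicE; congr ((_ : bool)%:R); apply/idP/idP => [/set_mem|h].
    by rewrite ball0E vk (rhoz_le hK hnu hbeta b0) lerN2.
  by apply/mem_set; rewrite ball0E vk (rhoz_le hK hnu hbeta b0) lerN2.
have part m : \sum_(i < m) hd (i%:Z - l%:Z) * \1_(ball (- (i%:Z - l%:Z)) 0) xi =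
    if (k <= m%:Z - l%:Z)%R then hv k - hv (m%:Z - l%:Z) else 0.
  elim: m => [|m IH]; first by rewrite big_ord0; case: leP => // km; rewrite (_ : _ - l%:Z = k) ?subrr//; lia.
  rewrite big_ord_recr /= IH ind; have -> : m.+1%:Z - l%:Z = m%:Z - l%:Z + 1 by lia.
  case: (leP k (m%:Z - l%:Z)) => km.
    rewrite ifT; last by lia.
    by rewrite mulr1 /heat_drop addrA subrK.
  rewrite mulr0 addr0; case: ifP => // km2.
  rewrite (_ : m%:Z - l%:Z + 1 = k) ?subrr//; lia.
rewrite part ifT; last by lia.
by congr (_ - hv _); rewrite mul2n -addnn PoszD addrK.
Qed.

Lemma smeas_one : smeas mu (fun=> 1 : C).
Proof.
exists (fun j => [:: (ball (- j%:Z) 0, 1)]); split.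
  move=> j a; rewrite inE => /eqP -> /=; split; [exact: dy_measurable Dy _ _|exact: dy_lty Dy _ _].
move=> x; apply: cvg_near_cst; have [m xm] := dy_exhaust Dy 0 x; exists m => // j /= mj.
rewrite /sfun_eval big_seq1 /= indicE mem_set ?scale1r//.
apply: dy_subset Dy _ _ _ _ _ xm; lia.
Qed.

(** Each layer of the symbol is transformed by [chi_ball_integral], so the kernel is a nonnegative
    combination of indicators of balls, in particular real. *)
Lemma heat_kernel_layers (x : Kn) : exists2 kap : R, heat_kernel mu chi alpha t x = kap%:C &
  (fun l : nat => \sum_(i < 2 * l) hd (i%:Z - l%:Z) * N ^ (i%:Z - l%:Z) * \1_(ball (i%:Z - l%:Z) 0) x) @ \oo --> kap.
Proof.
have [S hS] := heat_sum_bounded eigenratio_gt1 t0 N1.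
have sm : smeas mu (fun xi : T => chi (vdot (- x) xi) : C).
  have := smeas_chiM (- x) smeas_one.
  rewrite (_ : (fun x0 : T => _) = (fun xi : T => chi (vdot (- x) xi) : C))//.
  by apply/funext => xi; rewrite mulr1 vdotC.
have vI k := chi_ball_integral k (- x).
have ib k : (\int[mu]_(xi in (ball (- k) 0 : set T)%R) (nrm (chi (vdot (- x) xi) : C))%:E <= (N ^ k)%:E)%E.
  under eq_integral do rewrite nrm_chi.
  by rewrite integral_cst ?(dy_measure Dy) ?mul1e ?opprK//; exact: dy_measurable Dy _ _.
have [w hw cw] := bochner_two_sided_layers cC (fun k => dy_measurable Dy (- k) 0)
  (heat_drop_ge0 eigenratio_gt1 t0) (fun k => ltW (dy_wgt0 Dy k)) sm vI ib hS heat_layers.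
have wE : heat_kernel mu chi alpha t x = w.
  apply: bochnerTE; apply: bochner_eq hw => xi.
  by rewrite vdotNl -chi_conj.
pose u (l : nat) : R := \sum_(i < 2 * l) hd (i%:Z - l%:Z) * N ^ (i%:Z - l%:Z) * \1_(ball (i%:Z - l%:Z) 0) x.
have cw' : (fun l => (u l)%:C : C) @ \oo --> w.
  apply: cvg_trans cw; apply: near_eq_cvg; apply: nearW => l.
  rewrite /u rmorph_sum /=; apply: eq_bigr => i _; rewrite !rmorphM /= -mulrA.
  rewrite -[LHS]/((hd _)%:C * (\1_(ball _ 0) (- x) * (N ^ _)%:C)); congr (_ * _); rewrite mulrC; congr (_ * _).
  have e : (- x \in ball (i%:Z - l%:Z) 0) = (x \in ball (i%:Z - l%:Z) 0).
    by apply/idP/idP => /set_mem h; apply/mem_set; move: h; rewrite !ball0E (vnormN hK hnu).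
  by rewrite !indicE e; case: (_ \in _); rewrite ?rmorph1 ?rmorph0.
have [c1 c2] := complex_limit_of_real cw'.
by exists (complex.Re w); [rewrite wE|].
Qed.

Variable p : R.
Hypothesis p1 : 1 < p.

(** Convolution with N^k times the indicator of the ball of level k is the k-th average, so the
    layers of the kernel give a weighted sum of averages. *)
Lemma convolution_heat_kernel (phi : T -> C) (x : T) : phi \in BLfun mu p ->
  (fun l : nat => \sum_(i < 2 * l) (hd (i%:Z - l%:Z))%:C *: bavg (i%:Z - l%:Z) phi x) @ \oo -->
  convolution mu (heat_kernel mu chi alpha t) phi x.
Proof.
move=> phiL; have p0 : 0 < p := lt_trans ltr01 p1.
(* The growth rate of the k-th average of an L^p function. *)
pose r := N `^ p^-1; have r1 : 1 < r.
  rewrite /r /powR gt_eqF// -[ltLHS]expR0 ltr_expR mulr_gt0 ?invr_gt0//.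
  by rewrite ln_gt0.
have [S hS] := heat_sum_bounded eigenratio_gt1 t0 r1.
have /choice[kap hkap] (z : Kn) : exists kap : R, heat_kernel mu chi alpha t z = kap%:C /\
  (fun l : nat => \sum_(i < 2 * l) hd (i%:Z - l%:Z) * N ^ (i%:Z - l%:Z) * \1_(ball (i%:Z - l%:Z) 0) z) @ \oo --> kap.
  by have [kap ? ?] := heat_kernel_layers z; exists kap.
pose F := fine (BNorm mu p phi).
have F0 : 0 <= F by rewrite fine_ge0// BNorm_ge0.
have wk k : 0 < N ^ k := dy_wgt0 Dy k.
have hS' l : \sum_(i < 2 * l) (hd (i%:Z - l%:Z) * N ^ (i%:Z - l%:Z)) *
    ((N ^ (i%:Z - l%:Z)) `^ p^-1 * F * N ^ (- (i%:Z - l%:Z))) <= S * F.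
  apply: le_trans (ler_wpM2r F0 (hS l)); rewrite mulr_suml; apply: ler_sum => i _.
  rewrite powR_exprz ?(ltW N0)// -/r -invr_expz; apply: eqW.
  by field; rewrite gt_eqF.
have hl (y : T) : (fun l : nat => \sum_(i < 2 * l) (hd (i%:Z - l%:Z) * N ^ (i%:Z - l%:Z)) * \1_(ball (i%:Z - l%:Z) x) y) @ \oo --> kap ((x : Kn) - (y : Kn)).
  apply: cvg_trans (hkap ((x : Kn) - (y : Kn))).2; apply: near_eq_cvg; apply: nearW => l.
  apply: eq_bigr => i _; congr (_ * _); rewrite !indicE; congr ((_ : bool)%:R).
  by apply/idP/idP => /set_mem h; apply/mem_set; move: h; rewrite ball0E /vball /= -(vnormN hK hnu) opprB.
have [w hw cw] := bochner_two_sided_layers cC (fun k => dy_measurable Dy k x)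
  (fun k => mulr_ge0 (heat_drop_ge0 eigenratio_gt1 t0 k) (ltW (wk k)))
  (fun k => mulr_ge0 (mulr_ge0 (powR_ge0 _ _) F0) (ltW (wk (- k))))
  (BLfun_sm phiL) (fun k => ball_bochner Dy cC p1 k x phiL)
  (fun k => ball_integral_le_BNorm Dy cC p1 k x phiL) hS' hl.
have -> : convolution mu (heat_kernel mu chi alpha t) phi x = w.
  apply: bochnerTE; apply: bochner_eq hw => y.
  by rewrite (hkap ((x : Kn) - (y : Kn))).1.
apply: cvg_trans cw; apply: near_eq_cvg; apply: nearW => l; apply: eq_bigr => i _.
by rewrite /avg scalerA -rmorphM.
Qed.

(** Abel summation turns drops times averages into values times differences of averages. The
    boundary terms vanish: at plus infinity the heat value beats r^l, at minus infinity the averages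
    themselves decay like r^-l. *)
Lemma heat_partial_sum_cvg (phi : T -> C) (x : T) : phi \in BLfun mu p ->
  avg_partial_sum mu ball N (fun k => (hv k)%:C) l phi x @[l --> \oo] -->
  convolution mu (heat_kernel mu chi alpha t) phi x.
Proof.
move=> phiL; have p0 : 0 < p := lt_trans ltr01 p1.
pose a k : C := bavg k phi x.
have abel l m : \sum_(i < m) (hv (1 - l%:Z + i%:Z))%:C *: (a (1 - l%:Z + i%:Z) - a (1 - l%:Z + i%:Z - 1)) =
   (hv (m%:Z - l%:Z))%:C *: a (m%:Z - l%:Z) - (hv (- l%:Z))%:C *: a (- l%:Z) +
   \sum_(i < m) (hd (i%:Z - l%:Z))%:C *: a (i%:Z - l%:Z).
  elim: m => [|m IH]; first by rewrite !big_ord0 sub0r subrr addr0.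
  rewrite !big_ord_recr /= IH.
  have -> : 1 - l%:Z + m%:Z - 1 = m%:Z - l%:Z by ring.
  have -> : 1 - l%:Z + m%:Z = m.+1%:Z - l%:Z by rewrite intS; ring.
  have -> : hd (m%:Z - l%:Z) = hv (m%:Z - l%:Z) - hv (m.+1%:Z - l%:Z).
    by congr (_ - hv _); rewrite intS; ring.
  exact: summation_by_parts_step.
pose r := N `^ p^-1.
have r0 : 0 < r by rewrite powR_gt0.
pose F := fine (BNorm mu p phi).
have abound k : nrm (a k) <= r ^ k * F.
  by rewrite /r -powR_exprz ?(ltW N0)//; exact: (nrm_avg_le_BNorm Dy cC p1).
have h1 : (fun l : nat => (hv l%:Z)%:C *: a l%:Z) @ \oo --> (0 : C).
  apply/cvg_nrmP.
  have h : (fun l : nat => (hv l%:Z * r ^+ l) * F) @ \oo --> (0 : R).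
    have c0 := cvgM (heat_value_cvg0 eigenratio_gt1 t0 r0) (@cvg_cst R F nat \oo _).
    by rewrite mul0r in c0; exact: c0.
  apply: cvg0_le h; apply: nearW => l; rewrite nrm_ge0 subr0 /= nrmZr ger0_norm ?heat_value_ge0//.
  by rewrite -mulrA ler_wpM2l ?heat_value_ge0//; exact: abound.
have h2 : (fun l : nat => (hv (- l%:Z))%:C *: a (- l%:Z)) @ \oo --> (0 : C).
  apply/cvg_nrmP.
  have h : (fun l : nat => r^-1 ^+ l * F) @ \oo --> (0 : R).
    rewrite -(mul0r F); apply: cvgM; last exact: cvg_cst.
    apply: cvg_expr; rewrite ger0_norm ?invr_ge0 ?(ltW r0)// invf_lt1//.
    rewrite /r /powR gt_eqF// -[ltLHS]expR0 ltr_expR mulr_gt0 ?invr_gt0//.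
    by rewrite ln_gt0.
  apply: cvg0_le h; apply: nearW => l; rewrite nrm_ge0 subr0 /= nrmZr ger0_norm ?heat_value_ge0//.
  apply: (@le_trans _ _ (1 * nrm (a (- l%:Z)))).
    by rewrite ler_wpM2r ?nrm_ge0// (heat_value_le1 eigenratio_gt1 t0).
  by rewrite mul1r (le_trans (abound _))// exprVn -invr_expz.
have h := @cvgD _ _ _ \oo eventually_filter _ _ _ _ (@cvgB _ _ _ \oo eventually_filter _ _ _ _ h1 h2)
  (convolution_heat_kernel (x := x) phiL).
rewrite subr0 add0r in h; apply: cvg_trans h; apply: near_eq_cvg; apply: nearW => l.
rewrite -[RHS]/(\sum_(i < 2 * l) (hv (1 - l%:Z + i%:Z))%:C *: (a (1 - l%:Z + i%:Z) - a (1 - l%:Z + i%:Z - 1))).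
rewrite abel; have -> : (2 * l)%N%:Z - l%:Z = l%:Z by rewrite mul2n -addnn PoszD addrK.
by [].
Qed.

End heat.

Lemma shell_value (k : int) (xi : Kn) : ball (- k) 0 xi -> ~ ball (- (k - 1)) 0 xi ->
  vn xi `^ alpha = eigenratio ^ k.
Proof.
rewrite !ball0E => h1 h2; apply: vnorm_powR.
have [v0|[j vj]] := vnorm_values xi.
  by case: h2; rewrite v0 ltW// (rhoz_gt0 hK hnu b0).
rewrite vj; move: h1 h2; rewrite vj !(rhoz_le hK hnu hbeta b0) => h1 h2.
have -> // : j = k.
have h3 : ~ (j <= k - 1)%R by move=> h3; apply: h2; rewrite lerN2.
lia.
Qed.

Lemma shell_fourier (phi g : T -> C) (k : int) (x : T) : fourier_L2 mu chi phi g ->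
  has_bochner mu (fun xi : T => \1_(ball (- k) 0) xi *: (chi (vdot (- (x : Kn)) xi) * g xi) -
    \1_(ball (- (k - 1)) 0) xi *: (chi (vdot (- (x : Kn)) xi) * g xi) : C)
  (avg_diff mu ball N k phi x).
Proof.
move=> hg; have gL : g \in BLfun mu 2 by case: hg.
have [cgL _] := chiM_L2 (- (x : Kn)) gL.
have e j : bavg j phi x = bochner mu (ball (- j) 0) (fun xi : T => chi (vdot (- (x : Kn)) xi) * g xi : C).
  rewrite (avg_fourier_L2 j x hg) /avg.
  by rewrite scalerA -rmorphM -expfzDr ?gt_eqF// subrr expr0z scale1r.
rewrite /avg_diff !e.
exact: bochnerB (ball_bochner Dy cC p2 (- k) 0 cgL) (ball_bochner Dy cC p2 (- (k - 1)) 0 cgL).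
Qed.

(** A difference of averages is a Fourier integral over the shell |xi| = rho^-k, where the symbol
    takes the single value f(A^k). *)
Lemma avg_diff_spectral_multiplier (f : R -> R[i]) (phi psi : T -> C) (k : int) (x : T) :
  spectral_multiplier mu chi alpha f phi psi ->
  avg_diff mu ball N k psi x = f (eigenratio ^ k) *: avg_diff mu ball N k phi x.
Proof.
move=> [g [h [hg hh gh]]].
have I1 := bochnerZ (f (eigenratio ^ k)) (shell_fourier k x hg).
apply: (bochner_ae_unique (shell_fourier k x hh) I1).
apply: ae_imply gh => xi gh; rewrite gh !indicE.
case: (boolP (xi \in (ball (- k) 0 : set T))) => [/set_mem b1|/negP b1].
  case: (boolP (xi \in (ball (- (k - 1)) 0 : set T))) => [/set_mem b2|/negP b2].
    by rewrite !scale1r !subrr scaler0.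
  rewrite (shell_value b1); last by move=> b; apply: b2; exact: mem_set.
  by rewrite !scale1r !scale0r !subr0; exact: mulrCA.
case: (boolP (xi \in (ball (- (k - 1)) 0 : set T))) => [/set_mem b2|/negP b2].
  case: b1; apply: mem_set; apply: (dy_subset Dy) b2; lia.
by rewrite !scale0r subrr scaler0.
Qed.

Variable Y : normedModType R[i].
Hypothesis cY : seq_complete Y.
Variable p : R.
Hypothesis p1 : 1 < p.
Let p1' : 1 <= p := ltW p1.
Local Notation X := (BLp Y mu p1').
Local Notation E := (condE Dy cY (p1 := p1)).
Variable C0 : R.
Hypothesis H : spectral_resolution E C0.
Let cX : seq_complete X := Lp_complete cY.
Let lam (k : int) : R := A ^ k.
Let A1 : 1 < A := eigenratio_gt1.

Let lam_gt0 k : 0 < lam k.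
Proof. by rewrite exprz_gt0// (lt_trans ltr01 A1). Qed.

Lemma multiplier_operator (m : int -> R[i]) (B : R) : 0 <= B -> (forall k, nrm (m k : C) <= B) ->
  exists U : {linear X -> X}, [/\ forall F, U F = multiplier E m F, continuous U &
    forall F, nrm (U F) <= 2 * C0 * B * nrm F].
Proof.
move=> B0 mB.
have [U hU] := linear_exists
  (multiplierDZ cX H B0 mB).
have nU F : nrm (U F) <= 2 * C0 * B * nrm F.
  rewrite hU; exact: (nrm_multiplier cX H B0 mB F).
by exists U; split=> //; exact: bounded_linear_continuous nU.
Qed.

Let heat (t : R) (k : int) : R[i] := (expR (- (t * lam k)))%:C.

Let heat_le1 t k : 0 < t -> nrm (heat t k : C) <= 1.
Proof.
move=> t0; rewrite nrm_real ger0_norm ?expR_ge0// -[leRHS]expR0 ler_expR oppr_le0.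
by rewrite mulr_ge0// ltW.
Qed.

Lemma heat_multiplier_tensor (t : R) (phi : T -> C) (y : Y) (F : X) : 0 < t -> phi \in BLfun mu p ->
  in_class F (fun x => phi x *: y) ->
  in_class (multiplier E (heat t) F) (fun x => convolution mu (heat_kernel mu chi alpha t) phi x *: y).
Proof.
move=> t0 phiL Fphi; apply: (multiplier_tensor H ler01 (fun k => heat_le1 k t0) phiL Fphi) => x.
exact: (heat_partial_sum_cvg t0 p1 phiL).
Qed.

Lemma heat_semigroup_exists : exists U : R -> {linear X -> X}, heat_semigroup chi alpha U.
Proof.
(* The identity serves for every t <= 0, since [heat_semigroup] fixes the operator at t = 0. *)
have /choice[U hU] (t : R) : exists U : {linear X -> X},
    (t <= 0 -> forall F, U F = F) /\ (0 < t -> continuous U /\ forall F, U F = multiplier E (heat t) F).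
  have [t0|t0] := leP t 0.
    by have [U hU] := @linear_exists R X X id (fun a x y => erefl); exists U; split=> // h; move: t0; rewrite leNgt h.
  by have [U [h1 h2 _]] := multiplier_operator ler01 (fun k => heat_le1 k t0); exists U; split=> // h; move: t0; rewrite ltNge h.
exists U; split=> [F|t t0]; first exact: (hU 0).1.
have [cU UE] := (hU t).2 t0; split=> // phi psi y F [phiL ->] Fphi.
by rewrite UE; exact: heat_multiplier_tensor.
Qed.

Lemma heat_semigroup_multiplier (U : R -> {linear X -> X}) : heat_semigroup chi alpha U ->
  forall t F, 0 < t -> U t F = multiplier E (heat t) F.
Proof.
move=> [_ hU] t F t0; have [cU tU] := hU t t0.
have [V [VE cV _]] := multiplier_operator ler01 (fun k => heat_le1 k t0).
rewrite -VE; apply: linear_eq_on_tensors => // phi y G phiL Gphi.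
have h1 := tU phi _ y G (conj phiL erefl) Gphi.
have h2 := heat_multiplier_tensor t0 phiL Gphi.
by rewrite VE; exact: (in_class_inj h1 h2).
Qed.

(** Every heat semigroup consists of the multipliers e^(-t A^k), being determined on tensors, and
    one exists; [spectral_generator] then computes the generator. *)
Lemma taiblesonE : taibleson mu chi alpha Y p1' = spectral_graph E lam.
Proof.
apply/funext => F; apply/funext => G; apply/propext; split.
  move=> [U hU]; apply: (spectral_generator cX H lam_gt0 _ F G).1.
  by move=> t x t0; exact: heat_semigroup_multiplier.
move=> FG; have [U hU] := heat_semigroup_exists; exists U => //.
apply: (spectral_generator cX H lam_gt0 _ F G).2 => // t x t0.
exact: heat_semigroup_multiplier.
Qed.

Lemma taibleson_bounded_Hinfty_calculus theta : 0 < theta < pi ->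
  bounded_Hinfty_calculus (taibleson mu chi alpha Y p1') theta.
Proof. by rewrite taiblesonE; exact: (spectral_bounded_Hinfty_calculus cX H lam_gt0). Qed.

Lemma taibleson_bounded_hormander_calculus (eta : R -> R) (s : R) : bump_function eta -> 1 <= s ->
  taibleson_hormander_calculus mu chi alpha Y p1' eta s.
Proof.
move=> heta s1; have [D D0 hD] := hormander_sup_bound heta s1.
exists (2 * C0 * D); first by rewrite !mulr_ge0// (sr_C0 H).
move=> f hf; set Hn := fine (hormander_norm eta s f).
have Hn0 : 0 <= Hn by rewrite fine_ge0// hormander_norm_ge0.
have B0 : 0 <= D * Hn by rewrite mulr_ge0.
have fB k : nrm (f (lam k) : C) <= D * Hn by exact: hD.
have [U [UE _ nU]] := multiplier_operator B0 fB.
exists U; last by move=> F; rewrite -(mulrA _ D); exact: nU.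
move=> phi psi y F [phiL hsp] Fphi; rewrite UE.
have [g [h [_ [psi2 _ _] _]]] := hsp.
have q1 : 1 < 2 :> R by rewrite ltr1n.
apply: (multiplier_tensor_Lq H B0 fB q1 phiL psi2 _ Fphi) => k x.
exact: (avg_diff_spectral_multiplier k x hsp).
Qed.

End taibleson_operator.

Theorem theorem1p1 (R : realType)
  (K : topFieldType) (hK : nonarchimedean_local_field R K)
  (beta : K) (hbeta : prime_element R beta)
  (chi : K -> R[i]) (hchi : unitary_character chi)
  (hchi_integers : forall x, integers R x -> chi x = 1)
  (hchi_nontrivial : exists2 x, integers R x & chi (beta^-1 * x) != 1)
  (n : nat) (hn : (1 <= n)%N)
  (mu : {measure set (borel 'rV[K]_n) -> \bar R})
  (hmu : Haar_measure mu) (hmu1 : mu (integers_n R K n) = 1%E)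
  (alpha : R) (halpha : 0 < alpha)
  (d : measure_display) (Omega : measurableType d)
  (m : {sigma_finite_measure set Omega -> \bar R})
  (hm : measure_is_complete m)
  (Y : completeNormedModType R[i]) (ev : Y -> Omega -> R[i])
  (hY : Banach_function_space m ev) (hUMD : UMD Y)
  (p : R) (hp : 1 < p)
  (eta : R -> R) (heta : bump_function eta) :
  (forall theta, 0 < theta < pi ->
     bounded_Hinfty_calculus (taibleson mu chi alpha Y (ltW hp)) theta) /\
  (forall s, 3 / 2 < s ->
     taibleson_hormander_calculus mu chi alpha Y (ltW hp) eta s).
Proof.
have [x0 _ chi0] := hchi_nontrivial.
(* With beta = 0 the point beta^-1 x0 would be 0, where the character equals 1. *)
have b0 : beta != 0.
  apply/eqP => b0; move: chi0; rewrite b0 invr0 mul0r hchi_integers ?eqxx//.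
  by rewrite /integers /= modulus0 ler01.
(* The character is nontrivial at beta^-1 x0, so this point is not an integer and its modulus is
   nonzero; this is the source of a Haar measure on [K]. *)
have mod0 : modulus R (beta^-1 * x0) != 0.
  apply: contra chi0 => /eqP m0; rewrite hchi_integers//.
  by rewrite /integers /= m0 ler01.
have [nu hnu] := haar_exists mod0.
have [N Dy] := vball_dyadic hK hnu hbeta b0 hmu hmu1 hn.
have cY := @complete_seq_complete R Y.
have [C0 H] := condE_spectral_resolution Dy cY hp hUMD.
split=> [theta hth|s hs].
  exact: (taibleson_bounded_Hinfty_calculus hK hnu hbeta b0 hchi hchi_integers hchi_nontrivial halpha H).
apply: (taibleson_bounded_hormander_calculus hK hnu hbeta b0 hchi hchi_integers hchi_nontrivial halpha H) => //.
lra.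
Qed.
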